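(* Let $Y$ be an integral projective variety of dimension $r$ and let $\mathcal{L}$ be a very ample line bundle on $Y$ with $h^1(Y,\mathcal{L})=0$ such that $(Y,\mathcal{L})$ is not secant defective. Put $\alpha:=h^0(Y,\mathcal{L})$ and $X_2:=Y\times\mathbb{P}^2$. Assume that one of the following holds: \begin{itemize} \item $r\in\{2,3\}$ and $\alpha\ge 60$; \item $r=4$ and $\alpha\ge 98$; \item $r=5$ and $\alpha\ge 133$; \item $r=6$ and $\alpha\ge 176$; \item $r=7$ and $\alpha\ge 231$; \item $r\ge 8$ and $\alpha\ge \frac{1}{81}(27r^3+144r^2+210r+79)$. \end{itemize} Then for every integer $t\ge 2$ the pair $(X_2,\mathcal{L}[t])$ is not secant defective.
   Context: Varieties are defined over an algebraically closed field of characteristic $0$. For a projective variety $X$ and a regular point $p\in X$, the double point $(2p,X)$ is the closed subscheme of $X$ with ideal sheaf $(\mathcal{I}_{p,X})^2$; a general union of $z$ double points of $X$ is $\bigcup_{p\in S}(2p,X)$ with $S$ a general set of $z$ regular points of $X$ (general: in a suitable nonempty Zariski open subset of the parameter space). If $\mathcal{M}$ is a line bundle on $X$ with $h^1(X,\mathcal{M})=0$, the pair $(X,\mathcal{M})$ is not-$z$-secant defective if $h^0(X,\mathcal{I}_Z\otimes\mathcal{M})\cdot h^1(X,\mathcal{I}_Z\otimes\mathcal{M})=0$ for a general union $Z$ of $z$ double points of $X$; it is not secant defective if it is not-$z$-secant defective for all $z\ge 1$. For a line bundle $\mathcal{L}$ on $Y$ and $t\in\mathbb{Z}$, the line bundle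 $\mathcal{L}[t]$ on $Y\times\mathbb{P}^m$ is $\pi_1^*\mathcal{L}\otimes\pi_2^*\mathcal{O}_{\mathbb{P}^m}(t)$, where $\pi_1,\pi_2$ are the projections to $Y$ and $\mathbb{P}^m$. *)

(* Defs.v *)
From HB Require Import structures.
From mathcomp Require Import all_boot all_order all_algebra.
From mathcomp Require Import mpoly.

Set Implicit Arguments.
Unset Strict Implicit.
Unset Printing Implicit Defensive.

Import Order.TTheory GRing.Theory Num.Theory.

Local Open Scope ring_scope.

(* Varieties are treated classically, as in Serre's FAC: Zariski closed sets
   of points over an algebraically closed field K, with sheaves of K-valued
   functions.

   A colouring [c : I -> J] of finitely many coordinates encodes the
   multiprojective space  prod_(j : J) P^(#{i | c i = j} - 1).  A point of it
   is represented by vectors [v : vec K I] having, for every colour, a nonzero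
   coordinate of that colour; two vectors represent the same point when they
   differ by one nonzero scalar per colour.  Sets of points are represented by
   their preimages in this multi-cone, and a section of O(d), d : J -> int, is
   represented by a multihomogeneous function of multidegree d on the
   multi-cone. *)
Definition vec (K : Type) (I : finType) := {ffun I -> K}.

Definition is_point (K : closedFieldType) (I J : finType) (c : I -> J)
    (v : vec K I) : Prop :=
  forall j, exists2 i, c i = j & v i != 0.

Definition same_point (K : closedFieldType) (I J : finType) (c : I -> J)
    (v w : vec K I) : Prop :=
  exists2 l : J -> K, (forall j, l j != 0) & (forall i, w i = l (c i) * v i).

Definition peval (K : closedFieldType) (I : finType) (P : {mpoly K[#|I|]})
    (v : vec K I) : K :=
  P.@[fun k => v (enum_val k)].

Definition multihomog (K : closedFieldType) (I J : finType) (c : I -> J)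
    (a : J -> nat) (P : {mpoly K[#|I|]}) : Prop :=
  forall m, m \in msupp P ->
  forall j, (\sum_(i | c i == j) m (enum_rank i))%N = a j.

Definition zclosed (K : closedFieldType) (I J : finType) (c : I -> J)
    (X : vec K I -> Prop) : Prop :=
  exists2 S : {mpoly K[#|I|]} -> Prop,
    (forall P, S P -> exists a, multihomog c a P) &
    (forall v, X v <-> is_point c v /\ (forall P, S P -> peval P v = 0)).

Definition zopen_in (K : closedFieldType) (I J : finType) (c : I -> J)
    (X U : vec K I -> Prop) : Prop :=
  exists2 Z, zclosed c Z & (forall v, U v <-> X v /\ ~ Z v).

Definition zirreducible (K : closedFieldType) (I J : finType) (c : I -> J)
    (X : vec K I -> Prop) : Prop :=
  (exists v, X v) /\
  forall A B, zclosed c A -> zclosed c B -> (forall v, X v -> A v \/ B v) ->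
    (forall v, X v -> A v) \/ (forall v, X v -> B v).

Definition integral_variety (K : closedFieldType) (I J : finType) (c : I -> J)
    (X : vec K I -> Prop) : Prop :=
  zclosed c X /\ zirreducible c X.

Definition has_chain (K : closedFieldType) (I J : finType) (c : I -> J)
    (X : vec K I -> Prop) (n : nat) : Prop :=
  exists Z : nat -> vec K I -> Prop,
    (forall k, (k <= n)%N ->
       integral_variety c (Z k) /\ (forall v, Z k v -> X v)) /\
    (forall k, (k < n)%N ->
       (forall v, Z k v -> Z k.+1 v) /\ (exists2 v, Z k.+1 v & ~ Z k v)).

Definition has_dim (K : closedFieldType) (I J : finType) (c : I -> J)
    (X : vec K I -> Prop) (n : nat) : Prop :=
  has_chain c X n /\ ~ has_chain c X n.+1.

Definition near_in (K : closedFieldType) (I J : finType) (c : I -> J)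
    (X : vec K I -> Prop) (p : vec K I) (Q : vec K I -> Prop) : Prop :=
  exists2 U, zopen_in c X U /\ U p & (forall v, U v -> Q v).

(* [f] defines an element of the stalk of O_X(d) at [p]: near [p] it is a
   quotient of multihomogeneous polynomials whose multidegrees differ by d. *)
Definition regular_at (K : closedFieldType) (I J : finType) (c : I -> J)
    (X : vec K I -> Prop) (d : J -> int) (p : vec K I) (f : vec K I -> K)
    : Prop :=
  exists (a b : J -> nat) (g h : {mpoly K[#|I|]}),
    [/\ multihomog c a g, multihomog c b h,
        (forall j, (a j)%:Z - (b j)%:Z = d j) &
        near_in c X p (fun v => peval h v != 0 /\ f v = peval g v / peval h v)].

Definition in_max_ideal (K : closedFieldType) (I J : finType) (c : I -> J)
    (X : vec K I -> Prop) (p : vec K I) (f : vec K I -> K) : Prop :=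
  regular_at c X (fun=> 0) p f /\ f p = 0.

(* The stalk at [p] of m_p^2 O_X(d). *)
Definition in_max_ideal_sq (K : closedFieldType) (I J : finType) (c : I -> J)
    (X : vec K I -> Prop) (d : J -> int) (p : vec K I) (f : vec K I -> K)
    : Prop :=
  exists (n : nat) (a b s : 'I_n -> vec K I -> K),
    (forall k, [/\ in_max_ideal c X p (a k), in_max_ideal c X p (b k) &
                   regular_at c X d p (s k)]) /\
    near_in c X p (fun v => f v = \sum_(k < n) a k v * b k v * s k v).

(* The local ring at [p] is regular: dim m_p / m_p^2 = dim X.  The dimension
   of the local ring is that of X when X is irreducible, the only case used. *)
Definition regular_point (K : closedFieldType) (I J : finType) (c : I -> J)
    (X : vec K I -> Prop) (p : vec K I) : Prop :=
  X p /\
  exists2 n, has_dim c X n &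
  exists2 x : 'I_n -> vec K I -> K, (forall k, in_max_ideal c X p (x k)) &
    forall f, in_max_ideal c X p f ->
    exists! l : 'rV[K]_n,
      in_max_ideal_sq c X (fun=> 0) p
        (fun v => f v - \sum_(k < n) l 0 k * x k v).

(* A sheaf is given by the predicate "f is a section over U"; two functions
   are the same section over U when they agree on U, their values outside U
   being irrelevant. *)
Definition sheaf (K : closedFieldType) (I : finType) :=
  (vec K I -> Prop) -> (vec K I -> K) -> Prop.

Definition line_bundle (K : closedFieldType) (I J : finType) (c : I -> J)
    (X : vec K I -> Prop) (d : J -> int) : sheaf K I :=
  fun U f => forall p, U p -> regular_at c X d p f.

(* I_Z (x) O_X(d), as the subsheaf I_Z O_X(d) of O_X(d), for Z the union of
   the double points of X supported at [p 0, ..., p (z-1)]. *)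
Definition double_points_twist (K : closedFieldType) (I J : finType)
    (c : I -> J) (X : vec K I -> Prop) (d : J -> int) (z : nat)
    (p : 'I_z -> vec K I) : sheaf K I :=
  fun U f => line_bundle c X d U f /\
    forall k, U (p k) -> in_max_ideal_sq c X d (p k) f.

Definition has_h0 (K : closedFieldType) (I : finType)
    (X : vec K I -> Prop) (F : sheaf K I) (n : nat) : Prop :=
  exists2 s : 'I_n -> vec K I -> K, (forall k, F X (s k)) &
    forall f, F X f -> exists! l : 'rV[K]_n,
      forall v, X v -> f v = \sum_(k < n) l 0 k * s k v.

Definition open_cover (K : closedFieldType) (I J : finType) (c : I -> J)
    (X : vec K I -> Prop) (A : Type) (U : A -> vec K I -> Prop) : Prop :=
  (forall a, zopen_in c X (U a)) /\ (forall v, X v -> exists a, U a v).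

(* h^1(X, F) = 0: every Cech 1-cocycle on an open cover of X becomes a
   coboundary on a refinement, i.e. the direct limit over open covers (which
   is sheaf cohomology in degree 1 on any topological space) vanishes. *)
Definition h1_vanishes (K : closedFieldType) (I J : finType) (c : I -> J)
    (X : vec K I -> Prop) (F : sheaf K I) : Prop :=
  forall (A : Type) (U : A -> vec K I -> Prop) (g : A -> A -> vec K I -> K),
    open_cover c X U ->
    (forall a b, F (fun v => U a v /\ U b v) (g a b)) ->
    (forall a b e v, U a v -> U b v -> U e v ->
       g a e v = g a b v + g b e v) ->
  exists (B : Type) (V : B -> vec K I -> Prop) (tau : B -> A)
         (h : B -> vec K I -> K),
    [/\ open_cover c X V,
        (forall b v, V b v -> U (tau b) v),
        (forall b, F (V b) (h b)) &
        (forall b b' v, V b v -> V b' v ->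
           g (tau b) (tau b') v = h b' v - h b v)].

(* The z-fold product of a multiprojective space is again multiprojective,
   so that X^z carries the Zariski topology given by [power_col c z]. *)
Definition power_col (I J : finType) (c : I -> J) (z : nat)
    (u : I * 'I_z) : J * 'I_z := (c u.1, u.2).

Definition component (K : closedFieldType) (I : finType) (z : nat)
    (w : vec K (I * 'I_z)%type) (k : 'I_z) : vec K I := [ffun i => w (i, k)].

Definition power_set (K : closedFieldType) (I : finType)
    (X : vec K I -> Prop) (z : nat) (w : vec K (I * 'I_z)%type) : Prop :=
  forall k, X (component w k).

Definition distinct_regular (K : closedFieldType) (I J : finType) (c : I -> J)
    (X : vec K I -> Prop) (z : nat) (w : vec K (I * 'I_z)%type) : Prop :=
  (forall k, regular_point c X (component w k)) /\
  (forall k l, k != l -> ~ same_point c (component w k) (component w l)).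

(* [Q] holds for a general set of z regular points of X. *)
Definition for_general_regular_points (K : closedFieldType) (I J : finType)
    (c : I -> J) (X : vec K I -> Prop) (z : nat)
    (Q : ('I_z -> vec K I) -> Prop) : Prop :=
  exists2 W : vec K (I * 'I_z)%type -> Prop,
    zopen_in (power_col c (z := z)) (power_set X (z := z)) W /\
    (exists2 w, W w & distinct_regular c X w) &
    (forall w, W w -> distinct_regular c X w -> Q (component w)).

(* The vanishing of h^1(X, O_X(d)), under which the notion is considered, is
   part of the definition. *)
Definition not_z_secant_defective (K : closedFieldType) (I J : finType)
    (c : I -> J) (X : vec K I -> Prop) (d : J -> int) (z : nat) : Prop :=
  h1_vanishes c X (line_bundle c X d) /\
  for_general_regular_points c X (fun p : 'I_z -> vec K I =>
    has_h0 X (double_points_twist c X d p) 0 \/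
    h1_vanishes c X (double_points_twist c X d p)).

Definition not_secant_defective (K : closedFieldType) (I J : finType)
    (c : I -> J) (X : vec K I -> Prop) (d : J -> int) : Prop :=
  forall z, (1 <= z)%N -> not_z_secant_defective c X d z.

Definition proj_col (n : nat) (i : 'I_n.+1) : unit := tt.

Definition times_proj_col (n m : nat) (u : 'I_n.+1 + 'I_m.+1) : unit + unit :=
  match u with inl i => inl (proj_col i) | inr i => inr (proj_col i) end.

Definition times_proj (K : closedFieldType) (n m : nat)
    (Y : vec K 'I_n.+1 -> Prop) (v : vec K ('I_n.+1 + 'I_m.+1)%type) : Prop :=
  Y [ffun i => v (inl i)] /\ is_point (@proj_col m) [ffun i => v (inr i)].

(* For L = O_Y(1) on Y in P^n, the line bundle L[t] on Y x P^m is the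
   restriction of O(1, t). *)
Definition bidegree (s t : int) (u : unit + unit) : int :=
  if u is inl _ then s else t.

(* Main.v *)
(* Not being defective means that, for general points, the conditions that double points impose on
   sections have maximal rank: the jets of a regular function at p modulo m_p^2 are its values and
   derivatives along the tangent space, and h^1 of the twist vanishes when h^1(L) does and all jets
   are attained.  The open set of points is cut out by a maximal minor, made multihomogeneous.

   The rank on Y x P^m in degree t is computed by induction on (m, t), as in the Horace method.  The
   sections are sum_mu f_mu q^mu; split the monomials by divisibility by q_0, and place A points on
   the hyperplane q_0 = 0, filling its space of sections up to a remainder of U conditions, U
   further points at q_0 = s^2, and the others outside.  Scaling the
   monomials without q_0 by s^3 and letting s go to 0 makes the matrix block triangular.  The block
   of the hyperplane has A double points and U values on Y x P^(m-1); the block of the multiples of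
   q_0 has, in degree t-1, the remaining double points, U double points of the hyperplane and A
   values.  General values impose independent conditions until the space is exhausted, so that two
   numerical inequalities suffice, and these follow from the lower bound for alpha.  In degree 1 the
   points are placed over the vertices of P^m, and for m = 0 the hypothesis on Y is used.

   The vanishing of h^1(Y x P^2, L[t]) comes from the affine cover by the D(y_l q_i) and from the
   cohomology of P^2.  The dimension of the product is obtained from prime ideals in iterated
   polynomial rings, comparing the conormal spaces at general points with the transcendence
   degree. *)

Require Import Defs.
From mathcomp Require Import all_boot all_order all_algebra.
From mathcomp Require Import fingroup perm mpoly ring zify.
From mathcomp Require classical_sets.
From Stdlib Require Import Classical ClassicalEpsilon FunctionalExtensionality.

Set Implicit Arguments.
Unset Strict Implicit.
Unset Printing Implicit Defensive.

Import Order.TTheory GRing.Theory Num.Theory.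

Local Open Scope ring_scope.

(** * Polynomial functions and multihomogeneous forms *)

(** The induction cannot run on maximal rank alone. In the residual system the [U] points must lie
    on [q 0 = 0] while all their conditions are independent, so [expected] puts the first
    [alpha %/ (R + m)] points on that hyperplane; a step reproduces this because its [A] points are
    there. [U] is the remainder of a division by the number of conditions of one double point of the
    hyperplane. Genericity is handled through functions: a condition is general when it is implied
    by the non-vanishing of a function from a class in which two functions, neither identically
    zero, are nonzero at a common argument. This property passes to functions of several points that
    belong to the class in each point separately, so points of Y, where irreducibility gives it, and
    points of P^m, where lines give it, are treated alike. Dimension theory is forced by the
    definition of a regular point, which compares the cotangent space with the length of chains: an
    open set of tuples has to be shown to contain distinct regular points of the product. The bound
    enters through [60 <= alpha] and [3 * (r.+1 * r.+2) <= alpha]. *)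

Section PolyFun.
Variable K : closedFieldType.
Implicit Types I J : finType.

(* If [p] vanished everywhere, [p + 1] would have no root. *)
Lemma poly_nz (p : {poly K}) : p != 0 -> exists s, p.[s] != 0.
Proof.
move=> p0; apply: NNPP => H.
have Hz s : p.[s] = 0.
  by apply/eqP/negPn/negP => ps; apply: H; exists s.
have: size (p + 1) == 1%N.
  apply/negPn/negP => /closed_rootP [x]; rewrite /root hornerD hornerC Hz add0r.
  by rewrite oner_eq0.
case/size_poly1P => c c0 pc.
have pE : p = (c - 1)%:P by rewrite polyCB -pc addrK.
move: p0; rewrite pE polyC_eq0; move: (Hz 0); rewrite pE hornerC => ->.
by rewrite eqxx.
Qed.

Lemma poly_fun_eq0 (p : {poly K}) : (forall s, p.[s] = 0) -> p = 0.
Proof.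
move=> H; apply/eqP/negPn/negP => /poly_nz [s]; by rewrite H eqxx.
Qed.

(** [muni] isolates the last variable: at fixed values of the others the univariate polynomial
    vanishes identically, hence its coefficients do, and the induction applies to them. *)
Lemma mpoly_fun_eq0 n (P : {mpoly K[n]}) : (forall v, P.@[v] = 0) -> P = 0.
Proof.
elim: n P => [|n IH] P H.
  apply/mpolyP => m; have := H (fun _ => 0).
  rewrite mevalE mcoeff0.
  have [mP|/memN_msupp_eq0 //] := boolP (m \in msupp P).
  rewrite (bigD1_seq m) ?msupp_uniq //= big_ord0 mulr1 big1 ?addr0 // => m' /eqP [].
  by apply/mnmP; case.
pose w (v : 'I_n -> K) (s : K) (i : 'I_n.+1) :=
  if unlift ord_max i is Some j then v j else s.
have wE v s : (map_poly (meval v) (muni P)).[s] = P.@[w v s].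
  rewrite muniE mevalE rmorph_sum /= horner_sum; apply: eq_bigr => m _.
  rewrite map_polyZ map_polyXn hornerZ hornerXn /=.
  rewrite mevalZ mevalX big_ord_recr /= mulrA; congr (_ * _ * _).
    apply: eq_bigr => i _; rewrite mnmE /w.
    rewrite (_ : widen_ord (leqnSn n) i = lift ord_max i) ?liftK //.
    by apply/val_inj => /=; rewrite /bump leqNgt ltn_ord.
  by rewrite /w unlift_none.
have M0 : muni P = 0.
  apply/polyP => k; rewrite coef0; apply: IH => v.
  have : map_poly (meval v) (muni P) = 0.
    by apply: poly_fun_eq0 => s; rewrite wE.
  by move/polyP/(_ k); rewrite coef_map coef0.
apply/mpolyP => m; rewrite mcoeff0.
have [mP|/memN_msupp_eq0 //] := boolP (m \in msupp P).
have := congr1 (fun p : {poly {mpoly K[n]}} =>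
  (p`_(m ord_max))@_[multinom m (widen_ord (leqnSn n) i) | i < n]) M0.
rewrite /= coef0 mcoeff0 muniE coef_sum raddf_sum /=.
rewrite (bigD1_seq m) ?msupp_uniq //= coefZ coefXn eqxx mulr1.
rewrite mcoeffZ mcoeffX eqxx mulr1 big1 ?addr0 // => m' /eqP ne.
rewrite coefZ coefXn; case: eqP => [e|_]; last by rewrite mulr0 mcoeff0.
rewrite mulr1 mcoeffZ mcoeffX; case: eqP => [e'|_]; last by rewrite mulr0.
case: ne; apply/mnmP => i; case: (unliftP ord_max i) => [j ->|->] //.
have := congr1 (fun x : 'X_{1..n} => x j) e'; rewrite !mnmE.
rewrite (_ : widen_ord (leqnSn n) j = lift ord_max j) //.
by apply/val_inj => /=; rewrite /bump leqNgt ltn_ord.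
Qed.

(** Density arguments are reduced to one parameter: on a line or curve of parameters [poly_nz]
    decides. *)
Definition upoly (f : K -> K) := exists p : {poly K}, forall s, f s = p.[s].

Lemma upoly_cst a : upoly (fun=> a).
Proof. by exists a%:P => s; rewrite hornerC. Qed.
Lemma upoly_id : upoly id.
Proof. by exists 'X => s; rewrite hornerX. Qed.
Lemma upolyD f g : upoly f -> upoly g -> upoly (fun s => f s + g s).
Proof. by move=> [p fp] [q gq]; exists (p + q) => s; rewrite hornerD fp gq. Qed.
Lemma upolyM f g : upoly f -> upoly g -> upoly (fun s => f s * g s).
Proof. by move=> [p fp] [q gq]; exists (p * q) => s; rewrite hornerM fp gq. Qed.
Lemma upoly_sum (A : Type) (r : seq A) (f : A -> K -> K) :
  (forall a, upoly (f a)) -> upoly (fun s => \sum_(a <- r) f a s).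
Proof.
move=> H; elim: r => [|a r IH].
  by have [p pE] := upoly_cst 0; exists p => s; rewrite big_nil -pE.
by have [p pE] := upolyD (H a) IH; exists p => s; rewrite big_cons -pE.
Qed.
Lemma upoly_prod (A : Type) (r : seq A) (f : A -> K -> K) :
  (forall a, upoly (f a)) -> upoly (fun s => \prod_(a <- r) f a s).
Proof.
move=> H; elim: r => [|a r IH].
  by have [p pE] := upoly_cst 1; exists p => s; rewrite big_nil -pE.
by have [p pE] := upolyM (H a) IH; exists p => s; rewrite big_cons -pE.
Qed.
Lemma upolyX f k : upoly f -> upoly (fun s => f s ^+ k).
Proof. by move=> [p fp]; exists (p ^+ k) => s; rewrite horner_exp fp. Qed.
Lemma upoly_ext f g : f =1 g -> upoly f -> upoly g.
Proof. by move=> fg [p fp]; exists p => s; rewrite -fg fp. Qed.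

Lemma upoly_dom f g : upoly f -> upoly g ->
  (exists s, f s != 0) -> (exists s, g s != 0) ->
  exists s, f s != 0 /\ g s != 0.
Proof.
move=> [p fp] [q gq] [s fs] [s' gs'].
have p0 : p != 0 by apply: contraNneq fs => p0; rewrite fp p0 horner0.
have q0 : q != 0 by apply: contraNneq gs' => q0; rewrite gq q0 horner0.
have [u] := @poly_nz (p * q) (mulf_neq0 p0 q0).
by rewrite hornerM mulf_eq0 negb_or -fp -gq => /andP [? ?]; exists u.
Qed.

Lemma upoly_meval n (P : {mpoly K[n]}) (g : 'I_n -> K -> K) :
  (forall i, upoly (g i)) -> upoly (fun s => P.@[fun i => g i s]).
Proof.
move=> H; apply: upoly_ext (fun s => esym (mevalE _ _)) _.
apply: upoly_sum => m; apply: upolyM; first exact: upoly_cst.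
by apply: upoly_prod => i; apply: upolyX.
Qed.

Section Polyf.
Variable I : finType.

(** Functions instead of polynomials: restriction, substitution and differentiation then need no
    operations on [mpoly], and [peval_eq0] shows that nothing is lost. *)
Definition polyf (f : vec K I -> K) :=
  exists P : {mpoly K[#|I|]}, forall v, f v = peval P v.

Lemma polyf_ext f g : f =1 g -> polyf f -> polyf g.
Proof. by move=> fg [P fP]; exists P => v; rewrite -fg fP. Qed.
Lemma polyf_peval P : polyf (peval P).
Proof. by exists P. Qed.
Lemma polyf_cst a : polyf (fun=> a).
Proof. by exists a%:MP => v; rewrite /peval mevalC. Qed.
Lemma polyf_var i : polyf (fun v => v i).
Proof. by exists 'X_(enum_rank i) => v; rewrite /peval mevalXU enum_rankK. Qed.
Lemma polyfD f g : polyf f -> polyf g -> polyf (fun v => f v + g v).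
Proof. by move=> [P fP] [Q gQ]; exists (P + Q) => v; rewrite /peval mevalD fP gQ. Qed.
Lemma polyfN f : polyf f -> polyf (fun v => - f v).
Proof. by move=> [P fP]; exists (- P) => v; rewrite /peval mevalN fP. Qed.
Lemma polyfB f g : polyf f -> polyf g -> polyf (fun v => f v - g v).
Proof. by move=> Hf Hg; apply: polyfD => //; apply: polyfN. Qed.
Lemma polyfM f g : polyf f -> polyf g -> polyf (fun v => f v * g v).
Proof. by move=> [P fP] [Q gQ]; exists (P * Q) => v; rewrite /peval mevalM fP gQ. Qed.
Lemma polyf_sum (A : Type) (r : seq A) (p : pred A) (f : A -> vec K I -> K) :
  (forall a, p a -> polyf (f a)) -> polyf (fun v => \sum_(a <- r | p a) f a v).
Proof.
move=> H; elim: r => [|a r IH].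
  by apply: polyf_ext (polyf_cst 0) => v; rewrite big_nil.
have [pa|pa] := boolP (p a).
  apply: polyf_ext (polyfD (H a pa) IH) => v; by rewrite big_cons pa.
apply: polyf_ext IH => v; by rewrite big_cons (negbTE pa).
Qed.
Lemma polyf_prod (A : Type) (r : seq A) (p : pred A) (f : A -> vec K I -> K) :
  (forall a, p a -> polyf (f a)) -> polyf (fun v => \prod_(a <- r | p a) f a v).
Proof.
move=> H; elim: r => [|a r IH].
  by apply: polyf_ext (polyf_cst 1) => v; rewrite big_nil.
have [pa|pa] := boolP (p a).
  apply: polyf_ext (polyfM (H a pa) IH) => v; by rewrite big_cons pa.
apply: polyf_ext IH => v; by rewrite big_cons (negbTE pa).
Qed.
Lemma polyfX f k : polyf f -> polyf (fun v => f v ^+ k).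
Proof. by move=> [P fP]; exists (P ^+ k) => v; rewrite /peval rmorphXn fP. Qed.

Lemma polyf_det n (f : 'I_n -> 'I_n -> vec K I -> K) :
  (forall i j, polyf (f i j)) -> polyf (fun v => \det (\matrix_(i, j) f i j v)).
Proof.
move=> H.
pose P i j := constructive_indefinite_description _ (H i j).
exists (\det (\matrix_(i, j) proj1_sig (P i j))) => v.
rewrite /peval -det_map_mx; congr (\det _); apply/matrixP => i j; rewrite !mxE.
exact: (proj2_sig (P i j)).
Qed.

Lemma polyf_upoly f (g : I -> K -> K) : polyf f -> (forall i, upoly (g i)) ->
  upoly (fun s => f [ffun i => g i s]).
Proof.
move=> [P fP] H.
apply: (@upoly_ext (fun s => P.@[fun k => g (enum_val k) s])).
  by move=> s; rewrite fP /peval; apply: meval_eq => k; rewrite ffunE.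
exact: upoly_meval.
Qed.

(** Irreducibility of affine space: the line through the two witnesses reduces it to [upoly_dom]. *)
Lemma polyf_dom f g : polyf f -> polyf g ->
  (exists v, f v != 0) -> (exists v, g v != 0) ->
  exists v, f v != 0 /\ g v != 0.
Proof.
move=> Hf Hg [u fu] [w gw].
pose l i s := u i + s * (w i - u i).
have Hl i : upoly (l i).
  apply: upolyD; first exact: upoly_cst.
  by apply: upolyM; [exact: upoly_id | exact: upoly_cst].
have l0 : [ffun i => l i 0] = u by apply/ffunP => i; rewrite ffunE /l mul0r addr0.
have l1 : [ffun i => l i 1] = w.
  by apply/ffunP => i; rewrite ffunE /l mul1r addrC subrK.
have [||s [fs gs]] := upoly_dom (polyf_upoly Hf Hl) (polyf_upoly Hg Hl).
- by exists 0; rewrite l0.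
- by exists 1; rewrite l1.
by exists [ffun i => l i s].
Qed.

End Polyf.

Lemma polyf_comp I I' (f : vec K I -> K) (g : I -> vec K I' -> K) :
  polyf f -> (forall i, polyf (g i)) ->
  polyf (fun v => f [ffun i => g i v]).
Proof.
move=> [P fP] H.
apply: (@polyf_ext _ (fun v => \sum_(m <- msupp P) P@_m *
   \prod_i g (enum_val i) v ^+ m i)).
  move=> v; rewrite fP /peval mevalE; apply: eq_bigr => m _; congr (_ * _).
  by apply: eq_bigr => i _; rewrite ffunE.
apply: polyf_sum => m _; apply: polyfM; first exact: polyf_cst.
by apply: polyf_prod => i _; apply: polyfX.
Qed.

Lemma peval_eq0 I (P : {mpoly K[#|I|]}) : (forall v, peval P v = 0) -> P = 0.
Proof.
move=> H; apply: mpoly_fun_eq0 => v.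
rewrite -(H [ffun i => v (enum_rank i)]) /peval.
by apply: meval_eq => k; rewrite ffunE enum_valK.
Qed.

Definition scale I J (c : I -> J) (l : J -> K) (v : vec K I) : vec K I :=
  [ffun i => l (c i) * v i].

(** Homogeneity is tested by the action of the torus; [formP] recovers a polynomial with monomials
    of the right multidegree. *)
Definition mhom I J (c : I -> J) (a : J -> nat) (f : vec K I -> K) :=
  forall l v, (forall j, l j != 0) -> f (scale c l v) = (\prod_j l j ^+ a j) * f v.

Definition form I J (c : I -> J) (a : J -> nat) (f : vec K I -> K) :=
  polyf f /\ mhom c a f.

Section Forms.
Variables (I J : finType) (c : I -> J).

Definition mdg (m : 'X_{1..#|I|}) (j : J) : nat :=
  (\sum_(i | c i == j) m (enum_rank i))%N.

Lemma peval_scale (P : {mpoly K[#|I|]}) (l : J -> K) (v : vec K I) :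
  peval P (scale c l v) = \sum_(m <- msupp P)
    (\prod_j l j ^+ mdg m j) * (P@_m * \prod_i v (enum_val i) ^+ m i).
Proof.
rewrite /peval mevalE; apply: eq_bigr => m _.
rewrite mulrCA; congr (_ * _).
rewrite (reindex (@enum_rank I)) /=; last by apply: onW_bij; exact: enum_rank_bij.
rewrite [X in _ = _ * X](reindex (@enum_rank I)) /=; last first.
  by apply: onW_bij; exact: enum_rank_bij.
rewrite (partition_big c xpredT) //= [X in _ = _ * X](partition_big c xpredT) //=.
rewrite -big_split /=; apply: eq_bigr => j _.
rewrite /mdg -prodrXr -big_split /=; apply: eq_bigr => i /eqP ij.
by rewrite enum_rankK ffunE ij exprMn.
Qed.

Lemma multihomog_mhom a P : multihomog c a P -> mhom c a (peval P).
Proof.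
move=> H l v _; rewrite peval_scale /peval mevalE mulr_sumr.
rewrite big_seq [RHS]big_seq; apply: eq_bigr => m mP; congr (_ * _).
by apply: eq_bigr => j _; rewrite -(H m mP).
Qed.

Lemma multihomog_form a P : multihomog c a P -> form c a (peval P).
Proof. by split; [exact: polyf_peval | exact: multihomog_mhom]. Qed.

Definition hcomp (a : J -> nat) (P : {mpoly K[#|I|]}) : {mpoly K[#|I|]} :=
  \sum_(m <- msupp P | [forall j, mdg m j == a j]) P@_m *: 'X_[m].

Lemma hcomp_multihomog a P : multihomog c a (hcomp a P).
Proof.
move=> m mP j; suff /forallP /(_ j) /eqP : [forall j, mdg m j == a j] by [].
apply: contraLR mP => H.
rewrite mcoeff_msupp negbK /hcomp raddf_sum /=; apply/eqP.
rewrite big1 // => m' H'; rewrite mcoeffZ mcoeffX.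
case: eqP => [e|_]; last by rewrite mulr0.
by rewrite e in H'; rewrite H' in H.
Qed.

(* The components of [P] are recovered from the polynomial
   [l |-> P (scale c l v)] in the scaling factors. *)
Lemma scale_poly P v : exists Q : {mpoly K[#|J|]},
  (forall l : J -> K, Q.@[fun k => l (enum_val k)] = peval P (scale c l v)) /\
  (forall a : J -> nat, Q@_[multinom a (enum_val k) | k < #|J|] = peval (hcomp a P) v).
Proof.
exists (\sum_(m <- msupp P) (P@_m * \prod_i v (enum_val i) ^+ m i) *:
          'X_[[multinom mdg m (enum_val k) | k < #|J|]]); split.
  move=> l; rewrite raddf_sum /= peval_scale; apply: eq_bigr => m _.
  rewrite mevalZ mevalX mulrC; congr (_ * _).
  rewrite (reindex (@enum_rank J)) /=; last by apply: onW_bij; exact: enum_rank_bij.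
  by apply: eq_bigr => j _; rewrite mnmE enum_rankK.
move=> a; rewrite raddf_sum /= /hcomp /peval raddf_sum /= [RHS]big_mkcond /=.
apply: eq_bigr => m _; rewrite mcoeffZ mcoeffX.
case: ifPn => [/forallP H|H].
  rewrite mevalZ mevalX (_ : _ == _) ?mulr1 //.
  by apply/eqP/mnmP => k; rewrite !mnmE (eqP (H _)).
case: eqP => [e|_]; last by rewrite mulr0.
case/negP: H; apply/forallP => j; apply/eqP.
have := congr1 (fun x : 'X_{1..#|J|} => x (enum_rank j)) e.
by rewrite !mnmE enum_rankK.
Qed.

Lemma mpoly_torus_eq0 (Q : {mpoly K[#|J|]}) :
  (forall l : J -> K, (forall j, l j != 0) -> Q.@[fun k => l (enum_val k)] = 0) ->
  Q = 0.
Proof.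
move=> H; apply: (@peval_eq0 J) => v; apply/eqP/negPn/negP => Qv.
have [||||w [Qw pw]] := @polyf_dom J (peval Q) (fun v => \prod_j v j).
- exact: polyf_peval.
- by apply: polyf_prod => j _; exact: polyf_var.
- by exists v.
- by exists [ffun=> 1]; rewrite big1 ?oner_eq0 // => j _; rewrite ffunE.
by case/eqP: Qw; apply: H => j; apply: contraNneq pw => w0; rewrite (bigD1 j) //= w0 mul0r.
Qed.

(** At a fixed [v] the polynomial in the scaling factors agrees on the torus, hence identically,
    with [peval P v] times one monomial; the coefficients of that monomial are compared. *)
Lemma hcomp_mhom a P : mhom c a (peval P) -> forall v, peval (hcomp a P) v = peval P v.
Proof.
move=> H v; have [Q [Q1 Q2]] := scale_poly P v.
set A := [multinom a (enum_val k) | k < #|J|].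
have : Q - peval P v *: 'X_[A] = 0.
  apply: mpoly_torus_eq0 => l l0; rewrite mevalB mevalZ mevalX Q1 H //.
  rewrite [X in _ - _ * X](reindex (@enum_rank J)) /=; last by apply: onW_bij; exact: enum_rank_bij.
  rewrite [X in _ - _ * X](eq_bigr (fun j => l j ^+ a j)) 1?mulrC ?subrr //.
  by move=> j _; rewrite mnmE enum_rankK.
move/(congr1 (mcoeff A)); rewrite mcoeffB mcoeffZ mcoeffX eqxx mulr1 mcoeff0 Q2.
by move/eqP; rewrite subr_eq0 => /eqP.
Qed.

Lemma formP a f : form c a f -> exists2 P, multihomog c a P & forall v, f v = peval P v.
Proof.
move=> [[P fP] fh]; exists (hcomp a P); first exact: hcomp_multihomog.
move=> v; rewrite hcomp_mhom // => l w l0; by rewrite -!fP fh.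
Qed.

Lemma form_ext a f g : f =1 g -> form c a f -> form c a g.
Proof.
move=> fg [pf hf]; split; first exact: polyf_ext pf.
by move=> l v l0; rewrite -!fg hf.
Qed.

Lemma form_deg a b f : a =1 b -> form c a f -> form c b f.
Proof.
move=> ab [pf hf]; split=> // l v l0; rewrite hf //; congr (_ * _).
by apply: eq_bigr => j _; rewrite ab.
Qed.

Lemma formD a f g : form c a f -> form c a g -> form c a (fun v => f v + g v).
Proof.
move=> [pf hf] [pg hg]; split; first exact: polyfD.
by move=> l v l0; rewrite hf // hg // mulrDr.
Qed.

Lemma formM a b f g : form c a f -> form c b g ->
  form c (fun j => a j + b j)%N (fun v => f v * g v).
Proof.
move=> [pf hf] [pg hg]; split; first exact: polyfM.
move=> l v l0; rewrite hf // hg // mulrACA -big_split /=; congr (_ * _).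
by apply: eq_bigr => j _; rewrite exprD.
Qed.

Lemma formZ a k f : form c a f -> form c a (fun v => k * f v).
Proof.
move=> [pf hf]; split; first by apply: polyfM => //; exact: polyf_cst.
by move=> l v l0; rewrite hf // mulrCA.
Qed.

Lemma formN a f : form c a f -> form c a (fun v => - f v).
Proof. by move=> /(formZ (-1)); apply: form_ext => v; rewrite mulN1r. Qed.

Lemma formB a f g : form c a f -> form c a g -> form c a (fun v => f v - g v).
Proof. by move=> Hf Hg; apply: formD => //; apply: formN. Qed.

Lemma form0 a : form c a (fun=> 0).
Proof. by split; [exact: polyf_cst | move=> l v _; rewrite mulr0]. Qed.

Lemma form_cst k : form c (fun=> 0%N) (fun=> k).
Proof.
split; first exact: polyf_cst.
by move=> l v _; rewrite big1 ?mul1r.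
Qed.

Lemma form_var i : form c (fun j => (c i == j) : nat) (fun v => v i).
Proof.
split; first exact: polyf_var.
move=> l v _; rewrite ffunE; congr (_ * _).
rewrite (bigD1 (c i)) //= eqxx expr1 big1 ?mulr1 // => j /negbTE.
by rewrite eq_sym => ->.
Qed.

Lemma formX a f k : form c a f -> form c (fun j => k * a j)%N (fun v => f v ^+ k).
Proof.
move=> [pf hf]; split; first exact: polyfX.
move=> l v l0; rewrite hf // exprMn; congr (_ * _).
by rewrite -prodrXl; apply: eq_bigr => j _; rewrite mulnC exprM.
Qed.

Lemma form_sum a (A : Type) (r : seq A) (p : pred A) (f : A -> vec K I -> K) :
  (forall x, p x -> form c a (f x)) -> form c a (fun v => \sum_(x <- r | p x) f x v).
Proof.
move=> H; split; first by apply: polyf_sum => x px; case: (H x px).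
move=> l v l0; rewrite mulr_sumr; apply: eq_bigr => x px.
by case: (H x px) => _ ->.
Qed.

Lemma form_prod (A : Type) (r : seq A) (a : A -> J -> nat) (f : A -> vec K I -> K) :
  (forall x, form c (a x) (f x)) ->
  form c (fun j => \sum_(x <- r) a x j)%N (fun v => \prod_(x <- r) f x v).
Proof.
move=> H; elim: r => [|x r IH].
  apply: (form_deg (a := fun=> 0%N)); first by move=> j; rewrite big_nil.
  by apply: form_ext (form_cst 1) => v; rewrite big_nil.
apply: (form_deg (a := fun j => (a x j + \sum_(x <- r) a x j)%N)).
  by move=> j; rewrite big_cons.
by apply: form_ext (formM (H x) IH) => v; rewrite big_cons.
Qed.

(** Turns a condition that is not homogeneous, such as a minor, into a form. Where the chosen
    component is nonzero at [w], the polynomial in the scaling factors is nonzero, and so is [f] at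
    some torus translate of [w]. *)
Lemma comp_nz f v : polyf f -> f v != 0 -> exists P, (exists a, multihomog c a P) /\
  (peval P v != 0) /\
  (forall w, peval P w != 0 -> exists2 l : vec K J, (forall j, l j != 0) & f (scale c l w) != 0).
Proof.
move=> [P fP]; have [Q [Q1 Q2]] := scale_poly P v => fv.
have Q0 : Q != 0.
  apply: contraNneq fv => Q0; rewrite fP.
  have := Q1 (fun=> 1); rewrite Q0 meval0 => ->; apply/eqP; congr peval.
  by apply/ffunP => i; rewrite ffunE mul1r.
have [m mQ] : exists m, Q@_m != 0.
  apply: NNPP => H; case/eqP: Q0; apply/mpolyP => m; rewrite mcoeff0.
  by apply/eqP/negPn/negP => mQ; apply: H; exists m.
pose a j := m (enum_rank j).
have mE : m = [multinom a (enum_val k) | k < #|J|].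
  by apply/mnmP => k; rewrite mnmE /a enum_valK.
exists (hcomp a P); split; first by exists a; exact: hcomp_multihomog.
split; first by rewrite -Q2 -mE.
move=> w; have [Q' [Q'1 Q'2]] := scale_poly P w; rewrite -Q'2 -mE => mQ'.
apply: NNPP => H; case/eqP: mQ'; suff -> : Q' = 0 by rewrite mcoeff0.
apply: mpoly_torus_eq0 => l l0; apply/eqP/negPn/negP => Ql; apply: H.
exists [ffun j => l j]; first by move=> j; rewrite ffunE.
rewrite fP; move: Ql; rewrite Q'1; congr (peval _ _ != 0).
by apply/ffunP => i; rewrite !ffunE.
Qed.

End Forms.
End PolyFun.

(** * Directional derivatives and Taylor expansion to second order *)

Section Derivative.
Variables (K : closedFieldType) (I : finType).
Implicit Types (f g : vec K I -> K) (u v w x : vec K I).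

Lemma polyf_ind (Q : (vec K I -> K) -> Prop) :
  (forall f g, f =1 g -> Q f -> Q g) ->
  (forall a, Q (fun=> a)) -> (forall i, Q (fun v => v i)) ->
  (forall f g, polyf f -> polyf g -> Q f -> Q g -> Q (fun v => f v + g v)) ->
  (forall f g, polyf f -> polyf g -> Q f -> Q g -> Q (fun v => f v * g v)) ->
  forall f, polyf f -> Q f.
Proof.
move=> Qe Qc Qv QD QM f [P fP].
pose G f := polyf f /\ Q f.
have Gx i k : G (fun v => v i ^+ k).
  elim: k => [|k [IH1 IH2]].
    by split; [apply: polyf_ext (polyf_cst _ 1) | apply: Qe (Qc 1)] => v; rewrite expr0.
  have Hv := @polyf_var K I i.
  by split; [apply: polyf_ext (polyfM Hv IH1) | apply: Qe (QM _ _ Hv IH1 (Qv i) IH2)] => v;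
     rewrite exprS.
have Gp r (m : 'I_#|I| -> nat) : G (fun v => \prod_(i <- r) v (enum_val i) ^+ m i).
  elim: r => [|i r [IH1 IH2]].
    by split; [apply: polyf_ext (polyf_cst _ 1) | apply: Qe (Qc 1)] => v; rewrite big_nil.
  have [H1 H2] := Gx (enum_val i) (m i).
  by split; [apply: polyf_ext (polyfM H1 IH1) | apply: Qe (QM _ _ H1 IH1 H2 IH2)] => v;
     rewrite big_cons.
have Gs r : G (fun v => \sum_(m <- r) P@_m * \prod_i v (enum_val i) ^+ (m : 'X_{1..#|I|}) i).
  elim: r => [|m r [IH1 IH2]].
    by split; [apply: polyf_ext (polyf_cst _ 0) | apply: Qe (Qc 0)] => v; rewrite big_nil.
  have [H1 H2] := Gp (index_enum _) m.
  have Hc := polyf_cst I P@_m.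
  have H3 := polyfM Hc H1.
  by split; [apply: polyf_ext (polyfD H3 IH1) |
    apply: Qe (QD _ _ H3 IH1 (QM _ _ Hc H1 (Qc _) H2) IH2)] => v; rewrite big_cons.
have [_] := Gs (msupp P); apply: Qe => v; by rewrite fP /peval mevalE.
Qed.

Definition dline v u (s : K) : vec K I := [ffun i => v i + s * u i].

(** Read off from the polynomial that [f] induces on the line through [v] in direction [u], which is
    unique by [D_uniq]; no polynomial representing [f] itself is chosen. *)
Definition D f v u : K :=
  (epsilon (inhabits 0) (fun p : {poly K} => forall s, f (dline v u s) = p.[s]))^`().[0].

Lemma D_uniq f v u (p : {poly K}) : (forall s, f (dline v u s) = p.[s]) ->
  D f v u = p^`().[0].
Proof.
move=> H; rewrite /D.
have := epsilon_spec (inhabits 0) (fun p : {poly K} => forall s, f (dline v u s) = p.[s])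
  (ex_intro _ p H).
set q := epsilon _ _ => qE; congr (_^`().[0]); apply/eqP; rewrite -subr_eq0; apply/eqP.
by apply: poly_fun_eq0 => s; rewrite hornerD hornerN -qE H subrr.
Qed.

Lemma D_ext f g v u : f =1 g -> D f v u = D g v u.
Proof.
by move=> /functional_extensionality ->.
Qed.

Lemma polyf_dline f v u : polyf f -> exists p : {poly K}, forall s, f (dline v u s) = p.[s].
Proof.
move=> pf; apply: (polyf_upoly (g := fun i s => v i + s * u i) pf) => i.
by apply: upolyD; [exact: upoly_cst | apply: upolyM; [exact: upoly_id | exact: upoly_cst]].
Qed.

Lemma dline0 v u : dline v u 0 = v.
Proof. by apply/ffunP => i; rewrite ffunE mul0r addr0. Qed.

Lemma D_cst a v u : D (fun=> a) v u = 0.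
Proof. by rewrite (@D_uniq _ _ _ a%:P) ?derivC ?horner0 // => s; rewrite hornerC. Qed.

Lemma D_var i v u : D (fun w => w i) v u = u i.
Proof.
rewrite (@D_uniq _ _ _ ((v i)%:P + u i *: 'X)); last first.
  by move=> s; rewrite ffunE hornerD hornerC hornerZ hornerX mulrC.
by rewrite derivD derivC add0r derivZ derivX hornerZ hornerC mulr1.
Qed.

Lemma DD f g v u : polyf f -> polyf g ->
  D (fun w => f w + g w) v u = D f v u + D g v u.
Proof.
move=> /(@polyf_dline _ v u) [p pE] /(@polyf_dline _ v u) [q qE].
rewrite (D_uniq pE) (D_uniq qE) (@D_uniq _ _ _ (p + q)) ?derivD ?hornerD //.
by move=> s; rewrite hornerD pE qE.
Qed.

Lemma DM f g v u : polyf f -> polyf g ->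
  D (fun w => f w * g w) v u = D f v u * g v + f v * D g v u.
Proof.
move=> /(@polyf_dline _ v u) [p pE] /(@polyf_dline _ v u) [q qE].
rewrite (D_uniq pE) (D_uniq qE) (@D_uniq _ _ _ (p * q)).
  by rewrite derivM hornerD !hornerM -pE -qE dline0.
by move=> s; rewrite hornerM pE qE.
Qed.

Lemma DZ k f v u : polyf f -> D (fun w => k * f w) v u = k * D f v u.
Proof. by move=> pf; rewrite DM ?D_cst ?mul0r ?add0r //; exact: polyf_cst. Qed.

Lemma DN f v u : polyf f -> D (fun w => - f w) v u = - D f v u.
Proof.
by move=> pf; rewrite -[RHS]mulN1r -DZ //; apply: D_ext => w; rewrite mulN1r.
Qed.

Lemma DB f g v u : polyf f -> polyf g ->
  D (fun w => f w - g w) v u = D f v u - D g v u.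
Proof. by move=> pf pg; rewrite DD ?DN //; exact: polyfN. Qed.

Lemma D_sum (A : Type) (r : seq A) (f : A -> vec K I -> K) v u :
  (forall a, polyf (f a)) ->
  D (fun w => \sum_(a <- r) f a w) v u = \sum_(a <- r) D (f a) v u.
Proof.
move=> H; elim: r => [|a r IH].
  rewrite big_nil -[RHS](D_cst 0 v u); apply: D_ext => w; by rewrite big_nil.
rewrite big_cons -IH -DD //; last by apply: polyf_sum.
by apply: D_ext => w; rewrite big_cons.
Qed.

Lemma D_lin f v : polyf f -> forall k u w,
  D f v [ffun i => k * u i + w i] = k * D f v u + D f v w.
Proof.
move=> pf k u w; elim/polyf_ind: f / pf => [f g fg|a|i|f g pf pg IHf IHg|f g pf pg IHf IHg].
- by rewrite !(D_ext _ _ fg).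
- by rewrite !D_cst mulr0 addr0.
- by rewrite !D_var ffunE.
- by rewrite !DD // IHf IHg; ring.
by rewrite !DM // IHf IHg; ring.
Qed.

Definition basev (i : I) : vec K I := [ffun j => (i == j)%:R].

Lemma D_sum_dir (A : Type) (r : seq A) (k : A -> K) (u : A -> vec K I) f v : polyf f ->
  D f v [ffun i => \sum_(a <- r) k a * u a i] = \sum_(a <- r) k a * D f v (u a).
Proof.
move=> pf; elim: r => [|a r IH].
  rewrite big_nil.
  have := D_lin v pf (-1) [ffun=> 0] [ffun=> 0]; rewrite mulN1r addNr => H.
  rewrite -[RHS]H; congr D.
  by apply/ffunP => i; rewrite !ffunE big_nil mulr0 addr0.
rewrite big_cons -IH -D_lin //; congr D; apply/ffunP => i.
by rewrite !ffunE big_cons.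
Qed.

Lemma D_basev f v u : polyf f -> D f v u = \sum_i u i * D f v (basev i).
Proof.
move=> pf; rewrite -D_sum_dir //; congr D; apply/ffunP => j.
rewrite ffunE (bigD1 j) //= ffunE eqxx mulr1 big1 ?addr0 // => i /negbTE ij.
by rewrite ffunE ij mulr0.
Qed.

Lemma polyf_D f u : polyf f -> polyf (fun v => D f v u).
Proof.
move=> pf; elim/polyf_ind: f / pf => [f g fg|a|i|f g pf pg IHf IHg|f g pf pg IHf IHg].
- by apply: polyf_ext => v; exact: D_ext.
- by apply: polyf_ext (polyf_cst _ 0) => v; rewrite D_cst.
- by apply: polyf_ext (polyf_cst _ (u i)) => v; rewrite D_var.
- by apply: polyf_ext (polyfD IHf IHg) => v; rewrite DD.
by apply: polyf_ext (polyfD (polyfM IHf pg) (polyfM pf IHg)) => v; rewrite DM.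
Qed.

Definition of_ord0 (T : Type) (k : 'I_0) : T :=
  let: Ordinal _ lt := k in False_rect T (Bool.diff_false_true lt).

(** The square of a maximal ideal is recognised from values and derivatives by means of this
    expansion: the remainder is a sum of products of two functions vanishing at [x], with polynomial
    coefficients. *)
Lemma taylor2 f x : polyf f -> exists (n : nat) (i j : 'I_n -> I) (S : 'I_n -> vec K I -> K),
  (forall k, polyf (S k)) /\
  forall v, f v = f x + D f x [ffun l => v l - x l] +
    \sum_(k < n) (v (i k) - x (i k)) * (v (j k) - x (j k)) * S k v.
Proof.
(* Sums indexed by sequences are easier to concatenate than ordinal sums. *)
suff H : polyf f -> exists r : seq (I * I * (vec K I -> K)),
  (forall k, (k < size r)%N -> forall t, polyf (nth t r k).2) /\
  forall v, f v = f x + D f x [ffun l => v l - x l] +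
    \sum_(t <- r) (v t.1.1 - x t.1.1) * (v t.1.2 - x t.1.2) * t.2 v.
  move=> /H [r [rp rE]].
  case: r rp rE => [|t r] rp rE.
    exists 0%N, (@of_ord0 I), (@of_ord0 I), (fun _ _ => 0).
    by split=> [[]//|v]; rewrite rE big_nil big_ord0.
  exists (size (t :: r)), (fun k => (nth t (t :: r) k).1.1), (fun k => (nth t (t :: r) k).1.2),
    (fun k => (nth t (t :: r) k).2).
  by split=> [k|v]; [exact: rp | rewrite rE (big_nth t) big_mkord].
have fa (r : seq (I * I * (vec K I -> K))) (P : _ -> Prop) :
   (forall k, (k < size r)%N -> forall t, P (nth t r k)) <-> (List.Forall P r).
  elim: r => [|t r IH]; first by split=> // _; constructor.
  split=> [H|H].
    constructor; first by have := H 0%N isT t.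
    by apply/IH => k kr s; have := H k.+1 kr s.
  by inversion H; subst; case=> [|k] kr s //=; apply: (iffRL IH).
move=> pf; suff [r [rp rE]] : exists r : seq (I * I * (vec K I -> K)),
    List.Forall (fun t => polyf t.2) r /\
    forall v, f v = f x + D f x [ffun l => v l - x l] +
    \sum_(t <- r) (v t.1.1 - x t.1.1) * (v t.1.2 - x t.1.2) * t.2 v.
  by exists r; split=> //; apply: (iffRL (fa r (fun t => polyf t.2))).
pose dv v : vec K I := [ffun l => v l - x l].
have pdv i : polyf (fun v : vec K I => v i - x i).
  by apply: polyfB; [exact: polyf_var | exact: polyf_cst].
have pD g : polyf g -> polyf (fun v => D g x (dv v)).
  move=> pg; apply: (@polyf_ext _ _ (fun v => \sum_i (v i - x i) * D g x (basev i))).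
    by move=> v; rewrite (D_basev _ _ pg); apply: eq_bigr => i _; rewrite ffunE.
  by apply: polyf_sum => i _; apply: polyfM => //; exact: polyf_cst.
elim/polyf_ind: f / pf => [f g fg|a|i|f g pf pg [r [rp rE]] [r' [rp' rE']]
    |f g pf pg [r [rp rE]] [r' [rp' rE']]].
- by move=> [r [rp rE]]; exists r; split=> // v; rewrite -!fg rE (D_ext _ _ fg).
- by exists [::]; split=> [|v]; [constructor | rewrite big_nil D_cst !addr0].
- exists [::]; split=> [|v]; [by constructor | rewrite big_nil D_var ffunE addr0].
  by rewrite addrC subrK.
- exists (r ++ r'); split; first by apply/List.Forall_app.
  by move=> v; rewrite big_cat /= DD // rE rE'; ring.
(* The remainder of a product: the remainder of [f] times [g], the first-order part of [f] times the
   remainder of [g], and the product of the two linear parts. *)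
pose m1 := [seq (t.1, fun v => t.2 v * g v) | t <- r].
pose m2 := [seq (t.1, fun v => t.2 v * (f x + D f x (dv v))) | t <- r'].
pose m3 := [seq ((p.1, p.2), fun v : vec K I => D f x (basev p.1) * D g x (basev p.2))
   | p <- [seq (i, j) | i <- enum I, j <- enum I]].
exists (m1 ++ m2 ++ m3); split.
  apply/List.Forall_app; split; first apply/List.Forall_map.
    apply: List.Forall_impl rp => t /= pt; exact: polyfM.
  apply/List.Forall_app; split; apply/List.Forall_map.
    apply: List.Forall_impl rp' => t /= pt; apply: polyfM => //; apply: polyfD.
      exact: polyf_cst.
    exact: pD.
  by apply/List.Forall_forall => p _ /=; exact: polyf_cst.
move=> v; rewrite !big_cat /= !big_map DM //.
have -> : \sum_(t <- r) (v t.1.1 - x t.1.1) * (v t.1.2 - x t.1.2) * (t.2 v * g v)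
   = (\sum_(t <- r) (v t.1.1 - x t.1.1) * (v t.1.2 - x t.1.2) * t.2 v) * g v.
  by rewrite mulr_suml; apply: eq_bigr => t _; rewrite mulrA.
have -> : \sum_(t <- r') (v t.1.1 - x t.1.1) * (v t.1.2 - x t.1.2) * (t.2 v * (f x + D f x (dv v)))
   = (\sum_(t <- r') (v t.1.1 - x t.1.1) * (v t.1.2 - x t.1.2) * t.2 v) * (f x + D f x (dv v)).
  by rewrite mulr_suml; apply: eq_bigr => t _; rewrite mulrA.
have -> : \sum_(p <- [seq (i, j) | i <- enum I, j <- enum I])
    (v p.1 - x p.1) * (v p.2 - x p.2) * (D f x (basev p.1) * D g x (basev p.2)) =
    D f x (dv v) * D g x (dv v).
  rewrite big_allpairs_dep /= (D_basev _ _ pf) (D_basev _ _ pg) mulr_suml big_enum /=.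
  apply: eq_bigr => i _; rewrite big_enum mulr_sumr /=; apply: eq_bigr => j _.
  by rewrite !ffunE; ring.
rewrite (rE v) (rE' v) -/(dv v).
set sf := \sum_(t <- r) _; set sg := \sum_(t <- r') _; ring.
Qed.

End Derivative.

(** * Sections and tangent spaces *)

Section Variety.
Variables (K : closedFieldType) (I J : finType) (c : I -> J).
Implicit Types (X U Z : vec K I -> Prop) (f g h : vec K I -> K) (v w p u : vec K I).

Definition vanish X f := forall v, X v -> f v = 0.

Lemma zclosed_ext X Z : (forall v, X v <-> Z v) -> zclosed c X -> zclosed c Z.
Proof.
move=> XZ [S S1 S2]; exists S => // v; by rewrite -XZ S2.
Qed.

Lemma zclosed_forms (S : (vec K I -> K) -> Prop) :
  (forall f, S f -> exists a, form c a f) ->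
  zclosed c (fun v => is_point c v /\ forall f, S f -> f v = 0).
Proof.
move=> HS; exists (fun P => (exists a, multihomog c a P) /\ S (peval P)).
  by move=> P [].
move=> v; split=> [[pv H]|[pv H]]; split=> //.
  by move=> P [_ SP]; apply: H.
move=> f Sf; have [a fa] := HS _ Sf; have [P PP fP] := formP fa.
rewrite fP; apply: H; split; first by exists a.
by rewrite (_ : peval P = f) //; apply: functional_extensionality => w; rewrite fP.
Qed.

Lemma zclosed_point X v : zclosed c X -> X v -> is_point c v.
Proof. by move=> [S _ H] /H []. Qed.

Lemma zclosedE X : zclosed c X -> forall v, X v <->
  is_point c v /\ (forall a f, form c a f -> vanish X f -> f v = 0).
Proof.
move=> [S S1 S2] v; split=> [Xv|[pv H]].
  split; first by case/S2: Xv.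
  by move=> a f _; apply.
apply/S2; split=> // P SP; have [a PP] := S1 P SP.
apply: (H a) (multihomog_form PP) _ => w /S2 [_]; exact.
Qed.

Lemma is_point_scale l v : (forall j, l j != 0) -> is_point c v -> is_point c (scale c l v).
Proof.
move=> l0 pv j; have [i ij vi] := pv j; exists i => //.
by rewrite ffunE mulf_neq0.
Qed.

Lemma zclosed_scale X l v : zclosed c X -> (forall j, l j != 0) -> X v -> X (scale c l v).
Proof.
move=> HX l0 Xv; apply/(zclosedE HX); split.
  by apply: is_point_scale => //; apply: zclosed_point Xv.
by move=> a f [_ fh] fX; rewrite fh // fX // mulr0.
Qed.

Lemma zopen_form X a f : zclosed c X -> form c a f -> zopen_in c X (fun v => X v /\ f v != 0).
Proof.
move=> HX ff; exists (fun v => is_point c v /\ forall g, g = f -> g v = 0).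
  by apply: zclosed_forms => g ->; exists a.
move=> v; split=> [[Xv fv]|[Xv H]]; split=> //.
  by move=> [_ /(_ f erefl)]; apply/eqP.
apply/negP => /eqP fv; apply: H; split; first exact: zclosed_point Xv.
by move=> g ->.
Qed.

Lemma zopen_basic X U p : zclosed c X -> zopen_in c X U -> U p ->
  exists a f, [/\ form c a f, f p != 0 & forall v, X v -> f v != 0 -> U v].
Proof.
move=> HX [Z [S S1 S2] HU] /HU [Xp nZp].
have [P [SP Pp]] : exists P, S P /\ peval P p != 0.
  apply: NNPP => H; apply: nZp; apply/S2; split; first exact: zclosed_point Xp.
  by move=> P SP; apply/eqP/negPn/negP => Pp; apply: H; exists P.
have [a PP] := S1 P SP.
exists a, (peval P); split=> //; first exact: multihomog_form.
move=> v Xv Pv; apply/HU; split=> // /S2 [_ H]; by rewrite H ?eqxx in Pv.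
Qed.

Lemma zopen_sub X U v : zopen_in c X U -> U v -> X v.
Proof. by move=> [Z _ H] /H []. Qed.

(** Irreducibility concerns closed sets, hence forms. For arbitrary polynomial functions one passes
    to components by [comp_nz], and then looks for a common scaling factor, using that the torus is
    irreducible. *)
Lemma irr_dom X f g : zclosed c X -> zirreducible c X -> polyf f -> polyf g ->
  (exists2 v, X v & f v != 0) -> (exists2 v, X v & g v != 0) ->
  exists v, [/\ X v, f v != 0 & g v != 0].
Proof.
move=> HX [_ HI] pf pg [v Xv fv] [w Xw gw].
have [P [[a Pa] [Pv Pf]]] := comp_nz c pf fv.
have [Q [[b Qb] [Qw Qg]]] := comp_nz c pg gw.
have [x [Xx Px Qx]] : exists x, [/\ X x, peval P x != 0 & peval Q x != 0].
  apply: NNPP => H.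
  pose Z R (x : vec K I) := is_point c x /\ forall h, h = peval R -> h x = 0.
  have HZ a' R : multihomog c a' R -> zclosed c (Z R).
    by move=> Ra; apply: zclosed_forms => h ->; exists a'; exact: multihomog_form.
  case: (HI (Z P) (Z Q) (HZ _ _ Pa) (HZ _ _ Qb)) => [x Xx|ZP|ZQ].
  - have px := zclosed_point HX Xx.
    have [Px|Px] := eqVneq (peval P x) 0; first by left; split=> // h ->.
    right; split=> // h ->; apply/eqP/negPn/negP => Qx; by apply: H; exists x.
  - by have [_ /(_ _ erefl) e] := ZP v Xv; rewrite e eqxx in Pv.
  by have [_ /(_ _ erefl) e] := ZQ w Xw; rewrite e eqxx in Qw.
(* Both functions are nonzero at torus translates of the same [x]. The product of the coordinates of
   the scaling vector keeps the common choice inside the torus. *)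
have [l0 l0n fl] := Pf _ Px; have [l1 l1n gl] := Qg _ Qx.
pose sc (k : vec K I -> K) (l : vec K J) := k (scale c l x).
have psc k : polyf k -> polyf (sc k).
  move=> pk; apply: (polyf_comp (g := fun i (l : vec K J) => l (c i) * x i) pk) => i.
  by apply: polyfM; [exact: polyf_var | exact: polyf_cst].
have pprod : polyf (fun l : vec K J => \prod_j l j).
  by apply: polyf_prod => j _; exact: polyf_var.
have nzprod (l : vec K J) : (forall j, l j != 0) -> \prod_j l j != 0.
  by move=> ln; apply/prodf_neq0.
have [l2 [fl2 gl2]] : exists l, sc f l * (\prod_j l j) != 0 /\ sc g l != 0.
  apply: (polyf_dom (polyfM (psc f pf) pprod) (psc g pg)).
    by exists l0; rewrite mulf_neq0 ?nzprod.
  by exists l1.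
move: fl2; rewrite mulf_eq0 negb_or => /andP [fl2 pl2].
exists (scale c l2 x); split=> //; apply: zclosed_scale => // j.
by apply: contraNneq pl2 => e; rewrite (bigD1 j) //= e mul0r.
Qed.

Lemma irr_of_dom X : (exists v, X v) -> (forall v, X v -> is_point c v) ->
  (forall a b f g, form c a f -> form c b g ->
     (exists2 v, X v & f v != 0) -> (exists2 v, X v & g v != 0) ->
     exists v, [/\ X v, f v != 0 & g v != 0]) -> zirreducible c X.
Proof.
move=> X0 Xpt H; split=> // A B HA HB AB; apply: NNPP => N.
have nz Z : zclosed c Z -> ~ (forall v, X v -> Z v) ->
    exists a f, [/\ form c a f, vanish Z f & exists2 v, X v & f v != 0].
  move=> HZ N'; apply: NNPP => N2; apply: N' => v Xv; apply/(zclosedE HZ).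
  split; first exact: Xpt.
  move=> a f fa fZ; apply/eqP/negPn/negP => fv; apply: N2; exists a, f.
  by split=> //; exists v.
have [|a [f [fa fA Hf]]] := nz A HA; first by move=> ?; apply: N; left.
have [|b [g [gb gB Hg]]] := nz B HB; first by move=> ?; apply: N; right.
have [v [Xv fv gv]] := H _ _ _ _ fa gb Hf Hg.
by case: (AB v Xv) => [/fA e|/gB e]; rewrite e eqxx in fv gv.
Qed.

Lemma D_scale a f l v u : form c a f -> (forall j, l j != 0) ->
  D f (scale c l v) (scale c l u) = (\prod_j l j ^+ a j) * D f v u.
Proof.
move=> [pf fh] l0; have [p pE] := polyf_dline v u pf.
rewrite (D_uniq pE) (@D_uniq _ _ _ _ _ ((\prod_j l j ^+ a j) *: p)).
  by rewrite derivZ hornerZ.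
move=> s; rewrite hornerZ -pE -fh //; congr f; apply/ffunP => i.
by rewrite !ffunE; ring.
Qed.

(** The tangent vector to the orbit of [v] under the scaling factor of colour [j]. *)
Definition euler (j : J) v : vec K I := [ffun i => if c i == j then v i else 0].

Lemma D_euler a f j v : form c a f -> D f v (euler j v) = (a j)%:R * f v.
Proof.
move=> [pf fh]; have [p pE] := polyf_dline v (euler j v) pf.
rewrite (D_uniq pE).
have -> : p = (1 + 'X) ^+ a j * (f v)%:P.
  apply/eqP; rewrite -subr_eq0; apply/eqP.
  have [//|N] := eqVneq (p - (1 + 'X) ^+ a j * (f v)%:P) 0.
  (* The extra factor [1 + 'X] excludes [s = -1], where the scaling is not invertible. *)
  have [s] : exists s, ((p - (1 + 'X) ^+ a j * (f v)%:P) * (1 + 'X)).[s] != 0.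
    apply: poly_nz; apply: mulf_neq0 => //.
    apply/eqP => /(congr1 (fun q : {poly K} => q.[0])).
    by rewrite hornerD hornerC hornerX horner0 addr0 => /eqP; rewrite oner_eq0.
  rewrite hornerM mulf_eq0 negb_or => /andP [H1 H2].
  case/eqP: H1; move: H2; rewrite !(hornerD, hornerN, hornerM, hornerC, horner_exp, hornerX).
  move=> s1; rewrite -pE.
  pose l j' := if j' == j then 1 + s else 1.
  have -> : dline v (euler j v) s = scale c l v.
    by apply/ffunP => i; rewrite !ffunE /l; case: eqP => _; ring.
  rewrite fh; last by move=> j'; rewrite /l; case: ifP => // _; exact: oner_neq0.
  rewrite (bigD1 j) //= /l eqxx big1 ?mulr1 ?subrr // => j' /negbTE ->.
  by rewrite expr1n.
rewrite derivM derivC mulr0 addr0 hornerM hornerC deriv_exp derivD derivC derivX add0r mul1r.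
by rewrite hornerMn horner_exp hornerD hornerC hornerX addr0 expr1n.
Qed.
End Variety.

(** * Stalks of the sheaves O(d) and differentials of their elements *)

Section Regular.
Variables (K : closedFieldType) (I J : finType) (c : I -> J).
Variables (X : vec K I -> Prop) (HX : zclosed c X).
Implicit Types (U Z : vec K I -> Prop) (f g h : vec K I -> K) (v w p u : vec K I).
Implicit Types d : J -> int.

Definition near_eq p f f' := exists a (w : vec K I -> K), [/\ form c a w, w p != 0 &
  forall v, X v -> w v != 0 -> f v = f' v].

Lemma near_inP p (Q : vec K I -> Prop) : near_in c X p Q <->
  X p /\ exists a (w : vec K I -> K), [/\ form c a w, w p != 0 & forall v, X v -> w v != 0 -> Q v].
Proof.
split.
  move=> [U [HU Up] UQ]; split; first exact: zopen_sub HU Up.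
  have [a [w [wa wp wU]]] := zopen_basic HX HU Up.
  by exists a, w; split=> // v Xv wv; apply: UQ; apply: wU.
move=> [Xp [a [w [wa wp wQ]]]]; exists (fun v => X v /\ w v != 0).
  by split=> //; exact: zopen_form wa.
by move=> v [Xv wv]; apply: wQ.
Qed.

Definition rep d p f g h := exists a b, [/\ form c a g, form c b h,
  (forall j, (a j)%:Z - (b j)%:Z = d j), X p /\ h p != 0 &
  forall v, X v -> h v != 0 -> f v = g v / h v].

Lemma regular_atP d p f : regular_at c X d p f <-> exists g h, rep d p f g h.
Proof.
split.
  move=> [a [b [g [h [ga hb ab]]]]] /near_inP [Xp [e [w [we wp H]]]].
  have [hp _] := H _ Xp wp.
  exists (fun v => peval g v * w v), (fun v => peval h v * w v).
  exists (fun j => a j + e j)%N, (fun j => b j + e j)%N; split.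
  - by apply: formM => //; exact: multihomog_form.
  - by apply: formM => //; exact: multihomog_form.
  - by move=> j; rewrite -ab; lia.
  - by rewrite mulf_neq0.
  move=> v Xv; rewrite mulf_eq0 negb_or => /andP [hv wv].
  have [_ ->] := H _ Xv wv; rewrite -mulf_div divff ?mulr1 //.
move=> [g [h [a [b [ga hb ab [Xp hp] H]]]]].
have [g' g'a gE] := formP ga; have [h' h'b hE] := formP hb.
exists a, b, g', h'; split=> //; apply/near_inP; split=> //.
exists b, h; split=> // v Xv hv; rewrite -hE -gE; split=> //; exact: H.
Qed.

Lemma rep_near d p f f' g h : rep d p f g h -> near_eq p f f' ->
  exists g' h', rep d p f' g' h'.
Proof.
move=> [a [b [ga hb ab [Xp hp] H]]] [e [w [we wp ww]]].
exists (fun v => g v * w v), (fun v => h v * w v).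
exists (fun j => a j + e j)%N, (fun j => b j + e j)%N; split.
- exact: formM.
- exact: formM.
- by move=> j; rewrite -ab; lia.
- by rewrite mulf_neq0.
move=> v Xv; rewrite mulf_eq0 negb_or => /andP [hv wv].
by rewrite -ww // H // -mulf_div divff ?mulr1.
Qed.

Lemma regular_near d p f f' : near_eq p f f' -> regular_at c X d p f -> regular_at c X d p f'.
Proof.
move=> ff' /regular_atP [g [h H]]; apply/regular_atP; exact: rep_near H ff'.
Qed.

Lemma near_eq_refl p f : near_eq p f f.
Proof. by exists (fun=> 0%N), (fun=> 1); split=> //; [exact: form_cst | exact: oner_neq0]. Qed.

Lemma near_eq_ext p f f' : (forall v, X v -> f v = f' v) -> near_eq p f f'.
Proof.
by exists (fun=> 0%N), (fun=> 1); split; [exact: form_cst | exact: oner_neq0 | move=> v Xv _; apply: H].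
Qed.

Lemma near_eq_sym p f f' : near_eq p f f' -> near_eq p f' f.
Proof. by move=> [a [w [wa wp H]]]; exists a, w; split=> // v Xv wv; rewrite H. Qed.

Lemma regular_X d p f : regular_at c X d p f -> X p.
Proof. by move=> /regular_atP [g [h [a [b [_ _ _ []]]]]]. Qed.

Lemma regular_form p a f (d : J -> int) : X p -> form c a f -> (forall j, (a j)%:Z = d j) ->
  regular_at c X d p f.
Proof.
move=> Xp fa ad; apply/regular_atP; exists f, (fun=> 1), a, (fun=> 0%N); split=> //.
- exact: form_cst.
- by move=> j; rewrite subr0.
- by split=> //; exact: oner_neq0.
by move=> v _ _; rewrite divr1.
Qed.

Lemma regular_frac p a b g h (d : J -> int) : X p -> form c a g -> form c b h ->
  h p != 0 -> (forall j, (a j)%:Z - (b j)%:Z = d j) ->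
  regular_at c X d p (fun v => g v / h v).
Proof. by move=> Xp ga hb hp ab; apply/regular_atP; exists g, h, a, b; split. Qed.

Lemma regularD d p f f' : regular_at c X d p f -> regular_at c X d p f' ->
  regular_at c X d p (fun v => f v + f' v).
Proof.
move=> /regular_atP [g [h [a [b [ga hb ab [Xp hp] H]]]]].
move=> /regular_atP [g' [h' [a' [b' [ga' hb' ab' [_ hp'] H']]]]].
apply/regular_atP.
exists (fun v => g v * h' v + g' v * h v), (fun v => h v * h' v).
exists (fun j => a j + b' j)%N, (fun j => b j + b' j)%N; split.
- apply: formD; first exact: formM.
  apply: form_deg (formM ga' hb) => j; have := ab j; have := ab' j; lia.
- exact: formM.
- by move=> j; rewrite -ab; lia.
- by rewrite mulf_neq0.
move=> v Xv; rewrite mulf_eq0 negb_or => /andP [hv hv'].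
by rewrite H // H' // addf_div.
Qed.

Lemma regularM d d' p f f' : regular_at c X d p f -> regular_at c X d' p f' ->
  regular_at c X (fun j => d j + d' j) p (fun v => f v * f' v).
Proof.
move=> /regular_atP [g [h [a [b [ga hb ab [Xp hp] H]]]]].
move=> /regular_atP [g' [h' [a' [b' [ga' hb' ab' [_ hp'] H']]]]].
apply/regular_atP.
exists (fun v => g v * g' v), (fun v => h v * h' v).
exists (fun j => a j + a' j)%N, (fun j => b j + b' j)%N; split.
- exact: formM.
- exact: formM.
- by move=> j; rewrite -ab -ab'; lia.
- by rewrite mulf_neq0.
move=> v Xv; rewrite mulf_eq0 negb_or => /andP [hv hv'].
by rewrite H // H' // mulf_div.
Qed.

Lemma regular_deg d d' p f : (forall j, d j = d' j) -> regular_at c X d p f ->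
  regular_at c X d' p f.
Proof. by move=> /functional_extensionality ->. Qed.

Lemma regular_cst p k : X p -> regular_at c X (fun=> 0) p (fun=> k).
Proof. by move=> Xp; apply: regular_form (form_cst c k) _. Qed.

Lemma regularZ d p k f : regular_at c X d p f -> regular_at c X d p (fun v => k * f v).
Proof.
move=> H; apply: regular_deg (regularM (regular_cst k (regular_X H)) H) => j.
by rewrite add0r.
Qed.

Lemma regularB d p f f' : regular_at c X d p f -> regular_at c X d p f' ->
  regular_at c X d p (fun v => f v - f' v).
Proof.
move=> H H'; have := regularD H (regularZ (-1) H').
by apply: regular_near; apply: near_eq_ext => v _; rewrite mulN1r.
Qed.

Lemma regular0 d p : X p -> regular_at c X d p (fun=> 0).
Proof.
move=> Xp; have pp := zclosed_point HX Xp.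
(* Negative entries of [d] require a denominator of that degree even for the zero section: a
   monomial in coordinates that do not vanish at [p]. *)
pose m j := if d j is Negz k then k.+1 else 0%N.
pose i j := proj1_sig (constructive_indefinite_description (fun i => c i = j /\ p i != 0)
  (let: ex_intro2 i h1 h2 := pp j in ex_intro _ i (conj h1 h2))).
have iP j : c (i j) = j /\ p (i j) != 0 by rewrite /i; case: constructive_indefinite_description.
pose h v := \prod_j v (i j) ^+ m j.
have hf : form c m h.
  apply: form_deg (form_prod _ (fun j => formX (m j) (form_var K c (i j)))) => j.
  rewrite (bigD1 j) //= (iP j).1 eqxx muln1 big1 ?addn0 // => j' /negbTE.
  by rewrite (iP j').1 => ->; rewrite muln0.
apply/regular_atP; exists (fun=> 0), h, (fun j => if d j is Posz k then k else 0%N), m.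
split=> //; first exact: form0.
- by move=> j; rewrite /m; case: (d j) => k //; lia.
- by split=> //; apply/prodf_neq0 => j _; rewrite expf_neq0 // (iP j).2.
by move=> v _ _; rewrite mul0r.
Qed.

Lemma regular_sum d p (A : Type) (r : seq A) (f : A -> vec K I -> K) : X p ->
  (forall x, regular_at c X d p (f x)) ->
  regular_at c X d p (fun v => \sum_(x <- r) f x v).
Proof.
move=> Xp H; elim: r => [|x r IH].
  by apply: regular_near (regular0 d Xp); apply: near_eq_ext => v _; rewrite big_nil.
by apply: regular_near (regularD (H x) IH); apply: near_eq_ext => v _; rewrite big_cons.
Qed.

Lemma regular_scale d p f l : regular_at c X d p f -> (forall j, l j != 0) ->
  f (scale c l p) = (\prod_j l j ^ d j) * f p.
Proof.
move=> /regular_atP [g [h [a [b [[_ ga] [_ hb] ab [Xp hp] H]]]]] l0.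
have hl : h (scale c l p) != 0.
  by rewrite hb // mulf_neq0 //; apply/prodf_neq0 => j _; rewrite expf_neq0.
rewrite H //; last exact: zclosed_scale.
rewrite H // ga // hb //.
have -> : \prod_j l j ^ d j = (\prod_j l j ^+ a j) / (\prod_j l j ^+ b j).
  rewrite -prodfV -big_split /=; apply: eq_bigr => j _; rewrite -ab.
  by rewrite expfzDr // exprnP -exprnN.
by rewrite mulf_div.
Qed.

(** The tangent space of the multi-cone, not of [X]: it contains the Euler vectors, one for each
    colour. *)
Definition tangent p u := forall a f, form c a f -> vanish X f -> D f p u = 0.

Lemma tangent_lin p k u w : tangent p u -> tangent p w -> tangent p [ffun i => k * u i + w i].
Proof.
move=> Hu Hw a f fa fX; rewrite D_lin; last by case: fa.
by rewrite (Hu a) // (Hw a) // mulr0 addr0.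
Qed.

Lemma tangent_euler p j : X p -> tangent p (euler c j p).
Proof. by move=> Xp a f fa fX; rewrite (D_euler _ _ fa) fX // mulr0. Qed.

Definition qder g h p u := (D g p u * h p - g p * D h p u) / h p ^+ 2.

(** The difference of the cross products is zero only where the denominators and the form [w] are
    nonzero. Multiplied by them it vanishes on all of [X], so its derivative along a tangent vector
    is zero, and the extra factor cancels. *)
Lemma rep_uniq d p f f' g h g' h' u : rep d p f g h -> rep d p f' g' h' ->
  near_eq p f f' -> tangent p u -> qder g h p u = qder g' h' p u.
Proof.
move=> [a [b [ga hb ab [Xp hp] H]]] [a' [b' [ga' hb' ab' [_ hp'] H']]].
move=> [e [w [we wp ww]]] Tu.
pose F0 v := g v * h' v - g' v * h v.
have F0f : form c (fun j => a j + b' j)%N F0.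
  apply: formB; first exact: formM.
  apply: form_deg (formM ga' hb) => j; have := ab j; have := ab' j; lia.
pose F1 v := h v * h' v * w v.
have F1f := formM (formM hb hb') we.
have F0v v : X v -> h v != 0 -> h' v != 0 -> w v != 0 -> F0 v = 0.
  move=> Xv hv hv' wv; have := ww v Xv wv; rewrite H // H' // => /eqP.
  by rewrite eqr_div // => /eqP; rewrite /F0 => ->; rewrite subrr.
have FX : vanish X (fun v => F0 v * F1 v).
  move=> v Xv; rewrite /F1.
  have [->|hv] := eqVneq (h v) 0; first by rewrite !mul0r mulr0.
  have [->|hv'] := eqVneq (h' v) 0; first by rewrite mulr0 mul0r mulr0.
  have [->|wv] := eqVneq (w v) 0; first by rewrite !mulr0.
  by rewrite F0v // mul0r.
have := Tu _ _ (formM F0f F1f) FX.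
rewrite DM; try by case: F0f. 2: by case: F1f.
rewrite F0v // mul0r addr0 => /eqP; rewrite mulf_eq0.
have -> : (F1 p == 0) = false by apply/negbTE; rewrite /F1 !mulf_neq0.
rewrite orbF => /eqP.
have := F0v p Xp hp hp' wp; rewrite /F0.
case: ga ga' hb hb' => [pg _] [pg' _] [ph _] [ph' _].
rewrite DB ?DM //; try exact: polyfM.
rewrite /qder => E1 E2; apply/eqP; rewrite eqr_div ?expf_neq0 // -subr_eq0; apply/eqP.
have E1' : g p = g' p * h p / h' p.
  by apply: (mulIf hp'); rewrite mulfVK //; apply/eqP; rewrite -subr_eq0 E1.
move: E2; rewrite E1' => E2.
have -> : D g p u = (D g' p u * h p + g' p * D h p u - g' p * h p / h' p * D h' p u) / h' p.
  apply: (mulIf hp'); rewrite mulfVK //; apply/eqP; rewrite -subr_eq0 -E2; apply/eqP; ring.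
by field.
Qed.

(* The differential at [p] of a section of [O(d)]; it depends on the chosen representative
   outside the tangent space. *)
Definition djet d p f u : K :=
  let gh := epsilon (inhabits (f, f)) (fun gh => rep d p f gh.1 gh.2) in qder gh.1 gh.2 p u.

Lemma djetE d p f f' g h u : near_eq p f f' -> rep d p f' g h -> tangent p u ->
  djet d p f u = qder g h p u.
Proof.
move=> ff' H Tu; have [g' [h' H']] := rep_near H (near_eq_sym ff').
have := epsilon_spec (inhabits (f, f)) (fun gh => rep d p f gh.1 gh.2)
  (ex_intro _ (g', h') H').
by move=> H2; apply: rep_uniq H2 H ff' Tu.
Qed.

Lemma djet_near d p f f' u : near_eq p f f' -> regular_at c X d p f -> tangent p u ->
  djet d p f u = djet d p f' u.
Proof.
move=> ff' /regular_atP [g [h H]] Tu.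
rewrite (djetE (near_eq_refl p f) H Tu) (djetE (near_eq_sym ff') H Tu) //.
Qed.

Lemma djet_form d p a f u : X p -> form c a f -> (forall j, (a j)%:Z = d j) -> tangent p u ->
  djet d p f u = D f p u.
Proof.
move=> Xp fa ad Tu.
have H : rep d p f f (fun=> 1).
  exists a, (fun=> 0%N); split=> //; first exact: form_cst.
  - by move=> j; rewrite subr0.
  - by split=> //; exact: oner_neq0.
  by move=> v _ _; rewrite divr1.
rewrite (djetE (near_eq_refl p f) H Tu) /qder D_cst mulr0 subr0 mulr1 expr1n divr1 //.
Qed.

Lemma djetD d p f f' u : regular_at c X d p f -> regular_at c X d p f' -> tangent p u ->
  djet d p (fun v => f v + f' v) u = djet d p f u + djet d p f' u.
Proof.
move=> /regular_atP [g [h H]] /regular_atP [g' [h' H']] Tu.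
rewrite (djetE (near_eq_refl p f) H Tu) (djetE (near_eq_refl p f') H' Tu).
move: H H' => [a [b [ga hb ab [Xp hp] H]]] [a' [b' [ga' hb' ab' [_ hp'] H']]].
have R : rep d p (fun v => f v + f' v) (fun v => g v * h' v + g' v * h v)
    (fun v => h v * h' v).
  exists (fun j => a j + b' j)%N, (fun j => b j + b' j)%N; split.
  - apply: formD; first exact: formM.
    apply: form_deg (formM ga' hb) => j; have := ab j; have := ab' j; lia.
  - exact: formM.
  - by move=> j; rewrite -ab; lia.
  - by rewrite mulf_neq0.
  move=> v Xv; rewrite mulf_eq0 negb_or => /andP [hv hv'].
  by rewrite H // H' // addf_div.
rewrite (djetE (near_eq_refl p _) R Tu) /qder.
case: ga ga' hb hb' => [pg _] [pg' _] [ph _] [ph' _].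
rewrite DD ?DM //; try exact: polyfM.
by field; rewrite hp hp'.
Qed.

Lemma djetM d d' p f f' u : regular_at c X d p f -> regular_at c X d' p f' -> tangent p u ->
  djet (fun j => d j + d' j) p (fun v => f v * f' v) u =
  djet d p f u * f' p + f p * djet d' p f' u.
Proof.
move=> /regular_atP [g [h H]] /regular_atP [g' [h' H']] Tu.
rewrite (djetE (near_eq_refl p f) H Tu) (djetE (near_eq_refl p f') H' Tu).
move: H H' => [a [b [ga hb ab [Xp hp] H]]] [a' [b' [ga' hb' ab' [_ hp'] H']]].
have R : rep (fun j => d j + d' j) p (fun v => f v * f' v) (fun v => g v * g' v)
    (fun v => h v * h' v).
  exists (fun j => a j + a' j)%N, (fun j => b j + b' j)%N; split.
  - exact: formM.
  - exact: formM.
  - by move=> j; rewrite -ab -ab'; lia.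
  - by rewrite mulf_neq0.
  move=> v Xv; rewrite mulf_eq0 negb_or => /andP [hv hv'].
  by rewrite H // H' // mulf_div.
rewrite (djetE (near_eq_refl p _) R Tu) /qder H // H' //.
case: ga ga' hb hb' => [pg _] [pg' _] [ph _] [ph' _].
rewrite !DM //.
by field; rewrite hp hp'.
Qed.

Lemma djetZ d p k f u : regular_at c X d p f -> tangent p u ->
  djet d p (fun v => k * f v) u = k * djet d p f u.
Proof.
move=> /regular_atP [g [h H]] Tu; rewrite (djetE (near_eq_refl p f) H Tu).
move: H => [a [b [ga hb ab [Xp hp] H]]].
have R : rep d p (fun v => k * f v) (fun v => k * g v) h.
  exists a, b; split=> //; first exact: formZ.
  by move=> v Xv hv; rewrite H // mulrA.
rewrite (djetE (near_eq_refl p _) R Tu) /qder DZ //; last by case: ga.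
by rewrite mulrA mulrBr !mulrA.
Qed.

Lemma djetB d p f f' u : regular_at c X d p f -> regular_at c X d p f' -> tangent p u ->
  djet d p (fun v => f v - f' v) u = djet d p f u - djet d p f' u.
Proof.
move=> H H' Tu; rewrite -[- djet _ _ f' _]mulN1r -djetZ // -djetD //; last exact: regularZ.
apply: djet_near => //; last exact: regularB.
by apply: near_eq_ext => v _; rewrite mulN1r.
Qed.

Lemma djet0 d p u : X p -> tangent p u -> djet d p (fun=> 0) u = 0.
Proof.
move=> Xp Tu; have H := regular0 d Xp.
rewrite -[RHS](mul0r (djet d p (fun=> 0) u)) -djetZ //.
by congr djet; apply: functional_extensionality => v; rewrite mul0r.
Qed.

Lemma djet_sum d p (A : Type) (r : seq A) (f : A -> vec K I -> K) u : X p ->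
  (forall x, regular_at c X d p (f x)) -> tangent p u ->
  djet d p (fun v => \sum_(x <- r) f x v) u = \sum_(x <- r) djet d p (f x) u.
Proof.
move=> Xp H Tu; elim: r => [|x r IH].
  rewrite big_nil -[RHS](djet0 d Xp Tu); congr djet.
  by apply: functional_extensionality => v; rewrite big_nil.
rewrite big_cons -IH -djetD //; last exact: regular_sum.
by congr djet; apply: functional_extensionality => v; rewrite big_cons.
Qed.

Lemma djet_lin d p f k u w : regular_at c X d p f -> tangent p u -> tangent p w ->
  djet d p f [ffun i => k * u i + w i] = k * djet d p f u + djet d p f w.
Proof.
move=> /regular_atP [g [h H]] Tu Tw; rewrite !(djetE (near_eq_refl p f) H) //.
  move: H => [a [b [[pg _] [ph _] ab [Xp hp] H]]]; rewrite /qder !D_lin //.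
  by field; rewrite hp.
exact: tangent_lin.
Qed.

Lemma djet_euler d p f j : regular_at c X d p f ->
  djet d p f (euler c j p) = (d j)%:~R * f p.
Proof.
move=> R; have Xp := regular_X R; move: R => /regular_atP [g [h H]].
rewrite (djetE (near_eq_refl p f) H) //; last exact: tangent_euler.
move: H => [a [b [ga hb ab [_ hp] H]]]; rewrite /qder (D_euler _ _ ga) (D_euler _ _ hb).
by rewrite H // -ab rmorphB /= -!pmulrn; field; rewrite hp.
Qed.

Lemma max_ideal_sq_djet d p f : in_max_ideal_sq c X d p f ->
  [/\ regular_at c X d p f, f p = 0 & forall u, tangent p u -> djet d p f u = 0].
Proof.
move=> [n [a [b [s [H]]]]] /near_inP [Xp [e [w [we wp E]]]].
have E' : near_eq p (fun v => \sum_(k < n) a k v * b k v * s k v) f.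
  by exists e, w; split=> // v Xv wv; rewrite E.
have R k : regular_at c X d p (fun v => a k v * b k v * s k v).
  have [[ra _] [rb _] rs] := H k.
  by apply: regular_deg (regularM (regularM ra rb) rs) => j; rewrite !add0r.
have RS := regular_sum (index_enum 'I_n) Xp R.
split; first exact: regular_near E' RS.
  rewrite E // big1 // => k _; have [[_ ->] _ _] := H k; by rewrite !mul0r.
move=> u Tu; rewrite -(djet_near E') // djet_sum // big1 // => k _.
have [[ra za] [rb zb] rs] := H k.
have dE : d = (fun j => 0 + 0 + d j) by apply: functional_extensionality => j; rewrite !add0r.
rewrite {1}dE djetM // ?djetM // ?za ?zb ?mul0r ?mulr0 ?addr0 ?mul0r //.
exact: regularM ra rb.
Qed.

End Regular.

(** * Regular points *)

Section LinAlg.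
Variable K : fieldType.

(** No finiteness is assumed of [Phi]: if no independent family spanned it, independent families of
    every size would exist, also of size [N.+1]. *)
Lemma span_basis N (Phi : 'rV[K]_N -> Prop) : exists (k : nat) (A : 'M[K]_(k, N)),
  [/\ row_free A, forall i, Phi (row i A) & forall phi, Phi phi -> (phi <= A)%MS].
Proof.
apply: NNPP => H.
have step k : exists A : 'M[K]_(k, N), row_free A /\ forall i, Phi (row i A).
  elim: k => [|k [A [fA PA]]].
    by exists 0; split=> [|[]//]; rewrite /row_free mxrank0.
  have [phi [Pp np]] : exists phi, Phi phi /\ ~~ (phi <= A)%MS.
    apply: NNPP => H'; apply: H; exists k, A; split=> // phi Pp.
    by apply/negPn/negP => np; apply: H'; exists phi.
  exists (col_mx phi A : 'M_(1 + k, N)); split.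
    have lt : (\rank A < \rank (col_mx phi A))%N.
      rewrite -addsmxE; have := mxrank_leqif_sup (addsmxSr phi A) => -[le e].
      rewrite ltn_neqAle le andbT e; apply: contra np => le'.
      by apply: submx_trans le'; exact: addsmxSl.
    by rewrite /row_free eqn_leq rank_leq_row /= (leq_ltn_trans _ lt) // (eqP fA).
  move=> i; case: (splitP (i : 'I_(1 + k))) => j e.
    have -> : i = lshift k j by apply/val_inj.
    rewrite (_ : row _ _ = phi) //. transitivity (row j phi); first exact: (rowKu j phi A).
    by apply/rowP => l; rewrite mxE ord1.
  have -> : i = rshift 1 j by apply/val_inj.
  by rewrite (_ : row _ _ = row j A) //; exact: (rowKd j phi A).
have [A [fA _]] := step N.+1.
by have := rank_leq_col A; rewrite (eqP fA) ltnn.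
Qed.

Lemma submx_of_ker m N (A : 'M[K]_(m, N)) (phi : 'rV[K]_N) :
  (forall u : 'cV[K]_N, A *m u = 0 -> phi *m u = 0) -> (phi <= A)%MS.
Proof.
move=> H; rewrite submxE; apply/eqP/rowP => j.
have := H (cokermx A *m delta_mx j 0); rewrite mulmxA mulmx_coker mul0mx => /(_ erefl).
rewrite mulmxA -colE => /colP /(_ 0); by rewrite !mxE.
Qed.

End LinAlg.
Section Local.
Variables (K : closedFieldType) (I J : finType) (c : I -> J).
Variables (X : vec K I -> Prop) (HX : zclosed c X).
Implicit Types (f g h : vec K I -> K) (v w p u : vec K I) (d : J -> int).

Definition vrow (u : vec K I) : 'rV[K]_#|I| := \row_k u (enum_val k).
Definition rvec (x : 'rV[K]_#|I|) : vec K I := [ffun i => x 0 (enum_rank i)].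

Lemma vrowK u : rvec (vrow u) = u.
Proof. by apply/ffunP => i; rewrite ffunE mxE enum_rankK. Qed.
Lemma rvecK x : vrow (rvec x) = x.
Proof. by apply/rowP => k; rewrite mxE ffunE enum_valK. Qed.

Definition grad f p : 'rV[K]_#|I| := \row_k D f p (basev K (enum_val k)).

Lemma gradE f p u : polyf f -> D f p u = (grad f p *m (vrow u)^T) 0 0.
Proof.
move=> pf; rewrite (D_basev _ _ pf) [RHS]mxE.
rewrite (reindex_onto (@enum_val I xpredT) (@enum_rank I)) /=; last by move=> i _; rewrite enum_rankK.
rewrite (eq_bigl xpredT) => [|k]; last by rewrite enum_valK eqxx.
by apply: eq_bigr => k _; rewrite !mxE mulrC.
Qed.

Definition ideal_grad p (phi : 'rV[K]_#|I|) :=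
  exists a f, [/\ form c a f, vanish X f & phi = grad f p].

(** The rows of [A] are a basis of the conormal space, so that [k] is the codimension of the tangent
    space of the cone. *)
Definition conormal p k (A : 'M[K]_(k, #|I|)) :=
  [/\ row_free A, forall i, ideal_grad p (row i A) &
      forall phi, ideal_grad p phi -> (phi <= A)%MS].

Lemma conormal_ex p : exists k (A : 'M[K]_(k, #|I|)), conormal p A.
Proof. exact: span_basis. Qed.

Lemma conormal_tangent p k (A : 'M[K]_(k, #|I|)) u : conormal p A ->
  tangent c X p u <-> A *m (vrow u)^T = 0.
Proof.
move=> [_ H1 H2]; split=> H.
  apply/row_matrixP => i; rewrite row_mul row0.
  have [a [f [fa fX ->]]] := H1 i.
  by apply/rowP => j; rewrite ord1 -gradE ?(H a f) ?mxE //; case: fa.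
move=> a f fa fX; rewrite gradE; last by case: fa.
have /submxP [B ->] : (grad f p <= A)%MS by apply: H2; exists a, f.
by rewrite -mulmxA H mulmx0 mxE.
Qed.

(* Local coordinates at [p]: [chart i = v_i / v_(loc (c i))]. *)
Section Chart.
Variables (p : vec K I) (Xp : X p).
Let pp := zclosed_point HX Xp.

Definition loc (j : J) : I := proj1_sig (constructive_indefinite_description
  (fun i => c i = j /\ p i != 0) (let: ex_intro2 i h1 h2 := pp j in ex_intro _ i (conj h1 h2))).

Lemma locP j : c (loc j) = j /\ p (loc j) != 0.
Proof. by rewrite /loc; case: constructive_indefinite_description. Qed.

Definition mono (a : J -> nat) (v : vec K I) : K := \prod_j v (loc j) ^+ a j.

Lemma mono_form a : form c a (mono a).
Proof.
apply: form_deg (form_prod _ (fun j => formX (a j) (form_var K c (loc j)))) => j.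
rewrite (bigD1 j) //= (locP j).1 eqxx muln1 big1 ?addn0 // => j' /negbTE.
by rewrite (locP j').1 => ->; rewrite muln0.
Qed.

Lemma mono_nz a : mono a p != 0.
Proof. by apply/prodf_neq0 => j _; rewrite expf_neq0 // (locP j).2. Qed.

Definition chart (v : vec K I) : vec K I := [ffun i => v i / v (loc (c i))].

Lemma chart_scale v : chart v = scale c (fun j => (v (loc j))^-1) v.
Proof. by apply/ffunP => i; rewrite !ffunE mulrC. Qed.

Lemma regular_chart f : polyf f -> regular_at c X (fun=> 0) p (fun v => f (chart v)).
Proof.
elim/polyf_ind => {f} [f g fg|a|i|f g _ _ Rf Rg|f g _ _ Rf Rg].
- by apply: regular_near => //; apply: near_eq_ext => v _; rewrite fg.
- exact: regular_cst.
- apply: (@regular_near _ _ _ _ _ HX (fun=> 0) p (fun v => v i / v (loc (c i)))) => //.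
    by apply: near_eq_ext => v _; rewrite ffunE.
  apply: regular_frac (form_var _ c i) (form_var _ c (loc (c i))) _ _ => //.
    exact: (locP (c i)).2.
  by move=> j; rewrite (locP (c i)).1 subrr.
- exact: regularD.
by apply: regular_deg (regularM HX Rf Rg) => j; rewrite addr0.
Qed.

Lemma form_chart a f v : form c a f -> (forall j, v (loc j) != 0) ->
  f v = mono a v * f (chart v).
Proof.
move=> [_ fh] lv; rewrite chart_scale fh; last by move=> j; rewrite invr_eq0.
rewrite mulrA -[LHS]mul1r; congr (_ * _).
rewrite /mono -big_split /= big1 // => j _; by rewrite exprVn divff // expf_neq0.
Qed.

(** [g] is expanded by [taylor2] in the affine coordinates [chart]. The remainder is then built from
    products of two elements of the maximal ideal, and [mono a v / h v] restores the degree. *)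
Lemma max_ideal_sq_of_grad a b g h d : form c a g -> form c b h -> h p != 0 ->
  (forall j, (a j)%:Z - (b j)%:Z = d j) -> g p = 0 -> (forall u, D g p u = 0) ->
  in_max_ideal_sq c X d p (fun v => g v / h v).
Proof.
move=> ga hb hp ab gp Dg; have [pg gh] := ga.
have g0 : g (chart p) = 0.
  by apply: (mulfI (mono_nz a)); rewrite -form_chart ?gp ?mulr0 // => j; exact: (locP j).2.
have Dg0 u : D g (chart p) u = 0.
  have l0 j : (p (loc j))^-1 != 0 by rewrite invr_eq0 (locP j).2.
  rewrite chart_scale (_ : u = scale c (fun j => (p (loc j))^-1) (scale c (fun j => p (loc j)) u)).
    by rewrite (D_scale _ _ ga) // Dg mulr0.
  by apply/ffunP => i; rewrite !ffunE mulKf // (locP (c i)).2.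
have [n [i [j [S [pS SE]]]]] := taylor2 (chart p) pg.
exists n, (fun k v => chart v (i k) - chart p (i k)), (fun k v => chart v (j k) - chart p (j k)),
  (fun k v => S k (chart v) * (mono a v / h v)).
have mi l : in_max_ideal c X p (fun v => chart v l - chart p l).
  split; last by rewrite subrr.
  by apply: (regular_chart (f := fun v => v l - chart p l)); apply: polyfB;
    [exact: polyf_var | exact: polyf_cst].
split.
  move=> k; split; [exact: mi | exact: mi |].
  apply: regular_deg (regularM HX (regular_chart (pS k))
    (@regular_frac _ _ _ _ _ HX p a b (mono a) h d Xp (mono_form a) hb hp ab)) => l.
  by rewrite add0r.
apply/(near_inP HX); split=> //.
exists (fun=> 1%N), (mono (fun=> 1%N)); split; [exact: mono_form | exact: mono_nz |].
move=> v Xv mv; have lv l : v (loc l) != 0.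
  by apply: contraNneq mv => e; rewrite /mono (bigD1 l) //= e mul0r.
rewrite (form_chart ga lv) SE g0 Dg0 !add0r mulr_sumr mulr_suml.
by apply: eq_bigr => k _; ring.
Qed.

(** The numerator has zero derivative only along the tangent space, so its gradient is a combination
    of gradients of forms vanishing on [X]. Subtracting these forms changes nothing on [X] and makes
    the whole gradient zero. *)
Lemma max_ideal_sq_of_djet d f : regular_at c X d p f -> f p = 0 ->
  (forall u, tangent c X p u -> djet c X d p f u = 0) -> in_max_ideal_sq c X d p f.
Proof.
move=> Rf fp Jf; have [g [h H]] := (iffLR (regular_atP HX d p f) Rf).
have [a [b [ga hb ab [_ hp] E]]] := H.
have gp : g p = 0.
  by apply/eqP; move/eqP: fp; rewrite E // mulf_eq0 invr_eq0 (negbTE hp) orbF.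
have [k [A HA]] := conormal_ex p.
have DgT u : tangent c X p u -> D g p u = 0.
  move=> Tu; have := Jf u Tu; rewrite (djetE (near_eq_refl c X p f) H Tu) /qder gp mul0r subr0.
  by move/eqP; rewrite mulf_eq0 mulf_eq0 invr_eq0 expf_eq0 /= (negbTE hp) !orbF => /eqP.
have /submxP [C CE] : (grad g p <= A)%MS.
  apply: submx_of_ker => x Ax.
  have Tx : tangent c X p (rvec x^T).
    by apply/(conormal_tangent _ HA); rewrite rvecK trmxK.
  have := DgT _ Tx; rewrite gradE; last by case: ga.
  by rewrite rvecK trmxK => e; apply/rowP => l; rewrite ord1 e mxE.
have [_ HA1 _] := HA.
pose af i := constructive_indefinite_description
  (fun x : (J -> nat) * (vec K I -> K) =>
     [/\ form c x.1 x.2, vanish X x.2 & row i A = grad x.2 p])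
  (let: ex_intro a (ex_intro f H) := HA1 i in ex_intro _ (a, f) H).
pose e i := (proj1_sig (af i)).1; pose q i := (proj1_sig (af i)).2.
have qP i : [/\ form c (e i) (q i), vanish X (q i) & row i A = grad (q i) p].
  by rewrite /e /q; case: (af i).
(* Monomials normalised to be 1 at [p] bring all terms to degree [a + T]; as [T] bounds every [e i],
   the subtraction in [m1] is not truncated. *)
pose T j := (\sum_i e i j)%N.
have Te i j : (e i j <= T j)%N by rewrite /T (bigD1 i) //= leq_addr.
pose m0 v := (mono T p)^-1 * mono T v.
pose m1 i v := (mono (fun j => a j + T j - e i j)%N p)^-1 * mono (fun j => a j + T j - e i j)%N v.
pose G v := g v * m0 v - \sum_i C 0 i * (q i v * m1 i v).
have m0p : m0 p = 1 by rewrite /m0 mulVf // mono_nz.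
have m1p i : m1 i p = 1 by rewrite /m1 mulVf // mono_nz.
have m0f : form c T m0 by apply: formZ; exact: mono_form.
have qf i : form c (fun j => a j + T j)%N (fun v => q i v * m1 i v).
  have [qi _ _] := qP i.
  apply: form_deg (formM qi (formZ _ (mono_form _))) => j /=.
  by have := Te i j; lia.
have GX v : X v -> G v = g v * m0 v.
  by move=> Xv; rewrite /G big1 ?subr0 // => i _; have [_ qX _] := qP i; rewrite qX // mul0r mulr0.
have Gf : form c (fun j => a j + T j)%N G.
  apply: formB; first exact: formM.
  by apply: form_sum => i _; exact: formZ.
have DG u : D G p u = 0.
  have pg : polyf g by case: ga.
  have pm0 : polyf m0 by case: m0f.
  have pq i : polyf (q i) by have [[]] := qP i.
  have pm1 i : polyf (m1 i) by case: (formZ (mono (fun j => a j + T j - e i j)%N p)^-1 (mono_form (fun j => a j + T j - e i j)%N)).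
  have ps i : polyf (fun v => C 0 i * (q i v * m1 i v)).
    by apply: polyfM; [exact: polyf_cst | exact: polyfM].
  rewrite DB; [|exact: polyfM|exact: polyf_sum].
  rewrite DM // gp mul0r addr0 m0p mulr1 D_sum //.
  rewrite (gradE _ _ pg) CE -mulmxA mxE; apply/eqP; rewrite subr_eq0; apply/eqP.
  apply: eq_bigr => i _; rewrite DZ; last exact: polyfM.
  have [_ qX Ai] := qP i.
  rewrite DM // m1p mulr1 qX // mul0r addr0; congr (_ * _).
  by rewrite (gradE _ _ (pq i)) -Ai -row_mul [RHS]mxE.
have hm : form c (fun j => b j + T j)%N (fun v => h v * m0 v) by exact: formM.
have [|||//|n [a' [b' [s [Hs /(near_inP HX) [_ [e' [w [we wp Hw]]]]]]]]] :=
  @max_ideal_sq_of_grad (fun j => a j + T j)%N _ G _ d Gf hm.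
- by rewrite m0p mulr1.
- by move=> j; rewrite -ab; lia.
- by rewrite GX // gp mul0r.
exists n, a', b', s; split=> //; apply/(near_inP HX); split=> //.
exists (fun j => e' j + (b j + T j))%N, (fun v => w v * (h v * m0 v)); split.
- exact: formM.
- by rewrite m0p mulr1 mulf_neq0.
move=> v Xv; rewrite !mulf_eq0 !negb_or => /andP [wv /andP [hv mv]].
rewrite -Hw // GX // E // -mulf_div divff ?mulr1 //.
by rewrite /m0 mulf_eq0 negb_or.
Qed.
End Chart.
End Local.

Section RegularPoint.
Variables (K : closedFieldType) (I J : finType) (c : I -> J).
Variables (X : vec K I -> Prop) (HX : zclosed c X).
Implicit Types (f g h : vec K I -> K) (v w p u : vec K I) (d : J -> int).

Lemma has_chain_le n m : (m <= n)%N -> has_chain c X n -> has_chain c X m.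
Proof.
move=> mn [Z [H1 H2]]; exists Z; split=> k km; first by apply: H1; lia.
by apply: H2; lia.
Qed.

Lemma has_dim_eq n m : has_dim c X n -> has_dim c X m -> n = m.
Proof.
move=> [c1 nc1] [c2 nc2]; apply/eqP; rewrite eqn_leq; apply/andP; split.
  by rewrite leqNgt; apply/negP => lt; apply: nc2; apply: has_chain_le c1.
by rewrite leqNgt; apply/negP => lt; apply: nc1; apply: has_chain_le c2.
Qed.

Lemma djet_sum_dir d p f (A : Type) (r : seq A) (k : A -> K) (u : A -> vec K I) :
  regular_at c X d p f -> (forall a, tangent c X p (u a)) ->
  djet c X d p f [ffun i => \sum_(a <- r) k a * u a i] = \sum_(a <- r) k a * djet c X d p f (u a)
  /\ tangent c X p [ffun i => \sum_(a <- r) k a * u a i].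
Proof.
move=> Rf Tu; elim: r => [|a r [IH1 IH2]].
  have T0 : tangent c X p [ffun=> 0].
    move=> b g [pg _] _; rewrite (D_basev _ _ pg) big1 // => i _; by rewrite ffunE mul0r.
  have -> : [ffun i => \sum_(a <- [::]) k a * u a i] = [ffun=> 0] :> vec K I.
    by apply/ffunP => i; rewrite !ffunE big_nil.
  split=> //; rewrite big_nil.
  have := djet_lin HX (-1) Rf T0 T0; rewrite mulN1r addNr => H; rewrite -[RHS]H.
  by congr djet; apply/ffunP => i; rewrite !ffunE mulr0 addr0.
have -> : [ffun i => \sum_(a <- a :: r) k a * u a i] =
   [ffun i => k a * u a i + [ffun i => \sum_(a <- r) k a * u a i] i] :> vec K I.
  by apply/ffunP => i; rewrite !ffunE big_cons.
by split; [rewrite djet_lin // IH1 big_cons | exact: tangent_lin].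
Qed.

Variables (p : vec K I) (Xp : X p) (k : nat) (A : 'M[K]_(k, #|I|)) (HA : conormal c X p A).
Let B := locked (row_base (kermx A^T)).
Let N := #|I|.
Let tau := \rank (kermx A^T).

Lemma tangentB u : tangent c X p u <-> (vrow u <= B)%MS.
Proof.
rewrite (conormal_tangent _ HA) /B -lock (eq_row_base (kermx A^T)).
split=> [H|/sub_kermxP H].
  by apply/sub_kermxP; rewrite -[LHS]trmxK trmx_mul trmxK H trmx0.
by rewrite -[LHS]trmxK trmx_mul trmxK H trmx0.
Qed.

Let rB i := rvec (row i B).

Lemma tangent_rB i : tangent c X p (rB i).
Proof. by apply/tangentB; rewrite rvecK row_sub. Qed.

Definition jrow f : 'rV[K]_tau := \row_i djet c X (fun=> 0) p f (rB i).

Lemma jrowE f (x : 'rV[K]_tau) : regular_at c X (fun=> 0) p f ->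
  (jrow f *m x^T) 0 0 = djet c X (fun=> 0) p f (rvec (x *m B)).
Proof.
move=> Rf; have [H _] := djet_sum_dir (index_enum _) (x 0) Rf tangent_rB.
rewrite mxE (eq_bigr (fun i => x 0 i * djet c X (fun=> 0) p f (rB i))); last first.
  by move=> i _; rewrite !mxE mulrC.
rewrite -H; congr djet; apply/ffunP => i; rewrite !ffunE mxE; apply: eq_bigr => l _.
by rewrite ffunE !mxE.
Qed.

Let E : 'M[K]_(#|J|, N) := \matrix_(j < #|J|) vrow (euler c (enum_val j) p).

Lemma row_E j : row j E = vrow (euler c (enum_val j) p).
Proof. by rewrite rowK. Qed.

Lemma E_free : row_free E.
Proof.
apply: inj_row_free => x xE; apply/rowP => j; rewrite mxE.
have [cj pj] := locP HX Xp (enum_val j).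
have /rowP /(_ (enum_rank (loc HX Xp (enum_val j)))) := xE.
rewrite !mxE (bigD1 j) //= !mxE ffunE enum_rankK cj eqxx big1 ?addr0.
  by move/eqP; rewrite mulf_eq0 (negbTE pj) orbF => /eqP.
move=> l /negbTE lj; rewrite !mxE ffunE enum_rankK cj.
by rewrite (inj_eq enum_val_inj) eq_sym lj mulr0.
Qed.

Lemma E_subB : (E <= B)%MS.
Proof. by apply/row_subP => j; rewrite row_E; apply/tangentB; exact: tangent_euler. Qed.

(** The rows of [B] span the tangent space of the cone and those of [E] are the Euler vectors. [W]
    consists of the covectors killing the Euler vectors, evaluated on [B]: it is the cotangent space
    of [X] itself, smaller by [#|J|]. *)
Let W := kermx E^T *m B^T.

Lemma rank_W : (\rank W + #|J| = tau)%N.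
Proof.
have B_free : \rank B = tau by rewrite /B -lock; apply/eqP/row_base_free.
have h1 := mxrank_mul_ker (kermx E^T) B^T.
have sub : (kermx B^T <= kermx E^T)%MS.
  have [C CE] := submxP E_subB; apply/sub_kermxP.
  by rewrite CE trmx_mul mulmxA mulmx_ker mul0mx.
have e2 : (kermx E^T :&: kermx B^T :=: kermx B^T)%MS by exact: capmx_idPr.
have h2 := mxrank_ker E^T; have h3 := mxrank_ker B^T.
rewrite mxrank_tr (eqP E_free) in h2; rewrite mxrank_tr B_free in h3.
rewrite e2 h2 h3 in h1.
have le1 : (#|J| <= tau)%N by rewrite -(eqP E_free) -B_free; exact: mxrankS E_subB.
have le2 : (tau <= N)%N by rewrite -B_free rank_leq_col.
rewrite /W; lia.
Qed.

Lemma tau_codim : (tau + k = N)%N.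
Proof.
have [/eqP fA _ _] := HA; rewrite /tau mxrank_ker mxrank_tr fA.
by have := rank_leq_col A; rewrite fA /N; lia.
Qed.

Lemma jrow_sub f : regular_at c X (fun=> 0) p f -> (jrow f <= W)%MS.
Proof.
move=> Rf.
have full : row_full B^T.
  by rewrite /row_full mxrank_tr /B -lock; exact: row_base_free.
have /submxP [phi phiE] : (jrow f <= B^T)%MS by exact: submx_full.
have [C CE] := submxP E_subB.
have phi0 : phi *m E^T = 0.
  rewrite CE trmx_mul mulmxA -phiE; apply/rowP => j.
  have := jrowE (row j C) Rf; rewrite -row_mul -CE row_E vrowK djet_euler // mul0r.
  rewrite !mxE => H; rewrite -[RHS]H; apply: eq_bigr => i _; by rewrite !mxE.
have /submxP [y yE] : (phi <= kermx E^T)%MS by apply/sub_kermxP.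
by apply/submxP; exists y; rewrite phiE /W mulmxA -yE.
Qed.

(** A function of degree 0 with differential [phi] at [p], provided that [phi] kills the Euler
    vectors: each coordinate is divided by one of the same colour, and the coefficient compensates
    for this at [p]. *)
Definition coord (phi : 'rV[K]_N) v := \sum_i (phi 0 (enum_rank i) * p (loc HX Xp (c i))) *
  (v i / v (loc HX Xp (c i))).

Lemma coordP (phi : 'rV[K]_N) : phi *m E^T = 0 ->
  in_max_ideal c X p (coord phi) /\ jrow (coord phi) = phi *m B^T.
Proof.
move=> phiE.
have kill j : \sum_(i | c i == j) phi 0 (enum_rank i) * p i = 0.
  have /rowP /(_ (enum_rank j)) := phiE; rewrite !mxE => H; rewrite -[RHS]H big_mkcond /=.
  rewrite [RHS](reindex (@enum_rank I)) /=; last by apply: onW_bij; exact: enum_rank_bij.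
  apply: eq_bigr => i _; rewrite !mxE !ffunE !enum_rankK.
  by case: eqP => _; rewrite ?mulr0.
have lp j : p (loc HX Xp j) != 0 by exact: (locP HX Xp j).2.
have Rc i : regular_at c X (fun=> 0) p (fun v => v i / v (loc HX Xp (c i))).
  apply: regular_frac (form_var _ c i) (form_var _ c (loc HX Xp (c i))) _ _ => //.
  by move=> j; rewrite (locP HX Xp (c i)).1 subrr.
have Rx : regular_at c X (fun=> 0) p (coord phi).
  by apply: regular_sum => // i; exact: regularZ.
split.
  split=> //; rewrite /coord (partition_big c xpredT) //= big1 // => j _.
  rewrite -[RHS](kill j); apply: eq_bigr => i _; by rewrite -mulrA [_ * (_ / _)]mulrC mulfVK.
apply/rowP => l; rewrite !mxE djet_sum //; last exact: tangent_rB.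
  rewrite [RHS](reindex (@enum_rank I)) /=; last by apply: onW_bij; exact: enum_rank_bij.
  have dc i u : tangent c X p u -> djet c X (fun=> 0) p (fun v => v i / v (loc HX Xp (c i))) u =
      (u i * p (loc HX Xp (c i)) - p i * u (loc HX Xp (c i))) / p (loc HX Xp (c i)) ^+ 2.
    move=> Tu.
    have R : rep c X (fun=> 0) p (fun v => v i / v (loc HX Xp (c i)))
        (fun v => v i) (fun v => v (loc HX Xp (c i))).
      exists (fun j => (c i == j) : nat), (fun j => (c (loc HX Xp (c i)) == j) : nat).
      split=> //; [exact: form_var | exact: form_var |].
      by move=> j; rewrite (locP HX Xp (c i)).1 subrr.
    by rewrite (djetE (near_eq_refl c X p _) R Tu) /qder !D_var.
  rewrite (eq_bigr (fun i => phi 0 (enum_rank i) * p (loc HX Xp (c i)) *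
     ((rB l i * p (loc HX Xp (c i)) - p i * rB l (loc HX Xp (c i))) / p (loc HX Xp (c i)) ^+ 2)));
     last first.
    by move=> i _; rewrite djetZ ?dc //; exact: tangent_rB.
  rewrite (eq_bigr (fun i => phi 0 (enum_rank i) * rB l i -
     (phi 0 (enum_rank i) * p i) * (rB l (loc HX Xp (c i)) / p (loc HX Xp (c i))))); last first.
    by move=> i _; field; rewrite lp.
  rewrite sumrB [X in _ - X](partition_big c xpredT) //= [X in _ - X]big1 ?subr0.
    by apply: eq_bigr => i _; rewrite !ffunE !mxE.
  move=> j _; rewrite (eq_bigr (fun i => (phi 0 (enum_rank i) * p i) *
      (rB l (loc HX Xp j) / p (loc HX Xp j)))); last by move=> i /eqP ->.
  by rewrite -mulr_suml kill mul0r.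
by move=> i; exact: regularZ.
Qed.

Lemma msq_jrow f : in_max_ideal c X p f ->
  in_max_ideal_sq c X (fun=> 0) p f <-> jrow f = 0.
Proof.
move=> [Rf fp]; split=> [/(max_ideal_sq_djet HX) [_ _ H]|H].
  by apply/rowP => i; rewrite !mxE H //; exact: tangent_rB.
apply: max_ideal_sq_of_djet => // u /tangentB /submxP [x xE].
by rewrite -(vrowK u) xE -jrowE // H mul0mx mxE.
Qed.

Lemma jrow_lin n (x : 'I_n -> vec K I -> K) (l : 'rV[K]_n) f :
  in_max_ideal c X p f -> (forall i, in_max_ideal c X p (x i)) ->
  in_max_ideal c X p (fun v => f v - \sum_(i < n) l 0 i * x i v) /\
  jrow (fun v => f v - \sum_(i < n) l 0 i * x i v) = jrow f - l *m (\matrix_i jrow (x i)).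
Proof.
move=> [Rf fp] xm.
have Rx i : regular_at c X (fun=> 0) p (fun v => l 0 i * x i v).
  by apply: regularZ => //; case: (xm i).
have RS : regular_at c X (fun=> 0) p (fun v => \sum_(i < n) l 0 i * x i v).
  exact: regular_sum.
split.
  split; first exact: regularB.
  by rewrite fp big1 ?subr0 // => i _; have [_ ->] := xm i; rewrite mulr0.
apply/rowP => j; have Tj := tangent_rB j.
rewrite !mxE djetB // djet_sum //; congr (_ - _); apply: eq_bigr => i _.
by rewrite djetZ // ?mxE //; case: (xm i).
Qed.

(** [jrow] identifies the maximal ideal modulo its square with [W]: it is injective by [msq_jrow]
    and surjective by [coordP]. Regularity thus says that [W] has rank [n]. *)
Lemma regular_point_codim n : has_dim c X n -> regular_point c X p -> (k + n + #|J| = N)%N.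
Proof.
move=> dn [_ [m dm [x xm xP]]]; have e := has_dim_eq dm dn; subst m.
pose M : 'M[K]_(n, tau) := \matrix_i jrow (x i).
have M_free : row_free M.
  apply: inj_row_free => l lM.
  have m0 : in_max_ideal c X p (fun=> 0) by split=> //; exact: regular_cst.
  have J0 : jrow (fun=> 0) = 0.
    by apply/rowP => i; rewrite !mxE djet0 //; exact: tangent_rB.
  have [l' [_ uq]] := xP _ m0.
  have H (y : 'rV_n) : y *m M = 0 -> l' = y.
    move=> yM; apply: uq; have [h1 h2] := jrow_lin y m0 xm.
    by apply/(msq_jrow h1); rewrite h2 J0 -/M yM subr0.
  by rewrite -(H l lM) (H 0) // mul0mx.
have MW : (M :=: W)%MS.
  apply/eqmxP/andP; split.
    by apply/row_subP => i; rewrite rowK; apply: jrow_sub; case: (xm i).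
  apply/row_subP => i; rewrite row_mul.
  have [] := @coordP (row i (kermx E^T)); first by rewrite -row_mul mulmx_ker row0.
  set f := coord _ => fm fE; rewrite -fE.
  have [l [Hl _]] := xP _ fm.
  have [h1 h2] := jrow_lin l fm xm; move/(msq_jrow h1): Hl; rewrite h2 => /eqP.
  by rewrite subr_eq0 => /eqP ->; exact: submxMl.
have := rank_W; rewrite -MW (eqP M_free); have := tau_codim; lia.
Qed.

(** The same identification read backwards: [coord] lifts a basis of [W] to local parameters. *)
Lemma regular_point_of_codim n : has_dim c X n -> (k + n + #|J| = N)%N -> regular_point c X p.
Proof.
move=> dn kn; split=> //; exists n => //.
have rW : \rank W = n by have := rank_W; have := tau_codim; lia.
have fW (i : 'I_n) : exists f, in_max_ideal c X p f /\
    jrow f = row (cast_ord (esym rW) i) (row_base W).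
  have /submxP [y yE] : (row (cast_ord (esym rW) i) (row_base W) <= W)%MS.
    by apply: submx_trans (row_sub _ _) _; rewrite eq_row_base.
  have [] := @coordP (y *m kermx E^T); first by rewrite -mulmxA mulmx_ker mulmx0.
  by rewrite -mulmxA -yE; exists (coord (y *m kermx E^T)).
pose x i := proj1_sig (constructive_indefinite_description _ (fW i)).
have xP i : in_max_ideal c X p (x i) /\ jrow (x i) = row (cast_ord (esym rW) i) (row_base W).
  by rewrite /x; case: constructive_indefinite_description.
exists x; first by move=> i; case: (xP i).
pose M : 'M[K]_(n, tau) := \matrix_i jrow (x i).
have ME : (M :=: row_base W)%MS.
  apply/eqmxP/andP; split; apply/row_subP => i.
    by rewrite rowK (xP i).2 row_sub.
  have -> : row i (row_base W) = row (cast_ord rW i) M.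
    by rewrite rowK (xP _).2 cast_ordK.
  exact: row_sub.
have M_free : row_free M by rewrite /row_free ME (eq_row_base W) rW.
move=> f fm.
have xm i : in_max_ideal c X p (x i) by case: (xP i).
have [l lE] : exists l, jrow f = l *m M.
  apply/submxP; rewrite ME (eq_row_base W); apply: jrow_sub; by case: fm.
exists l; split.
  by have [h1 h2] := jrow_lin l fm xm; apply/(msq_jrow h1); rewrite h2 -/M lE subrr.
move=> l' Hl'; have [h1 h2] := jrow_lin l' fm xm.
move/(msq_jrow h1): Hl'; rewrite h2 -/M lE => /eqP; rewrite subr_eq0 => /eqP.
exact: row_free_inj.
Qed.

End RegularPoint.

(** * Prime ideals of iterated polynomial rings *)

Section IteratedPoly.
Variable K : closedFieldType.

(** Univariate polynomials are iterated because primes are studied by eliminating the last variable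
    with pseudo-division, over coefficients that again form an integral domain. *)
Fixpoint mring (n : nat) : idomainType :=
  if n is m.+1 then {poly (mring m)} else K.

Section Eval.
Variables (B : comNzRingType) (phi : {rmorphism K -> B}) (w : nat -> B).

Fixpoint evm (n : nat) : {rmorphism mring n -> B} :=
  match n return {rmorphism mring n -> B} with
  | 0 => phi
  | m.+1 => [the {rmorphism {poly (mring m)} -> B} of horner_eval (w m) \o map_poly (evm m)]
  end.

Lemma evmS n (F : {poly (mring n)}) : evm n.+1 F = \sum_(i < size F) evm n F`_i * w n ^+ i.
Proof.
rewrite /= /horner_eval (horner_coef_wide _ (size_poly _ _)).
by apply: eq_bigr => i _; rewrite coef_map.
Qed.

Lemma evmS_wide n (F : {poly (mring n)}) m : (size F <= m)%N ->
  evm n.+1 F = \sum_(i < m) evm n F`_i * w n ^+ i.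
Proof.
move=> Fm; rewrite /= /horner_eval (@horner_coef_wide _ m); last first.
  by apply: leq_trans Fm; exact: size_poly.
by apply: eq_bigr => i _; rewrite coef_map.
Qed.

Lemma evm_polyC n (a : mring n) : evm n.+1 a%:P = evm n a.
Proof. by rewrite /= /horner_eval map_polyC hornerC. Qed.

Lemma evm_X n : evm n.+1 'X = w n.
Proof. by rewrite /= /horner_eval map_polyX hornerX. Qed.

End Eval.

Lemma evm_ext (B : comNzRingType) (phi : {rmorphism K -> B}) (w w' : nat -> B) n (F : mring n) :
  (forall k, (k < n)%N -> w k = w' k) -> evm phi w n F = evm phi w' n F.
Proof.
elim: n F => [//|n IH] F H; rewrite !evmS; apply: eq_bigr => i _.
rewrite H // IH // => k kn; apply: H; exact: ltnW.
Qed.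

Lemma evm_comp (B B' : comNzRingType) (phi : {rmorphism K -> B}) (psi : {rmorphism B -> B'})
    (phi' : {rmorphism K -> B'}) (w : nat -> B) n (F : mring n) :
  (forall a, psi (phi a) = phi' a) -> psi (evm phi w n F) = evm phi' (psi \o w) n F.
Proof.
move=> H; elim: n F => [|n IH] F; first exact: H.
rewrite !evmS rmorph_sum; apply: eq_bigr => i _; by rewrite rmorphM rmorphXn IH.
Qed.

Fixpoint cst (n : nat) : {rmorphism K -> mring n} :=
  match n return {rmorphism K -> mring n} with
  | 0 => [the {rmorphism K -> K} of idfun]
  | m.+1 => [the {rmorphism K -> {poly (mring m)}} of polyC \o cst m]
  end.

Lemma evm_cst (B : comNzRingType) (phi : {rmorphism K -> B}) (w : nat -> B) n a :
  evm phi w n (cst n a) = phi a.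
Proof. by elim: n => [//|n IH]; rewrite [cst _ _]/= evm_polyC IH. Qed.

Notation ev v n := (evm (B := K) [the {rmorphism K -> K} of idfun] v n).

Fixpoint mvar (n k : nat) : mring n :=
  match n return mring n with
  | 0 => 0
  | m.+1 => if k == m then 'X else (mvar m k)%:P
  end.

Lemma evm_mvar (B : comNzRingType) (phi : {rmorphism K -> B}) (w : nat -> B) n k :
  (k < n)%N -> evm phi w n (mvar n k) = w k.
Proof.
elim: n => [//|n IH] kn; rewrite [mvar _ _]/=; case: eqP => [->|/eqP kn'].
  exact: evm_X.
by rewrite evm_polyC IH // ltn_neqAle kn' -ltnS.
Qed.

Definition lin (v u : nat -> K) (k : nat) : {poly K} := (v k)%:P + u k *: 'X.
Definition evl (v u : nat -> K) n : {rmorphism mring n -> {poly K}} :=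
  evm [the {rmorphism K -> {poly K}} of polyC] (lin v u) n.
Definition Dm (v u : nat -> K) n (F : mring n) : K := (evl v u n F)^`().[0].
Arguments Dm v u n F : clear implicits.

Lemma evl_horner v u n (F : mring n) s : (evl v u n F).[s] = ev (fun k => v k + s * u k) n F.
Proof.
have := @evm_comp _ _ [the {rmorphism K -> {poly K}} of polyC]
  [the {rmorphism {poly K} -> K} of horner_eval s] [the {rmorphism K -> K} of idfun] (lin v u) n F.
rewrite /= /horner_eval /evl => ->; last by move=> a; rewrite hornerC.
rewrite (_ : _ \o lin v u = fun k => v k + s * u k) //.
apply: functional_extensionality => k; rewrite /= /lin /horner_eval hornerD hornerC hornerZ hornerX.
by rewrite mulrC.
Qed.

Lemma evl0 v u n (F : mring n) : (evl v u n F).[0] = ev v n F.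
Proof.
rewrite evl_horner (_ : (fun k => _) = v) //.
by apply: functional_extensionality => k; rewrite mul0r addr0.
Qed.

Lemma DmD v u n (F G : mring n) : Dm v u n (F + G) = Dm v u n F + Dm v u n G.
Proof. by rewrite /Dm rmorphD derivD hornerD. Qed.

Lemma DmM v u n (F G : mring n) :
  Dm v u n (F * G) = Dm v u n F * ev v n G + ev v n F * Dm v u n G.
Proof. by rewrite /Dm rmorphM derivM hornerD !hornerM !evl0. Qed.

Lemma DmS v u n (F : {poly (mring n)}) m : (size F <= m)%N ->
  Dm v u n.+1 F = \sum_(i < m) (Dm v u n F`_i * v n ^+ i +
     ev v n F`_i * (v n ^+ i.-1 *+ i * u n)).
Proof.
move=> Fm; rewrite /Dm /evl (evmS_wide _ _ Fm) raddf_sum horner_sum.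
apply: eq_bigr => i _; rewrite [X in X.[_]]derivM hornerD !hornerM -/(evl v u n) evl0.
rewrite horner_exp /lin hornerD hornerC hornerZ hornerX mulr0 addr0; congr (_ + _ * _).
rewrite deriv_exp hornerMn hornerM derivD derivC add0r derivZ derivX horner_exp.
rewrite hornerZ hornerC mulr1 hornerD hornerC hornerZ hornerX mulr0 addr0.
by rewrite mulrC mulrnAl.
Qed.

Record prime_ideal (A : comNzRingType) (P : A -> Prop) : Prop := PrimeIdeal {
  prime0 : P 0;
  primeD : forall a b, P a -> P b -> P (a + b);
  primeMl : forall a b, P b -> P (a * b);
  prime1 : ~ P 1;
  primeM : forall a b, P (a * b) -> P a \/ P b }.

Lemma prime_contract (A : idomainType) (P : {poly A} -> Prop) : prime_ideal P ->
  prime_ideal (fun a => P a%:P).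
Proof.
move=> [p0 pD pM p1 pp]; split=> //.
- by move=> a b Pa Pb; rewrite polyCD; apply: pD.
- by move=> a b Pb; rewrite polyCM; apply: pM.
by move=> a b; rewrite polyCM; apply: pp.
Qed.

Section PrimePoly.
Variables (A : idomainType) (P : {poly A} -> Prop) (PP : prime_ideal P).
Let P' a := P a%:P.

Lemma prime_sum (T : Type) (r : seq T) (F : T -> {poly A}) :
  (forall i, P (F i)) -> P (\sum_(i <- r) F i).
Proof.
move=> H; elim: r => [|i r IH]; first by rewrite big_nil; exact: prime0 PP.
by rewrite big_cons; apply: (primeD PP).
Qed.

Lemma prime_coefs (F : {poly A}) : (forall i, P' F`_i) -> P F.
Proof.
move=> H; rewrite -(coefK F) poly_def.
apply: (@prime_sum _ (index_enum 'I_(size F)) (fun i => F`_i *: 'X^i)) => i.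
rewrite -mul_polyC mulrC; apply: (primeMl PP); exact: H.
Qed.

Lemma primeN F : P F -> P (- F).
Proof. by move=> H; rewrite -mulN1r; apply: (primeMl PP). Qed.

Lemma primeX F k : P (F ^+ k) -> P F.
Proof.
elim: k => [|k IH]; first by rewrite expr0 => /(prime1 PP).
by rewrite exprS => /(primeM PP) [].
Qed.

(** Modulo the contraction [P'] the last variable is either transcendental or a root of [Phi], an
    element of least degree having a coefficient outside [P']. If the leading coefficient were in
    [P'], removing the leading term would give a smaller such element. *)
Lemma prime_cases : (forall F, P F -> forall i, P' F`_i) \/
  exists Phi, [/\ P Phi, ~ P' (lead_coef Phi), (1 < size Phi)%N &
    forall F, P F -> (size F < size Phi)%N -> forall i, P' F`_i].
Proof.
case: (classic (forall F, P F -> forall i, P' F`_i)) => [H|N]; first by left.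
right; have [F0 H1] := not_all_ex_not _ _ N.
have [PF0 H2] := imply_to_and _ _ H1; have [i0 H0] := not_all_ex_not _ _ H2.
pose bad n := exists F, [/\ P F, size F = n & exists i, ~ P' F`_i].
have [n [[Phi [PPhi sPhi [i Hi]]] min]] : exists n, bad n /\ forall m, (m < n)%N -> ~ bad m.
  have : bad (size F0) by exists F0; split=> //; exists i0.
  elim/ltn_ind: (size F0) => n IH bn.
  have [[m [mn bm]]|NB] := classic (exists m, (m < n)%N /\ bad m); first exact: IH bm.
  by exists n; split=> // m mn bm; apply: NB; exists m.
have small F : P F -> (size F < size Phi)%N -> forall i, P' F`_i.
  move=> PF sF j; apply: NNPP => Hj; apply: (min (size F)); first by rewrite -sPhi.
  by exists F; split=> //; exists j.
have Phi0 : Phi != 0.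
  apply/eqP => e; apply: Hi; rewrite e coef0 /P' polyC0; exact: prime0 PP.
have lead : ~ P' (lead_coef Phi).
  move=> Pl; apply: Hi.
  pose G := Phi - lead_coef Phi *: 'X^((size Phi).-1).
  have PG : P G.
    apply: (primeD PP) => //; apply: primeN; rewrite -mul_polyC mulrC; exact: (primeMl PP).
  have sG : (size G < size Phi)%N.
    have sp : (0 < size Phi)%N by rewrite size_poly_gt0.
    rewrite -(prednK sp) ltnS; apply/leq_sizeP => j jle.
    rewrite coefB coefZ coefXn; have [->|ne] := eqVneq j (size Phi).-1.
      by rewrite mulr1 subrr.
    by rewrite mulr0 subr0 nth_default //; rewrite -(prednK sp) ltn_neqAle eq_sym ne.
  have := small _ PG sG i; rewrite coefB coefZ coefXn.
  case: eqP => [->|_]; first by [].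
  by rewrite mulr0 subr0.
exists Phi; split=> //.
rewrite ltnNge; apply/negP => /size1_polyC e.
by apply: lead; rewrite e lead_coefC /P' -e.
Qed.

End PrimePoly.

End IteratedPoly.
Arguments Dm {K} v u n F.
Notation ev v n := (evm (B := _) [the {rmorphism _ -> _} of idfun] v n).

(** * Zeros of prime ideals and the Nullstellensatz *)

Section PrimeGeometry.
Variable K : closedFieldType.

Lemma pdivision (A : idomainType) (F G : {poly A}) : G != 0 ->
  exists k Q R, (lead_coef G ^+ k) *: F = Q * G + R /\ (size R < size G)%N.
Proof.
move=> G0; exists (Pdiv.Idomain.scalp F G), (Pdiv.Idomain.divp F G), (Pdiv.Idomain.modp F G).
by rewrite -Pdiv.Idomain.divp_eq Pdiv.Idomain.ltn_modp.
Qed.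

Definition upd (T : Type) (v : nat -> T) n x k := if k == n then x else v k.

Lemma ev_upd (v : nat -> K) n x (F : {poly (mring K n)}) :
  ev (upd v n x) n.+1 F = (map_poly (ev v n) F).[x].
Proof.
rewrite evmS (horner_coef_wide _ (size_poly _ _)); apply: eq_bigr => i _.
rewrite coef_map /= /upd eqxx; congr (_ * _); apply: evm_ext => k kn.
by rewrite ltn_eqF.
Qed.

Lemma ev_upd_low (v : nat -> K) n x (a : mring K n) : ev (upd v n x) n a = ev v n a.
Proof. by apply: evm_ext => k kn; rewrite /upd ltn_eqF. Qed.

Section Cases.
Variables (A : idomainType) (P : {poly A} -> Prop) (PP : prime_ideal P).
Let P' a := P a%:P.

Lemma primeZ a F : P F -> P (a *: F).
Proof. by rewrite -mul_polyC; exact: (primeMl PP). Qed.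

Lemma primeB F G : P F -> P G -> P (F - G).
Proof. by move=> HF HG; apply: (primeD PP) => //; exact: (primeN PP). Qed.

Lemma prime_scale a k F : ~ P' a -> P (a ^+ k *: F) -> P F.
Proof.
move=> na; rewrite -mul_polyC polyC_exp => /(primeM PP) [|//].
by move/(primeX PP).
Qed.

Lemma prime_reduce Phi F : P Phi -> ~ P' (lead_coef Phi) ->
  (forall F, P F -> (size F < size Phi)%N -> forall i, P' F`_i) ->
  P F -> exists k Q R, [/\ (lead_coef Phi ^+ k) *: F = Q * Phi + R & forall i, P' R`_i].
Proof.
move=> PPhi nl small PF.
have Phi0 : Phi != 0.
  apply/eqP => e; apply: nl; rewrite e lead_coef0 /P' polyC0; exact: prime0 PP.
have [k [Q [R [E sR]]]] := pdivision F Phi0; exists k, Q, R; split=> //.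
apply: small => //; have -> : R = lead_coef Phi ^+ k *: F - Q * Phi by rewrite E addrC addKr.
by apply: primeB; [exact: primeZ | exact: (primeMl PP)].
Qed.

(** Takes the place of a resultant. Let [G] be of least degree in the ideal generated by [P] and
    [b], outside [P]. If [G] is not constant, pseudo-division of [Phi] by [G] leaves a remainder in
    [P], hence a quotient in [P] of degree less than that of [Phi]; its leading coefficient then
    lies in [P'], against those of [G] and [Phi]. *)
Lemma prime_eliminant Phi b : P Phi -> ~ P' (lead_coef Phi) -> (1 < size Phi)%N ->
  (forall F, P F -> (size F < size Phi)%N -> forall i, P' F`_i) -> ~ P b ->
  exists rho a F, [/\ ~ P' rho, P F & rho%:P = a * b + F].
Proof.
move=> PPhi nl s1 small nb.
have Phi0 : Phi != 0 by rewrite -size_poly_gt0; exact: ltn_trans s1.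
pose Q0 G := exists a F, P F /\ G = a * b + F.
have QP F : P F -> Q0 F by move=> PF; exists 0, F; rewrite mul0r add0r.
have QD F G : Q0 F -> Q0 G -> Q0 (F + G).
  move=> [a [F' [PF ->]]] [a' [G' [PG ->]]]; exists (a + a'), (F' + G').
  by split; [exact: (primeD PP) | rewrite mulrDl addrACA].
have QM x F : Q0 F -> Q0 (x * F).
  move=> [a [F' [PF ->]]]; exists (x * a), (x * F').
  by split; [exact: (primeMl PP) | rewrite mulrDr mulrA].
have QN F : Q0 F -> Q0 (- F) by move=> H; rewrite -mulN1r; exact: QM.
pose good n := exists G, [/\ Q0 G, ~ P G & size G = n].
have [n [[G [QG nG sG]] min]] : exists n, good n /\ forall m, (m < n)%N -> ~ good m.
  have : good (size b).
    by exists b; split=> //; exists 1, 0; split; [exact: prime0 PP | rewrite mul1r addr0].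
  elim/ltn_ind: (size b) => n IH bn.
  have [[m [mn bm]]|NB] := classic (exists m, (m < n)%N /\ good m); first exact: IH bm.
  by exists n; split=> // m mn bm; apply: NB; exists m.
have G0 : G != 0 by apply/eqP => e; apply: nG; rewrite e; exact: prime0 PP.
have min' F : Q0 F -> (size F < size G)%N -> P F.
  move=> QF sF; apply: NNPP => nF; apply: (min (size F)); first by rewrite -sG.
  by exists F.
have nlG : ~ P' (lead_coef G).
  move=> Pl.
  have PT : P (lead_coef G *: 'X^((size G).-1)).
    rewrite -mul_polyC mulrC; exact: (primeMl PP).
  apply: nG; rewrite -[G](subrK (lead_coef G *: 'X^((size G).-1))).
  apply: (primeD PP) => //; apply: min'; first by apply: QD => //; apply/QN/QP.
  have sp : (0 < size G)%N by rewrite size_poly_gt0.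
  rewrite -[X in (_ < X)%N](prednK sp) ltnS; apply/leq_sizeP => j jle.
  rewrite coefB coefZ coefXn; have [->|ne] := eqVneq j (size G).-1.
    by rewrite mulr1 subrr.
  by rewrite mulr0 subr0 nth_default //; rewrite -(prednK sp) ltn_neqAle eq_sym ne.
have [sG1|sG1] := leqP (size G) 1.
  have [a [F [PF E]]] := QG; exists G`_0, a, F.
  have GE := size1_polyC sG1; split=> //; last by rewrite -GE.
  by rewrite /P' -GE.
have sGPhi : (size G < size Phi)%N.
  have [k [Q [R [E sR]]]] := pdivision G Phi0.
  have RE : R = lead_coef Phi ^+ k *: G - Q * Phi by rewrite E addrC addKr.
  rewrite ltnNge; apply/negP => le; apply: nG; apply: (prime_scale (k := k) nl).
  rewrite E; apply: (primeD PP); first exact: (primeMl PP).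
  apply: min'; last exact: leq_trans sR le.
  by rewrite RE; apply: QD; [rewrite -mul_polyC; exact: QM | apply/QN/QM/QP].
have [k [Q [R [E sR]]]] := pdivision Phi G0.
have RE : R = lead_coef G ^+ k *: Phi - Q * G by rewrite E addrC addKr.
have PR : P R.
  by apply: min' => //; rewrite RE; apply: QD; [rewrite -mul_polyC; apply/QM/QP | apply/QN/QM].
have PQ : P Q.
  have : P (Q * G) by rewrite -[Q * G](addrK R) -E; apply: primeB => //; exact: primeZ.
  by move=> /(primeM PP) [].
have lG0 : lead_coef G ^+ k != 0 by rewrite expf_neq0 // lead_coef_eq0.
have QGE : Q * G = lead_coef G ^+ k *: Phi - R by rewrite E addrK.
have sE : size (lead_coef G ^+ k *: Phi) = size Phi by rewrite size_scale.
have sQG : size (Q * G) = size Phi.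
  by rewrite QGE size_polyDl // size_polyN sE; exact: ltn_trans sR sGPhi.
have lQG : lead_coef (Q * G) = lead_coef G ^+ k * lead_coef Phi.
  rewrite QGE lead_coefDl ?lead_coefZ // size_polyN sE; exact: ltn_trans sR sGPhi.
have Q0' : Q != 0.
  by apply/eqP => e; move: sQG; rewrite e mul0r size_poly0 => e'; rewrite -e' in s1.
have sQ : (size Q < size Phi)%N.
  have := size_mul Q0' G0; rewrite sQG.
  have : (0 < size Q)%N by rewrite size_poly_gt0.
  by lia.
have := small _ PQ sQ (size Q).-1; rewrite -/(lead_coef Q) => PlQ; exfalso.
have : P' (lead_coef G ^+ k * lead_coef Phi).
  by rewrite -lQG lead_coefM /P' polyCM mulrC; exact: (primeMl PP).
by rewrite /P' polyCM polyC_exp => /(primeM PP) [/(primeX PP)|].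
Qed.

End Cases.

(** By induction the contraction has a zero at which the eliminant of [b] and the leading
    coefficient of [Phi] are nonzero. There [Phi] keeps its degree and has a root, which serves as
    last coordinate; by [prime_reduce] all of [P] vanishes at it, and [b] does not because the
    eliminant does not. *)
Lemma prime_zero n (P : mring K n -> Prop) b : prime_ideal P -> ~ P b ->
  exists v, (forall F, P F -> ev v n F = 0) /\ ev v n b != 0.
Proof.
elim: n P b => [|n IH] P b PP nb.
  exists (fun=> 0); split.
    move=> a Pa; apply/eqP/negPn/negP => a0; apply: (prime1 PP).
    by rewrite -(mulVf (a0 : (a : K) != 0)); exact: (primeMl PP).
  by apply/eqP => /= b0; apply: nb; rewrite b0; exact: prime0 PP.
have PP' := prime_contract PP.
case: (prime_cases PP) => [H|[Phi [PPhi nl s1 small]]].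
  have [i nbi] : exists i, ~ P (b`_i)%:P.
    apply: NNPP => N; apply: nb; apply: (prime_coefs PP) => i.
    by apply: NNPP => N'; apply: N; exists i.
  have [v [vP vb]] := IH _ _ PP' nbi.
  have [|x bx] := @poly_nz K (map_poly (ev v n) b).
    apply/eqP => /polyP /(_ i); rewrite coef_map coef0 => /eqP; exact/negP.
  exists (upd v n x); split; last by rewrite ev_upd.
  move=> F PF; rewrite ev_upd (_ : map_poly _ F = 0) ?horner0 //.
  by apply/polyP => j; rewrite coef_map coef0 /= vP //; exact: H.
have [rho [a [F0 [nrho PF0 E]]]] := prime_eliminant PP PPhi nl s1 small nb.
have [v [vP]] := IH _ (rho * lead_coef Phi) PP' (fun H => match primeM PP' H with
  or_introl h => nrho h | or_intror h => nl h end).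
rewrite rmorphM mulf_eq0 negb_or => /andP [vrho vl].
have [x xroot] : exists x, root (map_poly (ev v n) Phi) x.
  apply/closed_rootP; rewrite size_poly_eq // gtn_eqF //.
have Phiv : ev (upd v n x) n.+1 Phi = 0 by rewrite ev_upd; apply/eqP.
have Z F : P F -> ev (upd v n x) n.+1 F = 0.
  move=> PF; have [k [Q [R [EF Rc]]]] := prime_reduce PP PPhi nl small PF.
  have := congr1 (ev (upd v n x) n.+1) EF.
  rewrite rmorphD rmorphM Phiv mulr0 add0r -mul_polyC rmorphM evm_polyC ev_upd_low rmorphXn.
  rewrite [X in _ = X](_ : _ = 0).
    by move/eqP; rewrite mulf_eq0 expf_eq0 (negbTE vl) andbF orFb => /eqP.
  rewrite ev_upd (_ : map_poly _ R = 0) ?horner0 //.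
  by apply/polyP => j; rewrite coef_map coef0 /= vP.
exists (upd v n x); split=> //.
apply/eqP => bv; have := congr1 (ev (upd v n x) n.+1) E.
rewrite evm_polyC ev_upd_low rmorphD rmorphM bv mulr0 (Z _ PF0) addr0 => e.
by rewrite e eqxx in vrho.
Qed.

Definition ideal_of (A : comNzRingType) (S : A -> Prop) (x : A) :=
  exists m (c s : 'I_m -> A), (forall i, S (s i)) /\ x = \sum_(i < m) c i * s i.

Section Ideal.
Variables (A : comNzRingType) (S : A -> Prop).

Lemma ideal_of0 : ideal_of S 0.
Proof.
by exists 0%N, (fun=> 0), (@of_ord0 A); split; [case | rewrite big_ord0].
Qed.

Lemma ideal_ofD x y : ideal_of S x -> ideal_of S y -> ideal_of S (x + y).
Proof.
move=> [m [c [s [Hs ->]]]] [m' [c' [s' [Hs' ->]]]].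
exists (m + m')%N, (fun i => match split i with inl j => c j | inr j => c' j end),
  (fun i => match split i with inl j => s j | inr j => s' j end); split.
  by move=> i; case: splitP.
rewrite big_split_ord /=; congr (_ + _); apply: eq_bigr => i _.
  by rewrite (unsplitK (inl i)).
by rewrite (unsplitK (inr i)).
Qed.

Lemma ideal_ofM x y : ideal_of S y -> ideal_of S (x * y).
Proof.
move=> [m [c [s [Hs ->]]]]; exists m, (fun i => x * c i), s; split=> //.
by rewrite mulr_sumr; apply: eq_bigr => i _; rewrite mulrA.
Qed.

Lemma ideal_of_gen x : S x -> ideal_of S x.
Proof.
move=> Sx; exists 1%N, (fun=> 1), (fun=> x); split=> //.
by rewrite big_ord1 mul1r.
Qed.
End Ideal.

(** An ideal containing [S] and maximal among those that avoid all powers of [h] is prime. *)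
Lemma prime_avoiding (A : comNzRingType) (S : A -> Prop) h :
  (forall k, ~ ideal_of S (h ^+ k)) ->
  exists P, [/\ prime_ideal P, forall x, S x -> P x & ~ P h].
Proof.
move=> H.
pose ideal (M : A -> Prop) := [/\ M 0, forall a b, M a -> M b -> M (a + b) &
  forall a b, M b -> M (a * b)].
pose good (M : A -> Prop) := [/\ ideal M, forall x, S x -> M x & forall k, ~ M (h ^+ k)].
have good0 : good (ideal_of S).
  split=> //; last exact: ideal_of_gen.
  by split; [exact: ideal_of0 | exact: ideal_ofD | exact: ideal_ofM].
have chain (F : (A -> Prop) -> Prop) :
    (forall M, F M -> (forall x, ~ M x) \/ good M) ->
    (forall M M', F M -> F M' -> (forall x, M x -> M' x) \/ (forall x, M' x -> M x)) ->
    let U := fun x => exists2 M, F M & M x in (forall x, ~ U x) \/ good U.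
  move=> FP Ftot U.
  have [[M0 FM0 [x0 Mx0]]|N] := classic (exists2 M, F M & exists x, M x); last first.
    by left=> x [M FM Mx]; apply: N; exists M => //; exists x.
  have gd M x : F M -> M x -> good M by move=> FM Mx; case: (FP M FM) => // /(_ x).
  have [[M00 M0D M0M] M0S M0h] := gd _ _ FM0 Mx0.
  right; split; last 2 first.
  - by move=> x Sx; exists M0 => //; exact: M0S.
  - by move=> k [M FM Mk]; have [_ _ /(_ k)] := gd _ _ FM Mk.
  split; first by exists M0.
    move=> a b [M FM Ma] [M' FM' M'b].
    have [[_ MD _] _ _] := gd _ _ FM Ma; have [[_ MD' _] _ _] := gd _ _ FM' M'b.
    case: (Ftot _ _ FM FM') => sub; [exists M' => //; apply: MD' | exists M => //; apply: MD] => //;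
      exact: sub.
  move=> a b [M FM Mb]; exists M => //; have [[_ _ MM] _ _] := gd _ _ FM Mb; exact: MM.
have [M [MP Mmax]] : exists M : A -> Prop, ((forall x, ~ M x) \/ good M) /\
    forall M', (forall x, M x -> M' x) -> (exists x, M' x /\ ~ M x) -> ~ good M'.
  have [|M [MP Mmax]] := @classical_sets.Zorn_bigcup A (fun M => (forall x, ~ M x) \/ good M).
    by move=> F FP Ftot; apply: chain => // M M' FM FM'; exact: Ftot.
  exists M; split=> // M' sub [x [M'x nMx]] gM'; apply: (Mmax M'); last by right.
  by split=> [|sub']; [exact: sub | apply: nMx; exact: sub'].

have gM : good M.
  case: MP => // M0; exfalso; apply: (Mmax (ideal_of S)) => //.
    by move=> x /M0.
  by exists 0; split; [exact: ideal_of0 | exact: M0].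
have [[M0 MD MM] MS Mh] := gM; exists M; split=> //; last by have := Mh 1%N; rewrite expr1.
split=> //; first by have := Mh 0%N; rewrite expr0.
move=> a b Mab; apply: NNPP => /not_or_and [na nb].
have hit x : ~ M x -> exists k m y, M m /\ h ^+ k = m + y * x.
  move=> nx; apply: NNPP => N.
  apply: (Mmax (fun z => exists m y, M m /\ z = m + y * x)).
  - by move=> z Mz; exists z, 0; rewrite mul0r addr0.
  - exists x; split=> //; exists 0, 1; by rewrite mul1r add0r.
  split.
  - split; first by exists 0, 0; rewrite mul0r addr0.
      move=> _ _ [m [y [Mm ->]]] [m' [y' [Mm' ->]]]; exists (m + m'), (y + y').
      by split; [exact: MD | rewrite mulrDl addrACA].
    move=> z _ [m [y [Mm ->]]]; exists (z * m), (z * y).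
    by split; [exact: MM | rewrite mulrDr mulrA].
  - by move=> z Sz; exists z, 0; split; [exact: MS | rewrite mul0r addr0].
  by move=> k [m [y [Mm E]]]; apply: N; exists k, m, y.
have [k [m [y [Mm E]]]] := hit a na; have [k' [m' [y' [Mm' E']]]] := hit b nb.
apply: (Mh (k + k')%N); rewrite exprD E E'.
have -> : (m + y * a) * (m' + y' * b) = (m' + y' * b) * m + (y * a) * m' + (y * y') * (a * b) by ring.
by apply: (MD); [apply: (MD); exact: MM | exact: MM].
Qed.

(* The strong Nullstellensatz. *)
Lemma nullstellensatz n (S : mring K n -> Prop) h :
  (forall v, (forall s, S s -> ev v n s = 0) -> ev v n h = 0) ->
  exists k, ideal_of S (h ^+ k).
Proof.
move=> H; apply: NNPP => N.
have [P [PP SP nh]] := @prime_avoiding _ S h (fun k Hk => N (ex_intro _ k Hk)).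
have [v [vP vh]] := prime_zero PP nh.
by move/eqP: vh; apply; apply: H => s Ss; apply: vP; apply: SP.
Qed.
End PrimeGeometry.

(** * Transcendence degree and dimension *)

Section Growth.
Variable K : closedFieldType.
Hypothesis charK : [pchar K] =i pred0.

Lemma char0_nz k : (0 < k)%N -> k%:R != 0 :> K.
Proof. by move=> k0; rewrite (iffLR (pcharf0P K) charK) -lt0n. Qed.

(** Degree at most [a] in each variable separately, so that the polynomials in question form a space
    of dimension [a.+1 ^ n]. *)
Fixpoint dg n (a : nat) : mring K n -> Prop :=
  match n return mring K n -> Prop with
  | 0 => fun=> True
  | m.+1 => fun F => (size F <= a.+1)%N /\ forall i, dg a F`_i
  end.

Lemma dg_le n a b (F : mring K n) : (a <= b)%N -> dg a F -> dg b F.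
Proof.
move=> ab; elim: n F => [//|n IH] F [sF cF]; split; first exact: leq_trans sF _.
by move=> i; exact: IH (cF i).
Qed.

Lemma dg0 n a : dg a (0 : mring K n).
Proof. by elim: n => [//|n IH]; split=> [|i]; rewrite ?size_poly0 // coef0. Qed.

Lemma dgD n a (F G : mring K n) : dg a F -> dg a G -> dg a (F + G).
Proof.
elim: n F G => [//|n IH] F G [sF cF] [sG cG]; split.
  by apply: leq_trans (size_polyD _ _) _; rewrite geq_max sF.
by move=> i; rewrite coefD; exact: IH (cF i) (cG i).
Qed.

Lemma dgN n a (F : mring K n) : dg a F -> dg a (- F).
Proof.
elim: n F => [//|n IH] F [sF cF]; split; first by rewrite size_polyN.
by move=> i; rewrite coefN; exact: IH (cF i).
Qed.

Lemma dg_sum n a (T : Type) (r : seq T) (F : T -> mring K n) :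
  (forall i, dg a (F i)) -> dg a (\sum_(i <- r) F i).
Proof.
move=> H; elim: r => [|i r IH]; first by rewrite big_nil; exact: dg0.
by rewrite big_cons; apply: dgD.
Qed.

Lemma dgM n a b (F G : mring K n) : dg a F -> dg b G -> dg (a + b) (F * G).
Proof.
elim: n F G => [//|n IH] F G [sF cF] [sG cG]; split.
  by apply: leq_trans (size_polyMleq _ _) _; lia.
by move=> i; rewrite coefM; apply: dg_sum => j; exact: IH (cF _) (cG _).
Qed.

Lemma dg1 n a : dg a (1 : mring K n).
Proof.
elim: n => [//|n IH]; split=> [|i]; first by rewrite size_poly1.
by rewrite coef1; case: (i == 0%N); [exact: IH | exact: dg0].
Qed.

Lemma dgX n a k (F : mring K n) : dg a F -> dg (k * a) (F ^+ k).
Proof.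
move=> H; elim: k => [|k IH]; first by rewrite expr0; exact: dg1.
by rewrite exprS mulSn; exact: dgM.
Qed.

Lemma dg_ex n (F : mring K n) : exists a, dg a F.
Proof.
elim: n F => [|n IH] F; first by exists 0%N.
have [a Ha] : exists a, forall i, (i < size F)%N -> dg a F`_i.
  elim: (size F) => [|m [a Ha]]; first by exists 0%N.
  have [b Hb] := IH F`_m; exists (maxn a b) => i; rewrite ltnS leq_eqVlt => /orP [/eqP ->|im].
    exact: dg_le (leq_maxr _ _) Hb.
  exact: dg_le (leq_maxl _ _) (Ha i im).
exists (maxn a (size F)); split; first by rewrite leqW // leq_maxr.
move=> i; have [im|im] := ltnP i (size F); first exact: dg_le (leq_maxl _ _) (Ha i im).
by rewrite nth_default //; exact: dg0.
Qed.

Lemma dg_ex_fam n k (f : 'I_k -> mring K n) : exists a, forall i, dg a (f i).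
Proof.
have H m : exists a, forall i : 'I_k, (i < m)%N -> dg a (f i).
  elim: m => [|m [a Ha]]; first by exists 0%N.
  have [mk|mk] := ltnP m k; last first.
    by exists a => i _; apply: Ha; exact: leq_trans (ltn_ord i) mk.
  have [b Hb] := dg_ex (f (Ordinal mk)); exists (maxn a b) => i.
  rewrite ltnS leq_eqVlt => /orP [/eqP e|im].
    by rewrite (_ : i = Ordinal mk); [exact: dg_le (leq_maxr _ _) Hb | apply/val_inj].
  exact: dg_le (leq_maxl _ _) (Ha i im).
by have [a Ha] := H k; exists a => i; exact: Ha.
Qed.

(** A bound for a Hilbert function: modulo [P] the polynomials with [dg a] span at most
    [C * a.+1 ^ d] dimensions. The bound is expressed by linear forms whose common zeros lie in [P],
    which avoids quotient spaces. *)
Definition growth n (P : mring K n -> Prop) d := exists C, forall a,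
  exists (J : finType) (la : mring K n -> J -> K),
  [/\ (#|J| <= C * a.+1 ^ d)%N,
      forall F G j, la (F + G) j = la F j + la G j,
      forall k F j, la (cst K n k * F) j = k * la F j &
      forall F, dg a F -> (forall j, la F j = 0) -> P F].

Definition extv n (u : 'rV[K]_n) (k : nat) : K := if insub k is Some i then u 0 i else 0.

Definition generic_tangent n (P : mring K n -> Prop) d := exists2 h, ~ P h &
  forall v, (forall F, P F -> ev v n F = 0) -> ev v n h != 0 ->
  exists2 B : 'M[K]_(d, n), row_free B & forall i F, P F -> Dm v (extv (row i B)) n F = 0.

Lemma evl_ext v v' u u' n (F : mring K n) : (forall k, (k < n)%N -> v k = v' k) ->
  (forall k, (k < n)%N -> u k = u' k) -> Dm v u n F = Dm v' u' n F.
Proof.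
by move=> Hv Hu; rewrite /Dm; congr (_^`().[0]); apply: evm_ext => k kn; rewrite /lin Hv // Hu.
Qed.

Section Reduction.
Variables (A : idomainType) (Phi : {poly A}).
Let c := lead_coef Phi.
Let delta := (size Phi).-1.

(** A step of pseudo-division that multiplies by the leading coefficient even if the coefficient to
    be removed is already zero. It is therefore linear in [F], as [growth] requires. *)
Definition red s (F : {poly A}) : {poly A} := c *: F - F`_s *: ('X^(s - delta) * Phi).

Lemma redD s (F G : {poly A}) : red s (F + G) = red s F + red s G.
Proof. by rewrite /red coefD scalerDr scalerDl; ring. Qed.

Lemma redZ s a (F : {poly A}) : red s (a *: F) = a *: red s F.
Proof. by rewrite /red coefZ scalerBr !scalerA mulrC. Qed.

Lemma size_red s (F : {poly A}) : (delta <= s)%N -> (size F <= s.+1)%N -> (size (red s F) <= s)%N.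
Proof.
move=> ds sF; apply/leq_sizeP => j sj; rewrite coefB !coefZ coefXnM.
rewrite ltnNge (leq_trans (leq_subr _ _) sj) /=.
have [e|ne] := eqVneq j s.
  by rewrite e subKn // -/(lead_coef Phi) -/c mulrC subrr.
have sj' : (s < j)%N by rewrite ltn_neqAle eq_sym ne.
rewrite nth_default; last exact: leq_trans sF sj'.
rewrite [Phi`__]nth_default ?mulr0 ?subrr //.
move: sj' ds; rewrite /delta; case: (size Phi) => [|q] /=; lia.
Qed.

Fixpoint redn m (F : {poly A}) : {poly A} := if m is m'.+1 then redn m' (red (delta + m') F) else F.

Lemma rednD m F G : redn m (F + G) = redn m F + redn m G.
Proof. by elim: m F G => [//|m IH] F G /=; rewrite redD IH. Qed.

Lemma rednZ m a F : redn m (a *: F) = a *: redn m F.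
Proof. by elim: m F => [//|m IH] F /=; rewrite redZ IH. Qed.

Lemma size_redn m (F : {poly A}) : (size F <= delta + m)%N -> (size (redn m F) <= delta)%N.
Proof.
elim: m F => [|m IH] F /= sF; first by rewrite addn0 in sF.
by apply: IH; apply: size_red; [exact: leq_addr | rewrite -addnS].
Qed.

Lemma rednE m F : exists Q, redn m F = c ^+ m *: F - Q * Phi.
Proof.
elim: m F => [|m IH] F /=; first by exists 0; rewrite expr0 scale1r mul0r subr0.
have [Q ->] := IH (red (delta + m) F).
exists (c ^+ m *: (F`_(delta + m) *: 'X^(delta + m - delta)) + Q).
by rewrite /red scalerBr (scalerA _ c F) -exprSr mulrDl -!scalerAl opprD addrA.
Qed.
End Reduction.

Lemma dgc_redn n (Phi F : {poly (mring K n)}) D m b :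
  (forall i, dg D Phi`_i) -> (forall i, dg b F`_i) ->
  forall i, dg (b + m * D) (redn Phi m F)`_i.
Proof.
move=> HD HF; elim: m b F HF => [|m IH] b F HF i /=; first by rewrite addn0.
rewrite mulSn addnA; apply: IH => {}i; rewrite coefB !coefZ coefXnM; apply: dgD.
  by rewrite addnC; apply: dgM; [exact: HD | exact: HF].
apply: dgN; case: ifP => _; first by rewrite mulr0; exact: dg0.
by apply: dgM; [exact: HF | exact: HD].
Qed.

Lemma mulrn_shuffle (x y z : K) m : x * (y *+ m * z) = x *+ m * y * z.
Proof. by rewrite -[y *+ m]mulr_natl -[x *+ m]mulr_natl; ring. Qed.

Lemma evMn v n (x : mring K n) m : ev v n (x *+ m) = ev v n x *+ m.
Proof. exact: raddfMn. Qed.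

(** Both estimates hold with the same [d], which is the transcendence degree. A transcendental last
    variable raises it by one in both. An algebraic one leaves it unchanged: [Phi] determines the
    last component of a tangent vector, and reduction modulo [Phi] bounds the degree in the last
    variable. *)
Lemma prime_dimension n (P : mring K n -> Prop) : prime_ideal P ->
  exists d, generic_tangent P d /\ growth P d.
Proof.
elim: n P => [|n IH] P PP.
  exists 0%N; split.
    exists 1; first exact: prime1 PP.
    move=> v _ _; exists 0; first by rewrite /row_free mxrank0.
    by case.
  exists 1%N => a; exists unit, (fun F _ => F); split=> //.
    by rewrite card_unit expn0.
  by move=> F _ /(_ tt) /= ->; exact: prime0 PP.
have PP' := prime_contract PP; have [d [[h nh Ht] [C HC]]] := IH _ PP'.
case: (prime_cases PP) => [H|[Phi [PPhi nl s1 small]]].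
  exists d.+1; split.
    exists (h%:P : {poly (mring K n)}) => // v vP; rewrite evm_polyC => vh.
    have vP' F : P F%:P -> ev v n F = 0 by move=> /vP; rewrite evm_polyC.
    have [B B_free BT] := Ht v vP' vh.
    (* The tangent vectors below are extended by zero, and the last unit vector is added. *)
    pose u (i : 'I_(1 + d)) : 'rV[K]_n.+1 := if unlift 0 i is Some j
      then \row_k (if insub (k : nat) is Some l then B j l else 0) else \row_k (k == n :> nat)%:R.
    exists (\matrix_(i, k) u i 0 k).
      apply: inj_row_free => x xB.
      have x0 : x 0 0 = 0.
        have /rowP /(_ ord_max) := xB; rewrite !mxE big_ord_recl !mxE /u unlift_none mxE eqxx mulr1.
        rewrite big1 ?addr0 // => i _; rewrite !mxE liftK mxE.
        by case: insubP => [l _ e|]; rewrite ?mulr0 //; have := ltn_ord l; rewrite e /= ltnn.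
      have x1 : (\row_j x 0 (lift 0 j)) *m B = 0.
        apply/rowP => k; have /rowP /(_ (widen_ord (leqnSn n) k)) := xB.
        rewrite !mxE big_ord_recl x0 mul0r add0r => e; rewrite -[RHS]e; apply: eq_bigr => i _.
        rewrite !mxE /u liftK mxE; congr (_ * _).
        by case: insubP => [l _ e'|/= /negP []]; [congr (B i _); apply/val_inj | exact: ltn_ord].
      have /rowP x2 : \row_j x 0 (lift 0 j) = 0.
        by apply: (row_free_inj B_free); rewrite x1 mul0mx.
      apply/rowP => i; rewrite mxE; case: (unliftP 0 i) => [j ->|-> //].
      by have := x2 j; rewrite !mxE.
    move=> i F PF; rewrite (DmS _ _ (leqnn _)) big1 // => j _.
    rewrite vP' ?mul0r ?addr0; last exact: H.
    case: (unliftP 0 i) => [i' ie|ie].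
      have -> : Dm v (extv (row i (\matrix_(i, k) u i 0 k))) n F`_j = 0; last by rewrite mul0r.
      rewrite -(BT i' F`_j (H F PF j)).
      apply: evl_ext => // k kn; rewrite /extv insubT ?(leqW kn) // => ?; rewrite !mxE /u ie liftK mxE /= !insubT.
      by rewrite mxE; congr (B i' _); apply/val_inj.
    rewrite (_ : Dm v _ n _ = 0) ?mul0r //.
    rewrite (@evl_ext _ v _ (fun=> 0)) // => [|k kn].
      rewrite /Dm /evl (_ : lin v (fun=> 0) = polyC \o v); last first.
        by apply: functional_extensionality => k; rewrite /lin scale0r addr0.
      rewrite -(@evm_comp _ _ _ [the {rmorphism K -> K} of idfun] [the {rmorphism K -> {poly K}} of polyC]) //.
      by rewrite derivC horner0.
    rewrite /extv insubT ?(leqW kn) // => ?; rewrite !mxE /u ie unlift_none mxE /=.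
    by rewrite ltn_eqF.
  exists C => a; have [J [la [HJ laD laZ laP]]] := HC a.
  exists ('I_a.+1 * J)%type, (fun (F : {poly (mring K n)}) (ij : 'I_a.+1 * J) => la F`_ij.1 ij.2); split.
  - by rewrite card_prod card_ord expnS mulnCA leq_mul.
  - by move=> F G j; rewrite coefD laD.
  - by move=> k F j; rewrite [cst _ _ _]/= coefCM laZ.
  move=> F [sF cF] F0; apply: (prime_coefs PP) => i.
  have [ia|ia] := ltnP i a.+1; last first.
    by rewrite nth_default ?polyC0; [exact: prime0 PP | exact: leq_trans ia].
  by apply: laP; [exact: cF | move=> j; exact: (F0 (Ordinal ia, j))].
exists d; split.
  (* The derivative has smaller degree than [Phi], so if it were in [P] its leading coefficient
     would lie in the contraction; in characteristic 0 the integer factor can be cancelled from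
     it. *)
  have nd : ~ P Phi^`().
    move=> Pd; have := small _ Pd (lt_size_deriv _) (size Phi).-2.
    have Phi0 : Phi != 0 by rewrite -size_poly_gt0; exact: ltn_trans s1.
    move=> /(_ Phi0); rewrite coef_deriv prednK; last by lia.
    rewrite -/(lead_coef Phi) -mulr_natl polyCM => /(primeM PP) [] // Pn.
    have : P ((cst K n.+1 ((size Phi).-1%:R)^-1) * ((size Phi).-1%:R)%:P) by exact: (primeMl PP).
    rewrite (_ : _ * _ = 1); first exact: (prime1 PP).
    have := congr1 (cst K n.+1) (mulVf (@char0_nz (size Phi).-1 (ltac:(lia)))).
    by rewrite rmorphM rmorph1 rmorph_nat polyC_natr.
  exists (h%:P * ((lead_coef Phi)%:P * Phi^`()) : {poly (mring K n)}).
    by move=> /(primeM PP) [|/(primeM PP) []].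
  move=> v vP; rewrite !rmorphM !evm_polyC !mulf_eq0 !negb_or => /andP [vh /andP [vl vd]].
  have vP' F : P F%:P -> ev v n F = 0 by move=> /vP; rewrite evm_polyC.
  have [B B_free BT] := Ht v vP' vh.
  (* The value forced by the requirement that the derivative of [Phi] along the extended vector be
     zero. *)
  pose sl (j : 'I_d) := - (\sum_(i < size Phi) Dm v (extv (row j B)) n Phi`_i * v n ^+ i) /
     ev v n.+1 Phi^`().
  pose u (j : 'I_d) : 'rV[K]_n.+1 := \row_k (if insub (k : nat) is Some l then B j l else sl j).
  have uE j F : P F -> forall m, (size (F : {poly (mring K n)}) <= m)%N ->
    Dm v (extv (u j)) n.+1 F = \sum_(i < m) (Dm v (extv (row j B)) n F`_i * v n ^+ i +
      ev v n F`_i * (v n ^+ i.-1 *+ i * sl j)).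
    move=> PF m sm; rewrite (DmS _ _ sm); apply: eq_bigr => i _; congr (_ * _ + _ * (_ * _)).
      apply: evl_ext => // k kn; rewrite /extv insubT ?(leqW kn) // => ?; rewrite !mxE /= !insubT.
      by rewrite mxE; congr (B j _); apply/val_inj.
    by rewrite /extv (insubT (fun k => (k < n.+1)%N) (ltnSn n)) /= /u mxE insubF //= ltnn.
  exists (\matrix_(j, k) u j 0 k).
    apply: inj_row_free => x xB; apply: (row_free_inj B_free); rewrite mul0mx.
    apply/rowP => k; have /rowP /(_ (widen_ord (leqnSn n) k)) := xB.
    rewrite !mxE => e; rewrite -[RHS]e; apply: eq_bigr => i _; rewrite !mxE; congr (_ * _).
    by case: insubP => [l _ e'|/= /negP []]; [congr (B i _); apply/val_inj | exact: ltn_ord].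
  move=> j F PF; have -> : row j (\matrix_(j, k) u j 0 k) = u j.
    by apply/rowP => k; rewrite !mxE.
  have DPhi : Dm v (extv (u j)) n.+1 Phi = 0.
    rewrite (uE _ _ PPhi _ (leqnn _)) big_split /=.
    have -> : \sum_(i < size Phi) ev v n Phi`_i * (v n ^+ i.-1 *+ i * sl j) =
       ev v n.+1 Phi^`() * sl j.
      rewrite (evmS_wide _ _ (m := (size Phi).-1)); last first.
        rewrite -ltnS (ltn_predK s1) lt_size_deriv // -size_poly_gt0; exact: ltn_trans s1.
      rewrite -[in LHS](ltn_predK s1) big_ord_recl mulr0n mul0r mulr0 add0r.
      rewrite mulr_suml; apply: eq_bigr => i _; rewrite coef_deriv lift0 evMn.
      exact: mulrn_shuffle.
    by rewrite /sl mulrC mulfVK // addrN.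
  have [k [Q [R [EF Rc]]]] := prime_reduce PP PPhi nl small PF.
  have PR : P R by exact: (prime_coefs PP).
  have DR : Dm v (extv (u j)) n.+1 R = 0.
    rewrite (uE _ _ PR _ (leqnn _)) big1 // => i _; rewrite BT // vP' //; by rewrite !mul0r addr0.
  have := congr1 (Dm v (extv (u j)) n.+1) EF.
  rewrite DmD !DmM DPhi DR (vP _ PPhi) !mulr0 !addr0 -mul_polyC DmM (vP _ PF) mulr0 add0r.
  rewrite evm_polyC rmorphXn => /eqP; rewrite mulf_eq0 expf_eq0 (negbTE vl) andbF orFb.
  by move/eqP.
have [D HD] : exists D, forall i, dg D Phi`_i.
  by have [D [_ HD]] := @dg_ex n.+1 Phi; exists D.
exists ((size Phi).-1 * (C * D.+1 ^ d))%N => a.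
(* Each of the [a.+1] reduction steps multiplies coefficients by those of [Phi], whose degrees are
   at most [D]. *)
have [J [la [HJ laD laZ laP]]] := HC (a + a.+1 * D)%N.
exists ('I_(size Phi).-1 * J)%type,
  (fun (F : {poly (mring K n)}) (ij : 'I_(size Phi).-1 * J) => la (redn Phi a.+1 F)`_ij.1 ij.2); split.
- rewrite card_prod card_ord -!mulnA leq_mul2l -expnMn; apply/orP; right.
  apply: leq_trans HJ _; rewrite leq_mul2l; apply/orP; right.
  by rewrite (_ : D.+1 * a.+1 = (a + a.+1 * D).+1)%N //; lia.
- by move=> F G j; rewrite rednD coefD laD.
- by move=> k F j; rewrite [cst _ _ _]/= mul_polyC rednZ coefZ laZ.
move=> F [sF cF] F0.
have PR : P (redn Phi a.+1 F).
  apply: (prime_coefs PP) => i.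
  have [ia|ia] := ltnP i (size Phi).-1; last first.
    rewrite nth_default ?polyC0; first exact: prime0 PP.
    apply: leq_trans ia; apply: size_redn; apply: leq_trans sF _; exact: leq_addl.
  apply: laP; last by move=> j; exact: (F0 (Ordinal ia, j)).
  exact: dgc_redn.
have [Q QE] := rednE Phi a.+1 F.
apply: (prime_scale PP (a := lead_coef Phi) (k := a.+1)) => //.
rewrite -[_ *: F](subrK (Q * Phi)) -QE; apply: (primeD PP) => //; exact: (primeMl PP).
Qed.
End Growth.

Section LinearSystems.
Variable K : fieldType.

Lemma kernel_ex (M J : finType) (L : {ffun M -> K} -> J -> K) :
  (forall x y j, L (x + y) j = L x j + L y j) ->
  (forall k (x : {ffun M -> K}) j, L [ffun m => k * x m] j = k * L x j) ->
  (#|J| < #|M|)%N -> exists2 x, x != 0 & forall j, L x j = 0.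
Proof.
move=> LD LZ lt; pose de m : {ffun M -> K} := [ffun m' => (m == m')%:R].
have L0 j : L 0 j = 0.
  have := LZ 0 0 j; rewrite mul0r => e; rewrite -[RHS]e; congr (L _ j).
  by apply/ffunP => m; rewrite !ffunE mul0r.
have LE (x : {ffun M -> K}) j : L x j = \sum_m x m * L (de m) j.
  have {1}-> : x = \sum_m [ffun m' => x m * de m m'].
    apply/ffunP => m; rewrite sum_ffunE (bigD1 m) //= !ffunE eqxx.
    rewrite mulr1 big1 ?addr0 // => m' /negbTE mm'.
    by rewrite !ffunE mm' mulr0.
  rewrite (big_morph (fun y => L y j) (fun y z => LD y z j) (L0 j)).
  by apply: eq_bigr => m _; rewrite LZ.
pose A : 'M[K]_(#|M|, #|J|) := \matrix_(m, j) L (de (enum_val m)) (enum_val j).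
have : kermx A != 0.
  rewrite kermx_eq0 /row_free; apply/negP => /eqP e.
  by have := rank_leq_col A; rewrite e leqNgt lt.
move=> /rowV0Pn [y /sub_kermxP yA y0].
exists [ffun m => y 0 (enum_rank m)].
  apply: contraNneq y0 => /ffunP e; apply/eqP/rowP => m; have := e (enum_val m).
  by rewrite !ffunE enum_valK mxE.
move=> j; have /rowP /(_ (enum_rank j)) := yA; rewrite !mxE => e; rewrite LE -[RHS]e.
rewrite (reindex (@enum_rank M)) /=; last by apply: onW_bij; exact: enum_rank_bij.
by apply: eq_bigr => m _; rewrite !mxE ffunE !enum_rankK.
Qed.
End LinearSystems.

Section AlgebraicIndependence.
Variable K : closedFieldType.
Hypothesis charK : [pchar K] =i pred0.

Section Boxes.
Variable a : nat.

Fixpoint box (k : nat) : finType := if k is k'.+1 then ('I_a.+1 * box k')%type else unit.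

Fixpoint box_poly k : {ffun box k -> K} -> mring K k :=
  match k return {ffun box k -> K} -> mring K k with
  | 0 => fun x => x tt
  | k'.+1 => fun x => \poly_(i < a.+1) box_poly [ffun m => x (inord i, m)]
  end.

Lemma card_box k : #|box k| = (a.+1 ^ k)%N.
Proof. by elim: k => [|k IH] /=; rewrite ?card_unit // card_prod card_ord IH expnS. Qed.

Lemma box_polyD k (x y : {ffun box k -> K}) : box_poly (x + y) = box_poly x + box_poly y.
Proof.
elim: k x y => [|k IH] x y /=; first by rewrite ffunE.
apply/polyP => i; rewrite coefD !coef_poly; case: ifP => _; last by rewrite addr0.
by rewrite -IH; congr box_poly; apply/ffunP => m; rewrite !ffunE.
Qed.

Lemma box_polyZ k (c : K) (x : {ffun box k -> K}) : box_poly [ffun m => c * x m] = cst K k c * box_poly x.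
Proof.
elim: k x => [|k IH] x /=; first by rewrite ffunE.
apply/polyP => i; rewrite coefCM !coef_poly; case: ifP => _; last by rewrite mulr0.
by rewrite -IH; congr box_poly; apply/ffunP => m; rewrite !ffunE.
Qed.

Lemma box_poly0 k (x : {ffun box k -> K}) : box_poly x = 0 -> x = 0.
Proof.
elim: k x => [|k IH] x /= e; apply/ffunP; first by case; rewrite ffunE.
move=> [i m]; move/polyP/(_ i): e; rewrite coef_poly ltn_ord coef0 => /IH /ffunP /(_ m).
by rewrite !ffunE inord_val.
Qed.

Lemma dg_box_poly k (x : {ffun box k -> K}) : dg a (box_poly x).
Proof.
elim: k x => [//|k IH] x /=; split; first exact: size_poly.
by move=> i; rewrite coef_poly; case: ifP => _; [exact: IH | exact: dg0].
Qed.
End Boxes.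

Lemma dg_subst n D (f : nat -> mring K n) k a (F : mring K k) :
  (forall i, (i < k)%N -> dg D (f i)) -> dg a F -> dg (k * (a * D)) (evm (cst K n) f k F).
Proof.
move=> Hf; elim: k Hf F => [|k IH] Hf F.
  move=> _; rewrite mul0n /=.
  elim: (n) => [//|m IH] /=; split=> [|i]; first exact: size_polyC_leq1.
  by rewrite coefC; case: ifP => _; [exact: IH | exact: dg0].
move=> [sF cF]; rewrite evmS; apply: dg_sum => i; rewrite mulSn addnC.
apply: dgM; first by apply: IH; [move=> j jk; apply: Hf; exact: leqW | exact: cF].
apply: dg_le (dgX _ (Hf k (ltnSn k))); rewrite leq_mul2r; apply/orP; right.
by have := leq_trans (ltn_ord i) sF; rewrite ltnS.
Qed.

Lemma growth_bound n (P : mring K n -> Prop) d k (f : nat -> mring K n) : growth P d ->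
  (forall F, P (evm (cst K n) f k F) -> F = 0) -> (k <= d)%N.
Proof.
move=> [C HC] Hf; rewrite leqNgt; apply/negP => dk.
have [D HD] := dg_ex_fam (fun i : 'I_k => f i).
(* For this [a] there are at most [a * a.+1 ^ d] conditions, fewer than the [a.+1 ^ k] coefficients
   available once [d < k]; a nontrivial relation follows. *)
pose a := (C * (k * D).+1 ^ d)%N.
have [J [la [HJ laD laZ laP]]] := HC (k * (a * D))%N.
pose L (x : {ffun box a k -> K}) j := la (evm (cst K n) f k (box_poly x)) j.
have [|||x x0 Lx] := @kernel_ex K (box a k) J L.
- by move=> x y j; rewrite /L box_polyD rmorphD laD.
- by move=> c x j; rewrite /L box_polyZ rmorphM evm_cst laZ.
- rewrite card_box; apply: leq_ltn_trans HJ _.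
  have h1 : (a.+1 ^ d.+1 <= a.+1 ^ k)%N by apply: leq_pexp2l.
  apply: leq_trans h1; rewrite expnSr.
  have h2 : ((k * (a * D)).+1 <= a.+1 * (k * D).+1)%N by nia.
  have h3 : (C * (k * (a * D)).+1 ^ d <= a * a.+1 ^ d)%N.
    apply: leq_trans (_ : C * ((k * D).+1 ^ d * a.+1 ^ d) <= _)%N.
      rewrite leq_mul2l -expnMn [(_ * a.+1)%N]mulnC; apply/orP; right.
      by case: (d) => [//|d']; rewrite leq_exp2r.
    by rewrite mulnA.
  apply: leq_ltn_trans h3 _; rewrite mulnC ltn_mul2l expn_gt0 /=; lia.
case/eqP: x0; apply: box_poly0; apply: Hf; apply: laP => //.
apply: dg_subst; last exact: dg_box_poly.
by move=> i ik; exact: (HD (Ordinal ik)).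
Qed.

Lemma mring_torus_eq0 k (F : mring K k) :
  (forall v, (forall i, (i < k)%N -> v i != 0) -> ev v k F = 0) -> F = 0.
Proof.
elim: k F => [|k IH] F H; first exact: (H (fun=> 1)).
apply/polyP => i; rewrite coef0; apply: IH => v v0.
have : map_poly (ev v k) F * 'X = 0.
  apply: poly_fun_eq0 => s; rewrite hornerM hornerX.
  have [->|s0] := eqVneq s 0; first by rewrite mulr0.
  rewrite -ev_upd H ?mul0r // => j; rewrite ltnS leq_eqVlt /upd.
  by case: eqP => // _ /=; exact: v0.
move=> /eqP; rewrite mulf_eq0 polyX_eq0 orbF => /eqP /polyP /(_ i).
by rewrite coef_map coef0.
Qed.
End AlgebraicIndependence.

(** * Dimension of irreducible sets of a multiprojective space *)

Section Dimension.
Variables (K : closedFieldType) (I J : finType) (c : I -> J).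
Hypothesis charK : [pchar K] =i pred0.
Implicit Types (X Z : vec K I -> Prop) (f g h : vec K I -> K) (v w u : vec K I).

Definition vn v (k : nat) : K := if insub k is Some i then v (enum_val (i : 'I_#|I|)) else 0.

Lemma vn_enum v (i : 'I_#|I|) : vn v i = v (enum_val i).
Proof. by rewrite /vn valK. Qed.

Lemma polyf_mring f : polyf f -> exists Q : mring K #|I|, forall v, f v = ev (vn v) #|I| Q.
Proof.
elim/polyf_ind => {f} [f g fg [Q QE]|a|i|f g _ _ [Q QE] [R RE]|f g _ _ [Q QE] [R RE]].
- by exists Q => v; rewrite -fg.
- by exists (cst K _ a) => v; rewrite evm_cst.
- by exists (mvar K _ (enum_rank i)) => v; rewrite evm_mvar // vn_enum enum_rankK.
- by exists (Q + R) => v; rewrite rmorphD QE RE.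
by exists (Q * R) => v; rewrite rmorphM QE RE.
Qed.

Lemma polyf_vn k : polyf (fun v => vn v k).
Proof. by rewrite /vn; case: insubP => [i _ _|_]; [exact: polyf_var | exact: polyf_cst]. Qed.

Lemma polyf_ev n (w : nat -> vec K I -> K) (Q : mring K n) :
  (forall k, (k < n)%N -> polyf (w k)) -> polyf (fun v => ev (w^~ v) n Q).
Proof.
elim: n Q => [|n IH] Q Hw; first exact: polyf_cst.
apply: (@polyf_ext _ _ (fun v => \sum_(i < size Q) ev (w^~ v) n Q`_i * w n v ^+ i)).
  by move=> v; rewrite evmS.
apply: polyf_sum => i _; apply: polyfM; first by apply: IH => k kn; apply: Hw; exact: leqW.
by apply: polyfX; exact: Hw.
Qed.

Lemma D_Dm (Q : mring K #|I|) v u : D (fun v => ev (vn v) #|I| Q) v u = Dm (vn v) (vn u) #|I| Q.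
Proof.
rewrite (@D_uniq _ _ _ _ _ (evl (vn v) (vn u) #|I| Q)) // => s; rewrite evl_horner.
congr (evm _ _ _ _); apply: functional_extensionality => k; rewrite /vn.
by case: insubP => [i _ _|_]; rewrite ?ffunE // mulr0 addr0.
Qed.

Section Irreducible.
Variables (Z : vec K I -> Prop) (HZ : zclosed c Z) (IZ : zirreducible c Z).

Definition zideal (Q : mring K #|I|) := forall v, Z v -> ev (vn v) #|I| Q = 0.

Lemma zideal_prime : prime_ideal zideal.
Proof.
have [[v0 Zv0] _] := IZ.
split.
- by move=> v _; rewrite rmorph0.
- by move=> a b Ha Hb v Zv; rewrite rmorphD Ha // Hb // addr0.
- by move=> a b Hb v Zv; rewrite rmorphM Hb // mulr0.
- by move=> /(_ v0 Zv0) /eqP; rewrite rmorph1 oner_eq0.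
move=> a b Hab; apply: NNPP => /not_or_and [na nb].
have nz Q : ~ zideal Q -> exists2 v, Z v & ev (vn v) #|I| Q != 0.
  move=> nQ; apply: NNPP => N; apply: nQ => v Zv; apply/eqP/negPn/negP => Qv.
  by apply: N; exists v.
have pQ Q : polyf (fun v => ev (vn v) #|I| Q).
  by apply: polyf_ev => k _; exact: polyf_vn.
have [v [Zv]] := irr_dom HZ IZ (pQ a) (pQ b) (nz a na) (nz b nb).
by have /eqP := Hab v Zv; rewrite rmorphM mulf_eq0 => /orP [] ->.
Qed.

Definition alg_indep (X : vec K I -> Prop) k (f : nat -> vec K I -> K) :=
  (forall i, (i < k)%N -> polyf (f i)) /\
  forall F : mring K k, (forall v, X v -> ev (f^~ v) k F = 0) -> F = 0.

(** The torus orbit of a single point suffices: one nonvanishing coordinate of each colour takes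
    there all tuples of nonzero values. *)
Lemma alg_indep_point : exists f : nat -> vec K I -> K, alg_indep Z #|J| f.
Proof.
have [[v0 Zv0] _] := IZ.
pose cl k := if insub k is Some j then Some (loc HZ Zv0 (enum_val (j : 'I_#|J|))) else None.
pose f k v := if cl k is Some i then v i else 0.
exists f; split.
  by move=> i _; rewrite /f; case: (cl i) => [l|]; [exact: polyf_var | exact: polyf_cst].
move=> F HF; apply: mring_torus_eq0 => x x0.
pose l j := x (enum_rank j) / v0 (loc HZ Zv0 j).
have l0 j : l j != 0.
  by rewrite /l mulf_neq0 ?invr_eq0 ?(locP HZ Zv0 j).2 // x0.
rewrite -[RHS](HF (scale c l v0)); last exact: zclosed_scale.
apply: evm_ext => k kJ; rewrite /f /cl insubT /= ffunE (locP HZ Zv0 _).1 /l.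
by rewrite enum_valK mulfVK // (locP HZ Zv0 _).2.
Qed.

(** In a polynomial relation the term free of [g] gives a relation on [X], hence is zero. The rest
    is divisible by [g], which can be cancelled on the irreducible [Z], and the degree in [g] has
    dropped. *)
Lemma alg_indep_step (X : vec K I -> Prop) k (f : nat -> vec K I -> K) g : alg_indep X k f -> polyf g ->
  (forall v, X v -> Z v) -> vanish X g -> (exists2 v, Z v & g v != 0) ->
  alg_indep Z k.+1 (upd f k g).
Proof.
move=> [pf Hf] pg XZ gX gZ.
have pu i : (i < k.+1)%N -> polyf (upd f k g i).
  by rewrite ltnS leq_eqVlt /upd; case: eqP => // _ /= ik; exact: pf.
split=> // F.
have evE v (G : mring K k) : ev ((upd f k g)^~ v) k G = ev (f^~ v) k G.
  by apply: evm_ext => j jk; rewrite /upd ltn_eqF.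
have evg v : upd f k g k v = g v by rewrite /upd eqxx.
elim/poly_ind: F => [//|F a IH] HF.
have a0 : a = 0.
  apply: Hf => v Xv; have := HF v (XZ v Xv).
  by rewrite rmorphD rmorphM evm_X evg gX // mulr0 add0r evm_polyC evE.
rewrite a0 polyC0 addr0 in HF *.
rewrite IH ?mul0r // => v Zv; apply/eqP/negPn/negP => Fv.
have [|w [Zw]] := irr_dom HZ IZ (@polyf_ev k.+1 _ F pu) pg _ gZ; first by exists v.
move=> Fw gw; have := HF w Zw; rewrite rmorphM evm_X evg => /eqP.
by rewrite mulf_eq0 (negbTE Fw) (negbTE gw).
Qed.
End Irreducible.

Lemma chain_alg_indep X m : has_chain c X m -> exists f : nat -> vec K I -> K, alg_indep X (m + #|J|) f.
Proof.
move=> [Z [HZ sub]].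
have H k : (k <= m)%N -> exists f : nat -> vec K I -> K, alg_indep (Z k) (k + #|J|) f.
  elim: k => [|k IH] km.
    by have [[Zc Zi] _] := HZ _ km; exact: alg_indep_point.
  have [f Hf] := IH (ltnW km).
  have [Zsub [v Zv nv]] := sub _ km.
  have [[Zc Zi] _] := HZ _ (ltnW km); have [[Zc' Zi'] _] := HZ _ km.
  have [a [g [ga gX gv]]] : exists a g, [/\ form c a g, vanish (Z k) g & g v != 0].
    apply: NNPP => N; apply: nv; apply/(zclosedE Zc); split.
      exact: zclosed_point Zc' Zv.
    by move=> a g ga gX; apply/eqP/negPn/negP => gv; apply: N; exists a, g.
  exists (upd f (k + #|J|)%N g); apply: alg_indep_step Hf _ _ _ _ => //; first by case: ga.
  by exists v.
have [f [pf Hf]] := H m (leqnn m); exists f; split=> // F HF; apply: Hf => v Zv.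
by apply: HF; have [_ ZX] := HZ _ (leqnn m); exact: ZX.
Qed.

(* [d] is the transcendence degree of the cone: in characteristic 0 the tangent spaces
   are generically at least that large, and it bounds the length of chains. *)
Lemma dimension Z : zclosed c Z -> zirreducible c Z -> exists d,
  (exists h, [/\ polyf h, exists2 v, Z v & h v != 0 &
    forall v k (A : 'M[K]_(k, #|I|)), Z v -> h v != 0 -> conormal c Z v A -> (d + k <= #|I|)%N]) /\
  forall m, has_chain c Z m -> (m + #|J| <= d)%N.
Proof.
move=> HZ IZ; have PP := zideal_prime HZ IZ.
have [d [[h nh Hh] HG]] := prime_dimension charK PP; exists d; split.
  exists (fun v => ev (vn v) #|I| h); split.
  - by apply: polyf_ev => k _; exact: polyf_vn.
  - apply: NNPP => N; apply: nh => v Zv; apply/eqP/negPn/negP => hv.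
    by apply: N; exists v.
  move=> v k A Zv hv HA.
  have [B B_free BT] := Hh (vn v) (fun F HF => HF v Zv) hv.
  have BA : (B <= kermx A^T)%MS.
    apply/row_subP => i; apply/sub_kermxP.
    have /(conormal_tangent _ HA) : tangent c Z v (rvec (row i B)).
      move=> a f fa fZ; have [Q QE] := polyf_mring (proj1 fa).
      rewrite (D_ext _ _ QE) D_Dm (_ : vn (rvec _) = extv (row i B)).
        by apply: BT => w Zw; rewrite -QE fZ.
      apply: functional_extensionality => l; rewrite /vn /extv.
      by case: insubP => // j _ _; rewrite ffunE enum_valK.
    by rewrite rvecK => e; rewrite -[LHS]trmxK trmx_mul trmxK e trmx0.
  have := mxrankS BA; rewrite mxrank_ker mxrank_tr (eqP B_free).
  have [/eqP -> _ _] := HA => le.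
  by have := rank_leq_col A; have [/eqP -> _ _] := HA; lia.
move=> m /chain_alg_indep [f [pf Hf]].
pose Q k : mring K #|I| := if insub k is Some i then
  proj1_sig (constructive_indefinite_description _ (polyf_mring (pf _ (ltn_ord (i : 'I_(m + #|J|)))))) else 0.
apply: (@growth_bound K _ (zideal Z) d (m + #|J|)%N Q HG) => F HF; apply: Hf => v Zv.
have := HF v Zv; rewrite (@evm_comp _ _ _ (cst K #|I|) _ [the {rmorphism K -> K} of idfun]).
  move=> e; rewrite -[RHS]e; apply: evm_ext => k km /=.
  rewrite /Q insubT /=; case: constructive_indefinite_description => /= q qE; exact: qE.
by move=> a; rewrite /= evm_cst.
Qed.

End Dimension.

(** * The product with a projective space *)

Section Product.
Variables (K : closedFieldType) (n m : nat).
Hypothesis charK : [pchar K] =i pred0.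
Let IX := ('I_n.+1 + 'I_m.+1)%type.
Let cY := @proj_col n.
Let cP := @proj_col m.
Let cX := @times_proj_col n m.
Implicit Types (Y Z : vec K 'I_n.+1 -> Prop) (v u : vec K ('I_n.+1 + 'I_m.+1)%type).
Implicit Types (y : vec K 'I_n.+1) (q : vec K 'I_m.+1).

Definition fstv v : vec K 'I_n.+1 := [ffun i => v (inl i)].
Definition sndv v : vec K 'I_m.+1 := [ffun i => v (inr i)].
Definition pairv y q : vec K IX := [ffun i => match i with inl i => y i | inr i => q i end].

Lemma fst_pair y q : fstv (pairv y q) = y.
Proof. by apply/ffunP => i; rewrite !ffunE. Qed.
Lemma snd_pair y q : sndv (pairv y q) = q.
Proof. by apply/ffunP => i; rewrite !ffunE. Qed.
Lemma pair_eta v : pairv (fstv v) (sndv v) = v.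
Proof. by apply/ffunP => -[i|i]; rewrite !ffunE. Qed.

Lemma fst_scale l v : fstv (scale cX l v) = scale cY (fun=> l (inl tt)) (fstv v).
Proof. by apply/ffunP => i; rewrite !ffunE. Qed.
Lemma snd_scale l v : sndv (scale cX l v) = scale cP (fun=> l (inr tt)) (sndv v).
Proof. by apply/ffunP => i; rewrite !ffunE. Qed.

Definition bideg (a b : nat) (j : unit + unit) : nat := if j is inl _ then a else b.

Lemma prod_unit2 (F : unit + unit -> K) : \prod_j F j = F (inl tt) * F (inr tt).
Proof.
rewrite (bigD1 (inl tt)) //= (bigD1 (inr tt)) //= big1 ?mulr1 //.
by move=> [[]|[]].
Qed.

Lemma prod_unit (F : unit -> K) : \prod_j F j = F tt.
Proof. by rewrite (bigD1 tt) //= big1 ?mulr1 // => -[]. Qed.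

Lemma polyf_fst f : polyf f -> polyf (fun v => f (fstv v)).
Proof. by move=> pf; apply: (polyf_comp (g := fun i v => v (inl i)) pf) => i; exact: polyf_var. Qed.
Lemma polyf_snd f : polyf f -> polyf (fun v => f (sndv v)).
Proof. by move=> pf; apply: (polyf_comp (g := fun i v => v (inr i)) pf) => i; exact: polyf_var. Qed.

Lemma form_fst a f : form cY a f -> form cX (bideg (a tt) 0) (fun v => f (fstv v)).
Proof.
move=> [pf hf]; split; first exact: polyf_fst.
by move=> l v l0; rewrite fst_scale hf // prod_unit prod_unit2 /= expr0 mulr1.
Qed.
Lemma form_snd a f : form cP a f -> form cX (bideg 0 (a tt)) (fun v => f (sndv v)).
Proof.
move=> [pf hf]; split; first exact: polyf_snd.
by move=> l v l0; rewrite snd_scale hf // prod_unit prod_unit2 /= expr0 mul1r.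
Qed.

Lemma polyf_pairl F q : polyf F -> polyf (fun y => F (pairv y q)).
Proof.
move=> pF; apply: (polyf_comp (g := fun i (y : vec K 'I_n.+1) =>
  match i with inl i => y i | inr i => q i end) pF) => -[i|i]; [exact: polyf_var | exact: polyf_cst].
Qed.
Lemma polyf_pairr F y : polyf F -> polyf (fun q => F (pairv y q)).
Proof.
move=> pF; apply: (polyf_comp (g := fun i (q : vec K 'I_m.+1) =>
  match i with inl i => y i | inr i => q i end) pF) => -[i|i]; [exact: polyf_cst | exact: polyf_var].
Qed.

Lemma form_pairl a F q : form cX a F -> form cY (fun=> a (inl tt)) (fun y => F (pairv y q)).
Proof.
move=> [pF hF]; split; first exact: polyf_pairl.
move=> l y l0; rewrite prod_unit.
have := hF (fun j => if j is inl _ then l tt else 1) (pairv y q).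
rewrite prod_unit2 expr1n mulr1 => <-; last by case=> _ //; exact: oner_neq0.
congr F; apply/ffunP => -[i|i]; rewrite !ffunE /= ?mul1r //.
Qed.
Lemma form_pairr a F y : form cX a F -> form cP (fun=> a (inr tt)) (fun q => F (pairv y q)).
Proof.
move=> [pF hF]; split; first exact: polyf_pairr.
move=> l q l0; rewrite prod_unit.
have := hF (fun j => if j is inl _ then 1 else l tt) (pairv y q).
rewrite prod_unit2 expr1n mul1r => <-; last by case=> _ //; exact: oner_neq0.
congr F; apply/ffunP => -[i|i]; rewrite !ffunE /= ?mul1r //.
Qed.

Lemma is_pointX v : is_point cX v <-> is_point cY (fstv v) /\ is_point cP (sndv v).
Proof.
split=> [H|[H1 H2]].
  split=> -[].
    by have [[i|i] //= _ vi] := H (inl tt); exists i => //; rewrite ffunE.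
  by have [[i|i] //= _ vi] := H (inr tt); exists i => //; rewrite ffunE.
case=> -[].
  by have [i _ vi] := H1 tt; exists (inl i) => //; rewrite ffunE in vi.
by have [i _ vi] := H2 tt; exists (inr i) => //; rewrite ffunE in vi.
Qed.

Lemma D_pair F v u : polyf F ->
  D F v u = D (fun y => F (pairv y (sndv v))) (fstv v) (fstv u) +
            D (fun q => F (pairv (fstv v) q)) (sndv v) (sndv u).
Proof.
move=> pF; have -> : u = [ffun i => 1 * pairv (fstv u) [ffun=> 0] i + pairv [ffun=> 0] (sndv u) i].
  by apply/ffunP => -[i|i]; rewrite !ffunE /= mul1r ?addr0 ?add0r.
rewrite D_lin // mul1r; congr (_ + _).
  have [p pE] := polyf_dline v (pairv (fstv u) [ffun=> 0]) pF.
  rewrite (D_uniq pE); symmetry; apply: D_uniq => s; rewrite -pE; congr F.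
  by apply/ffunP => -[i|i]; rewrite !ffunE /= ?mul1r ?mulr0 ?addr0.
have [p pE] := polyf_dline v (pairv [ffun=> 0] (sndv u)) pF.
rewrite (D_uniq pE); symmetry; apply: D_uniq => s; rewrite -pE; congr F.
by apply/ffunP => -[i|i]; rewrite !ffunE /= ?mul1r ?mulr0 ?addr0 ?add0r.
Qed.

Lemma D_fst f v u : polyf f -> D (fun v => f (fstv v)) v u = D f (fstv v) (fstv u).
Proof.
move=> pf; rewrite D_pair; last exact: polyf_fst.
rewrite (D_ext _ _ (g := fun=> f (fstv v)) (f := fun q => f (fstv (pairv (fstv v) q)))); last first.
  by move=> q; rewrite fst_pair.
by rewrite D_cst addr0; apply: D_ext => y; rewrite fst_pair.
Qed.

Lemma polyf_nonzero (f : vec K 'I_m.+1 -> K) : polyf f ->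
  (forall q, is_point cP q -> f q = 0) -> forall q, f q = 0.
Proof.
move=> pf H q; apply/eqP/negPn/negP => fq.
have [|q' [fq' q0]] := polyf_dom pf (polyf_var K (ord0 : 'I_m.+1)) (ex_intro _ q fq).
  by exists [ffun=> 1]; rewrite ffunE oner_neq0.
by case/eqP: fq'; apply: H; case; exists ord0.
Qed.

Section OnY.
Variables (Y : vec K 'I_n.+1 -> Prop) (HY : zclosed cY Y).
Let X := times_proj (m := m) Y.

Lemma times_projE v : X v <-> Y (fstv v) /\ is_point cP (sndv v).
Proof. by []. Qed.

Lemma zclosedX : zclosed cX X.
Proof.
apply: (zclosed_ext (X := fun v => is_point cX v /\ forall F,
  (exists a f, [/\ form cY a f, vanish Y f & F = fun v => f (fstv v)]) -> F v = 0)).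
  move=> v; rewrite times_projE is_pointX; split.
    move=> [[p1 p2] H]; split=> //; apply/(zclosedE HY); split=> // a f fa fY.
    by apply: (H (fun v => f (fstv v))); exists a, f.
  move=> [Yv p2]; split; first by split=> //; exact: zclosed_point Yv.
  by move=> _ [a [f [fa fY ->]]]; exact: fY.
by apply: zclosed_forms => _ [a [f [fa fY ->]]]; exists (bideg (a tt) 0); exact: form_fst.
Qed.

(** A form vanishing on the product is restricted to the two slices through [v]: over [Y] it
    vanishes on [Y], and along the projective space it vanishes at every point, hence
    identically. *)
Lemma tangentX v u : X v -> tangent cX X v u <-> tangent cY Y (fstv v) (fstv u).
Proof.
move=> [Yv Pv]; split=> T a f fa fY.
  rewrite -D_fst; last by case: fa.
  by apply: (T (bideg (a tt) 0)); [exact: form_fst | move=> w [/fY]].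
rewrite D_pair; last by case: fa.
rewrite (T (fun=> a (inl tt))); first last.
- by move=> y Yy; apply: fY; apply/times_projE; rewrite fst_pair snd_pair.
- exact: form_pairl.
rewrite (D_ext _ _ (g := fun=> 0)) ?D_cst ?addr0 //.
apply: polyf_nonzero; first by apply: polyf_pairr; case: fa.
by move=> q Pq; apply: fY; apply/times_projE; rewrite fst_pair snd_pair.
Qed.

(** Equations of [Y] pulled back to the product suffice, since by [tangentX] all directions of the
    second factor are tangent. *)
Lemma conormalX v k (A : 'M[K]_(k, #|{: 'I_n.+1}|)) : X v -> conormal cY Y (fstv v) A ->
  exists A' : 'M[K]_(k, #|{: IX}|), conormal cX X v A'.
Proof.
move=> Xv HA; have [A_free A1 _] := HA.
pose A' := \matrix_(i < k) (vrow (pairv (rvec (row i A)) [ffun=> 0])).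
have AE u : A' *m (vrow u)^T = A *m (vrow (fstv u))^T.
  apply/colP => i; rewrite !mxE.
  rewrite (reindex (@enum_rank IX)) /=; last by apply: onW_bij; exact: enum_rank_bij.
  rewrite [RHS](reindex (@enum_rank 'I_n.+1)) /=; last by apply: onW_bij; exact: enum_rank_bij.
  rewrite big_sumType /= [X in _ + X]big1 ?addr0.
    by apply: eq_bigr => j _; rewrite !mxE !enum_rankK !ffunE !mxE.
  by move=> j _; rewrite !mxE !enum_rankK !ffunE mul0r.
exists A'; split.
- apply: inj_row_free => x xA; apply: (row_free_inj A_free); rewrite mul0mx.
  apply/rowP => l; have /rowP /(_ (enum_rank (inl (enum_val l) : IX))) := xA.
  rewrite !mxE => e; rewrite -[RHS]e; apply: eq_bigr => i _.
  by rewrite !mxE enum_rankK !ffunE !mxE enum_valK.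
- move=> i; have [a [f [fa fY E]]] := A1 i.
  exists (bideg (a tt) 0), (fun v => f (fstv v)); split.
  - exact: form_fst.
  - by move=> w [/fY].
  rewrite rowK E; apply/rowP => l; rewrite !mxE D_fst; last by case: fa.
  case: (enum_val l) => j; rewrite ffunE.
    rewrite ffunE mxE enum_rankK; congr D; apply/ffunP => j'; by rewrite !ffunE.
  rewrite ffunE -[LHS](D_cst 0 (fstv v) (fstv (basev K (inr j : IX)))).
  rewrite D_cst (D_basev _ _ (proj1 fa)) big1 // => j' _; by rewrite !ffunE mul0r.
move=> phi [a [f [fa fX ->]]]; apply: submx_of_ker => u Au.
have Tu : tangent cX X v (rvec u^T).
  apply/(tangentX _ Xv)/(conormal_tangent _ HA).
  by rewrite -AE rvecK trmxK.
have := Tu a f fa fX; rewrite gradE; last by case: fa.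
by rewrite rvecK trmxK => e; apply/rowP => l; rewrite ord1 e mxE.
Qed.
End OnY.

(** The linear flag of P^m, which prolongs a chain in [Y] by [m] steps. *)
Definition flag (j : nat) q := is_point cP q /\ forall i : 'I_m.+1, (j < i)%N -> q i = 0.

Definition timesf Z (j : nat) v := Z (fstv v) /\ flag j (sndv v).

Lemma timesf_closed Z j : zclosed cY Z -> zclosed cX (timesf Z j).
Proof.
move=> HZ; have [S S1 S2] := zclosedX HZ.
apply: (zclosed_ext (X := fun v => is_point cX v /\ forall F,
  ((exists a, form cX a F) /\ vanish (times_proj (m := m) Z) F) \/
  (exists i : 'I_m.+1, (j < i)%N /\ F = fun v => v (inr i)) -> F v = 0)).
  move=> v; split.
    move=> [Pv H]; have [Zv Qv] : times_proj (m := m) Z v.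
      apply/(zclosedE (zclosedX HZ)); split=> // a f fa fX; apply: H; left; split=> //; by exists a.
    split=> //; split=> // i ji; rewrite ffunE; apply: (H (fun v => v (inr i))); right.
    by exists i.
  move=> [Zv [Pv Fv]]; have Xv : times_proj (m := m) Z v by [].
  split; first exact: zclosed_point (zclosedX HZ) Xv.
  move=> F [[_ FX]|[i [ji ->]]]; first exact: FX.
  by rewrite -(Fv i ji) ffunE.
apply: zclosed_forms => F [[Fa _] //|[i [_ ->]]].
by exists (fun l => (cX (inr i) == l) : nat); exact: form_var.
Qed.

Lemma timesf_irreducible Z j : zclosed cY Z -> zirreducible cY Z -> zirreducible cX (timesf Z j).
Proof.
move=> HZ IZ; have [[y0 Zy0] _] := IZ.
have flag0 : flag j [ffun i : 'I_m.+1 => (i == ord0)%:R].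
  split; first by case; exists ord0 => //; rewrite ffunE eqxx oner_neq0.
  by move=> i ji; rewrite ffunE; case: eqP ji => // ->.
apply: irr_of_dom.
- by exists (pairv y0 [ffun i : 'I_m.+1 => (i == ord0)%:R]); rewrite /timesf fst_pair snd_pair.
- move=> v [Zv [Pv _]]; apply/is_pointX; split=> //; exact: zclosed_point Zv.
move=> a b f g [pf _] [pg _] [v [Zv Fv] fv] [w [Zw Fw] gw].
have [||y [Zy fy gy]] := irr_dom HZ IZ (polyf_pairl (sndv v) pf) (polyf_pairl (sndv w) pg).
- by exists (fstv v) => //; rewrite pair_eta.
- by exists (fstv w) => //; rewrite pair_eta.
pose l i s := sndv v i + s * (sndv w i - sndv v i).
have Hl i : upoly (l i).
  apply: upolyD; first exact: upoly_cst.
  by apply: upolyM; [exact: upoly_id | exact: upoly_cst].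
have l0 : [ffun i => l i 0] = sndv v by apply/ffunP => i; rewrite ffunE /l mul0r addr0.
have l1 : [ffun i => l i 1] = sndv w by apply/ffunP => i; rewrite ffunE /l mul1r addrC subrK.
(* A coordinate is kept nonzero along the line in the second factor, so that the chosen vector still
   represents a point. *)
have [i0 _ vi0] := (proj1 Fv) tt.
have u1 := polyf_upoly (polyf_pairr y pf) Hl; have u2 := polyf_upoly (polyf_pairr y pg) Hl.
have [||s1 [s1f s1v]] := upoly_dom u1 (Hl i0).
- by exists 0; rewrite l0.
- by exists 0; rewrite /l mul0r addr0.
have [||s [sfv sg]] := upoly_dom (upolyM u1 (Hl i0)) u2.
- by exists s1; rewrite mulf_neq0.
- by exists 1; rewrite l1.
move: sfv; rewrite mulf_eq0 negb_or => /andP [sf sv].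
exists (pairv y [ffun i => l i s]); split=> //.
rewrite /timesf fst_pair snd_pair; split=> //; split.
  by case; exists i0 => //; rewrite ffunE.
by move=> i ji; rewrite ffunE /l (proj2 Fv) // (proj2 Fw) // subr0 mulr0 addr0.
Qed.

Lemma timesfX Y v : timesf Y m v <-> times_proj (m := m) Y v.
Proof.
split=> [[Yv [Pv _]]|[Yv Pv]]; split=> //; split=> // i.
by rewrite ltnNge -ltnS ltn_ord.
Qed.

Lemma times_proj_irreducible Y : zclosed cY Y -> zirreducible cY Y ->
  zirreducible cX (times_proj (m := m) Y).
Proof.
move=> HY IY; have [[v Xv] H] := timesf_irreducible m HY IY; split.
  by exists v; apply/timesfX.
move=> A B HA HB AB; case: (H A B HA HB) => [w /timesfX|sub|sub]; first exact: AB.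
  by left=> w /timesfX; exact: sub.
by right=> w /timesfX; exact: sub.
Qed.

Lemma times_proj_chain Y r : has_chain cY Y r -> has_chain cX (times_proj (m := m) Y) (r + m).
Proof.
move=> [Z [HZ sub]].
(* First the chain of [Y] over the lowest member of the flag, then the flag over the last member of
   the chain; truncated subtraction keeps the flag index at 0 in the first part. *)
exists (fun k => timesf (Z (minn k r)) (k - r)); split=> k km.
  have [[Zc Zi] ZY] := HZ (minn k r) (geq_minr _ _); split.
    by split; [exact: timesf_closed | exact: timesf_irreducible].
  by move=> v [/ZY Yv [Pv _]].
have [kr|rk] := ltnP k r.
  rewrite !(minn_idPl _) ?(ltnW kr) // (_ : k - r = 0)%N; last by lia.
  rewrite (_ : k.+1 - r = 0)%N; last by lia.
  have [s1 [y Zy nZy]] := sub k kr.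
  split; first by move=> v [/s1 Zv F]; split.
  exists (pairv y [ffun i : 'I_m.+1 => (i == ord0)%:R]); last by move=> [/=]; rewrite fst_pair.
  rewrite /timesf fst_pair snd_pair; split=> //; split.
    by case; exists ord0 => //; rewrite ffunE eqxx oner_neq0.
  by move=> i ji; rewrite ffunE; case: eqP ji => // ->.
rewrite !(minn_idPr _) //; last by lia.
have [[_ [[y Zy] _]] _] := HZ r (leqnn r).
split; first by move=> v [Zv [Pv Fv]]; split=> //; split=> // i ki; apply: Fv; lia.
have jm : (k.+1 - r < m.+1)%N by lia.
exists (pairv y [ffun i : 'I_m.+1 => (i == Ordinal jm)%:R]).
  rewrite /timesf fst_pair snd_pair; split=> //; split.
    by case; exists (Ordinal jm) => //; rewrite ffunE eqxx oner_neq0.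
  move=> i ji; rewrite ffunE; have [e|//] := eqVneq i (Ordinal jm).
  by rewrite e ltnn in ji.
move=> [_ [_ H]]; have kr' : (k - r < k.+1 - r)%N by lia.
by have /eqP := H (Ordinal jm) kr'; rewrite snd_pair ffunE eqxx oner_eq0.
Qed.

End Product.

(** * Ranks and general points *)

Section Minors.
Variable K : fieldType.

Lemma rowsub_mul m n k (f : 'I_k -> 'I_m) (M : 'M[K]_(m, n)) :
  rowsub f M = rowsub f 1%:M *m M.
Proof.
apply/matrixP => i j; rewrite !mxE (bigD1 (f i)) //= !mxE eqxx mul1r big1 ?addr0 // => l /negbTE.
by rewrite !mxE eq_sym => ->; rewrite mul0r.
Qed.

Lemma rank_rowsub m n k (f : 'I_k -> 'I_m) (M : 'M[K]_(m, n)) : (\rank (rowsub f M) <= \rank M)%N.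
Proof. by rewrite rowsub_mul; exact: mxrankM_maxr. Qed.

Lemma rowsub_rank_ex m n k (M : 'M[K]_(m, n)) : (k <= \rank M)%N ->
  exists f : 'I_k -> 'I_m, \rank (rowsub f M) = k.
Proof.
move=> kM; pose w := widen_ord kM; exists (fun i => maxrankfun M (w i)).
have -> : rowsub (fun i => maxrankfun M (w i)) M = rowsub w (rowsub (maxrankfun M) M).
  by apply/matrixP => i j; rewrite !mxE.
rewrite rowsub_mul mxrankMfree ?maxrowsub_free //.
apply/eqP; rewrite eqn_leq rank_leq_row /=.
have e : rowsub w 1%:M *m (rowsub w 1%:M)^T = 1%:M :> 'M[K]_k.
  by apply/matrixP => i j; rewrite -rowsub_mul !mxE -[w j == w i]val_eqE /= val_eqE eq_sym.
by rewrite -{1}(mxrank1 K k) -e mxrankM_maxl.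
Qed.
End Minors.

Section Frank.
Variable K : closedFieldType.

(** Rank for matrices indexed by arbitrary finite types: the conditions are indexed by sums and
    products, and rearranging them then needs no casts. *)
Definition frank (A B : finType) (F : A -> B -> K) : nat :=
  \rank (\matrix_(i < #|A|, j < #|B|) F (enum_val i) (enum_val j)).

Lemma frank_minor (A B : finType) (F : A -> B -> K) k : (k <= frank F)%N <->
  exists (f : 'I_k -> A) (g : 'I_k -> B), \det (\matrix_(i, j) F (f i) (g j)) != 0.
Proof.
rewrite /frank; set M := \matrix_(i, j) _; split=> [kM|[f [g fg]]].
  have [f ef] := rowsub_rank_ex kM.
  have kM' : (k <= \rank (rowsub f M)^T)%N by rewrite mxrank_tr ef.
  have [g eg] := rowsub_rank_ex kM'.
  exists (fun i => enum_val (f i)), (fun j => enum_val (g j)).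
  rewrite -unitfE -unitmxE -row_free_unit /row_free -mxrank_tr -[X in _ == X]eg.
  by apply/eqP; congr (\rank _); apply/matrixP => i j; rewrite !mxE.
have e : \matrix_(i, j) F (f i) (g j) =
    (rowsub (fun j => enum_rank (g j)) (rowsub (fun i => enum_rank (f i)) M)^T)^T.
  by apply/matrixP => i j; rewrite !mxE !enum_rankK.
move: fg; rewrite -unitfE -unitmxE -row_free_unit => /eqP {1}<-.
rewrite e mxrank_tr; apply: leq_trans (rank_rowsub _ _) _.
by rewrite mxrank_tr; exact: rank_rowsub.
Qed.

Lemma frank_leA (A B : finType) (F : A -> B -> K) : (frank F <= #|A|)%N.
Proof. exact: rank_leq_row. Qed.

Lemma eq_frank (A B : finType) (F F' : A -> B -> K) : (forall a b, F a b = F' a b) -> frank F = frank F'.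
Proof. by move=> e; rewrite /frank; congr (\rank _); apply/matrixP => i j; rewrite !mxE. Qed.

Lemma frank_sub (A B A' B' : finType) (F : A -> B -> K) (f : A' -> A) (g : B' -> B) :
  (frank (fun a b => F (f a) (g b)) <= frank F)%N.
Proof.
have /frank_minor [f' [g' H]] := leqnn (frank (fun a b => F (f a) (g b))).
by apply/frank_minor; exists (f \o f'), (g \o g').
Qed.

Lemma frank_rows (A A' B : finType) (F : A -> B -> K) (F' : A' -> B -> K) :
  (forall a', exists c : A -> K, forall b, F' a' b = \sum_a c a * F a b) ->
  (frank F' <= frank F)%N.
Proof.
move=> H; pose c a' := proj1_sig (constructive_indefinite_description _ (H a')).
have cE a' b : F' a' b = \sum_a c a' a * F a b.
  by rewrite /c; case: constructive_indefinite_description.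
rewrite /frank; set M := \matrix_(i, j) _.
have -> : M = \matrix_(i, j) c (enum_val i) (enum_val j) *m
    \matrix_(i < #|A|, j < #|B|) F (enum_val i) (enum_val j).
  apply/matrixP => i j; rewrite !mxE cE (reindex (@enum_val A xpredT)) /=.
    by apply: eq_bigr => k _; rewrite !mxE.
  by apply: onW_bij; exact: enum_val_bij.
exact: mxrankM_maxr.
Qed.

Lemma frank_colscale (A B : finType) (F : A -> B -> K) (w : B -> K) :
  (frank (fun a b => F a b * w b)%R <= frank F)%N.
Proof.
rewrite /frank; set M := \matrix_(i, j) _.
have -> : M = (\matrix_(i < #|A|, j < #|B|) F (enum_val i) (enum_val j)) *m
   diag_mx (\row_j w (enum_val j)).
  by apply/matrixP => i j; rewrite mul_mx_diag !mxE.
exact: mxrankM_maxl.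
Qed.

Lemma frank_block (A B A1 B1 A2 B2 : finType) (F : A -> B -> K)
    (e1 : A1 -> A) (e2 : A2 -> A) (c1 : B1 -> B) (c2 : B2 -> B) :
  (forall a b, F (e1 a) (c2 b) = 0) ->
  (frank (fun a b => F (e1 a) (c1 b)) + frank (fun a b => F (e2 a) (c2 b)) <= frank F)%N.
Proof.
move=> F0; set r1 := frank _; set r2 := frank _.
have /frank_minor [f1 [g1 H1]] : (r1 <= r1)%N := leqnn r1.
have /frank_minor [f2 [g2 H2]] : (r2 <= r2)%N := leqnn r2.
apply/frank_minor.
exists (fun i => match split i with inl i => e1 (f1 i) | inr i => e2 (f2 i) end),
  (fun j => match split j with inl j => c1 (g1 j) | inr j => c2 (g2 j) end).
set M := \matrix_(i, j) _.
have sl i : split (lshift r2 i : 'I_(r1 + r2)) = inl i by rewrite (unsplitK (inl i)).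
have sr i : split (rshift r1 i : 'I_(r1 + r2)) = inr i by rewrite (unsplitK (inr i)).
have ur0 : ursubmx M = 0 by apply/matrixP => i j; rewrite !mxE sl sr F0.
have ulE : ulsubmx M = \matrix_(i, j) F (e1 (f1 i)) (c1 (g1 j)).
  by apply/matrixP => i j; rewrite !mxE !sl.
have drE : drsubmx M = \matrix_(i, j) F (e2 (f2 i)) (c2 (g2 j)).
  by apply/matrixP => i j; rewrite !mxE !sr.
rewrite -(submxK M) ur0 ulE drE.
by rewrite det_lblock mulf_neq0.
Qed.

(** Semicontinuity along a curve: a minor that is nonzero at 0 is a nonzero polynomial, hence
    nonzero at some [s] other than 0. *)
Lemma frank_upoly (A B : finType) (F : K -> A -> B -> K) k :
  (forall a b, upoly (fun s => F s a b)) -> (k <= frank (F 0%R))%N ->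
  exists2 s, s != 0 & (k <= frank (F s))%N.
Proof.
move=> HF /frank_minor [f [g H]].
have Hd : upoly (fun s => \det (\matrix_(i, j) F s (f i) (g j))).
  pose P a b := constructive_indefinite_description _ (HF a b).
  exists (\det (\matrix_(i, j) proj1_sig (P (f i) (g j)))) => s.
  rewrite -[RHS]/(horner_eval s _) -det_map_mx; congr (\det _); apply/matrixP => i j.
  rewrite !mxE; exact: (proj2_sig (P (f i) (g j))).
have [||s [s0 Hs]] := upoly_dom (@upoly_id K) Hd.
- by exists 1; exact: oner_neq0.
- by exists 0.
by exists s => //; apply/frank_minor; exists f, g.
Qed.

Definition killed (A B : finType) (F : A -> B -> K) (x : B -> K) :=
  forall a, \sum_b F a b * x b = 0.

Lemma frank_inj (A B : finType) (F : A -> B -> K) :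
  (forall x, killed F x -> forall b, x b = 0) -> frank F = #|B|.
Proof.
move=> H; rewrite /frank -mxrank_tr; apply/eqP; apply: inj_row_free => x xM.
apply/rowP => j; rewrite mxE -(enum_valK j); apply: (H (fun b => x 0 (enum_rank b))) => a.
have /rowP /(_ (enum_rank a)) := xM; rewrite !mxE => e; rewrite -[RHS]e.
rewrite [RHS](reindex (@enum_rank B)) /=; last by apply: onW_bij; exact: enum_rank_bij.
by apply: eq_bigr => i _; rewrite !mxE !enum_rankK mulrC.
Qed.

Lemma frank_full (A B : finType) (F : A -> B -> K) x : (#|B| <= frank F)%N -> killed F x ->
  forall b, x b = 0.
Proof.
move=> le Hx; set M := \matrix_(i < #|A|, j < #|B|) F (enum_val i) (enum_val j).
have free : row_free M^T by rewrite /row_free mxrank_tr eqn_leq rank_leq_col.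
pose y : 'rV[K]_#|B| := \row_j x (enum_val j).
have : y *m M^T = 0.
  apply/rowP => i; rewrite !mxE -[RHS](Hx (enum_val i)).
  rewrite (reindex (@enum_rank B)) /=; last by apply: onW_bij; exact: enum_rank_bij.
  by apply: eq_bigr => j _; rewrite !mxE enum_rankK mulrC.
rewrite -(mul0mx _ M^T) => /(row_free_inj free) /rowP y0 b.
by have := y0 (enum_rank b); rewrite !mxE enum_rankK.
Qed.

Definition addrows (A A' B : finType) (F : A -> B -> K) (F' : A' -> B -> K)
  (a : A + A') b := match a with inl a => F a b | inr a => F' a b end.

Lemma frank_addrows (A A' B : finType) (F : A -> B -> K) (F' : A' -> B -> K) :
  (frank (addrows F F') <= frank F + frank F')%N.
Proof.
pose M := \matrix_(i < #|A|, j < #|B|) F (enum_val i) (enum_val j).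
pose M' := \matrix_(i < #|A'|, j < #|B|) F' (enum_val i) (enum_val j).
apply: (@leq_trans (\rank (M + M')%MS)).
  rewrite /frank; apply: mxrankS; apply/row_subP => i.
  case E : (enum_val i) => [a|a].
    apply: submx_trans (addsmxSl _ _); apply: submx_trans (row_sub (enum_rank a) _).
    rewrite (_ : row i _ = row (enum_rank a) M) ?submx_refl //.
    by apply/rowP => j; rewrite !mxE E /= enum_rankK.
  apply: submx_trans (addsmxSr _ _); apply: submx_trans (row_sub (enum_rank a) _).
  rewrite (_ : row i _ = row (enum_rank a) M') ?submx_refl //.
  by apply/rowP => j; rewrite !mxE E /= enum_rankK.
exact: mxrank_adds_leqif.
Qed.

Definition span_of (A B : finType) (F : A -> B -> K) (g : B -> K) :=
  exists c : A -> K, forall b, g b = \sum_a c a * F a b.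

Section Span.
Variables (A B : finType) (F : A -> B -> K).

Lemma span_row a : span_of F (F a).
Proof.
exists (fun a' => (a' == a)%:R) => b; rewrite (bigD1 a) //= eqxx mul1r big1 ?addr0 // => a' /negbTE ->.
by rewrite mul0r.
Qed.

Lemma spanD g h : span_of F g -> span_of F h -> span_of F (fun b => g b + h b).
Proof.
move=> [c gE] [d hE]; exists (fun a => c a + d a) => b; rewrite gE hE -big_split /=.
by apply: eq_bigr => a _; rewrite mulrDl.
Qed.

Lemma spanZ k g : span_of F g -> span_of F (fun b => k * g b).
Proof.
move=> [c gE]; exists (fun a => k * c a) => b; rewrite gE mulr_sumr.
by apply: eq_bigr => a _; rewrite mulrA.
Qed.

Lemma span0 : span_of F (fun=> 0).
Proof. by exists (fun=> 0) => b; rewrite big1 // => a _; rewrite mul0r. Qed.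

Lemma span_sum (T : Type) (r : seq T) (k : T -> K) (g : T -> B -> K) :
  (forall i, span_of F (g i)) -> span_of F (fun b => \sum_(i <- r) k i * g i b).
Proof.
move=> H; elim: r => [|i r [c cE]].
  by have [c cE] := span0; exists c => b; rewrite big_nil -cE.
have [d dE] := spanD (spanZ (k i) (H i)) (ex_intro _ c cE).
by exists d => b; rewrite big_cons -dE.
Qed.

Lemma span_ext g h : g =1 h -> span_of F g -> span_of F h.
Proof. by move=> gh [c gE]; exists c => b; rewrite -gh gE. Qed.
End Span.

Lemma frank_addrow (A B : finType) (F : A -> B -> K) (w : B -> K) x : killed F x ->
  \sum_b w b * x b != 0 -> (frank F < frank (addrows F (fun _ : unit => w)))%N.
Proof.
move=> Fx wx; have [le|//] := leqP (frank (addrows F (fun _ : unit => w))) (frank F).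
pose M := \matrix_(i < #|A|, j < #|B|) F (enum_val i) (enum_val j).
pose M' := \matrix_(i < #|{: A + unit}|, j < #|B|) addrows F (fun=> w) (enum_val i) (enum_val j).
have MM' : (M <= M')%MS.
  apply/row_subP => i; apply: submx_trans (row_sub (enum_rank (inl (enum_val i))) _).
  rewrite (_ : row i _ = row (enum_rank (inl (enum_val i))) M') ?submx_refl //.
  by apply/rowP => j; rewrite !mxE enum_rankK.
have M'M : (M' <= M)%MS by have [_ <-] := mxrank_leqif_sup MM'; rewrite eqn_leq le mxrankS.
have /submxP [y yE] : (row (enum_rank (inr tt)) M' <= M)%MS by apply: submx_trans (row_sub _ _) M'M.
case/eqP: wx; pose xc : 'cV[K]_#|B| := \col_j x (enum_val j).
have Mx : M *m xc = 0.
  apply/colP => i; rewrite !mxE -[RHS](Fx (enum_val i)).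
  rewrite (reindex (@enum_rank B)) /=; last by apply: onW_bij; exact: enum_rank_bij.
  by apply: eq_bigr => j _; rewrite !mxE enum_rankK.
have : row (enum_rank (inr tt)) M' *m xc = 0 by rewrite yE -mulmxA Mx mulmx0.
move=> /matrixP /(_ 0 0); rewrite !mxE => e; rewrite -[RHS]e.
rewrite [RHS](reindex (@enum_rank B)) /=; last by apply: onW_bij; exact: enum_rank_bij.
by apply: eq_bigr => j _; rewrite !mxE !enum_rankK.
Qed.

(* Each general value condition raises the rank until the common kernel is killed. *)
Lemma add_values (A B : finType) (G : A -> B -> K) (X : Type) (val : X -> B -> K) (x0 : X) u :
  (forall x, killed G x -> (exists b, x b != 0) -> exists p, \sum_b val p b * x b != 0) ->
  exists p : 'I_u -> X,
    (minn (frank G + u) #|B| <= frank (addrows G (fun i b => val (p i) b)))%N.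
Proof.
move=> H; elim: u => [|u [p IH]].
  exists (fun=> x0); rewrite addn0 geq_min; apply/orP; left.
  exact: (frank_sub (addrows G (fun (i : 'I_0) b => val x0 b)) (fun a => inl a) id).
set F := addrows G _ in IH.
have [full|nfull] := leqP #|B| (frank F).
  exists (fun i => if insub (i : nat) is Some j then p j else x0).
  rewrite geq_min; apply/orP; right; apply: leq_trans full _.
  pose e (a : A + 'I_u) : A + 'I_u.+1 :=
    match a with inl a => inl a | inr i => inr (widen_ord (leqnSn u) i) end.
  rewrite (eq_frank (F' := fun a b => addrows G (fun (i : 'I_u.+1) b =>
     val (if insub (i : nat) is Some j then p j else x0) b) (e a) b)).
    exact: (frank_sub _ e id).
  by move=> [a|i] b //=; rewrite valK.
have [x [Fx [b xb]]] : exists x, killed F x /\ exists b, x b != 0.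
  apply: NNPP => N; move: nfull; rewrite frank_inj ?ltnn // => x Fx b.
  by apply/eqP/negPn/negP => xb; apply: N; exists x; split=> //; exists b.
have [q qx] : exists q, \sum_b val q b * x b != 0.
  by apply: H; [move=> a; exact: (Fx (inl a)) | exists b].
exists (fun i => if insub (i : nat) is Some j then p j else q).
have lt := frank_addrow Fx qx.
apply: leq_trans (_ : frank F + 1 <= _)%N.
  by move: IH; rewrite -/F !geq_min => /orP [h|h]; apply/orP; [left | right]; lia.
rewrite addn1; apply: leq_trans lt _.
pose e (a : (A + 'I_u) + unit) : A + 'I_u.+1 :=
  match a with inl (inl a) => inl a | inl (inr i) => inr (widen_ord (leqnSn u) i)
  | inr _ => inr ord_max end.
rewrite (eq_frank (F' := fun a b => addrows G (fun (i : 'I_u.+1) b =>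
   val (if insub (i : nat) is Some j then p j else q) b) (e a) b)).
  exact: (frank_sub _ e id).
by move=> [[a|i]|[]] b' //=; rewrite ?valK // insubF //= ltnn.
Qed.

End Frank.

(** * Classes of functions that admit general choices *)

Section Classes.
Variable K : closedFieldType.

(* [fc_dom] plays the role of irreducibility of the parameter space. *)
Record fclass (X : Type) (A : (X -> K) -> Prop) : Prop := FClass {
  fc_ext : forall f g, f =1 g -> A f -> A g;
  fc_cst : forall a, A (fun=> a);
  fcD : forall f g, A f -> A g -> A (fun x => f x + g x);
  fcM : forall f g, A f -> A g -> A (fun x => f x * g x);
  fc_dom : forall f g, A f -> A g -> (exists x, f x != 0) -> (exists x, g x != 0) ->
    exists x, f x != 0 /\ g x != 0 }.

Definition generic X (A : (X -> K) -> Prop) (P : X -> Prop) :=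
  exists f, [/\ A f, exists x, f x != 0 & forall x, f x != 0 -> P x].

Lemma generic_ex X (A : (X -> K) -> Prop) P : generic A P -> exists x, P x.
Proof. by move=> [f [_ [x fx] H]]; exists x; apply: H. Qed.

Lemma generic_and X (A : (X -> K) -> Prop) P Q : fclass A -> generic A P -> generic A Q ->
  generic A (fun x => P x /\ Q x).
Proof.
move=> HA [f [Af fn fP]] [g [Ag gn gQ]].
exists (fun x => f x * g x); split; first exact: (fcM HA).
  by have [x [fx gx]] := fc_dom HA Af Ag fn gn; exists x; rewrite mulf_neq0.
by move=> x; rewrite mulf_eq0 negb_or => /andP [? ?]; split; [exact: fP | exact: gQ].
Qed.

Lemma generic_imp X (A : (X -> K) -> Prop) (P Q : X -> Prop) :
  (forall x, P x -> Q x) -> generic A P -> generic A Q.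
Proof. by move=> PQ [f [Af fn fP]]; exists f; split=> // x fx; apply: PQ; exact: fP. Qed.

Lemma generic_rank X (A : (X -> K) -> Prop) (R C : finType) (F : X -> R -> C -> K) k :
  fclass A -> (forall a b, A (fun x => F x a b)) -> (exists x, (k <= frank (F x))%N) ->
  generic A (fun x => (k <= frank (F x))%N).
Proof.
move=> HA HF [x /frank_minor [f [g H]]].
exists (fun x => \det (\matrix_(i, j) F x (f i) (g j))); split; last 1 first.
- by move=> y Hy; apply/frank_minor; exists f, g.
- rewrite /determinant.
  have As (T : Type) (r : seq T) (h : T -> X -> K) : (forall t, A (h t)) ->
      A (fun x => \sum_(t <- r) h t x).
    move=> Hh; elim: r => [|t r IH].
      by apply: (fc_ext HA) (fc_cst HA 0) => y; rewrite big_nil.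
    by apply: (fc_ext HA) (fcD HA (Hh t) IH) => y; rewrite big_cons.
  have Ap (T : Type) (r : seq T) (h : T -> X -> K) : (forall t, A (h t)) ->
      A (fun x => \prod_(t <- r) h t x).
    move=> Hh; elim: r => [|t r IH].
      by apply: (fc_ext HA) (fc_cst HA 1) => y; rewrite big_nil.
    by apply: (fc_ext HA) (fcM HA (Hh t) IH) => y; rewrite big_cons.
  pose h (p : {perm 'I_k}) (x : X) : K := (-1) ^+ (perm.odd_perm p) * \prod_i F x (f i) (g (p i)).
  apply: (fc_ext HA (f := fun x => \sum_p h p x)).
    by move=> y; apply: eq_bigr => p _; congr (_ * _); apply: eq_bigr => i _; rewrite mxE.
  apply: As => p; apply: (fcM HA); first exact: (fc_cst HA).
  exact: Ap.
by exists x.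
Qed.

(** Membership in each variable separately is enough, since the common non-zero is found one factor
    at a time. *)
Definition prodc X Y (A : (X -> K) -> Prop) (B : (Y -> K) -> Prop) (f : X * Y -> K) :=
  (forall y, A (fun x => f (x, y))) /\ (forall x, B (fun y => f (x, y))).

Lemma fclass_prod X Y (A : (X -> K) -> Prop) (B : (Y -> K) -> Prop) :
  fclass A -> fclass B -> fclass (prodc A B).
Proof.
move=> HA HB; split.
- move=> f g fg [f1 f2]; split=> z; [apply: (fc_ext HA) (f1 z) | apply: (fc_ext HB) (f2 z)] => t;
    exact: fg.
- by move=> a; split=> z; [exact: (fc_cst HA) | exact: (fc_cst HB)].
- by move=> f g [f1 f2] [g1 g2]; split=> z; [exact: (fcD HA) | exact: (fcD HB)].
- by move=> f g [f1 f2] [g1 g2]; split=> z; [exact: (fcM HA) | exact: (fcM HB)].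
move=> f g [f1 f2] [g1 g2] [[x y] fxy] [[x' y'] gxy].
have [||a [fa ga]] := fc_dom HA (f1 y) (g1 y'); [by exists x | by exists x' |].
have [||b [fb gb]] := fc_dom HB (f2 a) (g2 a); [by exists y | by exists y' |].
by exists (a, b).
Qed.

Definition setf (I : eqType) X (p : I -> X) i x (j : I) := if j == i then x else p j.

Definition powc (I : eqType) X (A : (X -> K) -> Prop) (f : (I -> X) -> K) :=
  forall p i, A (fun x => f (setf p i x)).

Lemma fclass_pow (I : finType) X (A : (X -> K) -> Prop) : fclass A -> fclass (@powc I X A).
Proof.
move=> HA; split.
- by move=> f g fg H p i; apply: (fc_ext HA) (H p i) => x; exact: fg.
- by move=> a p i; exact: (fc_cst HA).
- by move=> f g Hf Hg p i; exact: (fcD HA).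
- by move=> f g Hf Hg p i; exact: (fcM HA).
move=> f g Hf Hg [p fp] [q gq].
(* The two witnesses are made equal one coordinate at a time, both functions staying nonzero. *)
have H (s : seq I) : exists p q, [/\ f p != 0, g q != 0 & forall i, i \in s -> p i = q i].
  elim: s => [|i s [p' [q' [fp' gq' e]]]]; first by exists p, q.
  have se (r : I -> X) : setf r i (r i) = r.
    by apply: functional_extensionality => j; rewrite /setf; case: eqP => [->|].
  have [||x [fx gx]] := fc_dom HA (Hf p' i) (Hg q' i).
  - by exists (p' i); rewrite se.
  - by exists (q' i); rewrite se.
  exists (setf p' i x), (setf q' i x); split=> // j; rewrite inE /setf.
  by case: eqP => //= _; exact: e.
have [p' [q' [fp' gq' e]]] := H (enum I); exists p'; split=> //.
by rewrite (_ : p' = q') //; apply: functional_extensionality => i; apply: e; rewrite mem_enum.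
Qed.

(** Points of P^m are sequences of which only the first [m.+1] entries matter, so that [m] can vary
    in the induction; being polynomial on every line is all that is asked of functions of them. *)
Definition linec (f : (nat -> K) -> K) :=
  forall q q', upoly (fun s => f (fun k => q k + s * (q' k - q k))).

Lemma fclass_line : fclass linec.
Proof.
split.
- by move=> f g fg H q q'; apply: upoly_ext (H q q') => s; exact: fg.
- by move=> a q q'; exact: upoly_cst.
- by move=> f g Hf Hg q q'; exact: upolyD.
- by move=> f g Hf Hg q q'; exact: upolyM.
move=> f g Hf Hg [q fq] [q' gq].
have e0 : (fun k => q k + 0 * (q' k - q k)) = q.
  by apply: functional_extensionality => k; rewrite mul0r addr0.
have e1 : (fun k => q k + 1 * (q' k - q k)) = q'.
  by apply: functional_extensionality => k; rewrite mul1r addrC subrK.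
have [||s [fs gs]] := upoly_dom (Hf q q') (Hg q q').
- by exists 0; rewrite e0.
- by exists 1; rewrite e1.
by exists (fun k => q k + s * (q' k - q k)).
Qed.
End Classes.

(** * The Horace degeneration *)

(* Monomials of degree [t] in the variables [q 0, .., q m], split by whether [q 0] divides. *)
Fixpoint Mon (m : nat) : nat -> finType :=
  match m with
  | 0 => fun=> unit
  | m'.+1 => fix M t : finType := match t with
    | 0 => unit
    | t'.+1 => (Mon m' t'.+1 + M t')%type
    end
  end.

Section Monomials.
Variable K : closedFieldType.
Implicit Types q : nat -> K.

Definition sh q (i : nat) : K := q i.+1.

Fixpoint emon m : forall t, Mon m t -> (nat -> K) -> K :=
  match m return forall t, Mon m t -> (nat -> K) -> K with
  | 0 => fun t _ q => q 0%N ^+ t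
  | m'.+1 => fix e t : Mon m'.+1 t -> (nat -> K) -> K :=
    match t return Mon m'.+1 t -> (nat -> K) -> K with
    | 0 => fun _ _ => 1
    | t'.+1 => fun mu q => match mu with
      | inl mu => emon mu (sh q)
      | inr mu => q 0%N * e t' mu q
      end
    end
  end.

(** The partial derivative of the monomial in [q i], along the recursion of [emon]; the lowered
    index in the case [inl] corresponds to [sh]. *)
Fixpoint demon m : forall t, Mon m t -> nat -> (nat -> K) -> K :=
  match m return forall t, Mon m t -> nat -> (nat -> K) -> K with
  | 0 => fun t _ i q => if i is 0 then t%:R * q 0%N ^+ t.-1 else 0
  | m'.+1 => fix e t : Mon m'.+1 t -> nat -> (nat -> K) -> K :=
    match t return Mon m'.+1 t -> nat -> (nat -> K) -> K with
    | 0 => fun _ _ _ => 0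
    | t'.+1 => fun mu i q => match mu with
      | inl mu => if i is i'.+1 then demon mu i' (sh q) else 0
      | inr mu => (i == 0%N)%:R * emon (m := m'.+1) mu q + q 0%N * e t' mu i q
      end
    end
  end.

Lemma card_Mon m t : #|Mon m t| = 'C(t + m, m).
Proof.
elim: m t => [|m IHm] t; first by rewrite card_unit bin0.
elim: t => [|t IHt]; first by rewrite /= card_unit add0n binn.
by rewrite [Mon _ _]/= card_sum IHm IHt addSnnS [(t.+1 + m.+1)%N]addSn binS addnC.
Qed.

Lemma emonr m t (mu : Mon m.+1 t) q :
  emon (m := m.+1) (t := t.+1) (inr mu) q = q 0%N * emon mu q.
Proof. by []. Qed.

Lemma demonr m t (mu : Mon m.+1 t) i q : demon (m := m.+1) (t := t.+1) (inr mu) i q =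
  (i == 0%N)%:R * emon mu q + q 0%N * demon mu i q.
Proof. by []. Qed.

Lemma linec_coord i : linec (fun q : nat -> K => q i).
Proof.
move=> q q'; apply: upolyD; first exact: upoly_cst.
by apply: upolyM; [exact: upoly_id | exact: upoly_cst].
Qed.

Lemma linec_sh (f : (nat -> K) -> K) : linec f -> linec (fun q => f (sh q)).
Proof. by move=> H q q'; exact: H. Qed.

Lemma linecX (f : (nat -> K) -> K) k : linec f -> linec (fun q => f q ^+ k).
Proof. by move=> H q q'; exact: upolyX. Qed.

Lemma linec_emon m t (mu : Mon m t) : linec (emon mu).
Proof.
elim: m t mu => [|m IHm] t mu; first by apply: linecX; exact: linec_coord.
elim: t mu => [|t IHt] mu; first exact: (fc_cst (fclass_line K) 1).
case: mu => mu; first by apply: linec_sh; exact: IHm.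
exact: (fcM (fclass_line K) (linec_coord 0) (IHt mu)).
Qed.

Lemma linec_demon m t (mu : Mon m t) i : linec (demon mu i).
Proof.
have LC a := fc_cst (fclass_line K) a.
elim: m t mu i => [|m IHm] t mu i.
  case: i => [|i]; last exact: (LC 0).
  apply: (fcM (fclass_line K) (LC t%:R)); apply: linecX; exact: linec_coord.
elim: t mu i => [|t IHt] mu i; first exact: (LC 0).
case: mu => mu.
  case: i => [|i]; first exact: (LC 0).
  apply: linec_sh; exact: IHm.
apply: (fcD (fclass_line K)); apply: (fcM (fclass_line K)).
- exact: LC.
- exact: (@linec_emon m.+1 t mu).
- exact: linec_coord.
exact: IHt.
Qed.

Lemma emon_ext m t (mu : Mon m t) q q' : (forall i, (i <= m)%N -> q i = q' i) ->
  emon mu q = emon mu q'.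
Proof.
elim: m t mu q q' => [|m IHm] t mu q q' H; first by rewrite /= H.
elim: t mu => [//|t IHt] [] mu /=.
  by apply: IHm => i im; exact: H.
by rewrite H //; congr (_ * _); exact: IHt.
Qed.

Lemma demon_ext m t (mu : Mon m t) i q q' : (forall i, (i <= m)%N -> q i = q' i) ->
  demon mu i q = demon mu i q'.
Proof.
elim: m t mu i q q' => [|m IHm] t mu i q q' H; first by rewrite /= H.
elim: t mu i => [//|t IHt] [] mu i /=.
  by case: i => // i; apply: IHm => j jm; exact: H.
rewrite H //; congr (_ * _ + _ * _); [exact: (@emon_ext m.+1 t mu q q') | exact: IHt].
Qed.

Lemma emon_free m t (x : Mon m t -> K) : (exists mu, x mu != 0) ->
  exists q, \sum_mu x mu * emon mu q != 0.
Proof.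
elim: m t x => [|m IHm] t x [mu xmu].
  exists (fun=> 1); rewrite (bigD1 tt) //= big1 => [|[]//].
  by rewrite expr1n mulr1 addr0; case: mu xmu.
elim: t x mu xmu => [|t IHt] x mu xmu.
  exists (fun=> 1); rewrite (bigD1 tt) //= big1 => [|[]//].
  by rewrite mulr1 addr0; case: mu xmu.
have [[nu xnu]|N] := classic (exists nu : Mon m t.+1, x (inl nu) != 0).
  have [q Hq] := IHm t.+1 (fun nu => x (inl nu)) (ex_intro _ nu xnu).
  exists (fun i => if i is i'.+1 then q i' else 0).
  rewrite big_sumType /= [X in _ + X]big1 ?addr0 //.
  by move=> nu' _; rewrite mul0r mulr0.
case: mu xmu => mu xmu; first by case: N; exists mu.
have [q1 H1] := IHt (fun mu => x (inr mu)) mu xmu.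
have L : linec (fun q => \sum_(mu : Mon m.+1 t) x (inr mu) * emon mu q).
  move=> q q'; apply: upoly_sum => nu; apply: upolyM; [exact: upoly_cst | exact: linec_emon].
have [||q [Hq q0]] := fc_dom (fclass_line K) L (@linec_coord 0).
- by exists q1.
- by exists (fun=> 1); exact: oner_neq0.
exists q; rewrite big_sumType /= [X in X + _]big1 ?add0r => [|nu _]; last first.
  have -> : x (inl nu) = 0 by apply/eqP/negPn/negP => h; apply: N; exists nu.
  by rewrite mul0r.
rewrite (eq_bigr (fun mu : Mon m.+1 t => q 0%N * (x (inr mu) * emon (m := m.+1) (t := t) mu q))); last first.
  by move=> nu _; rewrite mulrCA.
by rewrite -mulr_sumr mulf_neq0.
Qed.

Lemma euler_emon m t (mu : Mon m t) q :
  \sum_(i < m.+1) q i * demon mu i q = t%:R * emon mu q.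
Proof.
elim: m t mu q => [|m IHm] t mu q.
  rewrite big_ord1 /=; case: t mu => [|t] _; first by rewrite !mul0r mulr0.
  by rewrite mulrCA exprS.
elim: t mu => [|t IHt] mu; first by rewrite big1 ?mul0r // => i _; rewrite /= mulr0.
case: mu => mu /=.
  by rewrite big_ord_recl mulr0 add0r -IHm.
rewrite (eq_bigr (fun i : 'I_m.+2 => q i * ((i == 0 :> nat)%:R * emon (m := m.+1) mu q) +
   q 0%N * (q i * demon (m := m.+1) mu i q))); last by move=> i _; rewrite mulrDr [q i * (q 0%N * _)]mulrCA.
rewrite big_split /= -mulr_sumr IHt big_ord_recl /= mul1r big1 ?addr0; last first.
  by move=> i _; rewrite mul0r mulr0.
by rewrite -[t.+1]addn1 natrD; ring.
Qed.

End Monomials.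

Section Horace.
Variable K : closedFieldType.
Hypothesis charK : [pchar K] =i pred0.
(** An abstract form of the situation on [Y]: [T] parametrises general points, [v k] is the value of
    the k-th section, and [J k j] its derivative in the j-th direction of a frame of the tangent
    space of the cone, of dimension [R]. The relation [vJ] is Euler's, and [J_rank] expresses that
    [Y] is not defective. *)
Variables (T : Type) (reg : (T -> K) -> Prop) (regP : fclass reg) (y0 : T).
Variables (alpha R : nat) (J : 'I_alpha -> 'I_R -> T -> K) (v : 'I_alpha -> T -> K).
Variable (beta : 'I_R -> T -> K).
Hypothesis regJ : forall k j, reg (J k j).
Hypothesis regv : forall k, reg (v k).
Hypothesis vJ : forall k y, v k y = \sum_j beta j y * J k j y.
Hypothesis v_free : forall x : 'I_alpha -> K, (exists k, x k != 0) ->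
  exists y, \sum_k x k * v k y != 0.
Hypothesis J_rank : forall z, exists y : 'I_z -> T,
  (minn (z * R) alpha <= frank (fun (a : 'I_z * 'I_R) k => J k a.2 (y a.1)))%N.

Let P := (T * (nat -> K))%type.
Let pc : (P -> K) -> Prop := prodc reg (@linec K).
Let pcP : fclass pc := fclass_prod regP (fclass_line K).

(* The conditions imposed on [sum_mu f_mu q^mu] by the double point at [(y, q)]. *)
Definition cond m t (p : P) (a : 'I_R + 'I_m.+1) (b : 'I_alpha * Mon m t) : K :=
  match a with
  | inl j => J b.1 j p.1 * emon b.2 p.2
  | inr i => v b.1 p.1 * demon b.2 i p.2
  end.

Definition cut (q : nat -> K) (i : nat) : K := if i is 0 then 0 else q i.
Definition hq (h : bool) (p : P) : P := (p.1, if h then cut p.2 else p.2).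

(* [z] double points, the first [u] of them on [q 0 = 0], impose [rho] conditions. *)
Definition bigp m t z u rho := exists p : 'I_z -> P,
  (rho <= frank (fun (a : 'I_z * ('I_R + 'I_m.+1)) (b : 'I_alpha * Mon m t) =>
     cond (hq (a.1 < u)%N (p a.1)) a.2 b))%N.

Lemma pc_mul (f : T -> K) (g : (nat -> K) -> K) : reg f -> linec g -> pc (fun p => f p.1 * g p.2).
Proof.
move=> Hf Hg; split=> z /=; first exact: (fcM regP Hf (fc_cst regP (g z))).
exact: (fcM (fclass_line K) (fc_cst (fclass_line K) (f z)) Hg).
Qed.

Lemma linec_cut f : linec f -> linec (fun q => f (cut q)).
Proof.
move=> H q q'; apply: upoly_ext (H (cut q) (cut q')) => s; congr f.
by apply: functional_extensionality => -[|i] //=; rewrite subrr mulr0 addr0.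
Qed.

Lemma pc_cond m t h a b : pc (fun p => @cond m t (hq h p) a b).
Proof.
have L f : linec f -> linec (fun q => f (if h then cut q else q)).
  by case: h => // Hf; exact: linec_cut.
case: a => [j|i]; rewrite /cond /=.
  exact: (pc_mul (regJ b.1 j) (L _ (linec_emon b.2))).
exact: (pc_mul (regv b.1) (L _ (linec_demon b.2 i))).
Qed.

Lemma pow_coord z (f : P -> K) (i : 'I_z) : pc f -> powc pc (fun p => f (p i)).
Proof.
by move=> Hf p j; rewrite /setf; case: eqP => _; [exact: Hf | exact: (fc_cst pcP)].
Qed.

Lemma bigp_generic m t z u rho : bigp m t z u rho ->
  generic (powc (I := 'I_z) pc) (fun p : 'I_z -> P =>
   (rho <= frank (fun (a : 'I_z * ('I_R + 'I_m.+1)) (b : 'I_alpha * Mon m t) =>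
     cond (hq (a.1 < u)%N (p a.1)) a.2 b))%N).
Proof.
move=> H; apply: (generic_rank (fclass_pow ('I_z : finType) pcP)) H => a b.
apply: (@pow_coord z (fun p => cond (hq (a.1 < u)%N p) a.2 b)); exact: pc_cond.
Qed.

Lemma bigp_le m t z u rho rho' : (rho' <= rho)%N -> bigp m t z u rho -> bigp m t z u rho'.
Proof. by move=> le [p H]; exists p; apply: leq_trans le H. Qed.

Lemma hq_hq (h h' : bool) p : (h -> h') -> hq h (hq h' p) = hq h' p.
Proof.
rewrite /hq /=; case: h; case: h' => // H; first by congr (_, _); apply: functional_extensionality => -[].
by have := H isT.
Qed.

Lemma bigp_sup m t z u z' u' rho : (z <= z')%N -> (u' <= u)%N -> bigp m t z u rho -> bigp m t z' u' rho.
Proof.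
move=> zz uu [p H].
pose p' (i : 'I_z') : P :=
  if (insub (i : nat) : option 'I_z) is Some j then hq (i < u)%N (p j) else (y0, fun=> 0).
exists p'; pose e (a : 'I_z * ('I_R + 'I_m.+1)) := (widen_ord zz a.1, a.2).
pose G (a : 'I_z' * ('I_R + 'I_m.+1)) (b : 'I_alpha * Mon m t) :=
  cond (hq (a.1 < u')%N (p' a.1)) a.2 b.
apply: leq_trans H _; rewrite (eq_frank (F' := fun a b => G (e a) b)).
  exact: (frank_sub _ e id).
move=> [i a] b; rewrite /G /p' /= valK hq_hq // => iu; exact: leq_trans iu uu.
Qed.

(** A double point has [R + m.+1] rows but imposes at most [R + m] conditions. Euler's formula in
    [q] expresses a multiple of the value by the derivatives in [q], and [vJ] expresses the value by
    the rows [J]; a nonzero [q i] allows the i-th derivative to be eliminated. *)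
Lemma point_rank m t (p : P) : (0 < R)%N ->
  (frank (@cond m t.+1 p) <= R + m)%N.
Proof.
move=> R0; have ch k : (0 < k)%N -> k%:R != 0 :> K.
  by move=> k0; rewrite (iffLR (pcharf0P K) charK) -lt0n.
have [[i qi]|N] := classic (exists i : 'I_m.+1, p.2 i != 0).
  pose e (a : 'I_R + 'I_m) : 'I_R + 'I_m.+1 :=
    match a with inl j => inl j | inr l => inr (lift i l) end.
  apply: (@leq_trans (frank (fun a b => @cond m t.+1 p (e a) b))); last first.
    by apply: leq_trans (frank_leA _) _; rewrite card_sum !card_ord.
  apply: frank_rows => a'; case: a' => [j|l]; first exact: (span_row _ (inl j)).
  case: (unliftP i l) => [l' ->|->]; first exact: (span_row _ (inr l')).
  pose g1 b := \sum_j beta j p.1 * @cond m t.+1 p (e (inl j)) b.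
  pose g2 b := \sum_(l : 'I_m) p.2 (lift i l) * @cond m t.+1 p (e (inr l)) b.
  apply: (@span_ext _ _ _ _ (fun b => (p.2 i)^-1 * (t.+1%:R * g1 b + -1 * g2 b))).
    move=> b /=; apply: (mulfI qi); rewrite mulVKf //.
    have -> : g1 b = v b.1 p.1 * emon b.2 p.2.
      by rewrite /g1 vJ mulr_suml; apply: eq_bigr => j _; rewrite /= mulrA.
    have -> : g2 b = v b.1 p.1 * \sum_(l < m) p.2 (lift i l) * demon b.2 (lift i l) p.2.
      by rewrite /g2 mulr_sumr; apply: eq_bigr => l' _; rewrite /= mulrCA.
    have E := euler_emon b.2 p.2; rewrite (bigD1_ord i) //= in E.
    rewrite [t.+1%:R * _]mulrCA -E; set S := \sum_(l < m) _; set d := demon _ _ _; ring.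
  apply: spanZ; apply: spanD; apply: spanZ; apply: span_sum => j; exact: span_row.
have q0 i : (i < m.+1)%N -> p.2 i = 0.
  by move=> im; apply/eqP/negPn/negP => qi; apply: N; exists (Ordinal im).
apply: (@leq_trans (frank (fun (a : 'I_m.+1) b => @cond m t.+1 p (inr a) b))); last first.
  by apply: leq_trans (frank_leA _) _; rewrite card_ord -add1n leq_add2r.
apply: frank_rows => -[j|l]; last exact: (span_row _ l).
apply: (@span_ext _ _ _ _ (fun=> 0)); last exact: span0.
move=> b /=; suff -> : emon b.2 p.2 = 0 by rewrite mulr0.
apply: (mulfI (ch _ (ltn0Sn t))); rewrite mulr0 -euler_emon big1 // => i _.
by rewrite q0 ?mul0r.
Qed.

(** If all conditions are independent they remain so for fewer points, each removed point accounting
    for at most [R + m] of the rank. *)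
Lemma bigp_sub m t z u z' u' : (0 < R)%N -> (z' <= z)%N -> (u' <= u)%N ->
  bigp m t.+1 z u (z * (R + m)) -> bigp m t.+1 z' u' (z' * (R + m)).
Proof.
move=> R0 zz uu; have H0 : bigp m t.+1 z u (z * (R + m)) -> bigp m t.+1 z u' (z * (R + m)).
  exact: bigp_sup.
move=> /H0; elim: z zz {H0} => [|z IH] zz; first by rewrite (_ : z' = 0%N) //; lia.
move: zz; rewrite leq_eqVlt => /orP [/eqP -> //|zz] [p H]; apply: IH; first by [].
exists (fun i => p (widen_ord (leqnSn z) i)).
rewrite -(leq_add2r (R + m)) -mulSnr; apply: leq_trans H _.
set F := (X in (_ <= frank X + _)%N).
pose F' (a : 'I_R + 'I_m.+1) b := @cond m t.+1 (hq (z < u')%N (p ord_max)) a b.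
apply: leq_trans (_ : frank (addrows F F') <= _)%N.
  pose e (a : 'I_z.+1 * ('I_R + 'I_m.+1)) : ('I_z * ('I_R + 'I_m.+1)) + ('I_R + 'I_m.+1) :=
    if (insub (a.1 : nat) : option 'I_z) is Some i then inl (i, a.2) else inr a.2.
  rewrite (eq_frank (F' := fun a b => addrows F F' (e a) b)); first exact: (frank_sub _ e id).
  move=> [i a] b; rewrite /e /=; case: insubP => [j ij e'|].
    have <- : widen_ord (leqnSn z) j = i by apply: ord_inj.
    by [].

  rewrite -leqNgt => zi; have iz : i = ord_max.
    by apply/val_inj/eqP; rewrite eqn_leq zi andbT -ltnS ltn_ord.
  by rewrite /= /F' iz.
apply: leq_trans (frank_addrows _ _) _; rewrite leq_add2l; exact: point_rank.
Qed.

Definition val m t (p : P) (b : 'I_alpha * Mon m t) : K := v b.1 p.1 * emon b.2 p.2.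

Lemma val_free m t (x : 'I_alpha * Mon m t -> K) : (exists b, x b != 0) ->
  exists p, \sum_b val p b * x b != 0.
Proof.
move=> [[k mu] xb].
have [q Hq] := @emon_free K m t (fun mu => x (k, mu)) (ex_intro _ mu xb).
have [y Hy] := v_free (ex_intro (fun k => \sum_mu x (k, mu) * emon mu q != 0) k Hq).
exists (y, q); move: Hy; congr (_ != 0).
have -> : \sum_b val (y, q) b * x b = \sum_k \sum_mu val (y, q) (k, mu) * x (k, mu).
  by rewrite pair_bigA; apply: eq_bigr => -[].
apply: eq_bigr => k' _; rewrite mulr_suml; apply: eq_bigr => mu' _.
by rewrite /val /= mulrC -mulrA [emon _ _ * _]mulrC.
Qed.

Definition setq0 (q : nat -> K) (a : K) (i : nat) : K := if i is 0 then a else q i.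
Definition shp (p : P) : P := (p.1, sh p.2).

Lemma upoly_sqr (f : K -> K) : upoly f -> upoly (fun s => f (s ^+ 2)).
Proof.
move=> [p pE]; exists (p \Po 'X^2) => s.
by rewrite horner_comp hornerXn pE.
Qed.

Lemma linec_setq0 (f : (nat -> K) -> K) q : linec f -> upoly (fun s => f (setq0 q s)).
Proof.
move=> H; apply: upoly_ext (H (setq0 q 0) (setq0 q 1)) => s; congr f.
by apply: functional_extensionality => -[|i] /=; rewrite ?subr0 ?subrr ?mulr1 ?mulr0 ?add0r ?addr0.
Qed.

Lemma linec_shp m t (a : 'I_R + 'I_m.+1) b : pc (fun p => @cond m t (shp p) a b).
Proof.
case: a => [j|i]; rewrite /cond /=.
  exact: (pc_mul (regJ b.1 j) (linec_sh (linec_emon b.2))).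
exact: (pc_mul (regv b.1) (linec_sh (linec_demon b.2 i))).
Qed.

Lemma pc_val_shp m t b : pc (fun p => @val m t (shp p) b).
Proof. exact: (pc_mul (regv b.1) (linec_sh (linec_emon b.2))). Qed.

Lemma pc_val_hq m t h b : pc (fun p => @val m t (hq h p) b).
Proof.
case: h; first exact: (pc_mul (regv b.1) (linec_cut (linec_emon b.2))).
exact: (pc_mul (regv b.1) (linec_emon b.2)).
Qed.

Section Step.
Variables (m t A U D u : nat).
Hypothesis uA : (u <= A)%N.

Let rt1 := ('I_R + 'I_m.+1)%type.
Let rt2 := ('I_R + 'I_m.+2)%type.
Let CF := ('I_alpha * Mon m t.+2)%type.
Let CG := ('I_alpha * Mon m.+1 t.+1)%type.
Let XX := (('I_A -> P) * (('I_U -> P) * ('I_D -> P)))%type.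
Let YY := (('I_U -> P) * ('I_D -> P))%type.
Let yc : (YY -> K) -> Prop := prodc (powc (I := 'I_U) pc) (powc (I := 'I_D) pc).
Let xc : (XX -> K) -> Prop := prodc (powc (I := 'I_A) pc) yc.
Let ycP : fclass yc := fclass_prod (fclass_pow ('I_U : finType) pcP) (fclass_pow ('I_D : finType) pcP).
Let xcP : fclass xc := fclass_prod (fclass_pow ('I_A : finType) pcP) ycP.

Lemma yc1 (f : P -> K) (i : 'I_U) : pc f -> yc (fun y => f (y.1 i)).
Proof. by move=> Hf; split=> z /=; [exact: pow_coord | exact: (fc_cst (fclass_pow ('I_D : finType) pcP))]. Qed.
Lemma yc2 (f : P -> K) (i : 'I_D) : pc f -> yc (fun y => f (y.2 i)).
Proof. by move=> Hf; split=> z /=; [exact: (fc_cst (fclass_pow ('I_U : finType) pcP)) | exact: pow_coord]. Qed.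
Lemma xc1 (f : P -> K) (i : 'I_A) : pc f -> xc (fun x => f (x.1 i)).
Proof. by move=> Hf; split=> z /=; [exact: pow_coord | exact: (fc_cst ycP)]. Qed.
Lemma xc2 (f : YY -> K) : yc f -> xc (fun x => f x.2).
Proof. by move=> Hf; split=> z /=; [exact: (fc_cst (fclass_pow ('I_A : finType) pcP)) | exact: Hf]. Qed.

Definition lift_row (a : rt1) : rt2 :=
  match a with inl j => inl j | inr i => inr (lift ord0 i) end.

(* On the part of degree 0 in [q 0]: double points, and the values left by the
   differential points. *)
Definition Ff (x : XX) : ('I_A * rt1) + 'I_U -> CF -> K :=
  addrows (fun a b => cond (shp (x.1 a.1)) a.2 b) (fun i b => val (shp (x.2.1 i)) b).

(* On the multiples of [q 0]. *)
Definition Drow (p : P) (a : rt2) (b : CG) : K := @cond m.+1 t.+2 p a (b.1, inr b.2).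
Lemma Drow_inl p j b : Drow p (inl j) b = J b.1 j p.1 * (p.2 0%N * emon b.2 p.2).
Proof. by []. Qed.

Lemma Drow_inr p (l : 'I_m.+2) b : Drow p (inr l) b =
  v b.1 p.1 * ((l == 0 :> nat)%:R * emon b.2 p.2 + p.2 0%N * demon b.2 l p.2).
Proof. by []. Qed.

Lemma Drow_inlr p j (b : 'I_alpha * Mon m.+1 t) : Drow p (inl j) (b.1, inr b.2) =
  J b.1 j p.1 * (p.2 0%N * (p.2 0%N * emon b.2 p.2)).
Proof. by []. Qed.

Lemma Drow_inrr p (l : 'I_m.+2) (b : 'I_alpha * Mon m.+1 t) : Drow p (inr l) (b.1, inr b.2) =
  v b.1 p.1 * ((l == 0 :> nat)%:R * (p.2 0%N * emon b.2 p.2) + p.2 0%N *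
    ((l == 0 :> nat)%:R * emon b.2 p.2 + p.2 0%N * demon b.2 l p.2)).
Proof. by []. Qed.

(** A double point of the hyperplane only: [lift_row] leaves out the derivative in [q 0]. *)
Definition Urow (p : P) (a : rt1) (b : CG) : K := cond (hq true p) (lift_row a) b.
Definition Gg (y : YY) : ('I_D * rt2) + ('I_U * rt1) -> CG -> K :=
  addrows (fun a b => Drow (y.2 a.1) a.2 b) (fun a b => Urow (y.1 a.1) a.2 b).
Definition Fg (x : XX) : (('I_D * rt2) + ('I_U * rt1)) + 'I_A -> CG -> K :=
  addrows (Gg x.2) (fun i b => val (hq true (x.1 i)) b).

Lemma Ff_ex : bigp m t.+2 A 0 (A * (R + m)) -> (A * (R + m) + U <= alpha * #|Mon m t.+2|)%N ->
  exists x, (A * (R + m) + U <= frank (Ff x))%N.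
Proof.
move=> [p Hp] le.
have [|q Hq] := @add_values _ _ _ (fun (a : 'I_A * rt1) (b : CF) => cond (p a.1) a.2 b)
    P (fun p b => val p b) (y0, fun=> 0) U.
  by move=> x _; exact: val_free.
pose ins (p : P) : P := (p.1, fun i => if i is i'.+1 then p.2 i' else 0).
exists (fun i => ins (p i), (fun i => ins (q i), fun _ : 'I_D => (y0, fun=> 0))).
apply: leq_trans Hq; rewrite leq_min; apply/andP; split; first by rewrite leq_add2r.
by rewrite card_prod card_ord.
Qed.

Lemma val_cond m' t' (p : P) (b : 'I_alpha * Mon m' t') :
  val p b = \sum_j beta j p.1 * cond p (inl j) b.
Proof. by rewrite /val vJ mulr_suml; apply: eq_bigr => j _; rewrite /= mulrA. Qed.

(** Two systems are used. In degree [t.+1] all [U + D] points are independent, and removing the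
    transverse derivatives of the [U] points costs at most [U]. In degree [t] the [D] points exhaust
    the system; hence no nonzero section satisfying the conditions vanishes on the hyperplane, as
    [q 0] could be divided out, and [A] general values there impose as many conditions as
    possible. *)
Lemma Fg_ex : bigp m.+1 t.+1 (U + D) U ((U + D) * (R + m.+1)) ->
  bigp m.+1 t D 0 (alpha * #|Mon m.+1 t|) ->
  exists x, (minn (D * (R + m.+1) + U * (R + m) + A) (alpha * #|Mon m.+1 t.+1|) <= frank (Fg x))%N.
Proof.
move=> Hb Hc.
pose Fb (y : YY) : ('I_U * rt2) + ('I_D * rt2) -> CG -> K :=
  addrows (fun a b => cond (hq true (y.1 a.1)) a.2 b) (fun a b => cond (y.2 a.1) a.2 b).
pose Fc (y : YY) (a : 'I_D * rt2) (b : 'I_alpha * Mon m.+1 t) : K := cond (y.2 a.1) a.2 b.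
have gb : generic yc (fun y => ((U + D) * (R + m.+1) <= frank (Fb y))%N).
  apply: (generic_rank ycP).
    move=> [a|a] b; first exact: (yc1 a.1 (pc_cond true a.2 b)).
    exact: (yc2 a.1 (pc_cond false a.2 b)).
  have [p Hp] := Hb; exists (fun i => p (lshift D i), fun i => p (rshift U i)).
  apply: leq_trans Hp _.
  pose e (a : 'I_(U + D) * rt2) : ('I_U * rt2) + ('I_D * rt2) :=
    match split a.1 with inl i => inl (i, a.2) | inr i => inr (i, a.2) end.
  rewrite (eq_frank (F' := fun a b => Fb (fun i => p (lshift D i), fun i => p (rshift U i)) (e a) b)).
    exact: (frank_sub _ e id).
  move=> [i a] b; rewrite /e /=; case: (splitP i) => l el /=.
    have -> : i = lshift D l by apply: ord_inj.
    by [].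
  have -> : i = rshift U l by apply: ord_inj.
  by [].
have gc : generic yc (fun y => (alpha * #|Mon m.+1 t| <= frank (Fc y))%N).
  apply: (generic_rank ycP).
    by move=> a b; exact: (yc2 a.1 (pc_cond false a.2 b)).
  by have [p Hp] := Hc; exists (fun=> (y0, fun=> 0), p).
have g0 : generic yc (fun y => forall i, (y.2 i).2 0%N != 0).
  exists (fun y => \prod_i (y.2 i).2 0%N); split.
  - have pr (r : seq 'I_D) : yc (fun y => \prod_(i <- r) (y.2 i).2 0%N).
      elim: r => [|i r IH].
        by apply: (fc_ext ycP) (fc_cst ycP 1) => y; rewrite big_nil.
      have Hi : yc (fun y => (y.2 i).2 0%N).
        apply: (@yc2 (fun p : P => p.2 0%N) i); split=> z /=; first exact: (fc_cst regP).
        exact: linec_coord.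
      by apply: (fc_ext ycP) (fcM ycP Hi IH) => y; rewrite big_cons.
    exact: pr.
  - exists (fun=> (y0, fun=> 1), fun=> (y0, fun=> 1)).
    by apply/prodf_neq0 => i _; exact: oner_neq0.
  by move=> y /prodf_neq0 H i; exact: H.
have [y [[Hyb Hyc] Hy0]] := generic_ex (generic_and ycP (generic_and ycP gb gc) g0).
have rG : (D * (R + m.+1) + U * (R + m) <= frank (Gg y))%N.
  (* The transverse derivatives, which separate the full double points from those of the
     hyperplane. *)
  pose extra (i : 'I_U) (b : CG) := cond (hq true (y.1 i)) (inr (ord0 : 'I_m.+2)) b.
  have le1 : (frank (Fb y) <= frank (addrows (Gg y) extra))%N.
    apply: frank_rows => -[[i a]|[i a]].
      case: a => [j|l]; first exact: (span_row _ (inl (inr (i, inl j)))).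
      case: (unliftP ord0 l) => [l' ->|->]; first exact: (span_row _ (inl (inr (i, inr l')))).
      exact: (span_row _ (inr i)).
    (* Off the hyperplane multiplication by [q 0] is invertible on jets, so the rows for multiples
       of [q 0] span those of degree [t.+1]. *)
    have q0 := Hy0 i.
    pose dr a b := addrows (Gg y) extra (inl (inl (i, a))) b.
    have drE a' b : dr a' b = Drow (y.2 i) a' b by [].
    have Sd a' : span_of (addrows (Gg y) extra) (dr a') by exact: span_row.
    have Sv : span_of (addrows (Gg y) extra) (fun b => (y.2 i).2 0%N * val (y.2 i) b).
      apply: (@span_ext _ _ _ _ (fun b => \sum_j beta j (y.2 i).1 * dr (inl j) b)).
        move=> b; rewrite val_cond mulr_sumr; apply: eq_bigr => j _.
        rewrite drE Drow_inl /cond; move: (emon _ _) => x2; ring.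
      by apply: span_sum => j.
    case: a => [j|l].
      apply: (@span_ext _ _ _ _ (fun b => ((y.2 i).2 0%N)^-1 * dr (inl j) b)).
        by move=> b; rewrite drE Drow_inl [J _ _ _ * _]mulrCA mulKf.
      exact: spanZ.
    apply: (@span_ext _ _ _ _ (fun b => ((y.2 i).2 0%N)^-1 * (dr (inr l) b +
        - (l == 0 :> nat)%:R / (y.2 i).2 0%N * ((y.2 i).2 0%N * val (y.2 i) b)))).
      move=> b; rewrite drE Drow_inr /val -[RHS]/(v b.1 (y.2 i).1 * demon b.2 l (y.2 i).2).
      by move: (demon _ _ _) (emon _ _) => x1 x2; field.
    by apply: spanZ; apply: spanD => //; apply: spanZ.
  have := leq_trans Hyb (leq_trans le1 (frank_addrows _ _)).
  have := frank_leA extra; rewrite card_ord => le2 le3.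
  have : ((U + D) * (R + m.+1) <= frank (Gg y) + U)%N by lia.
  by rewrite mulnDl !addnS !mulnS; lia.
have [|pA HA] := @add_values _ _ _ (Gg y) P (fun p b => val (hq true p) b) (y0, fun=> 0) A.
  move=> x Gx xb; apply: NNPP => N.
  have N' p : \sum_b val (hq true p) b * x b = 0.
    by apply/eqP/negPn/negP => h; apply: N; exists p.
  (* Vanishing on the whole hyperplane kills the coefficients of the monomials without [q 0]. *)
  have xH k mu : x (k, inl mu) = 0.
    apply/eqP/negPn/negP => xk.
    have [p Hp] := @val_free m t.+1 (fun b => x (b.1, inl b.2)) (ex_intro _ (k, mu) xk).
    case/eqP: Hp; rewrite -[RHS](N' (p.1, fun i => if i is i'.+1 then p.2 i' else 0)).
    have -> : \sum_(b : CG) val (hq true (p.1, fun i => if i is i'.+1 then p.2 i' else 0)) b * x b =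
      \sum_k \sum_nu val (hq true (p.1, fun i => if i is i'.+1 then p.2 i' else 0)) (k, nu) * x (k, nu).
      by rewrite pair_bigA; apply: eq_bigr => -[].
    have -> : \sum_b val p b * x (b.1, inl b.2) = \sum_k \sum_nu val p (k, nu) * x (k, inl nu).
      by rewrite pair_bigA; apply: eq_bigr => -[].
    apply: eq_bigr => k' _; rewrite big_sumType /= [X in _ = _ + X]big1 ?addr0.
      by apply: eq_bigr => nu _; rewrite /val /=.
    by move=> nu _; rewrite /val /= mul0r mulr0 mul0r.
  have Dx p (a : rt2) : \sum_b Drow p a b * x b =
      \sum_(b : 'I_alpha * Mon m.+1 t) Drow p a (b.1, inr b.2) * x (b.1, inr b.2).
    have -> : \sum_b Drow p a b * x b = \sum_k \sum_nu Drow p a (k, nu) * x (k, nu).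
      by rewrite pair_bigA; apply: eq_bigr => -[].
    have -> : \sum_(b : 'I_alpha * Mon m.+1 t) Drow p a (b.1, inr b.2) * x (b.1, inr b.2) =
      \sum_k \sum_nu Drow p a (k, inr nu) * x (k, inr nu).
      by rewrite pair_bigA; apply: eq_bigr => -[].
    apply: eq_bigr => k _; rewrite big_sumType /= [X in X + _]big1 ?add0r //.
    by move=> nu _; rewrite xH mulr0.
  pose x' (b : 'I_alpha * Mon m.+1 t) := x (b.1, inr b.2).
  (* The remaining section is a multiple of [q 0]; its quotient satisfies the same conditions at the
     [D] points, the rows being compared after multiplication by the square of [q 0]. *)
  have kc : killed (Fc y) x'.
    move=> [i a]; have q0 := Hy0 i.
    have kJ j : \sum_b Fc y (i, inl j) b * x' b = 0.
      have e : \sum_b Drow (y.2 i) (inl j) b * x b = 0 := Gx (inl (i, inl j)); rewrite Dx in e.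
      apply: (mulfI (mulf_neq0 q0 q0)); rewrite mulr0 -[RHS]e mulr_sumr.
      apply: eq_bigr => b _; have -> : Fc y (i, inl j) b = J b.1 j (y.2 i).1 * emon b.2 (y.2 i).2 by [].
      rewrite Drow_inlr /x'.
      by move: (emon _ _) (x _) => x2 x3; ring.
    have kv : \sum_b val (y.2 i) b * x' b = 0.
      rewrite (eq_bigr (fun b => \sum_j beta j (y.2 i).1 * (Fc y (i, inl j) b * x' b))).
        by rewrite exchange_big /= big1 // => j _; rewrite -mulr_sumr kJ mulr0.
      by move=> b _; rewrite val_cond mulr_suml; apply: eq_bigr => j _; rewrite mulrA.
    case: a => [j|l]; first exact: kJ.
    have e : \sum_b Drow (y.2 i) (inr l) b * x b = 0 := Gx (inl (i, inr l)); rewrite Dx in e.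
    apply: (mulfI (mulf_neq0 q0 q0)); rewrite mulr0 -[RHS]e mulr_sumr.
    rewrite [RHS](eq_bigr (fun b => (l == 0 :> nat)%:R * (2%:R * (y.2 i).2 0%N) * (val (y.2 i) b * x' b) +
       (y.2 i).2 0%N * (y.2 i).2 0%N * (Fc y (i, inr l) b * x' b))).
      by rewrite [RHS]big_split /= -[X in _ = X + _]mulr_sumr kv mulr0 add0r.
    move=> b _; rewrite /val.
    have -> : Fc y (i, inr l) b = v b.1 (y.2 i).1 * demon b.2 l (y.2 i).2 by [].
    rewrite Drow_inrr /x'.
    by move: (emon _ _) (demon _ _ _) (x _) => x1 x2 x3; ring.
  have [b bx] := xb.
  have x0 := frank_full _ kc; case/eqP: bx; case: b => k [mu|mu]; first exact: xH.
  by apply: (x0 _ (k, mu)); rewrite card_prod card_ord.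
exists (pA, y); rewrite /Fg /=; apply: leq_trans HA.
by rewrite card_prod card_ord leq_min !geq_min leqnn orbT andbT leq_add2r rG.
Qed.

(** For a point at [q 0 = s^2] the combination of the value with [- s^2] times the derivative in
    [q 0] is the value on monomials without [q 0] and of order [s^4] on the others. The remaining
    rows of the point have order 1 on the former and [s^2] on the latter. Rescaling the former
    columns by [s^e] makes all unwanted entries tend to 0 exactly when [2 < e < 4]. This explains
    [s^3], and also the square, since placing the point at [q 0 = s] would require [1 < e < 2]. *)
Lemma horace : bigp m t.+2 A 0 (A * (R + m)) -> (A * (R + m) + U <= alpha * #|Mon m t.+2|)%N ->
  bigp m.+1 t.+1 (U + D) U ((U + D) * (R + m.+1)) ->
  bigp m.+1 t D 0 (alpha * #|Mon m.+1 t|) ->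
  bigp m.+1 t.+2 (A + (U + D)) u (A * (R + m) + U +
     minn (D * (R + m.+1) + U * (R + m) + A) (alpha * #|Mon m.+1 t.+1|)).
Proof.
move=> Ha le Hb Hc.
have gf : generic xc (fun x => (A * (R + m) + U <= frank (Ff x))%N).
  apply: (generic_rank xcP); last exact: Ff_ex.
  move=> [a|i] b; first exact: (xc1 a.1 (linec_shp a.2 b)).
  exact: (xc2 (yc1 i (pc_val_shp b))).
have gg : generic xc (fun x => (minn (D * (R + m.+1) + U * (R + m) + A)
    (alpha * #|Mon m.+1 t.+1|) <= frank (Fg x))%N).
  apply: (generic_rank xcP); last exact: Fg_ex.
  move=> [[a|a]|i] b.
  - exact: (xc2 (yc2 a.1 (@pc_cond m.+1 t.+2 false a.2 (b.1, inr b.2)))).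
  - exact: (xc2 (yc1 a.1 (pc_cond true (lift_row a.2) b))).
  exact: (xc1 i (pc_val_hq true b)).
have [[pA [pU pD]] [Hf Hg]] := generic_ex (generic_and xcP gf gg).
set x := (pA, (pU, pD)) in Hf Hg.
(* The matrix after row and column operations that are invertible for nonzero [s]; its entries are
   polynomial in [s], also at 0. *)
pose Fs (s : K) (a : (('I_A * rt1) + 'I_U) + ((('I_D * rt2) + ('I_U * rt1)) + 'I_A)) (b : CF + CG) : K :=
  match a, b with
  | inl a, inl b => Ff x a b
  | inl (inl _), inr _ => 0
  | inl (inr i), inr b => - s * (v b.1 (pU i).1 * demon b.2 0 (setq0 (pU i).2 (s ^+ 2)))
  | inr (inl (inl (i, a))), inl b => s ^+ 3 * @cond m.+1 t.+2 (pD i) a (b.1, inl b.2)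
  | inr (inl (inl (i, a))), inr b => Drow (pD i) a b
  | inr (inl (inr (i, a))), inl b => s * cond (shp (pU i)) a b
  | inr (inl (inr (i, a))), inr b => cond ((pU i).1, setq0 (pU i).2 (s ^+ 2)) (lift_row a) b
  | inr (inr i), inl _ => 0
  | inr (inr i), inr b => val (hq true (pA i)) b
  end.
have Fs_poly a b : upoly (fun s => Fs s a b).
  have us := @upoly_id K.
  have usq f : linec f -> forall q, upoly (fun s => f (setq0 q (s ^+ 2))).
    by move=> Hl q; apply: (upoly_sqr (linec_setq0 q Hl)).
  case: a => [[a|i]|[[[i a]|[i a]]|i]]; case: b => b; rewrite /Fs; try exact: upoly_cst.
  - apply: upolyM; first by apply: upoly_ext (upolyM (upoly_cst (-1)) us) => s; rewrite mulN1r.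
    by apply: upolyM; [exact: upoly_cst | exact: usq (linec_demon b.2 0) _].
  - by apply: upolyM; [exact: upolyX us | exact: upoly_cst].
  - by apply: upolyM; [exact: us | exact: upoly_cst].
  case: a => [j|l]; rewrite /lift_row /cond; apply: upolyM.
    - exact: (upoly_cst (J b.1 j (pU i).1)).
  - exact: (usq _ (linec_emon b.2)).
  - exact: (upoly_cst (v b.1 (pU i).1)).
  exact: (usq _ (linec_demon b.2 (lift ord0 l))).
have Fs0 : (A * (R + m) + U + minn (D * (R + m.+1) + U * (R + m) + A)
    (alpha * #|Mon m.+1 t.+1|) <= frank (Fs 0%R))%N.
  have := @frank_block _ _ _ _ _ _ _ (Fs 0) inl inr inl inr.
  move=> /(_ _) le2; apply: leq_trans (le2 _); last by case=> [a|i] b //=; rewrite oppr0 mul0r.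
  apply: leq_add; first by apply: leq_trans Hf _; apply: eq_leq; apply: eq_frank => -[a|i] b.
  apply: leq_trans Hg _; apply: eq_leq; apply: eq_frank => -[[[i a]|[i a]]|i] b //=.
  have cutE : setq0 (pU i).2 (0 ^+ 2) = cut (pU i).2.
    by rewrite expr0n; apply: functional_extensionality => -[].
  by rewrite cutE.
have [s s0 Hs] := frank_upoly Fs_poly Fs0.
pose ps (i : 'I_(A + (U + D))) : P := match split i with
  | inl i => hq true (pA i)
  | inr i => match split i with
    | inl i => ((pU i).1, setq0 (pU i).2 (s ^+ 2)) | inr i => pD i end end.
exists ps; apply: leq_trans Hs _.
pose M (a : 'I_(A + (U + D)) * rt2) (b : 'I_alpha * Mon m.+1 t.+2) :=
  cond (hq (a.1 < u)%N (ps a.1)) a.2 b.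
pose cm (b : CF + CG) : 'I_alpha * Mon m.+1 t.+2 :=
  match b with inl b => (b.1, inl b.2) | inr b => (b.1, inr b.2) end.
pose w (b : CF + CG) : K := if b is inl _ then s ^+ 3 else 1.
have w0 b : w b != 0 by case: b => b; rewrite /w ?expf_neq0 ?oner_neq0.
apply: leq_trans (_ : frank (fun a b => M a (cm b)) <= _)%N; last exact: (frank_sub M id cm).
apply: leq_trans (_ : frank (fun a b => (Fs s a b / w b)%R) <= _)%N.
  rewrite (eq_frank (F' := fun a b => Fs s a b / w b * w b)).
    exact: (frank_colscale (fun a b => Fs s a b / w b) w).
  by move=> a b; rewrite mulfVK.
set N := fun a b => M a (cm b).
have psA i : ps (lshift (U + D) i) = hq true (pA i).
  by rewrite /ps (unsplitK (inl i)).
have psU i : ps (rshift A (lshift D i)) = ((pU i).1, setq0 (pU i).2 (s ^+ 2)).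
  by rewrite /ps (unsplitK (inr _)) (unsplitK (inl i)).
have psD i : ps (rshift A (rshift U i)) = pD i.
  by rewrite /ps (unsplitK (inr _)) (unsplitK (inr i)).
have NA i a b : N (lshift (U + D) i, a) b = cond (hq true (pA i)) a (cm b).
  by rewrite /N /M /= psA hq_hq.
have ge i : (rshift A i < u)%N = false.
  by apply/negbTE; rewrite -leqNgt; apply: leq_trans uA _; exact: leq_addr.
have NU i a b : N (rshift A (lshift D i), a) b =
    cond ((pU i).1, setq0 (pU i).2 (s ^+ 2)) a (cm b).
  rewrite -[N _ _]/(cond (hq (rshift A (lshift D i) < u)%N (ps (rshift A (lshift D i)))) a (cm b)).
  by rewrite ge /hq psU.
have ND i a b : N (rshift A (rshift U i), a) b = cond (pD i) a (cm b).
  rewrite -[N _ _]/(cond (hq (rshift A (rshift U i) < u)%N (ps (rshift A (rshift U i)))) a (cm b)).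
  by rewrite ge /hq psD; case: (pD i).
have s3 : s ^+ 3 != 0 by rewrite expf_neq0.
apply: frank_rows => -[[[i a]|i]|[[[i a]|[i a]]|i]].
- apply: (@span_ext _ _ _ _ (fun b => (s ^+ 3)^-1 * N (lshift (U + D) i, lift_row a) b)).
    move=> b; rewrite NA; case: b => b; rewrite /Fs /Ff /w /cm /=.
      by case: a => [j|l] /=; rewrite mulrC.
    by rewrite mul0r; case: a => [j|l] /=; rewrite !mul0r ?addr0 !mulr0.
  by apply: spanZ; exact: span_row.
(* The value minus [q 0] times the derivative in [q 0]: on multiples of [q 0] the terms of order
   [s^2] cancel. *)
- apply: (@span_ext _ _ _ _ (fun b => (s ^+ 3)^-1 *
    (\sum_j beta j (pU i).1 * N (rshift A (lshift D i), inl j) b +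
      - (s ^+ 2) * N (rshift A (lshift D i), inr ord0) b))).
    move=> b; rewrite NU (eq_bigr (fun j => beta j (pU i).1 *
      cond ((pU i).1, setq0 (pU i).2 (s ^+ 2)) (inl j) (cm b))); last by move=> j _; rewrite NU.
    have <- : val ((pU i).1, setq0 (pU i).2 (s ^+ 2)) (cm b) = \sum_j beta j (pU i).1 *
      cond ((pU i).1, setq0 (pU i).2 (s ^+ 2)) (inl j) (cm b) := val_cond _ _.
    case: b => b; first by rewrite /Fs /Ff /w /cm /val /= !mulr0 addr0 mulrC.
    set q := setq0 _ _.
    have -> : Fs s (inl (inr i)) (inr b) = - s * (v b.1 (pU i).1 * demon b.2 0 q) by [].
    have -> : val ((pU i).1, q) (cm (inr b)) = v b.1 (pU i).1 * (s ^+ 2 * emon b.2 q) by [].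
    have -> : cond ((pU i).1, q) (inr ord0) (cm (inr b)) =
      v b.1 (pU i).1 * (1 * emon b.2 q + s ^+ 2 * demon b.2 0 q) by [].
    by rewrite /w divr1; move: (demon _ _ _) (emon _ _) => x1 x2; field.
  apply: spanZ; apply: spanD; last by apply: spanZ; exact: span_row.
  by apply: span_sum => j; exact: span_row.
- apply: (@span_ext _ _ _ _ (N (rshift A (rshift U i), a))); last exact: span_row.
  move=> b; rewrite ND; case: b => b; last by rewrite /w divr1.
  by rewrite /Fs /w /cm mulrC mulKf.
- apply: (@span_ext _ _ _ _ (fun b => (s ^+ 2)^-1 * N (rshift A (lshift D i), lift_row a) b)).
    move=> b; rewrite NU; case: b => b; last first.
      have -> : Fs s (inr (inl (inr (i, a)))) (inr b) =
        cond ((pU i).1, setq0 (pU i).2 (s ^+ 2)) (lift_row a) b by [].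
      set q := setq0 _ _; rewrite /w divr1; case: a => [j|l].
        rewrite -[cond _ _ (cm _)]/(J b.1 j (pU i).1 * (s ^+ 2 * emon b.2 q)).
        rewrite -[cond _ _ _]/(J b.1 j (pU i).1 * emon b.2 q).
        by move: (emon _ _) => x1; field.
      rewrite -[cond _ _ (cm _)]/(v b.1 (pU i).1 *
        ((lift ord0 l == 0%N :> nat)%:R * emon b.2 q + s ^+ 2 * demon b.2 (lift ord0 l) q)).
      rewrite -[cond _ _ _]/(v b.1 (pU i).1 * demon b.2 (lift ord0 l) q) mul0r add0r.
      by move: (demon _ _ _) => x1; field.
    have -> : cond ((pU i).1, setq0 (pU i).2 (s ^+ 2)) (lift_row a) (cm (inl b)) =
      cond (shp (pU i)) a b by case: a.
    have -> : Fs s (inr (inl (inr (i, a)))) (inl b) = s * cond (shp (pU i)) a b by [].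
    by rewrite /w; move: (cond _ _ _) => x1; field.
  by apply: spanZ; exact: span_row.
apply: (@span_ext _ _ _ _ (N (lshift (U + D) i, inr ord0))); last exact: span_row.
move=> b; rewrite NA; case: b => b; first by rewrite /Fs /w /cm /= mul0r mulr0.
have -> : cond (hq true (pA i)) (inr ord0) (cm (inr b)) = v b.1 (pA i).1 *
  ((0%N == 0%N)%:R * emon b.2 (cut (pA i).2) + 0 * demon b.2 0 (cut (pA i).2)) by [].
by rewrite /w mul1r mul0r addr0 divr1.
Qed.
End Step.

End Horace.

(** * Induction on the degree *)

Lemma frank_diag (K : closedFieldType) (A B A' B' : finType) n (F : A -> B -> K)
  (e : 'I_n -> A' -> A) (c : 'I_n -> B' -> B) (G : 'I_n -> A' -> B' -> K) k :
  (forall j j' a b, F (e j a) (c j' b) = if j == j' then G j a b else 0) ->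
  (forall j, (k <= frank (G j))%N) -> (n * k <= frank F)%N.
Proof.
elim: n A B F e c G => [|n IH] A B F e c G HF Hk //.
pose e2 (p : 'I_n * A') := e (lift ord0 p.1) p.2.
pose c2 (p : 'I_n * B') := c (lift ord0 p.1) p.2.
have := @frank_block _ _ _ _ _ _ _ F (e ord0) e2 (c ord0) c2.
move=> /(_ (fun a b => HF ord0 (lift ord0 b.1) a b.2)); apply: leq_trans.
rewrite mulSn; apply: leq_add.
  apply: leq_trans (Hk ord0) _; apply: eq_leq; apply: eq_frank => a b.
  by rewrite HF eqxx.
apply: (IH _ _ (fun a b => F (e2 a) (c2 b)) (fun j a => (j, a)) (fun j b => (j, b))
  (fun j => G (lift ord0 j))) => // j j' a b.
by rewrite /e2 /c2 /= HF (inj_eq lift_inj).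
Qed.

Section Degree1.
Variable K : closedFieldType.

Definition bvec (i : nat) (l : nat) : K := (l == i)%:R.

Fixpoint mono1 m : 'I_m.+1 -> Mon m 1 :=
  match m return 'I_m.+1 -> Mon m 1 with
  | 0 => fun=> tt
  | m'.+1 => fun j => if unlift ord0 j is Some j' then inl (mono1 j') else inr tt
  end.

Lemma emon_mono1 m (j : 'I_m.+1) q : emon (mono1 j) q = q j :> K.
Proof.
elim: m j q => [|m IH] j q; first by rewrite /= expr1 (ord1 j).
by rewrite /=; case: unliftP => [j' ->|->] /=; rewrite ?IH ?mulr1.
Qed.

Lemma demon_mono1 m (j : 'I_m.+1) i q : demon (mono1 j) i q = (i == j)%:R :> K.
Proof.
elim: m j i q => [|m IH] j i q; first by rewrite (ord1 j); case: i => //=; rewrite expr0 mulr1.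
rewrite /=; case: unliftP => [j' ->|->] /=; last by rewrite mulr1 mulr0 addr0.
by case: i => [|i] //; rewrite IH.
Qed.

End Degree1.

Section Simplex.
Variable K : closedFieldType.
Hypothesis charK : [pchar K] =i pred0.
Variables (T : Type) (reg : (T -> K) -> Prop) (regP : fclass reg) (y0 : T).
Variables (alpha R : nat) (J : 'I_alpha -> 'I_R -> T -> K) (v : 'I_alpha -> T -> K).
Hypothesis regJ : forall k j, reg (J k j).
Hypothesis regv : forall k, reg (v k).
Hypothesis v_free : forall x : 'I_alpha -> K, (exists k, x k != 0) ->
  exists y, \sum_k x k * v k y != 0.
Hypothesis J_rank : forall z, exists y : 'I_z -> T,
  (minn (z * R) alpha <= frank (fun (a : 'I_z * 'I_R) k => J k a.2 (y a.1)))%N.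

Lemma bigp_family (B : finType) (pt : B -> T * (nat -> K)) m t z u rho (e : 'I_z -> B) (e' : B -> 'I_z) :
  cancel e' e -> (forall i : 'I_z, (i < u)%N -> (pt (e i)).2 0%N = 0) ->
  (rho <= frank (fun (a : B * ('I_R + 'I_m.+1)) (b : 'I_alpha * Mon m t) => cond J v (pt a.1) a.2 b))%N ->
  bigp J v m t z u rho.
Proof.
move=> ee pt0 H; exists (fun i => pt (e i)); apply: leq_trans H _.
pose f (a : B * ('I_R + 'I_m.+1)) := (e' a.1, a.2).
rewrite (eq_frank (F' := fun a b => cond J v (hq ((f a).1 < u)%N (pt (e (f a).1))) (f a).2 b)).
  exact: (frank_sub (fun (a : 'I_z * ('I_R + 'I_m.+1)) b =>
    cond J v (hq (a.1 < u)%N (pt (e a.1))) a.2 b) f id).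
move=> [b a] b'; rewrite /f /= ee; congr (cond J v _ _ _); rewrite /hq; case: ifP => h; last by case: (pt b).
have := pt0 _ h; rewrite ee; case: (pt b) => p q /= q0; congr (_, _).
by apply: functional_extensionality => -[].
Qed.

(* Points over the vertices [q = e_i]: the conditions split into one block for each variable,
   with the double points over that vertex and the values at the others. *)
Lemma simplex m kappa : bigp J v m 1 (m.+1 * kappa) (m * kappa)
  (m.+1 * minn (kappa * (R + m)) alpha).
Proof.
have [->|k0] := posnP kappa; first by exists (fun=> (y0, fun=> 0)); rewrite mul0n min0n muln0.
pose B := ('I_m.+1 * 'I_kappa)%type.
pose G (y : B -> T) (j : 'I_m.+1) : ('I_kappa * 'I_R) + B -> 'I_alpha -> K :=
  addrows (fun a k => J k a.2 (y (j, a.1))) (fun b k => v k (y b)).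
have gen j : generic (powc (I := B) reg) (fun y => (minn (kappa * (R + m)) alpha <= frank (G y j))%N).
  have pcx (f : T -> K) b : reg f -> powc (I := B) reg (fun y => f (y b)).
    by move=> Hf p i; rewrite /setf; case: eqP => _; [exact: Hf | exact: (fc_cst regP)].
  apply: (generic_rank (fclass_pow (B : finType) regP)).
    by move=> [a|b] k; [apply: (pcx (J k a.2)) | apply: (pcx (v k))].
  have [y Hy] := J_rank kappa.
  have [|q Hq] := @add_values _ _ _ (fun (a : 'I_kappa * 'I_R) k => J k a.2 (y a.1)) T
    (fun p k => v k p) y0 #|{: 'I_m * 'I_kappa}|.
    move=> x _ xb; have [p Hp] := v_free xb; exists p; move: Hp; congr (_ != 0).
    by apply: eq_bigr => k _; rewrite mulrC.
  exists (fun b => if unlift j b.1 is Some i then q (enum_rank (i, b.2)) else y b.2).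
  set Y := fun b : B => _.
  have le1 : (minn (kappa * (R + m)) alpha <=
     minn (frank (fun (a : 'I_kappa * 'I_R) k => J k a.2 (y a.1)) + #|{: 'I_m * 'I_kappa}|) #|'I_alpha|)%N.
    rewrite card_prod !card_ord; move: Hy; rewrite mulnDr [(m * kappa)%N]mulnC; lia.
  apply: leq_trans le1 _; apply: leq_trans Hq _.
  pose f (a : ('I_kappa * 'I_R) + 'I_#|{: 'I_m * 'I_kappa}|) : ('I_kappa * 'I_R) + B :=
    match a with inl a => inl a | inr i => let p := enum_val i in inr (lift j p.1, p.2) end.
  rewrite (eq_frank (F' := fun a k => G Y j (f a) k)); first exact: (frank_sub (G Y j) f id).
  move=> [a|i] k; rewrite /G /f /= /Y /=; first by rewrite unlift_none.
  by rewrite liftK -surjective_pairing enum_valK.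
have [y Hy] : exists y, forall j, (minn (kappa * (R + m)) alpha <= frank (G y j))%N.
  have H (s : seq 'I_m.+1) : generic (powc (I := B) reg)
      (fun y => forall j, j \in s -> (minn (kappa * (R + m)) alpha <= frank (G y j))%N).
    elim: s => [|j s IH].
      exists (fun=> 1); split=> //; first exact: (fc_cst (fclass_pow (B : finType) regP)).
      by exists (fun=> y0); exact: oner_neq0.
    apply: generic_imp (generic_and (fclass_pow (B : finType) regP) (gen j) IH) => y [h1 h2] i.
    by rewrite inE => /orP [/eqP ->|/h2].
  by have [y Hy] := generic_ex (H (enum 'I_m.+1)); exists y => j; apply: Hy; rewrite mem_enum.
pose pt (b : B) : T * (nat -> K) := (y b, @bvec K b.1).
have mk i : (m - i %/ kappa < m.+1)%N by rewrite ltnS leq_subr.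
(* The vertices are listed backwards, so that the first [m * kappa] points lie over vertices other
   than the one with [q 0 = 1], hence on the hyperplane. *)
pose e (i : 'I_(m.+1 * kappa)) : B := (Ordinal (mk i), Ordinal (ltn_pmod i k0)).
have he (b : B) : ((m - b.1) * kappa + b.2 < m.+1 * kappa)%N.
  by case: b => -[i /= im] [l /= lk]; nia.
apply: (@bigp_family _ pt m 1 _ _ _ e (fun b => Ordinal (he b))).
- move=> [[i im] [l lk]]; congr (_, _); apply: val_inj => /=.
    by rewrite divnMDl // divn_small // addn0 subKn.
  by rewrite modnMDl modn_small.
- move=> i iu; rewrite /pt /= /bvec; have : (i %/ kappa < m)%N by rewrite ltn_divLR.
  by rewrite -subn_gt0; case: (m - _)%N.
pose er (j : 'I_m.+1) (a : ('I_kappa * 'I_R) + B) : B * ('I_R + 'I_m.+1) :=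
  match a with inl a => ((j, a.1), inl a.2) | inr b => (b, inr j) end.
apply: (frank_diag (e := er) (c := fun j k => (k, mono1 j)) (G := G y)) => // j j' a k.
case: a => [a|b]; rewrite /cond /er /= ?emon_mono1 ?demon_mono1 /bvec -?val_eqE /=.
  by rewrite eq_sym; case: eqP => _; rewrite ?mulr1 ?mulr0.
by case: eqP => _; rewrite ?mulr1 ?mulr0.
Qed.

Lemma bigp_degree0 m D : (alpha <= D * R)%N -> bigp J v m.+1 0 D 0 alpha.
Proof.
move=> le; have [y Hy] := J_rank D; exists (fun i => (y i, fun=> 0)).
rewrite (minn_idPr le) in Hy; apply: leq_trans Hy _.
pose f (a : 'I_D * 'I_R) : 'I_D * ('I_R + 'I_m.+2) := (a.1, inl a.2).
pose F (a : 'I_D * ('I_R + 'I_m.+2)) (b : 'I_alpha * Mon m.+1 0) : K :=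
  cond J v (hq (a.1 < 0)%N (y a.1, fun=> 0)) a.2 b.
rewrite (eq_frank (F' := fun a k => F (f a) (k, tt))); first exact: (frank_sub F f (fun k => (k, tt))).
by move=> a k; rewrite /F /f /cond /= mulr1.
Qed.

Lemma bigp_dim0 t A : (A * R <= alpha)%N -> bigp J v 0 t A 0 (A * (R + 0)).
Proof.
move=> le; have [y Hy] := J_rank A; exists (fun i => (y i, fun=> 1)).
rewrite (minn_idPl le) in Hy; rewrite addn0; apply: leq_trans Hy _.
pose f (a : 'I_A * 'I_R) : 'I_A * ('I_R + 'I_1) := (a.1, inl a.2).
pose F (a : 'I_A * ('I_R + 'I_1)) (b : 'I_alpha * Mon 0 t) : K :=
  cond J v (hq (a.1 < 0)%N (y a.1, fun=> 1)) a.2 b.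
rewrite (eq_frank (F' := fun a k => F (f a) (k, tt))); first exact: (frank_sub F f (fun k => (k, tt))).
by move=> a k; rewrite /F /f /cond /= expr1n mulr1.
Qed.
End Simplex.

(** * Inequalities between the numbers of points *)

Section Numerics.
(** Here [n] stands for [R - 3] and [a] for [alpha]. The shift removes truncated subtractions and
    leaves polynomials in [n] with nonnegative coefficients. *)
Variables n a : nat.
Hypothesis a_ge : (3 * ((n + 3) * (n + 4)) <= a)%N.

Lemma div_lower d A U q w : (A * d.+1 + U = q)%N -> (U < d.+1)%N -> (w * d.+1 <= q)%N -> (w <= A)%N.
Proof.
move=> E LU Lq; rewrite -ltnS -(ltn_pmul2r (ltn0Sn d)) mulSn; lia.
Qed.

(** Case of P^1 in degree 2. The first inequality keeps [U + D] within the number of points that are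
    independent in degree 1, the second makes [D] large enough to exhaust degree 0; the other three
    lemmas have the same shape. *)
Lemma numerics1_deg2 k e A U C : (a = k * (n + 4) + e)%N -> (e < n + 4)%N ->
  (A * (n + 3) + U = a)%N -> (U < n + 3)%N -> (C * (n + 3) <= a + (n + 2))%N ->
  (U + a * 2 <= A + 2 * k * (n + 4))%N /\ (A + U * (n + 3) + C * (n + 4) <= a * 2)%N.
Proof.
move=> E0 L0 AU UR HC; have k3 : (3 * (n + 3) <= k)%N.
  by apply: (@div_lower (n + 3) k e a); [lia | lia | nia].
split.
  have A3 : (k + 3 <= A)%N by apply: (@div_lower (n + 2) A U a); [lia | lia | nia].
  have {A3} [w wE] : exists w, A = (k + 3 + w)%N by exists (A - (k + 3))%N; lia.
  subst A; nia.
rewrite -(leq_pmul2r (m := n + 3)) ?addn3 // -addn3.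
have h1 : (U * ((n + 3) * (n + 3)) <= (n + 2) * ((n + 3) * (n + 3)))%N.
  by rewrite leq_mul2r; apply/orP; right; lia.
have h2 : (3 * ((n + 3) * (n + 4)) * (n + 1) <= a * (n + 1))%N by rewrite leq_mul2r a_ge orbT.
have h3 : (C * (n + 3) * (n + 4) <= (a + (n + 2)) * (n + 4))%N by rewrite leq_mul2r HC orbT.
nia.
Qed.

(** The slack [2 * (n + 3)] allowed for [C] is the rounding at the two vertices of P^1, the worst
    case, which occurs when [q'] belongs to degree 1. In [numerics2] there are three vertices and
    the slack is [3 * (n + 4)]. *)
Lemma numerics1 q q' e A U B C : (A * (n + 3) + U = a)%N -> (U < n + 3)%N ->
  (q = B * (n + 4) + e)%N -> (e < n + 4)%N -> (C * (n + 4) <= q' + 2 * (n + 3))%N -> (q' + a = q)%N ->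
  (U + q <= A + B * (n + 4))%N /\ (A + U * (n + 3) + C * (n + 4) <= q)%N.
Proof.
move=> AU UR E0 L0 HC qE; split.
  have : (2 * n + 6 <= A)%N by apply: (@div_lower (n + 2) A U a); [lia | lia | nia].
  lia.
suff : (A + U * (n + 3) + 2 * (n + 3) <= a)%N by lia.
rewrite -(leq_pmul2r (m := n + 3)) ?addn3 // -addn3.
have h1 : (U * ((n + 3) * (n + 3)) <= (n + 2) * ((n + 3) * (n + 3)))%N.
  by rewrite leq_mul2r; apply/orP; right; lia.
have h2 : (3 * ((n + 3) * (n + 4)) * (n + 2) <= a * (n + 2))%N by rewrite leq_mul2r a_ge orbT.
nia.
Qed.

Lemma numerics2_deg2 k e A U C : (60 <= a)%N -> (a = k * (n + 5) + e)%N -> (e < n + 5)%N ->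
  (A * (n + 4) + U = a * 3)%N -> (U < n + 4)%N -> (C * (n + 3) <= a + (n + 2))%N ->
  (U + a * 3 <= A + 3 * k * (n + 5))%N /\ (A + U * (n + 4) + C * (n + 5) <= a * 3)%N.
Proof.
(* This amounts to [(2 * n + 8) * (n + 5) <= a]. It follows from [a_ge] for positive [n], whereas
   for [n = 0] it reads [40 <= a], beyond the 36 given by [a_ge]. *)
move=> a60 E0 L0 AU UR HC; have k3 : (2 * n + 8 <= k)%N.
  by apply: (@div_lower (n + 4) k e a); [lia | lia | case: (posnP n) => [n0|n0]; [subst n; lia | nia]].
split.
  have A3 : (3 * k + 6 <= A)%N by apply: (@div_lower (n + 3) A U (a * 3)); [lia | lia | nia].
  have {A3} [w wE] : exists w, A = (3 * k + 6 + w)%N by exists (A - (3 * k + 6))%N; lia.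
  subst A; nia.
have p0 : (0 < (n + 3) * (n + 4))%N by rewrite muln_gt0 !addn_gt0 !orbT.
rewrite -(leq_pmul2r p0).
have h1 : (U * ((n + 3) * (n + 4) * (n + 4)) <= (n + 3) * ((n + 3) * (n + 4) * (n + 4)))%N.
  by rewrite leq_mul2r; apply/orP; right; lia.
have h2 : (3 * ((n + 3) * (n + 4)) * ((2 * n + 7) * (n + 1)) <= a * ((2 * n + 7) * (n + 1)))%N.
  by rewrite leq_mul2r a_ge orbT.
have h3 : (C * (n + 3) * ((n + 4) * (n + 5)) <= (a + (n + 2)) * ((n + 4) * (n + 5)))%N.
  by rewrite leq_mul2r HC orbT.
have h4 : (A * (n + 4) * (n + 3) <= a * 3 * (n + 3))%N by rewrite leq_mul2r -AU leq_addr orbT.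
nia.
Qed.

Lemma numerics2 t q q' e A U B C : (A * (n + 4) + U = a * t.+4)%N -> (U < n + 4)%N ->
  (q = B * (n + 5) + e)%N -> (e < n + 5)%N -> (C * (n + 5) <= q' + 3 * (n + 4))%N -> (q' + a * t.+3 = q)%N ->
  (U + q <= A + B * (n + 5))%N /\ (A + U * (n + 4) + C * (n + 5) <= q)%N.
Proof.
move=> AU UR E0 L0 HC qE; split.
  have : (2 * n + 8 <= A)%N by apply: (@div_lower (n + 3) A U (a * t.+4)); [lia | lia | nia].
  lia.
suff : (A + U * (n + 4) + 3 * (n + 4) <= a * t.+3)%N by lia.
rewrite -(leq_pmul2r (m := n + 4)) ?addn4 // -addn4.
have h1 : (U * ((n + 4) * (n + 4)) <= (n + 3) * ((n + 4) * (n + 4)))%N.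
  by rewrite leq_mul2r; apply/orP; right; lia.
have h2 : (3 * ((n + 3) * (n + 4)) * (3 * n + 8) <= a * (3 * n + 8))%N by rewrite leq_mul2r a_ge orbT.
have h3 : (0 <= a * t * (n + 3))%N by [].
nia.
Qed.
End Numerics.

(** * Maximal rank over P^1 and P^2 in degree at least 2 *)

Section SegreVeronese.
Variable K : closedFieldType.
Hypothesis charK : [pchar K] =i pred0.
Variables (T : Type) (reg : (T -> K) -> Prop) (regP : fclass reg) (y0 : T).
Variables (alpha R : nat) (J : 'I_alpha -> 'I_R -> T -> K) (v : 'I_alpha -> T -> K).
Variable (beta : 'I_R -> T -> K).
Hypothesis regJ : forall k j, reg (J k j).
Hypothesis regv : forall k, reg (v k).
Hypothesis vJ : forall k y, v k y = \sum_j beta j y * J k j y.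
Hypothesis v_free : forall x : 'I_alpha -> K, (exists k, x k != 0) ->
  exists y, \sum_k x k * v k y != 0.
Hypothesis J_rank : forall z, exists y : 'I_z -> T,
  (minn (z * R) alpha <= frank (fun (a : 'I_z * 'I_R) k => J k a.2 (y a.1)))%N.
Hypothesis R3 : (3 <= R)%N.
Hypothesis alpha60 : (60 <= alpha)%N.
Hypothesis alphaR : (3 * (R * R.+1) <= alpha)%N.

Let R0 : (0 < R)%N. Proof. by apply: leq_trans R3. Qed.

Definition expected m t := forall z, bigp J v m t z (alpha %/ (R + m)) (minn (z * (R + m)) (alpha * #|Mon m t|)).

(** Only the two numbers of points around exhaustion matter: fewer points are covered by
    independence at the lower one, more points by exhaustion at the upper one. *)
Lemma expectedI m t (q := (alpha * #|Mon m t.+1|)%N) :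
  (forall z, (q < z.+1 * (R + m))%N -> (z * (R + m) < q + (R + m))%N ->
     bigp J v m t.+1 z (alpha %/ (R + m)) (minn (z * (R + m)) q)) -> expected m t.+1.
Proof.
move=> H z; set c := (R + m)%N in H *; have c0 : (0 < c)%N by rewrite addn_gt0 R0.
have E := divn_eq q c; have L := ltn_pmod q c0.
move: E L; set d := (q %/ c)%N; set e := (q %% c)%N; move: d e => d e E L.
have [le|lt] := leqP z d.
  have Hq : bigp J v m t.+1 d (alpha %/ c)%N (d * c)%N.
    have h1 : (q < d.+1 * c)%N by rewrite mulSn; lia.
    have h2 : (d * c < q + c)%N by lia.
    by apply: bigp_le (H d h1 h2); lia.
  apply: bigp_le (bigp_sub charK y0 vJ R0 le (leqnn _) Hq).
  exact: geq_minl.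
have [d0|d1] := posnP e.
  have Hq : bigp J v m t.+1 d (alpha %/ c)%N (minn (d * c) q) by apply: H; rewrite ?mulSn; lia.
  apply: bigp_le (bigp_sup y0 (ltnW lt) (leqnn _) Hq).
  by rewrite -/q; lia.
have Hq : bigp J v m t.+1 d.+1 (alpha %/ c)%N (minn (d.+1 * c) q) by apply: H; rewrite !mulSn; lia.
apply: bigp_le (bigp_sup y0 lt (leqnn _) Hq).
by rewrite -/q mulSn; lia.
Qed.

(** The hyperplane receives as many points as its own system allows, [U] being the remainder. The
    last hypothesis yields [z <= A + B] and [A + U + C <= z], so the number [D = z - A - U] of free
    points satisfies [U + D <= B] and [C <= D], as [horace] requires. *)
Lemma expected_step m t A B C (c := (R + m.+1)%N) :
  A = (alpha * #|Mon m t.+2| %/ (R + m))%N ->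
  bigp J v m t.+2 A 0 (A * (R + m)) ->
  bigp J v m.+1 t.+1 B (alpha %/ c) (B * c) ->
  bigp J v m.+1 t C 0 (alpha * #|Mon m.+1 t|) ->
  (alpha %/ c <= A)%N -> (R + m <= (alpha %/ c).+1)%N ->
  (forall U, (A * (R + m) + U = alpha * #|Mon m t.+2|)%N -> (U < R + m)%N ->
     (U + alpha * #|Mon m.+1 t.+1| <= A + B * c)%N /\
     (A + U * (R + m) + C * c <= alpha * #|Mon m.+1 t.+1|)%N) -> expected m.+1 t.+2.
Proof.
move=> AE Ha Hb Hc uA uc cond; apply: expectedI => z z1 z2.
set q := (alpha * #|Mon m t.+2|)%N in AE *.
have c0 : (0 < R + m)%N by rewrite addn_gt0 R0.
have E : (alpha * #|Mon m.+1 t.+2| = q + alpha * #|Mon m.+1 t.+1|)%N.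
  by rewrite /q -mulnDr; congr (alpha * _)%N; rewrite [Mon m.+1 t.+2]/= card_sum.
set W := (alpha * #|Mon m.+1 t.+1|)%N in E cond *.
have [] := cond (q %% (R + m))%N; rewrite ?AE -?divn_eq ?ltn_pmod // -AE.
set U := (q %% (R + m))%N => zA Cz.
have qE : q = (A * (R + m) + U)%N by rewrite AE -divn_eq.
have Uc : (U < R + m)%N by rewrite ltn_pmod.
rewrite E in z1 z2 *.
have [le1 le2] : (z <= A + B)%N /\ (A + U + C <= z)%N.
  move: z1 z2 zA Cz; rewrite qE /c !addnS; set P := (R + m)%N; clearbody W U P => z1 z2 zA Cz.
  by split; rewrite -ltnS -(ltn_pmul2r (ltn0Sn P)); nia.
pose D := (z - A - U)%N; have zE : (A + (U + D) = z)%N by rewrite /D; lia.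
rewrite -zE; have UD : (U + D <= B)%N by lia.
have H1 := bigp_sub charK y0 vJ R0 UD (_ : U <= alpha %/ c)%N Hb.
have H2 : bigp J v m.+1 t D 0 (alpha * #|Mon m.+1 t|).
  by apply: (bigp_sup y0) Hc => //; lia.
have := @horace _ _ _ regP y0 _ _ _ _ _ regJ regv vJ v_free m t A U D _ uA Ha _ (H1 _) H2.
rewrite -/q qE leqnn => /(_ isT) H; apply: bigp_le (H _); last by lia.
rewrite !addnS !mulnS !mulnDl -/W; lia.
Qed.

Lemma card_Mon1 t : #|Mon 1 t| = t.+1.
Proof. by rewrite card_Mon bin1 addn1. Qed.

Lemma card_Mon2 t : (2 * #|Mon 2 t| = t.+1 * t.+2)%N.
Proof. by rewrite card_Mon addn2 -mul_bin_diag /= bin1 mulnC. Qed.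

Lemma card_Mon0 t : #|Mon 0 t| = 1%N.
Proof. by rewrite card_Mon bin0. Qed.

Lemma ceil_le a b : (0 < b)%N -> (a <= (a + b.-1) %/ b * b <= a + b.-1)%N.
Proof.
move=> b0; rewrite leq_trunc_div andbT.
have := divn_eq (a + b.-1) b; have := ltn_pmod (a + b.-1) b0; lia.
Qed.

Let c1 : (0 < R + 1)%N. Proof. lia. Qed.
Let c2 : (0 < R + 2)%N. Proof. lia. Qed.

(** In degree 1 only two numbers of points are used: rounding down at every vertex gives
    independence here, rounding up gives exhaustion in [simplex_high]. *)
Lemma simplex_low m : bigp J v m 1 (m.+1 * (alpha %/ (R + m))) (m * (alpha %/ (R + m)))
  (m.+1 * (alpha %/ (R + m)) * (R + m)).
Proof.
apply: bigp_le (simplex regP y0 regJ regv v_free J_rank m _).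
by rewrite -mulnA leq_mul2l leq_min leqnn leq_trunc_div.
Qed.

Lemma simplex_high m k : (alpha <= k * (R + m))%N -> bigp J v m 1 (m.+1 * k) 0 (alpha * #|Mon m 1|).
Proof.
move=> le; have := simplex regP y0 regJ regv v_free J_rank m k.
rewrite (minn_idPr le) card_Mon add1n binSn [(alpha * _)%N]mulnC.
exact: (bigp_sup y0 (leqnn _) (leq0n _)).
Qed.

Lemma expected_low m t (q := (alpha * #|Mon m t|)%N) : (0 < R + m)%N -> expected m t ->
  bigp J v m t (q %/ (R + m)) (alpha %/ (R + m)) (q %/ (R + m) * (R + m)).
Proof.
move=> c0 H; apply: bigp_le (H _); rewrite leq_min leqnn; exact: leq_trunc_div.
Qed.

Lemma expected_high m t (q := (alpha * #|Mon m t|)%N) : (0 < R + m)%N -> expected m t ->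
  bigp J v m t ((q + (R + m).-1) %/ (R + m)) 0 q.
Proof.
move=> c0 H; apply: (bigp_sup y0 (leqnn _) (leq0n _) (bigp_le _ (H ((q + (R + m).-1) %/ (R + m))%N))).
by rewrite leq_min leqnn andbT; have /andP [] := ceil_le q c0.
Qed.

(* The number of points used for the system of degree [t.+1], and for that of degree [t]. *)
Definition Bnum m t := (if t is 0 then m.+1 * (alpha %/ (R + m))
  else (alpha * #|Mon m t.+1|) %/ (R + m))%N.
Definition Cnum m t := (match t with
  | 0 => (alpha + R.-1) %/ R
  | 1 => m.+1 * ((alpha + (R + m).-1) %/ (R + m))
  | _ => (alpha * #|Mon m t| + (R + m).-1) %/ (R + m) end)%N.

Lemma Bnum_bigp m t : (forall s, (s < t)%N -> expected m.+1 s.+2) ->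
  bigp J v m.+1 t.+1 (Bnum m.+1 t) (alpha %/ (R + m.+1)) (Bnum m.+1 t * (R + m.+1)).
Proof.
case: t => [|t] H.
  by apply: (bigp_sup y0 _ _ (simplex_low m.+1)) => //; exact: leq_pmull.
by apply: expected_low; [rewrite addnS | exact: H].
Qed.

Lemma Cnum_bigp m t : (forall s, (s < t)%N -> expected m.+1 s.+2) ->
  bigp J v m.+1 t (Cnum m.+1 t) 0 (alpha * #|Mon m.+1 t|).
Proof.
have c0 : (0 < R + m.+1)%N by rewrite addnS.
case: t => [|[|t]] H.
- rewrite [Mon _ _]/= card_unit muln1; apply: (bigp_degree0 v J_rank).
  by have /andP [] := ceil_le alpha R0.
- by apply: simplex_high; have /andP [] := ceil_le alpha c0.
by apply: expected_high => //; apply: H.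
Qed.

Let n := (R - 3)%N.
Let n2 : (n + 2 = R.-1)%N. Proof. by rewrite /n; lia. Qed.
Let n3 : (n + 3 = R)%N. Proof. by rewrite /n; lia. Qed.
Let n4 : (n + 4 = R + 1)%N. Proof. by rewrite /n; lia. Qed.
Let n5 : (n + 5 = R + 2)%N. Proof. by rewrite /n; lia. Qed.
Let a_ge : (3 * ((n + 3) * (n + 4)) <= alpha)%N. Proof. by rewrite n3 n4 addn1. Qed.

(** Strong induction, as a step refers to the two preceding degrees. For degrees 0 and 1 [Bnum] and
    [Cnum] take their values from the vertices or from [Y] itself. *)
Lemma expected1 t : expected 1 t.+2.
Proof.
elim/ltn_ind: t => t IH.
have E0 := divn_eq alpha (R + 1); have L0 := ltn_pmod alpha c1.
set A := (alpha %/ (R + 0))%N.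
apply: (@expected_step 0 t A (Bnum 1 t) (Cnum 1 t)).
- by rewrite card_Mon0 muln1.
- by apply: (bigp_dim0 v J_rank); rewrite /A addn0 leq_trunc_div.
- exact: Bnum_bigp.
- exact: Cnum_bigp.
- by rewrite /A addn0; apply: leq_div2l => //; rewrite leq_addr.
- rewrite addn0; apply: leq_trans (leqnSn _); rewrite leq_divRL //.
  by apply: leq_trans alphaR; rewrite addn1 leq_pmull.
rewrite !addn0 card_Mon0 muln1 card_Mon1 => U AU UR.
case: t {IH} => [|t].
  have := @numerics1_deg2 n alpha a_ge _ _ A U ((alpha + R.-1) %/ R)%N.
  rewrite n2 n3 n4 => /(_ _ _ E0 L0 AU UR); apply.
  by have /andP [] := ceil_le alpha R0.
have := @numerics1 n alpha a_ge (alpha * t.+3)%N (alpha * t.+2)%N _ A U _ (Cnum 1 t.+1).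
rewrite n3 n4 => /(_ _ _ AU UR (divn_eq _ _) (ltn_pmod _ c1)) H; rewrite /Bnum card_Mon1.
apply: H; last by rewrite [in RHS]mulnS addnC.
rewrite /Cnum; case: t => [|t].
  have /andP [_] := ceil_le alpha c1; rewrite addn1 /=; move: (_ %/ _)%N => w; lia.
rewrite card_Mon1; have /andP [_] := ceil_le (alpha * t.+3)%N c1; rewrite addn1 /=.
by move: (_ %/ _)%N => w; lia.
Qed.

Lemma expected2 t : expected 2 t.+2.
Proof.
elim/ltn_ind: t => t IH.
have E0 := divn_eq alpha (R + 2); have L0 := ltn_pmod alpha c2.
set q := (alpha * #|Mon 1 t.+2|)%N.
set A := (q %/ (R + 1))%N.
apply: (@expected_step 1 t A (Bnum 2 t) (Cnum 2 t)) => //.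
- exact: (bigp_sup y0 (leqnn _) (leq0n _) (expected_low c1 (expected1 t))).
- exact: Bnum_bigp.
- exact: Cnum_bigp.
- rewrite /A leq_divRL //; apply: leq_trans (_ : alpha %/ (R + 2) * (R + 2) <= _)%N.
    by rewrite leq_mul2l; apply/orP; right; lia.
  by apply: leq_trans (leq_trunc_div _ _) _; rewrite /q card_Mon1; apply: leq_pmulr.
- rewrite addn1 ltnS leq_divRL //; apply: leq_trans alphaR; clear; nia.
rewrite card_Mon1 => U; rewrite /A /q card_Mon1; move: (_ %/ _)%N => {q}A AU UR.
case: t {IH} => [|t] in A AU *.
  have N1 := card_Mon2 1; have -> : #|Mon 2 1| = 3 by lia.
  have := @numerics2_deg2 n alpha a_ge _ _ A U ((alpha + R.-1) %/ R)%N alpha60.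
  rewrite n2 n3 n4 n5 => /(_ _ _ E0 L0 AU UR); apply.
  by have /andP [] := ceil_le alpha R0.
have N1 := card_Mon2 t.+2; set N := #|Mon 2 t.+2| in N1 *.
have N2 := card_Mon2 t.+1; set N' := #|Mon 2 t.+1| in N2 *.
have := @numerics2 n alpha a_ge t (alpha * N)%N (alpha * N')%N _ A U _ (Cnum 2 t.+1).
rewrite n4 n5 => /(_ _ _ AU UR (divn_eq _ _) (ltn_pmod _ c2)) H; rewrite /Bnum -/N.
apply: H; last first.
  by rewrite -mulnDr; congr (_ * _)%N; clear - N1 N2; lia.
rewrite /Cnum; case: t => [|t] in A AU N N' N1 N2 *.
  have -> : N' = 3 by clear - N2; lia.
  have /andP [_] := ceil_le alpha c2; rewrite addn2 /=; move: (_ %/ _)%N => w; lia.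
have /andP [_] := ceil_le (alpha * N')%N c2; rewrite addn2 /=.
by move: (_ %/ _)%N => w; lia.
Qed.

End SegreVeronese.

(** * Affine acyclicity *)

Lemma frac_id (K : fieldType) (x y z x' g' G' c' : K) : x != 0 -> y != 0 -> z != 0 ->
  c' * (G' * x') / (y * z) * z + g' * (c' * (x * x')) = c' * (x * x') * (G' / (x * y) + g').
Proof. by move=> x0 y0 z0; field; rewrite ?x0 ?y0 ?z0. Qed.

Section Affine.
Variables (K : closedFieldType) (I J : finType) (c : I -> J).
Variables (X : vec K I -> Prop) (HX : zclosed c X).
Implicit Types (U : vec K I -> Prop) (f g h : vec K I -> K) (v : vec K I) (d : J -> int).

Lemma polyf_mpoly f : polyf f -> {P : {mpoly K[#|I|]} | forall v, f v = peval P v}.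
Proof. exact: constructive_indefinite_description. Qed.

Lemma monomial_eval (e : J -> nat) (l : J -> K) :
  ('X_[[multinom e (enum_val k) | k < #|J|]] : {mpoly K[#|J|]}).@[fun k => l (enum_val k)] =
  \prod_j l j ^+ e j.
Proof.
rewrite mevalXU_prod || rewrite mevalX.
rewrite (reindex (@enum_val J predT)) /=; last by apply: onW_bij; exact: enum_val_bij.
by apply: eq_bigr => k _; rewrite mnmE.
Qed.

Section Standard.
Variables (F : vec K I -> K) (a : J -> nat).
Hypotheses (fF : form c a F) (a0 : forall j, (0 < a j)%N) (Fp : forall v, F v != 0 -> is_point c v).

Section Partition.
Variables (Idx : Type) (b : Idx -> J -> nat) (H : Idx -> vec K I -> K).
Hypotheses (fH : forall s, form c (b s) (H s)).
Hypothesis cover : forall v, X v -> F v != 0 -> exists s, H s v != 0.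

(** [F] vanishes wherever the ideal of [X] and all [H s] do, so by the Nullstellensatz a power of it
    is a combination of them. The index [None] stands for generators in the ideal of [X]. *)
Lemma partition_poly : exists k n (s : 'I_n -> option Idx) (P : 'I_n -> {mpoly K[#|I|]}),
  forall v, X v -> F v ^+ k = \sum_i peval (P i) v * oapp (H^~ v) 0 (s i).
Proof.
have [QF QFE] := polyf_mring fF.1.
pose S (Q : mring K #|I|) := (exists s, forall v, H s v = ev (vn v) #|I| Q) \/
  (forall v, X v -> ev (vn v) #|I| Q = 0).
have [w HS|k [n [e [s [Ss sE]]]]] := @nullstellensatz K #|I| S QF.
  pose v : vec K I := [ffun i => w (enum_rank i)].
  have vw Q : ev (vn v) #|I| Q = ev w #|I| Q.
    apply: evm_ext => i iI; rewrite -[i]/(nat_of_ord (Ordinal iI)) vn_enum ffunE.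
    by rewrite enum_valK.
  apply/eqP/negPn/negP => Fw; have Fv : F v != 0 by rewrite QFE vw.
  have Xv : X v.
    apply/(zclosedE HX); split; first exact: Fp.
    move=> a' f [/polyf_mring [Q QE] _] fX; rewrite QE vw; apply: HS; right=> u Xu.
    by rewrite -QE fX.
  have [i /eqP] := cover Xv Fv; have [Q QE] := polyf_mring (fH i).1; case.
  by rewrite QE vw; apply: HS; left; exists i.
have ex i : exists (o : option Idx) (P : {mpoly K[#|I|]}),
    forall v, X v -> ev (vn v) #|I| (e i * s i) = peval P v * oapp (H^~ v) 0 o.
  have [P PE] := polyf_ev (e i) (fun k _ => polyf_vn K I k).
  have [[o oE]|z] := Ss i.
    by exists (Some o), P => v _; rewrite rmorphM PE /= oE.
  by exists None, P => v Xv; rewrite rmorphM z // /= !mulr0.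
pose o i := proj1_sig (constructive_indefinite_description _ (ex i)).
have oP i := proj2_sig (constructive_indefinite_description _ (ex i)).
pose P i := proj1_sig (constructive_indefinite_description _ (oP i)).
have PP i := proj2_sig (constructive_indefinite_description _ (oP i)).
exists k, n, o, P => v Xv; rewrite QFE -rmorphXn sE rmorph_sum.
by apply: eq_bigr => i _; rewrite PP.
Qed.

(** The coefficients are replaced by their components of the complementary degree. This is
    legitimate at each point of [X], by comparing one coefficient in the scaling factors; a large
    exponent makes all these degrees nonnegative. *)
Lemma partition k0 : exists k n (s : 'I_n -> Idx) (e : 'I_n -> vec K I -> K),
  [/\ (k0 <= k)%N, forall i j, (b (s i) j <= k * a j)%N,
      forall i, form c (fun j => k * a j - b (s i) j)%N (e i) &
      forall v, X v -> F v ^+ k = \sum_i e i v * H (s i) v].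
Proof.
have [[v0 [Xv0 Fv0]]|NX] := classic (exists v, X v /\ F v != 0); last first.
  have s0 : forall (T : Type), 'I_0 -> T by move=> T [].
  exists k0.+1, 0%N, (s0 _), (s0 _); split=> //; try by case.
  move=> v Xv; rewrite big_ord0 (_ : F v = 0) ?expr0n //; apply/eqP/negPn/negP => Fv.
  by apply: NX; exists v.
have [i0 _] := cover Xv0 Fv0.
have [k [n [s [P PE]]]] := partition_poly.
pose t i := odflt i0 (s i).
pose k' := (k + k0 + \sum_i \sum_j b (t i) j)%N.
have bk i j : (b (t i) j <= k' * a j)%N.
  apply: leq_trans (leq_pmulr _ (a0 j)); apply: leq_trans (leq_addl _ _).
  by rewrite (bigD1 i) //= (bigD1 j) //= -addnA leq_addr.
have [PF PFE] := polyf_mpoly fF.1.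
pose P' i := if s i is Some _ then P i * PF ^+ (k' - k) else 0.
have evX p m v : peval (p ^+ m) v = peval p v ^+ m by rewrite /peval rmorphXn.
have P'E v : X v -> F v ^+ k' = \sum_i peval (P' i) v * H (t i) v.
  move=> Xv; have kk : (k <= k')%N by rewrite /k' -!addnA leq_addr.
  rewrite -(subnK kk) exprD PE // mulr_sumr; apply: eq_bigr => i _.
  rewrite /P' /t; case: (s i) => [i1|] /=; last by rewrite /peval meval0 mulr0 mul0r mulr0.
  by rewrite /peval mevalM -/(peval _ _) -/(peval _ _) evX -PFE; ring.
exists k', n, t, (fun i => peval (hcomp c (fun j => k' * a j - b (t i) j)%N (P' i))).
split=> //; first by rewrite /k' -addnA addnCA leq_addr.
  by move=> i; apply: multihomog_form; exact: hcomp_multihomog.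
move=> v Xv.
pose Q i := proj1_sig (constructive_indefinite_description _ (scale_poly c (P' i) v)).
have QP i := proj2_sig (constructive_indefinite_description _ (scale_poly c (P' i) v)).
pose mm (e : J -> nat) := [multinom e (enum_val k) | k < #|J|].
have /eqP E0 : F v ^+ k' *: 'X_[mm (fun j => k' * a j)%N] -
    \sum_i H (t i) v *: (Q i * 'X_[mm (b (t i))]) = 0.
  apply: mpoly_torus_eq0 => l l0.
  rewrite mevalB mevalZ monomial_eval (raddf_sum (meval (fun k => l (enum_val k)))) /=.
  have := P'E _ (zclosed_scale HX l0 Xv); rewrite fF.2 // exprMn -prodrXl.
  rewrite mulrC (eq_bigr (fun j => l j ^+ (k' * a j))); last by move=> j _; rewrite -exprM mulnC.
  move=> ->; apply/eqP; rewrite subr_eq0; apply/eqP; apply: eq_bigr => i _.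
  by rewrite mevalZ mevalM monomial_eval (QP i).1 (fH (t i)).2 //; ring.
move: E0; rewrite subr_eq0 => /eqP /(congr1 (fun p => p@_(mm (fun j => k' * a j)%N))).
rewrite mcoeffZ mcoeffX eqxx mulr1 => ->; rewrite raddf_sum /=; apply: eq_bigr => i _.
have -> : mm (fun j => k' * a j)%N = (mm (b (t i)) + mm (fun j => k' * a j - b (t i) j)%N)%MM.
  by apply/mnmP => j; rewrite mnmDE !mnmE subnKC.
by rewrite mcoeffZ mcoeffMX (QP i).2 mulrC.
Qed.
End Partition.

Definition basic v := X v /\ F v != 0.

(** Local quotients [g / h] are patched by a partition in terms of the squares of the [h]. From
    [f = g / h] off the zeros of [h] one gets [f h^2 = g h] everywhere, whereas [f h = g] may fail
    where [h] vanishes. *)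
Lemma affine_section d f : line_bundle c X d basic f -> exists k0, forall k, (k0 <= k)%N ->
  exists G e, [/\ form c e G, forall j, (e j)%:Z = (k * a j)%:Z + d j &
    forall v, X v -> F v != 0 -> f v = G v / F v ^+ k].
Proof.
move=> Hf.
have ex (p : {p | basic p}) := (regular_atP HX d (proj1_sig p) f).1 (Hf _ (proj2_sig p)).
pose g p := proj1_sig (constructive_indefinite_description _ (ex p)).
have gP p := proj2_sig (constructive_indefinite_description _ (ex p)).
pose h p := proj1_sig (constructive_indefinite_description _ (gP p)).
have hP p := proj2_sig (constructive_indefinite_description _ (gP p)).
pose ag p := proj1_sig (constructive_indefinite_description _ (hP p)).
have agP p := proj2_sig (constructive_indefinite_description _ (hP p)).
pose bh p := proj1_sig (constructive_indefinite_description _ (agP p)).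
have bhP p : [/\ form c (ag p) (g p), form c (bh p) (h p),
  (forall j, (ag p j)%:Z - (bh p j)%:Z = d j), X (proj1_sig p) /\ h p (proj1_sig p) != 0 &
  forall v, X v -> h p v != 0 -> f v = g p v / h p v] :=
  proj2_sig (constructive_indefinite_description _ (agP p)).
have [||k [n [s [e [_ be fe Fe]]]]] := @partition _ (fun p j => bh p j + bh p j)%N
    (fun p v => h p v * h p v) _ _ (\sum_j `|d j|)%N.
- by move=> p; have [_ fh _ _ _] := bhP p; exact: formM.
- move=> v Xv Fv; exists (exist _ v (conj Xv Fv)).
  by have [_ _ _ [_ hp] _] := bhP (exist _ v (conj Xv Fv)); rewrite mulf_neq0.
exists (k + \sum_j `|d j|)%N => k' kk'.
have kk : (k <= k')%N by apply: leq_trans kk'; exact: leq_addr.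
have pos j : (`|((k' * a j)%:Z + d j)%R|)%N%:Z = (k' * a j)%:Z + d j.
  have le : (`|d j| <= k' * a j)%N.
    apply: leq_trans (leq_pmulr _ (a0 j)); apply: leq_trans kk'; apply: leq_trans (leq_addl _ _).
    by rewrite (bigD1 j) //= leq_addr.
  lia.
exists (fun v => F v ^+ (k' - k) * \sum_i e i v * (g (s i) v * h (s i) v)),
  (fun j => `|((k' * a j)%:Z + d j)%R|%N); split=> //.
  apply: (form_ext (f := fun v => \sum_i F v ^+ (k' - k) * (e i v * (g (s i) v * h (s i) v)))).
    by move=> v; rewrite mulr_sumr.
  apply: form_sum => i _; have [fg fh dd _ _] := bhP (s i).
  apply: form_deg (formM (formX (k' - k) fF) (formM (fe i) (formM fg fh))) => j /=.
  apply/eqP; rewrite -eqz_nat pos; apply/eqP.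
  have := dd j; have := be i j; have : ((k' - k) * a j + k * a j = k' * a j)%N by rewrite -mulnDl subnK.
  by move: (k' * a j)%N (k * a j)%N => x y /=; lia.
move=> v Xv Fv; have E : F v ^+ k' = F v ^+ (k' - k) * F v ^+ k by rewrite -exprD subnK.
apply: (mulIf (expf_neq0 k' Fv)); rewrite divfK ?expf_neq0 // E mulrCA; congr (_ * _).
rewrite Fe // mulr_sumr; apply: eq_bigr => i _; rewrite mulrCA; congr (_ * _).
have [_ _ _ _ fE] := bhP (s i); have [->|hv] := eqVneq (h (s i) v) 0; first by rewrite !mulr0.
by rewrite fE // mulrA divfK.
Qed.
End Standard.

(** A cocycle is required to split on the given cover, not on a refinement. In degree 1 this is
    equivalent, by [h1_acyc] and [acyc_h1], and the open set [W] may be smaller than [X]. *)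
Definition acyc d (W : vec K I -> Prop) := forall (A : Type) (U : A -> vec K I -> Prop) (g : A -> A -> vec K I -> K),
  (forall a, zopen_in c X (U a)) -> (forall a v, U a v -> W v) -> (forall v, W v -> exists a, U a v) ->
  (forall a b, line_bundle c X d (fun v => U a v /\ U b v) (g a b)) ->
  (forall a b e v, U a v -> U b v -> U e v -> g a e v = g a b v + g b e v) ->
  exists h : A -> vec K I -> K, (forall a, line_bundle c X d (U a) (h a)) /\
    forall a b v, U a v -> U b v -> g a b v = h b v - h a v.

Lemma near_open U p f f' : zopen_in c X U -> U p -> (forall v, U v -> f v = f' v) -> near_eq c X p f f'.
Proof.
move=> oU Up H; have [a [w [fw wp wU]]] := zopen_basic HX oU Up.
by exists a, w; split=> // v Xv wv; apply: H; exact: wU.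
Qed.

Lemma zopen_and U U' : zopen_in c X U -> zopen_in c X U' -> zopen_in c X (fun v => U v /\ U' v).
Proof.
move=> [Z cZ ZE] [Z' cZ' ZE'].
pose S f := (exists a, form c a f) /\ exists f1 f2 a1 a2, [/\ form c a1 f1, form c a2 f2, vanish Z f1, vanish Z' f2 &
  forall v, f v = f1 v * f2 v].
exists (fun v => is_point c v /\ forall f, S f -> f v = 0).
  by apply: zclosed_forms => f [].
move=> v; split=> [[Uv Uv']|[Xv N]].
  have [Xv NZ] := (ZE v).1 Uv; have [_ NZ'] := (ZE' v).1 Uv'.
  split=> // -[pv H].
  have [f1 [a1 [ff1 v1 n1]]] : exists f1 a1, [/\ form c a1 f1, vanish Z f1 & f1 v != 0].
    apply: NNPP => N; apply: NZ; apply/(zclosedE cZ); split=> // a f ff vf.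
    by apply/eqP/negPn/negP => fv; apply: N; exists f, a.
  have [f2 [a2 [ff2 v2 n2]]] : exists f1 a1, [/\ form c a1 f1, vanish Z' f1 & f1 v != 0].
    apply: NNPP => N; apply: NZ'; apply/(zclosedE cZ'); split=> // a f ff vf.
    by apply/eqP/negPn/negP => fv; apply: N; exists f, a.
  have Sf : S (fun v => f1 v * f2 v).
    split; first by exists (fun j => a1 j + a2 j)%N; exact: formM.
    by exists f1, f2, a1, a2.
  have /eqP := H _ Sf.
  by rewrite mulf_eq0 (negbTE n1) (negbTE n2).
by split; [apply/ZE | apply/ZE']; split=> // Zv; apply: N; split; [exact: (zclosed_point HX) | |exact: (zclosed_point HX) |];
  move=> f [_ [f1 [f2 [a1 [a2 [_ _ h1 h2 ->]]]]]]; rewrite ?(h1 v Zv) ?(h2 v Zv) ?mul0r ?mulr0.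
Qed.

(** Serre's argument. The cover is refined to finitely many [W i != 0], the cocycle is written there
    with a common power of the denominators, and it is averaged with a partition of a power of [F]
    in terms of powers of the [W i]. *)
Lemma affine_acyc F a d : form c a F -> (forall j, (0 < a j)%N) -> (forall v, F v != 0 -> is_point c v) ->
  acyc d (basic F).
Proof.
move=> fF a0 Fp A U g oU UW WU Hg cg.
have ex (p : {p | basic F p}) : exists i b (w : vec K I -> K),
    [/\ form c b w, w (proj1_sig p) != 0 & forall v, X v -> w v != 0 -> U i v].
  by have [i Ui] := WU _ (proj2_sig p); exists i; exact: (zopen_basic HX (oU i) Ui).
pose al p := proj1_sig (constructive_indefinite_description _ (ex p)).
have alP p := proj2_sig (constructive_indefinite_description _ (ex p)).
pose b p := proj1_sig (constructive_indefinite_description _ (alP p)).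
have bP p := proj2_sig (constructive_indefinite_description _ (alP p)).
pose w p := proj1_sig (constructive_indefinite_description _ (bP p)).
have wP p : [/\ form c (b p) (w p), w p (proj1_sig p) != 0 & forall v, X v -> w p v != 0 -> U (al p) v] :=
  proj2_sig (constructive_indefinite_description _ (bP p)).
have [||k1 [n [s [e1 [_ _ _ Fe1]]]]] := @partition F a fF a0 Fp _ b w _ _ 0.
- by move=> p; have [] := wP p.
- by move=> v Xv Fv; exists (exist _ v (conj Xv Fv)); have [] := wP (exist _ v (conj Xv Fv)).
pose W (i : 'I_n) v := F v * w (s i) v; pose bW (i : 'I_n) j := (a j + b (s i) j)%N.
pose be (i : 'I_n) := al (s i).
have fW i : form c (bW i) (W i) by apply: formM => //; have [] := wP (s i).
have WUi i v : X v -> W i v != 0 -> U (be i) v.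
  by move=> Xv; rewrite mulf_eq0 negb_or => /andP [_]; have [_ _ ] := wP (s i); apply.
have coverW v : X v -> F v != 0 -> exists i, W i v != 0.
  move=> Xv Fv; apply: NNPP => N; have /negP := expf_neq0 k1 Fv; apply.
  rewrite Fe1 // big1 // => i _; have [->|wv] := eqVneq (w (s i) v) 0; first by rewrite mulr0.
  by case: N; exists i; rewrite mulf_neq0.
have secs (ij : 'I_n * 'I_n) : exists k0, forall k, (k0 <= k)%N -> exists G e,
    [/\ form c e G, forall j, (e j)%:Z = (k * (bW ij.1 j + bW ij.2 j))%:Z + d j &
    forall v, X v -> W ij.1 v * W ij.2 v != 0 ->
      g (be ij.1) (be ij.2) v = G v / (W ij.1 v * W ij.2 v) ^+ k].
  apply: (@affine_section _ _ (formM (fW ij.1) (fW ij.2))).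
  - by move=> j; rewrite /bW !addn_gt0 a0.
  - by move=> v; rewrite !mulf_eq0 !negb_or => /andP [/andP [/Fp]].
  by move=> p [Xp]; rewrite mulf_eq0 negb_or => /andP [h1 h2]; apply: Hg; split; apply: WUi.
pose k0 ij := proj1_sig (constructive_indefinite_description _ (secs ij)).
have k0P ij := proj2_sig (constructive_indefinite_description _ (secs ij)).
pose N := (\sum_ij k0 ij)%N.
have kN ij : (k0 ij <= N)%N by rewrite /N (bigD1 ij) //= leq_addr.
have GP ij := k0P ij N (kN ij).
pose G ij := proj1_sig (constructive_indefinite_description _ (GP ij)).
have eP ij := proj2_sig (constructive_indefinite_description _ (GP ij)).
pose eG ij := proj1_sig (constructive_indefinite_description _ (eP ij)).
have GE ij : [/\ form c (eG ij) (G ij), forall j, (eG ij j)%:Z = (N * (bW ij.1 j + bW ij.2 j))%:Z + d j &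
    forall v, X v -> W ij.1 v * W ij.2 v != 0 ->
      g (be ij.1) (be ij.2) v = G ij v / (W ij.1 v * W ij.2 v) ^+ N] :=
  proj2_sig (constructive_indefinite_description _ (eP ij)).
have [||M [n' [t [cc [_ bM fc FM]]]]] := @partition F a fF a0 Fp _ (fun i j => N.+1 * bW i j)%N
    (fun i v => W i v ^+ N.+1) _ _ 0.
- by move=> i; exact: formX.
- by move=> v Xv /(coverW v Xv) [i Wi]; exists i; rewrite expf_neq0.
(* The exponent is [N.+1] rather than [N]: the summand and its regular rewriting in [Rt] then both
   vanish with [W (t l)], and values of [g] outside its domain have no effect. *)
pose h i v := (\sum_l cc l v * W (t l) v ^+ N.+1 * g (be (t l)) i v) / F v ^+ M.
have UX i v : U i v -> X v by move=> Uv; exact: zopen_sub (oU i) Uv.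
exists h; split=> [i p Uip|i i' v Uiv Uiv']; last first.
  have [Xv Fv] := UW _ _ Uiv; rewrite /h -mulrBl -sumrB.
  apply: (mulIf (expf_neq0 M Fv)); rewrite divfK ?expf_neq0 // FM // mulr_sumr.
  apply: eq_bigr => l _; rewrite -mulrBr [LHS]mulrC; have [->|Wl] := eqVneq (W (t l) v) 0.
    by rewrite expr0n /= !mulr0 !mul0r.
  by rewrite (cg (be (t l)) i i' v (WUi _ _ Xv Wl)) // addrAC subrr add0r.
have [Xp Fpp] := UW _ _ Uip; have [j Wj] := coverW p Xp Fpp.
pose Rt v := \sum_l (cc l v * (G (t l, j) v * W (t l) v)) / (W j v ^+ N * F v ^+ M).
have rRt : regular_at c X d p Rt.
  apply: regular_sum => // l; have [fG dG _] := GE (t l, j).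
  apply: (regular_frac HX Xp (formM (fc l) (formM fG (fW (t l)))) (formM (formX N (fW j)) (formX M fF))).
    by rewrite mulf_neq0 ?expf_neq0.
  move=> jj; have := dG jj; have := bM l jj => /=; rewrite mulSn mulnDr.
  by move: (N * bW (t l) jj)%N (N * bW j jj)%N (M * a jj)%N => x y z; lia.
have rg : regular_at c X d p (g (be j) i) by apply: Hg; split=> //; exact: WUi.
have rr := regularD HX rRt rg; apply: (regular_near HX _ rr).
apply: (@near_open (fun v => U i v /\ (X v /\ W j v != 0))) => //.
  by apply: zopen_and => //; exact: (zopen_form HX (fW j)).
move=> v [Uiv [Xv Wjv]]; have [_ Fv] := UW _ _ Uiv.
have WN : W j v ^+ N != 0 by rewrite expf_neq0.
have FM0 : F v ^+ M != 0 by rewrite expf_neq0.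
apply: (mulIf FM0); rewrite /h divfK // mulrDl /Rt mulr_suml.
rewrite [X in _ + g _ _ _ * X]FM // mulr_sumr -big_split /=.
apply: eq_bigr => l _; have [W0|Wl] := eqVneq (W (t l) v) 0.
  by rewrite W0 expr0n /= !(mulr0, mul0r) addr0.
have [_ _ gE] := GE (t l, j).
have gE' : g (be (t l)) (be j) v = G (t l, j) v / (W (t l) v ^+ N * W j v ^+ N).
  by rewrite -exprMn; apply: gE => //=; rewrite mulf_neq0.
rewrite (cg (be (t l)) (be j) i v) ?gE' //; try exact: WUi.
rewrite exprSr; have x0 : W (t l) v ^+ N != 0 by rewrite expf_neq0.
exact: frac_id.
Qed.

(** If the cocycle splits on a refinement by [h], the expression [h b + g (tau b) a] does not depend
    on [b], and glues to a splitting on the original cover. *)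
Lemma h1_acyc d : h1_vanishes c X (line_bundle c X d) -> acyc d X.
Proof.
move=> H1 A U g oU UX XU Hg cg.
have [B [V [tau [h [[oV cV] VU Hh hE]]]]] := H1 A U g (conj oU XU) Hg cg.
have sB v : X v -> {b | V b v} by move=> /cV; exact: constructive_indefinite_description.
pose b0 v : option B := if excluded_middle_informative (X v) is left h then Some (proj1_sig (sB v h)) else None.
have b0P v b : b0 v = Some b -> V b v.
  by rewrite /b0; case: excluded_middle_informative => // h' [<-]; exact: (proj2_sig (sB v h')).
have b0X v : X v -> exists b, b0 v = Some b.
  by move=> Xv; rewrite /b0; case: excluded_middle_informative => // h'; eexists.
have g0 a v : U a v -> g a a v = 0.
  by move=> Ua; have /eqP := cg a a a v Ua Ua Ua; rewrite -subr_eq subrr eq_sym => /eqP.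
pose k a v := if b0 v is Some b then h b v + g (tau b) a v else 0.
have kE a b v : U a v -> V b v -> k a v = h b v + g (tau b) a v.
  move=> Ua Vb; have Xv := zopen_sub (oU a) Ua; have [b' b'E] := b0X v Xv; rewrite /k b'E.
  have Vb' := b0P _ _ b'E; rewrite (cg (tau b') (tau b) a v) //; try exact: VU.
  by rewrite (hE b' b v Vb' Vb); ring.
exists k; split=> [a p Ua|a a' v Ua Ua'].
  have Xp := zopen_sub (oU a) Ua; have [b Vb] := cV p Xp.
  have rr : regular_at c X d p (fun v => h b v + g (tau b) a v).
    by apply: regularD => //; [exact: Hh | apply: Hg; split=> //; exact: VU].
  apply: (regular_near HX _ rr); apply: (@near_open (fun v => U a v /\ V b v)) => //; first exact: zopen_and.
  by move=> v [h1 h2]; rewrite (kE _ b).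
have Xv := zopen_sub (oU a) Ua; have [b Vb] := cV v Xv.
by rewrite (kE _ b) // (kE _ b) // (cg (tau b) a a' v) //; [ring | exact: VU].
Qed.

Lemma acyc_h1 d : acyc d X -> h1_vanishes c X (line_bundle c X d).
Proof.
move=> H A U g [oU XU] Hg cg.
have [h [Hh hE]] := H A U g oU (fun a v => @zopen_sub _ _ _ c X (U a) v (oU a)) XU Hg cg.
by exists A, U, id, h.
Qed.
End Affine.

(** * Cohomology of the product *)

Section Split.
Variables (K : closedFieldType) (I J : finType) (c : I -> J) (i : I) (k : nat).
Implicit Types (v : vec K I) (A B G f : vec K I -> K).

Definition setc (s : K) v : vec K I := [ffun l => if l == i then s else v l].

Lemma setc_id v : setc (v i) v = v.
Proof. by apply/ffunP => l; rewrite ffunE; case: eqP => [->|]. Qed.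

Lemma upoly_setc f v : polyf f -> upoly (fun s => f (setc s v)).
Proof.
move=> Hf; apply: polyf_upoly => // l; case: (l == i); [exact: upoly_id | exact: upoly_cst].
Qed.

(** Degree less than [k] in the coordinate [i]: the remainders of division by the k-th power of that
    coordinate. *)
Definition degx A := forall v, exists2 p : {poly K}, (size p <= k)%N & forall s, A (setc s v) = p.[s].

Lemma degx_ext A B : A =1 B -> degx A -> degx B.
Proof. by move=> AB H v; have [p sp pE] := H v; exists p => // s; rewrite -AB. Qed.

Lemma degx0 : degx (fun=> 0).
Proof. by move=> v; exists 0 => [|s]; rewrite ?size_poly0 ?horner0. Qed.

Lemma degxD A B : degx A -> degx B -> degx (fun v => A v + B v).
Proof.
move=> HA HB v; have [p sp pE] := HA v; have [q sq qE] := HB v; exists (p + q) => [|s].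
  by apply: leq_trans (size_polyD _ _) _; rewrite geq_max sp.
by rewrite hornerD pE qE.
Qed.

Lemma degxM f A : (forall v s, f (setc s v) = f v) -> degx A -> degx (fun v => f v * A v).
Proof.
move=> Hf HA v; have [p sp pE] := HA v; exists (f v *: p) => [|s].
  exact: leq_trans (size_scale_leq _ _) sp.
by rewrite hornerZ pE Hf.
Qed.

Lemma degx_sum (T : Type) (r : seq T) (p : pred T) (F : T -> vec K I -> K) :
  (forall x, p x -> degx (F x)) -> degx (fun v => \sum_(x <- r | p x) F x v).
Proof.
move=> H; elim: r => [|x r IH].
  by apply: degx_ext degx0 => v; rewrite big_nil.
case px : (p x); last by apply: degx_ext IH => v; rewrite big_cons px.
by apply: degx_ext (degxD (H x px) IH) => v; rewrite big_cons px.
Qed.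

(** Uniqueness of this division is needed along a single line in direction [i] only, since on the
    product identities hold only over [Y]. *)
Lemma split_uniq A A' B B' v : degx A -> degx A' -> polyf B -> polyf B' ->
  (forall s, A (setc s v) + s ^+ k * B (setc s v) = A' (setc s v) + s ^+ k * B' (setc s v)) ->
  A v = A' v /\ B v = B' v.
Proof.
move=> HA HA' HB HB' H.
have [p sp pE] := HA v; have [p' sp' pE'] := HA' v.
have [q qE] := upoly_setc v HB; have [q' qE'] := upoly_setc v HB'.
have E : p - p' = 'X^k * (q' - q).
  apply/eqP; rewrite -subr_eq0; apply/eqP/poly_fun_eq0 => s.
  rewrite !(hornerD, hornerN, hornerM, hornerXn) -pE -pE' -qE -qE'.
  by move/eqP: (H s); rewrite -subr_eq0 => /eqP E; rewrite -[RHS]E; ring.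
have sz : (size (p - p')%R <= k)%N.
  by apply: leq_trans (size_polyD _ _) _; rewrite size_polyN geq_max sp.
have q0 : q' - q = 0.
  apply/eqP/negPn/negP => nz; move: sz; rewrite E mulrC size_mulXn //.
  by rewrite leqNgt; move: nz; rewrite -size_poly_gt0; lia.
move/eqP: E; rewrite q0 mulr0 subr_eq0 => /eqP pp; move/eqP: q0; rewrite subr_eq0 => /eqP qq.
by split; rewrite -(setc_id v); [rewrite pE pE' pp | rewrite qE qE' qq].
Qed.

Lemma form_monomial (e : I -> nat) :
  form c (fun j => \sum_l e l * (c l == j))%N (fun v => \prod_l v l ^+ e l).
Proof. exact: (form_prod _ (fun l => formX (e l) (form_var K c l))). Qed.

Lemma split_ex a G : form c a G -> exists A B, [/\ form c a A,
  form c (fun j => a j - k * (c i == j))%N B, degx A & forall v, G v = A v + v i ^+ k * B v].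
Proof.
move=> /formP [P hP PE].
pose e (m : 'X_{1..#|I|}) (l : I) := m (enum_rank l).
pose e' (m : 'X_{1..#|I|}) (l : I) := (e m l - k * (l == i))%N.
have he m j : m \in msupp P -> (\sum_l e m l * (c l == j))%N = a j.
  move=> /hP /(_ j) <-; rewrite [RHS]big_mkcond; apply: eq_bigr => l _.
  by case: (c l == j); rewrite ?muln1 ?muln0.
have GE v : G v = \sum_(m <- msupp P) P@_m * \prod_l v l ^+ e m l.
  rewrite PE /peval mevalE; apply: eq_bigr => m _; congr (_ * _).
  rewrite [RHS](reindex (@enum_val I predT)) /=; last by apply: onW_bij; exact: enum_val_bij.
  by apply: eq_bigr => l _; rewrite /e enum_valK.
exists (fun v => \sum_(m <- msupp P | (m \in msupp P) && (e m i < k)%N) P@_m * \prod_l v l ^+ e m l),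
  (fun v => \sum_(m <- msupp P | (m \in msupp P) && (k <= e m i)%N) P@_m * \prod_l v l ^+ e' m l).
split.
- apply: form_sum => m /andP [mP _]; apply: formZ; apply: form_deg (form_monomial (e m)) => j.
  exact: he.
- apply: form_sum => m /andP [mP ki]; apply: formZ; apply: form_deg (form_monomial (e' m)) => j.
  rewrite -(he m j mP) (bigD1 i) //= [in RHS](bigD1 i) //= /e' eqxx muln1 mulnBl.
  rewrite (eq_bigr (fun l => e m l * (c l == j))%N); last by move=> l /negbTE ->; rewrite muln0 subn0.
  have : (k * (c i == j) <= e m i * (c i == j))%N by rewrite leq_mul2r ki orbT.
  lia.
- apply: degx_sum => m /andP [_ mk] v; exists ((P@_m * \prod_(l | l != i) v l ^+ e m l) *: 'X^(e m i)).
    by apply: leq_trans (size_scale_leq _ _) _; rewrite size_polyXn.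
  move=> s; rewrite hornerZ hornerXn (bigD1 i) //= ffunE eqxx mulrA [P@_m * _]mulrC -mulrA mulrC.
  by congr (_ * _ * _); apply: eq_bigr => l /negbTE li; rewrite ffunE li.
move=> v; rewrite GE big_seq (bigID (fun m => (e m i < k)%N)) /= [in RHS]big_seq_cond [in LHS]big_seq_cond.
congr (_ + _).
rewrite mulr_sumr [in LHS]big_seq_cond [in RHS]big_seq_cond; apply: eq_big => [m|m].
  by rewrite -leqNgt !andbA !andbb.
move=> /and3P [_ _]; rewrite -leqNgt => ki; rewrite mulrCA; congr (_ * _).
rewrite (bigD1 i) //= [in RHS](bigD1 i) //= mulrA -exprD /e' eqxx muln1 subnKC //; congr (_ * _).
by apply: eq_bigr => l /negbTE ->; rewrite muln0 subn0.
Qed.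
End Split.

(** * Forms and sections on projective space *)

Section ProjectiveSpace.
Variables (K : closedFieldType) (m : nat).
Let cP := @proj_col m.
Implicit Types (q : vec K 'I_m.+1) (f : vec K 'I_m.+1 -> K).

Lemma zclosed_proj : zclosed cP (@is_point K _ _ cP).
Proof.
apply: zclosed_ext (zclosed_forms (c := cP) (S := fun=> False) _) => [v|//].
by split=> [[]|pv].
Qed.

Lemma polyf_dense f : polyf f -> (forall q, (forall i, q i != 0) -> f q = 0) -> forall q, f q = 0.
Proof.
move=> Hf H q; apply/eqP/negPn/negP => fq.
have Hp : polyf (fun q : vec K 'I_m.+1 => \prod_i q i) by apply: polyf_prod => i _; exact: polyf_var.
have [||w [fw /prodf_neq0 gw]] := polyf_dom Hf Hp.
- by exists q.
- by exists [ffun=> 1]; apply/prodf_neq0 => i _; rewrite ffunE oner_neq0.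
by move/eqP: fw; apply; apply: H => i; exact: gw.
Qed.

Lemma proj_col_deg (i : 'I_m.+1) : form cP (fun=> 1%N) (fun q => q i).
Proof. exact: form_var. Qed.

Lemma point_coord i q : q i != 0 -> is_point cP q.
Proof. by move=> qi; case; exists i. Qed.

Definition nq q (i : nat) : K := q (inord i).

Lemma form_emon (I J : finType) (c : I -> J) b t (mu : Mon m t) (g : nat -> vec K I -> K) :
  (forall i, form c b (g i)) -> form c (fun j => t * b j)%N (fun v => emon mu (fun i => g i v)).
Proof.
elim: m t mu g => [|m' IHm] t mu g Hg; first exact: formX.
elim: t mu => [|t IHt] mu.
  by have H := form_deg (fun j => erefl : 0%N = (0 * b j)%N) (form_cst c (1 : K)).
case: mu => mu; first exact: (IHm t.+1 mu (fun i => g i.+1)).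
by apply: form_deg (formM (Hg 0%N) (IHt mu)) => j; rewrite mulSn.
Qed.

Lemma form_emonq t (mu : Mon m t) : form cP (fun=> t) (fun q => emon mu (nq q)).
Proof.
by apply: form_deg (form_emon mu (fun i => proj_col_deg (inord i))) => j; rewrite muln1.
Qed.

Lemma mon_ex (e : nat -> nat) t : (\sum_(i < m.+1) e i)%N = t ->
  exists mu : Mon m t, forall q : nat -> K, emon mu q = \prod_(i < m.+1) q i ^+ e i.
Proof.
elim: m e t => [|m' IHm] e t; first by rewrite big_ord1 => <-; exists tt => q; rewrite big_ord1.
move E : (e 0%N) => k; elim: k t e E => [|k IHk] t e E; rewrite big_ord_recl /= E.
  rewrite add0n; case: t => [|t] Et.
    exists tt => q; rewrite big1 // => i _; case: i => -[|i] ilt /=; first by rewrite E.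
    have := Et; rewrite (bigD1 (Ordinal (ilt : (i < m'.+1)%N))) //= => /eqP; rewrite addn_eq0.
    by case/andP => /eqP; rewrite /bump /= add1n => -> _.
  have [mu muE] := IHm (fun i => e i.+1) t.+1 Et.
  by exists (inl mu) => q; rewrite /= muE [RHS]big_ord_recl E mul1r.
case: t => [//|t]; rewrite addSn => -[] Et.
have [|mu muE] := IHk t (fun i => if i is 0 then k else e i) erefl; first by rewrite big_ord_recl.
exists (inr mu) => q; rewrite -[LHS]/(q 0%N * emon (m := m'.+1) mu q) muE.
by rewrite !big_ord_recl /= E mulrA exprS.
Qed.

Lemma form_span t f : form cP (fun=> t) f -> exists C : Mon m t -> K,
  forall q, f q = \sum_mu C mu * emon mu (nq q).
Proof.
move=> /formP [P hP PE].
have mu0 : (exists mu : Mon m t, True).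
  have [|mu _] := @mon_ex (fun i => if i is 0 then t else 0%N) t; last by exists mu.
  by rewrite big_ord_recl big1 ?addn0.
have ex (mm : 'X_{1..#|{: 'I_m.+1}|}) : exists mu : Mon m t, mm \in msupp P ->
    forall q, emon mu (nq q) = \prod_i q (enum_val i) ^+ mm i.
  have [mmP|] := boolP (mm \in msupp P); last by have [mu _] := mu0; exists mu.
  have [|mu muE] := @mon_ex (fun i => mm (enum_rank (inord i : 'I_m.+1))) t.
    rewrite -[RHS](hP _ mmP tt); apply: eq_big => [i|i _]; first by rewrite eqxx.
    by rewrite inord_val.
  exists mu => _ q; rewrite muE (reindex (@enum_val 'I_m.+1 predT)) /=; last first.
    by apply: onW_bij; exact: enum_val_bij.
  by apply: eq_bigr => i _; rewrite /nq inord_val enum_valK.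
pose mo mm := proj1_sig (constructive_indefinite_description _ (ex mm)).
have moP mm := proj2_sig (constructive_indefinite_description _ (ex mm)).
exists (fun mu => \sum_(mm <- msupp P | mo mm == mu) P@_mm) => q.
rewrite PE /peval mevalE (partition_big mo predT) //=; apply: eq_bigr => mu _.
rewrite mulr_suml big_seq_cond [RHS]big_seq_cond; apply: eq_bigr => mm /andP [mP /eqP <-].
by rewrite moP.
Qed.

(** Finitely many values determine a form, so its coefficients are fixed linear combinations of
    values. In this way the coefficients of a section on a product inherit regularity in the other
    factor. *)
Lemma emon_interp t : exists (N : nat) (w : 'I_N -> vec K 'I_m.+1) (L : Mon m t -> 'I_N -> K),
  (forall a, is_point cP (w a)) /\ forall C mu, C mu = \sum_a L mu a * \sum_nu C nu * emon nu (nq (w a)).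
Proof.
pose X := {q : vec K 'I_m.+1 | is_point cP q}.
pose vv (x : X) (mu : Mon m t) := emon mu (nq (proj1_sig x)).
have p1 : is_point cP ([ffun=> 1] : vec K 'I_m.+1) by apply: (@point_coord ord0); rewrite ffunE oner_neq0.
have [|w Hw] := @add_values K _ _ (fun (a : 'I_0) (mu : Mon m t) => 0) X vv (exist _ _ p1) #|Mon m t|.
  move=> x _ xb; apply: NNPP => N.
  have pf : polyf (fun q => \sum_mu emon mu (nq q) * x mu).
    by apply: polyf_sum => mu _; apply: polyfM; [have [] := form_emonq mu | exact: polyf_cst].
  have [q /eqP] := emon_free xb; apply.
  have := polyf_nonzero pf _ [ffun i : 'I_m.+1 => q i] => /= E.
  rewrite -[RHS]E; last first.
    move=> q' pq'; apply/eqP/negPn/negP => h; apply: N; by exists (exist _ q' pq').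
  apply: eq_bigr => mu _; rewrite mulrC; congr (_ * _); apply: emon_ext => i im.
  by rewrite /nq ffunE inordK.
set F := addrows _ _ in Hw; have le : (#|Mon m t| <= frank F)%N.
  by apply: leq_trans Hw; rewrite leq_min leq_addl leqnn.
exists #|Mon m t|, (fun a => proj1_sig (w a)).
pose M := \matrix_(i < #|{: 'I_0 + 'I_#|Mon m t|}|, j < #|Mon m t|) F (enum_val i) (enum_val j).
have /row_fullP [B BM] : row_full M by rewrite /row_full eqn_leq rank_leq_col.
exists (fun mu a => B (enum_rank mu) (enum_rank (inr a))); split=> [a|C mu]; first exact: proj2_sig.
have E1 : \sum_nu (1%:M : 'M_#|Mon m t|) (enum_rank mu) (enum_rank nu) * C nu = C mu.
  rewrite (bigD1 mu) //= mxE eqxx mul1r big1 ?addr0 // => nu nm.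
  by rewrite mxE (inj_eq enum_rank_inj) eq_sym (negbTE nm) mul0r.
have E nu : (B *m M) (enum_rank mu) (enum_rank nu) =
    \sum_a B (enum_rank mu) (enum_rank (inr a)) * emon nu (nq (proj1_sig (w a))).
  rewrite mxE (reindex (@enum_rank ('I_0 + 'I_#|Mon m t|)%type)) /=; last by apply: onW_bij; exact: enum_rank_bij.
  rewrite big_sumType /= big_ord0 add0r; apply: eq_bigr => a _.
  by rewrite mxE !enum_rankK.
rewrite -[LHS]E1 -BM (eq_bigr (fun nu => \sum_a B (enum_rank mu) (enum_rank (inr a)) *
  emon nu (nq (proj1_sig (w a))) * C nu)); last by move=> nu _; rewrite E mulr_suml.
rewrite exchange_big; apply: eq_bigr => a _; rewrite mulr_sumr; apply: eq_bigr => nu _; ring.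
Qed.
End ProjectiveSpace.

Lemma regroup (K : comNzRingType) (a b c d : K) : c * a + b * (c * d) = (a + b * d) * c.
Proof. ring. Qed.

Lemma clear_denominators (K : fieldType) (a b c e g1 g2 g3 : K) :
  a != 0 -> b != 0 -> c != 0 -> e != 0 ->
  g3 / (e * e * a * c) = g2 / (e * e * a * b) + g1 / (e * e * b * c) -> g3 * b = g2 * c + g1 * a.
Proof.
move=> a0 b0 c0 e0 E; have -> : g3 * b = g3 / (e * e * a * c) * (e * e * a * b * c).
  by field; rewrite ?a0 ?c0 ?e0.
by rewrite E; field; rewrite ?a0 ?b0 ?c0 ?e0.
Qed.

Lemma cech_split (K : fieldType) (a b e g h : K) : a != 0 -> b != 0 -> e != 0 ->
  (b * g + a * h) / (e * e * a * b) = h / (e * e * b) - (- 1 * g) / (e * e * a).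
Proof. by move=> a0 b0 e0; field; rewrite ?a0 ?b0 ?e0. Qed.

Section ProjSections.
Variables (K : closedFieldType) (m : nat).
Let cP := @proj_col m.+1.
Implicit Types q : vec K 'I_m.+2.

(** A second coordinate is essential: the remainder of the 0-th numerator modulo [q ord0 ^+ k],
    multiplied by [q i1 ^+ k], is divisible by [q ord0 ^+ k], hence zero. *)
Lemma proj_sections (t : nat) f : (forall q, is_point cP q -> regular_at cP (@is_point K _ _ cP) (fun=> t%:Z) q f) ->
  exists2 B, form cP (fun=> t) B & forall q, is_point cP q -> f q = B q.
Proof.
move=> Hf; have HX := zclosed_proj K m.+1.
have sec i := affine_section HX (proj_col_deg K i) (fun=> isT) (@point_coord K m.+1 i)
  (fun p bp => Hf p bp.1 : regular_at cP (@is_point K _ _ cP) (fun=> t%:Z) p f).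
pose k0 i := proj1_sig (constructive_indefinite_description _ (sec i)).
have k0P i := proj2_sig (constructive_indefinite_description _ (sec i)).
pose k := (\sum_i k0 i)%N.
have kk i : (k0 i <= k)%N by rewrite /k (bigD1 i) //= leq_addr.
pose G i := proj1_sig (constructive_indefinite_description _ (k0P i k (kk i))).
have eP i := proj2_sig (constructive_indefinite_description _ (k0P i k (kk i))).
have fG i : form cP (fun=> k + t)%N (G i).
  have [e [fe ee _]] := eP i; apply: form_deg fe => j; apply/eqP; rewrite -eqz_nat ee muln1; apply/eqP; lia.
have fE i q : q i != 0 -> f q = G i q / q i ^+ k.
  by move=> qi; have [e [_ _]] := eP i; apply=> //; exact: point_coord qi.
have GG i i' q : G i q * q i' ^+ k = G i' q * q i ^+ k.
  apply/eqP; rewrite -subr_eq0; apply/eqP; move: q; apply: polyf_dense.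
    by apply: polyfB; apply: polyfM; try exact: (fG _).1; apply: polyfX; exact: polyf_var.
  move=> q qn; have := fE i q (qn i); rewrite (fE i' q (qn i')) => /eqP.
  by rewrite eqr_div ?expf_neq0 // => /eqP ->; rewrite subrr.
pose i1 : 'I_m.+2 := lift ord0 ord0.
have [A [B [fA fB dA GE]]] := split_ex ord0 k (fG ord0).
have A0 q : A q = 0.
  move: q; apply: polyf_dense; first exact: fA.1.
  move=> q qn; apply: (mulfI (expf_neq0 k (qn i1))); rewrite mulr0.
  have [|||||-> _] := @split_uniq K _ ord0 k (fun q => q i1 ^+ k * A q) (fun=> 0)
    (fun q => q i1 ^+ k * B q) (G i1) q => //.
  - by apply: degxM => // v s; rewrite ffunE.
  - exact: degx0.
  - by apply: polyfM; [apply: polyfX; exact: polyf_var | exact: fB.1].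
  - exact: (fG _).1.
  move=> s; set w := setc _ _ _; have w0 : w ord0 = s by rewrite ffunE eqxx.
  by have := GG ord0 i1 w; rewrite GE w0 => e; rewrite add0r [RHS]mulrC -e; exact: regroup.
have GE0 q : G ord0 q = q ord0 ^+ k * B q by rewrite GE A0 add0r.
exists B; first by apply: form_deg fB => -[] /=; rewrite muln1 addKn.
move=> q /(_ tt) [i _ qi]; rewrite (fE i) //.
have -> : G i q = B q * q i ^+ k.
  apply/eqP; rewrite -subr_eq0; apply/eqP; move: (q); apply: polyf_dense.
    by apply: polyfB; [exact: (fG _).1 | apply: polyfM; [exact: fB.1 | apply: polyfX; exact: polyf_var]].
  move=> q' qn; apply: (mulIf (expf_neq0 k (qn ord0))).
  rewrite mul0r mulrBl -GG GE0; move: (B q') (q' i ^+ k) (q' ord0 ^+ k) => a b c0; ring.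
by rewrite mulfK ?expf_neq0.
Qed.
End ProjSections.

(** * Sections and first cohomology on the product with the plane *)

Section ProductSections.
Variables (K : closedFieldType) (n : nat).
Let IX := ('I_n.+1 + 'I_3)%type.
Let cY := @proj_col n.
Let cP := @proj_col 2.
Let cX := @times_proj_col n 2.
Variables (Y : vec K 'I_n.+1 -> Prop) (HY : zclosed cY Y).
Let X := times_proj (m := 2) Y.
Let HX : zclosed cX X := zclosedX 2 HY.
Implicit Types (y : vec K 'I_n.+1) (q : vec K 'I_3) (v : vec K IX).

Lemma pairX y q : Y y -> is_point cP q -> X (pairv y q).
Proof. by move=> Yy pq; apply/times_projE; rewrite fst_pair snd_pair. Qed.

Lemma regular_snd s t y q f : regular_at cX X (bidegree s t) (pairv y q) f ->
  regular_at cP (@is_point K _ _ cP) (fun=> t) q (fun q => f (pairv y q)).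
Proof.
move=> /(regular_atP HX) [g [h [a [b [fg fh ab [Xp hp] fE]]]]].
have [Yy pq] := (times_projE Y _).1 Xp; rewrite fst_pair snd_pair in Yy pq.
apply/(regular_atP (zclosed_proj K 2)); exists (fun q => g (pairv y q)), (fun q => h (pairv y q)).
exists (fun=> a (inr tt)), (fun=> b (inr tt)); split; try exact: form_pairr.
- by move=> _; exact: (ab (inr tt)).
- by [].
by move=> q' pq' hq'; apply: fE => //; exact: pairX.
Qed.

Lemma regular_fst s t y q f : regular_at cX X (bidegree s t) (pairv y q) f ->
  regular_at cY Y (fun=> s) y (fun y => f (pairv y q)).
Proof.
move=> /(regular_atP HX) [g [h [a [b [fg fh ab [Xp hp] fE]]]]].
have [Yy pq] := (times_projE Y _).1 Xp; rewrite fst_pair snd_pair in Yy pq.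
apply/(regular_atP HY); exists (fun y => g (pairv y q)), (fun y => h (pairv y q)).
exists (fun=> a (inl tt)), (fun=> b (inl tt)); split; try exact: form_pairl.
- by move=> _; exact: (ab (inl tt)).
- by [].
by move=> y' Yy' hy'; apply: fE => //; exact: pairX.
Qed.

Lemma regular_pull s v C : X v -> regular_at cY Y (fun=> s) (fstv v) C ->
  regular_at cX X (bidegree s 0) v (fun v => C (fstv v)).
Proof.
move=> Xv /(regular_atP HY) [g [h [a [b [fg fh ab [Yp hp] fE]]]]].
apply/(regular_atP HX); exists (fun v => g (fstv v)), (fun v => h (fstv v)).
exists (bideg (a tt) 0), (bideg (b tt) 0); split; try exact: form_fst.
- by case=> [[]|[]] /=; [exact: ab | rewrite subrr].
- by [].
by move=> v' /times_projE [Yv' _] hv'; exact: fE.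
Qed.

Lemma regular_emon t (mu : Mon 2 t) v : X v ->
  regular_at cX X (bidegree 0 t) v (fun v => emon mu (nq (sndv v))).
Proof.
move=> Xv; apply: (regular_form HX Xv (form_snd n (form_emonq K mu))).
by case=> [[]|[]].
Qed.

Lemma regular_combo t v (C : Mon 2 t -> vec K 'I_n.+1 -> K) : X v ->
  (forall mu, regular_at cY Y (fun=> 1) (fstv v) (C mu)) ->
  regular_at cX X (bidegree 1 t) v (fun v => \sum_mu C mu (fstv v) * emon mu (nq (sndv v))).
Proof.
move=> Xv HC; apply: regular_sum => // mu.
apply: regular_deg (regularM HX (regular_pull Xv (HC mu)) (regular_emon mu Xv)).
by case=> [[]|[]] /=; rewrite ?addr0 ?add0r.
Qed.

Section Interp.
Variables (t N : nat) (w : 'I_N -> vec K 'I_3) (L : Mon 2 t -> 'I_N -> K).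
Hypothesis pw : forall a, is_point cP (w a).
Hypothesis interp : forall C mu, C mu = \sum_a L mu a * \sum_nu C nu * emon nu (nq (w a)).

Definition coef (f : vec K IX -> K) (mu : Mon 2 t) y := \sum_a L mu a * f (pairv y (w a)).

Lemma coefP f y : (forall q, is_point cP q -> regular_at cX X (bidegree 1 t) (pairv y q) f) ->
  forall q, is_point cP q -> f (pairv y q) = \sum_mu coef f mu y * emon mu (nq q).
Proof.
move=> Hf; have [B fB BE] := proj_sections (fun q pq => regular_snd (Hf q pq)).
have [C CE] := form_span fB => q pq; rewrite BE // CE; apply: eq_bigr => mu _; congr (_ * _).
by rewrite interp /coef; apply: eq_bigr => a _; rewrite BE // CE.
Qed.

Lemma coef_regular f y : Y y -> (forall q, is_point cP q -> regular_at cX X (bidegree 1 t) (pairv y q) f) ->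
  forall mu, regular_at cY Y (fun=> 1) y (coef f mu).
Proof.
move=> Yy Hf mu; apply: regular_sum => // a; apply: regularZ => //.
exact: regular_fst (Hf _ (pw a)).
Qed.
End Interp.

Section Fibre.
Variables (t : nat) (l : 'I_n.+1).
Let o0 : 'I_3 := @Ordinal 3 0 isT.
Let o1 : 'I_3 := @Ordinal 3 1 isT.
Let o2 : 'I_3 := @Ordinal 3 2 isT.
Let x (i : 'I_3) v := v (inr i).
Let z v := v (inl l).

Definition Fl (i : 'I_3) v : K := z v * x i v.

Lemma form_x i : form cX (bideg 0 1) (x i).
Proof. by apply: form_deg (form_var K cX (inr i)) => -[[]|[]]. Qed.

Lemma form_z : form cX (bideg 1 0) z.
Proof. by apply: form_deg (form_var K cX (inl l)) => -[[]|[]]. Qed.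

Lemma form_Fl i : form cX (bideg 1 1) (Fl i).
Proof. by apply: form_deg (formM form_z (form_x i)) => -[[]|[]]. Qed.

Lemma Fl_point i v : Fl i v != 0 -> is_point cX v.
Proof.
rewrite mulf_eq0 negb_or => /andP [zv xv]; apply/is_pointX; split=> -[].
  by exists l; rewrite ?ffunE.
by exists i; rewrite ?ffunE.
Qed.

Lemma dense_fibre (F : vec K IX -> K) : polyf F ->
  (forall v, Y (fstv v) -> z v != 0 -> (forall i, x i v != 0) -> F v = 0) ->
  forall v, Y (fstv v) -> z v != 0 -> F v = 0.
Proof.
move=> pF H v Yv zv; rewrite -(pair_eta v); move: (sndv v); apply: polyf_dense.
  exact: polyf_pairr.
move=> q qn; apply: H; rewrite ?fst_pair //; first by rewrite /z ffunE; move: zv; rewrite /z ffunE.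
by move=> i; rewrite /x ffunE.
Qed.

(** The vanishing of H^1(P^2, O(t)), with parameters in the part of [Y] where the coordinate [l] is
    nonzero. The numerators satisfy [G02 x1^k = G01 x2^k + G12 x0^k], and a splitting is read off by
    dividing by powers of coordinates. *)
Lemma cech_fibre (th : 'I_3 -> 'I_3 -> vec K IX -> K) :
  (forall i i' v, X v -> z v != 0 -> x i v != 0 -> x i' v != 0 -> regular_at cX X (bidegree 1 t) v (th i i')) ->
  (forall i i' i'' v, X v -> z v != 0 -> x i v != 0 -> x i' v != 0 -> x i'' v != 0 ->
    th i i'' v = th i i' v + th i' i'' v) ->
  exists eta : 'I_3 -> vec K IX -> K,
    (forall i v, X v -> z v != 0 -> x i v != 0 -> regular_at cX X (bidegree 1 t) v (eta i)) /\
    forall i i' v, X v -> z v != 0 -> x i v != 0 -> x i' v != 0 -> th i i' v = eta i' v - eta i v.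
Proof.
move=> rth cth.
have sec (ii : 'I_3 * 'I_3) : exists k0, forall k, (k0 <= k)%N -> exists G e,
    [/\ form cX e G, forall j, (e j)%:Z = (k * (bideg 1 1 j + bideg 1 1 j)%N)%:Z + bidegree 1 t j &
    forall v, X v -> Fl ii.1 v * Fl ii.2 v != 0 -> th ii.1 ii.2 v = G v / (Fl ii.1 v * Fl ii.2 v) ^+ k].
  apply: (affine_section HX (formM (form_Fl ii.1) (form_Fl ii.2))).
  - by case=> [[]|[]].
  - by move=> v; rewrite mulf_eq0 negb_or => /andP [/Fl_point].
  by move=> p [Xp]; rewrite !mulf_eq0 !negb_or => /andP [/andP [h1 h2] /andP [_ h3]]; exact: rth.
pose k0 ii := proj1_sig (constructive_indefinite_description _ (sec ii)).
have k0P ii := proj2_sig (constructive_indefinite_description _ (sec ii)).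
pose k := (\sum_ii k0 ii)%N.
have kk ii : (k0 ii <= k)%N by rewrite /k (bigD1 ii) //= leq_addr.
pose G ii := proj1_sig (constructive_indefinite_description _ (k0P ii k (kk ii))).
have eP ii := proj2_sig (constructive_indefinite_description _ (k0P ii k (kk ii))).
have fG ii : form cX (bideg (2 * k + 1) (2 * k + t)) (G ii).
  have [e [fe ee _]] := eP ii; apply: form_deg fe => -[[]|[]]; apply/eqP; rewrite -eqz_nat ee /=; apply/eqP; lia.
have thE i i' v : X v -> z v != 0 -> x i v != 0 -> x i' v != 0 ->
    th i i' v = G (i, i') v / (z v ^+ 2 * x i v * x i' v) ^+ k.
  move=> Xv zv xv xv'; have [e [_ _ H]] := eP (i, i'); rewrite [LHS]H ?mulf_neq0 //=.
  by congr (_ / _ ^+ _); rewrite /Fl; ring.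
have px i : polyf (x i) by exact: (form_x i).1.
have pxk i : polyf (fun v => x i v ^+ k) by exact: polyfX.
have pG ii : polyf (G ii) := (fG ii).1.
have GG v : Y (fstv v) -> z v != 0 -> G (o0, o2) v * x o1 v ^+ k =
    G (o0, o1) v * x o2 v ^+ k + G (o1, o2) v * x o0 v ^+ k.
  move=> Yv zv; apply/eqP; rewrite -subr_eq0; apply/eqP; move: v Yv zv; apply: dense_fibre.
    by apply: polyfB; [|apply: polyfD]; apply: polyfM.
  move=> v Yv zv xv; have Xv : X v.
    by apply/times_projE; split=> // -[]; exists o0; rewrite ?ffunE //; exact: xv.
  have := cth o0 o1 o2 v Xv zv (xv _) (xv _) (xv _); rewrite !thE // !exprMn.
  have := expf_neq0 k (xv o0); have := expf_neq0 k (xv o1); have := expf_neq0 k (xv o2).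
  have := expf_neq0 k zv.
  move: (x o0 v ^+ k) (x o1 v ^+ k) (x o2 v ^+ k) (z v ^+ k) => a b c' e e0 c0 b0 a0.
  by move=> /(clear_denominators a0 b0 c0 e0) ->; rewrite subrr.
(* [G01] and [G02] are divided by [x0^k], and the remainder of [G01] by [x1^k]. By uniqueness [S1]
   and [S2] give the final remainder [C] as zero, so that [G01 = x1^k E + x0^k B1], which shows the
   components 0 and 1 of [eta]. *)
have [A1 [B1 [fA1 fB1 dA1 E1]]] := split_ex (inr o0) k (fG (o0, o1)).
have [A2 [B2 [fA2 fB2 dA2 E2]]] := split_ex (inr o0) k (fG (o0, o2)).
have [C [E [fC fE dC EA1]]] := split_ex (inr o1) k fA1.
have fst_setc i s v : fstv (setc (inr i) s v) = fstv v by apply/ffunP => j; rewrite !ffunE.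
have z_setc i s v : z (setc (inr i) s v) = z v by rewrite /z ffunE.
have x_setc i i' s v : i' != i -> x i' (setc (inr i) s v) = x i' v.
  by move=> ii; rewrite /x ffunE (inj_eq inr_inj) (negbTE ii).
have x_setc0 i s v : x i (setc (inr i) s v) = s by rewrite /x ffunE eqxx.
have S1 v : Y (fstv v) -> z v != 0 -> x o1 v ^+ k * A2 v = x o2 v ^+ k * A1 v /\
    x o1 v ^+ k * B2 v = x o2 v ^+ k * B1 v + G (o1, o2) v.
  move=> Yv zv; apply: (@split_uniq K _ (inr o0) k (fun v => x o1 v ^+ k * A2 v) (fun v => x o2 v ^+ k * A1 v)
    (fun v => x o1 v ^+ k * B2 v) (fun v => x o2 v ^+ k * B1 v + G (o1, o2) v) v).
  - by apply: degxM => // u s; rewrite x_setc.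
  - by apply: degxM => // u s; rewrite x_setc.
  - by apply: polyfM => //; exact: fB2.1.
  - by apply: polyfD => //; apply: polyfM => //; exact: fB1.1.
  move=> s; have := GG (setc (inr o0) s v); rewrite fst_setc z_setc => /(_ Yv zv).
  rewrite E1 E2 -/(x o0 _) x_setc0 => e; move: e; set u := setc _ _ _ => e.
  rewrite regroup e -regroup.
  by move: (x o2 u ^+ k) (s ^+ k) (A1 u) (B1 u) (G _ u) => a b c' d g; ring.
have S2 v : Y (fstv v) -> z v != 0 -> x o2 v ^+ k * C v = 0 /\ x o2 v ^+ k * E v = A2 v.
  move=> Yv zv; apply: (@split_uniq K _ (inr o1) k (fun v => x o2 v ^+ k * C v) (fun=> 0)
    (fun v => x o2 v ^+ k * E v) A2 v).
  - by apply: degxM => // u s; rewrite x_setc.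
  - exact: degx0.
  - by apply: polyfM => //; exact: fE.1.
  - exact: fA2.1.
  move=> s; have := S1 (setc (inr o1) s v); rewrite fst_setc z_setc => /(_ Yv zv) [].
  rewrite EA1 -/(x o1 _) x_setc0 => e _; move: e; set u := setc _ _ _ => e.
  rewrite add0r e [RHS]mulrC; exact: regroup.
have C0 v : Y (fstv v) -> z v != 0 -> C v = 0.
  move: v; apply: dense_fibre; first exact: fC.1.
  by move=> v Yv zv xv; apply: (mulfI (expf_neq0 k (xv o2))); rewrite mulr0; have [] := S2 v Yv zv.
have fzx i : form cX (bideg 2 1) (fun v => z v ^+ 2 * x i v).
  by apply: form_deg (formM (formX 2 form_z) (form_x i)) => -[[]|[]].
have reg B i v : form cX (bideg (2 * k + 1) (k + t)) B -> X v -> z v != 0 -> x i v != 0 ->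
    regular_at cX X (bidegree 1 t) v (fun v => B v / (z v ^+ 2 * x i v) ^+ k).
  move=> fB Xv zv xv; apply: (regular_frac HX Xv fB (formX k (fzx i))).
    by rewrite expf_neq0 // mulf_neq0 // expf_neq0.
  by case=> [[]|[]] /=; lia.
have dg B i : form cX (fun j => bideg (2 * k + 1) (2 * k + t) j - k * (cX (inr i) == j))%N B ->
    form cX (bideg (2 * k + 1) (k + t)) B.
  by apply: form_deg => -[[]|[]] /=; lia.
pose eta (i : 'I_3) v : K := match nat_of_ord i with
  | 0 => (- 1 * E v) / (z v ^+ 2 * x o0 v) ^+ k
  | 1 => B1 v / (z v ^+ 2 * x o1 v) ^+ k
  | _ => B2 v / (z v ^+ 2 * x o2 v) ^+ k end.
have I3 (Q : 'I_3 -> Prop) : Q o0 -> Q o1 -> Q o2 -> forall i, Q i.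
  move=> q0 q1 q2 [[|[|[|//]]] lt].
  - by rewrite (_ : Ordinal lt = o0) //; exact: val_inj.
  - by rewrite (_ : Ordinal lt = o1) //; exact: val_inj.
  by rewrite (_ : Ordinal lt = o2) //; exact: val_inj.
have XY v : X v -> Y (fstv v) by move=> /times_projE [].
have fieldK a b c' d g h (a0 : a != 0) (b0 : b != 0) (d0 : d != 0) : c' = b ^+ k * g + a ^+ k * h ->
    c' / (d ^+ 2 * a * b) ^+ k = h / (d ^+ 2 * b) ^+ k - (- 1 * g) / (d ^+ 2 * a) ^+ k :> K.
  by move=> ->; rewrite !exprMn; apply: cech_split; rewrite expf_neq0.
have e01 v : X v -> z v != 0 -> x o0 v != 0 -> x o1 v != 0 -> th o0 o1 v = eta o1 v - eta o0 v.
  move=> Xv zv x0 x1; rewrite thE // /eta /=; apply: fieldK => //.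
  by rewrite E1 EA1 C0 ?add0r //; exact: XY.
have e02 v : X v -> z v != 0 -> x o0 v != 0 -> x o2 v != 0 -> th o0 o2 v = eta o2 v - eta o0 v.
  move=> Xv zv x0 x2; rewrite thE // /eta /=; apply: fieldK => //.
  by rewrite E2; have [_ <-] := S2 v (XY v Xv) zv.
have e12 v : X v -> z v != 0 -> x o1 v != 0 -> x o2 v != 0 -> th o1 o2 v = eta o2 v - eta o1 v.
  move=> Xv zv x1 x2; rewrite thE // /eta /= (_ : B1 v = - 1 * (- B1 v)); last by rewrite mulN1r opprK.
  apply: fieldK => //.
  by have [_ e] := S1 v (XY v Xv) zv; rewrite e mulrN addKr.
exists eta; split.
  apply: (I3) => v Xv zv xv.
  - by rewrite /eta /=; apply: reg => //; apply: formZ; exact: dg fE.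
  - by rewrite /eta /=; apply: reg => //; exact: dg fB1.
  by rewrite /eta /=; apply: reg => //; exact: dg fB2.
have tii i v : X v -> z v != 0 -> x i v != 0 -> th i i v = 0.
  move=> Xv zv xv; have /eqP := cth i i i v Xv zv xv xv xv.
  by rewrite -subr_eq subrr eq_sym => /eqP.
have tsym i i' v : X v -> z v != 0 -> x i v != 0 -> x i' v != 0 -> th i' i v = - th i i' v.
  move=> Xv zv xv xv'; have := cth i i' i v Xv zv xv xv' xv; rewrite tii // => /eqP.
  by rewrite eq_sym addrC addr_eq0 => /eqP.
by apply: (I3); apply: (I3) => v Xv zv xv xv'; first [by rewrite tii // subrr | exact: e01 | exact: e02 |
  exact: e12 | by rewrite tsym // e01 // opprB | by rewrite tsym // e02 // opprB | by rewrite tsym // e12 // opprB].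
Qed.
End Fibre.

(* Leray's argument for the affine cover by the [D(y_l q_i)]: fibrewise the cocycle is a
   coboundary, and what remains comes from cocycles on [Y]. *)
Lemma product_acyc (t : nat) : acyc cY Y (fun=> 1) Y -> acyc cX X (bidegree 1 t) X.
Proof.
move=> aY A U g oU UX XU Hg cg.
pose PI := ('I_n.+1 * 'I_3)%type; pose FF (p : PI) := Fl p.1 p.2.
have fFF p : form cX (bideg 1 1) (FF p) := form_Fl p.1 p.2.
have oD p : zopen_in cX X (basic X (FF p)) := zopen_form HX (fFF p).
have exH (p : PI) : exists h : A -> vec K IX -> K,
    (forall a, line_bundle cX X (bidegree 1 t) (fun v => U a v /\ basic X (FF p) v) (h a)) /\
    forall a b v, U a v /\ basic X (FF p) v -> U b v /\ basic X (FF p) v -> g a b v = h b v - h a v.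
  apply: (affine_acyc HX (F := FF p) (a := bideg 1 1) _ _ _
    (U := fun a v => U a v /\ basic X (FF p) v) (g := g)).
  - exact: fFF.
  - by case=> [[]|[]].
  - by move=> v; exact: Fl_point.
  - by move=> a; exact: zopen_and.
  - by move=> a v [].
  - by move=> v bv; have [a Ua] := XU v bv.1; exists a.
  - by move=> a b v [[h1 h2] [h3 h4]]; exact: Hg.
  by move=> a b e v [h1 _] [h2 _] [h3 _]; exact: cg.
pose H p := proj1_sig (constructive_indefinite_description _ (exH p)).
have HP p := proj2_sig (constructive_indefinite_description _ (exH p)).
have sA v : X v -> {a | U a v} by move=> /XU; exact: constructive_indefinite_description.
(* The difference of two splittings of [g] does not depend on the index [a], which is chosen at each
   point; it is a cocycle for the cover by the affine sets. *)
pose th p p' v : K := if excluded_middle_informative (X v) is left Xv then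
  H p (proj1_sig (sA v Xv)) v - H p' (proj1_sig (sA v Xv)) v else 0.
have thE p p' a v : U a v -> FF p v != 0 -> FF p' v != 0 -> th p p' v = H p a v - H p' a v.
  move=> Ua pv pv'; rewrite /th; case: excluded_middle_informative => [Xv|[]]; last exact: UX Ua.
  case: (sA v Xv) => b Ub /=.
  have := (HP p).2 a b v (conj Ua (conj Xv pv)) (conj Ub (conj Xv pv)).
  rewrite ((HP p').2 a b v (conj Ua (conj Xv pv')) (conj Ub (conj Xv pv'))) => e.
  have -> : H p b v = H p b v - H p a v + H p a v by rewrite subrK.
  by rewrite -e addrAC [H p' b v - _]addrC addrK addrC.
have rth p p' v : X v -> FF p v != 0 -> FF p' v != 0 -> regular_at cX X (bidegree 1 t) v (th p p').
  move=> Xv pv pv'; have [a Ua] := XU v Xv.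
  have rr := regularB HX ((HP p).1 a v (conj Ua (conj Xv pv))) ((HP p').1 a v (conj Ua (conj Xv pv'))).
  apply: (regular_near HX _ rr).
  apply: (@near_open _ _ _ _ _ HX (fun v => U a v /\ (basic X (FF p) v /\ basic X (FF p') v))) => //.
    by apply: zopen_and => //; exact: zopen_and.
  by move=> u [Uu [[_ pu] [_ pu']]]; rewrite (thE p p' a).
have cth p p' p'' v : X v -> FF p v != 0 -> FF p' v != 0 -> FF p'' v != 0 ->
    th p p'' v = th p p' v + th p' p'' v.
  by move=> Xv h1 h2 h3; have [a Ua] := XU v Xv; rewrite !(thE _ _ a) // addrA subrK.
have exE (l : 'I_n.+1) := @cech_fibre t l (fun i i' => th (l, i) (l, i'))
  (fun i i' v Xv zv xv xv' => rth (l, i) (l, i') v Xv (mulf_neq0 zv xv) (mulf_neq0 zv xv'))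
  (fun i i' i'' v Xv zv xv xv' xv'' => cth (l, i) (l, i') (l, i'') v Xv
    (mulf_neq0 zv xv) (mulf_neq0 zv xv') (mulf_neq0 zv xv'')).
pose eta l := proj1_sig (constructive_indefinite_description _ (exE l)).
have etaP l := proj2_sig (constructive_indefinite_description _ (exE l)).
(* After this correction the cocycle is trivial along the coordinates of the plane, so [ps] depends
   only on the indices of the coordinates of [Y]. *)
pose th' (p p' : PI) v := th p p' v - (eta p'.1 p'.2 v - eta p.1 p.2 v).
have FFn p v : FF p v != 0 -> v (inl p.1) != 0 /\ v (inr p.2) != 0.
  by rewrite mulf_eq0 negb_or => /andP.
have cth' p p' p'' v : X v -> FF p v != 0 -> FF p' v != 0 -> FF p'' v != 0 ->
    th' p p'' v = th' p p' v + th' p' p'' v.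
  by move=> Xv h1 h2 h3; rewrite /th' (cth p p' p'') //; move: (th _ _ v) (th _ _ v) (eta _ _ v) (eta _ _ v)
    (eta _ _ v) => a b x y z; ring.
have th'0 l i i' v : X v -> FF (l, i) v != 0 -> FF (l, i') v != 0 -> th' (l, i) (l, i') v = 0.
  move=> Xv h1 h2; have [z1 x1] := FFn _ _ h1; have [_ x2] := FFn _ _ h2.
  by rewrite /th' /= (etaP l).2 // subrr.
have exi v : X v -> exists i : 'I_3, v (inr i) != 0.
  by move=> /times_projE [_ /(_ tt) [i _]]; rewrite ffunE; exists i.
pose ii v : 'I_3 := if [pick i : 'I_3 | v (inr i) != 0] is Some i then i else ord0.
have iiP v : X v -> v (inr (ii v)) != 0.
  by move=> /exi [i vi]; rewrite /ii; case: pickP => // /(_ i); rewrite vi.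
pose ps l l' v := th' (l, ii v) (l', ii v) v.
have psE l l' i i' v : X v -> v (inl l) != 0 -> v (inl l') != 0 -> v (inr i) != 0 -> v (inr i') != 0 ->
    ps l l' v = th' (l, i) (l', i') v.
  move=> Xv zl zl' xi xi'; have xv := iiP v Xv.
  rewrite /ps (cth' _ (l, i)) ?(th'0 l) ?add0r //; try exact: mulf_neq0.
  by rewrite (cth' _ (l', i')) ?(th'0 l') ?addr0 //; exact: mulf_neq0.
have rps l l' v : X v -> v (inl l) != 0 -> v (inl l') != 0 -> regular_at cX X (bidegree 1 t) v (ps l l').
  move=> Xv zl zl'; have [i xi] := exi v Xv.
  have h1 : FF (l, i) v != 0 by exact: mulf_neq0.
  have h2 : FF (l', i) v != 0 by exact: mulf_neq0.
  have rr := regularB HX (rth (l, i) (l', i) v Xv h1 h2)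
    (regularB HX ((etaP l').1 i v Xv zl' xi) ((etaP l).1 i v Xv zl xi)).
  apply: (regular_near HX _ rr).
  apply: (@near_open _ _ _ _ _ HX (fun v => basic X (FF (l, i)) v /\ basic X (FF (l', i)) v)) => //.
    exact: zopen_and.
  move=> u [[Xu pu] [_ pu']]; have [z1 x1] := FFn _ _ pu; have [z2 _] := FFn _ _ pu'.
  by rewrite (psE l l' i i).
have [N [w [L [pw interp]]]] := emon_interp K 2 t.
pose C l l' mu := coef w L (ps l l') mu.
have fstz l y q : (pairv y q : vec K IX) (inl l) = y l by rewrite ffunE.
have rpsq l l' y : Y y -> y l != 0 -> y l' != 0 ->
    forall q, is_point cP q -> regular_at cX X (bidegree 1 t) (pairv y q) (ps l l').
  by move=> Yy yl yl' q pq; apply: rps; rewrite ?fstz //; exact: pairX.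
(* The coefficient of each monomial in [q] is a cocycle of O(1) on [Y], which splits by
   hypothesis. *)
have exe (mu : Mon 2 t) : exists e : 'I_n.+1 -> vec K 'I_n.+1 -> K,
    (forall l, line_bundle cY Y (fun=> 1) (fun y => Y y /\ y l != 0) (e l)) /\
    forall l l' y, Y y /\ y l != 0 -> Y y /\ y l' != 0 -> C l l' mu y = e l' y - e l y.
  apply: (aY _ (fun l y => Y y /\ y l != 0) (fun l l' => C l l' mu)).
  - by move=> l; exact: (zopen_form HY (form_var K cY l)).
  - by move=> l y [].
  - by move=> y Yy; have [l _ yl] := zclosed_point HY Yy tt; exists l.
  - by move=> l l' y [[Yy yl] [_ yl']]; apply: coef_regular => //; exact: rpsq.
  move=> l l' l'' y [Yy yl] [_ yl'] [_ yl'']; rewrite /C /coef -big_split /=; apply: eq_bigr => a _.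
  have Xa := pairX Yy (pw a); have xa := iiP _ Xa; rewrite -mulrDr; congr (_ * _).
  by rewrite /ps (cth' _ (l', ii (pairv y (w a)))) //; apply: mulf_neq0 => //; rewrite /= fstz.
pose e mu := proj1_sig (constructive_indefinite_description _ (exe mu)).
have eP mu := proj2_sig (constructive_indefinite_description _ (exe mu)).
pose et' l v := \sum_mu e mu l (fstv v) * emon mu (nq (sndv v)).
have psC l l' v : X v -> v (inl l) != 0 -> v (inl l') != 0 -> ps l l' v = et' l' v - et' l v.
  move=> Xv zl zl'; have /times_projE [Yv pv] := Xv.
  have fl k : fstv v k = v (inl k) by rewrite ffunE.
  have [h1 h2] : fstv v l != 0 /\ fstv v l' != 0 by rewrite !fl.
  rewrite -{1}(pair_eta v) (coefP pw interp (rpsq l l' _ Yv h1 h2) pv).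
  rewrite /et' -sumrB; apply: eq_bigr => mu _; rewrite -mulrBl; congr (_ * _).
  by apply: (eP mu).2; rewrite fl.
pose et (p : PI) v := eta p.1 p.2 v + et' p.1 v.
have thet p p' v : X v -> FF p v != 0 -> FF p' v != 0 -> th p p' v = et p' v - et p v.
  move=> Xv h1 h2; have [z1 x1] := FFn _ _ h1; have [z2 x2] := FFn _ _ h2.
  have := psE p.1 p'.1 p.2 p'.2 v Xv z1 z2 x1 x2; rewrite psC // /th' -!surjective_pairing /et => E.
  by rewrite -[th p p' v](subrK (eta p'.1 p'.2 v - eta p.1 p.2 v)) -E; ring.
have ret p v : X v -> FF p v != 0 -> regular_at cX X (bidegree 1 t) v (et p).
  move=> Xv h1; have [z1 x1] := FFn _ _ h1; apply: regularD => //; first exact: (etaP p.1).1.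
  have /times_projE [Yv _] := Xv; have fl : fstv v p.1 != 0 by rewrite ffunE.
  by apply: (@regular_combo t v (fun mu => e mu p.1)) => // mu; exact: ((eP mu).1 p.1 (fstv v) (conj Yv fl)).
pose pp v : PI := if [pick p | FF p v != 0] is Some p then p else (ord0, ord0).
have exp v : X v -> exists p, FF p v != 0.
  move=> Xv; have [i xi] := exi v Xv; have /times_projE [Yv _] := Xv.
  have [l _] := zclosed_point HY Yv tt; rewrite ffunE => zl; exists (l, i); exact: mulf_neq0.
have ppP v : X v -> FF (pp v) v != 0.
  by move=> /exp [p vp]; rewrite /pp; case: pickP => // /(_ p); rewrite vp.
(* Corrected by [et], the splittings over the affine sets agree and glue. *)
pose h a v := H (pp v) a v + et (pp v) v.
have hE a p v : U a v -> FF p v != 0 -> h a v = H p a v + et p v.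
  move=> Ua pv; have Xv := UX _ _ Ua; have ppv := ppP v Xv.
  have := thet (pp v) p v Xv ppv pv; rewrite (thE _ _ a) // /h => E.
  by rewrite -[H (pp v) a v](subrK (H p a v)) E; ring.
exists h; split=> [a v Ua|a b v Ua Ub].
  have Xv := UX _ _ Ua; have [p pv] := exp v Xv.
  have rr := regularD HX ((HP p).1 a v (conj Ua (conj Xv pv))) (ret p v Xv pv).
  apply: (regular_near HX _ rr).
  apply: (@near_open _ _ _ _ _ HX (fun v => U a v /\ basic X (FF p) v)) => //; first exact: zopen_and.
  by move=> u [Uu [_ pu]]; rewrite (hE a p).
have Xv := UX _ _ Ua; have [p pv] := exp v Xv.
by rewrite !(hE _ p) // ((HP p).2 a b v (conj Ua (conj Xv pv)) (conj Ub (conj Xv pv))) opprD addrACA subrr addr0.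
Qed.

Lemma product_global_sections (t alpha : nat) (s : 'I_alpha -> vec K 'I_n.+1 -> K) :
  (forall f, line_bundle cY Y (fun=> 1) Y f -> exists x : 'I_alpha -> K, forall y, Y y -> f y = \sum_k x k * s k y) ->
  forall f, line_bundle cX X (bidegree 1 t) X f -> exists x : 'I_alpha * Mon 2 t -> K,
    forall v, X v -> f v = \sum_b x b * (s b.1 (fstv v) * emon b.2 (nq (sndv v))).
Proof.
move=> Hs f Hf; have [N [w [L [pw interp]]]] := emon_interp K 2 t.
have rf y (Yy : Y y) q (pq : is_point cP q) : regular_at cX X (bidegree 1 t) (pairv y q) f.
  by apply: Hf; exact: pairX.
have ex (mu : Mon 2 t) : exists x : 'I_alpha -> K, forall y, Y y -> coef w L f mu y = \sum_k x k * s k y.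
  by apply: Hs => y Yy; apply: coef_regular => //; exact: rf.
pose x mu := proj1_sig (constructive_indefinite_description _ (ex mu)).
have xP mu := proj2_sig (constructive_indefinite_description _ (ex mu)).
exists (fun b => x b.2 b.1) => v Xv; have /times_projE [Yv pv] := Xv.
rewrite -{1}(pair_eta v) (coefP pw interp (rf _ Yv) pv).
have -> : \sum_b x b.2 b.1 * (s b.1 (fstv v) * emon b.2 (nq (sndv v))) =
  \sum_k \sum_mu x mu k * (s k (fstv v) * emon mu (nq (sndv v))).
  by rewrite pair_bigA; apply: eq_bigr => -[].
rewrite exchange_big; apply: eq_bigr => mu _; rewrite xP // mulr_suml.
by apply: eq_bigr => k _; rewrite mulrA.
Qed.
End ProductSections.

(** * Jets and double points *)

Section Jets.
Variables (K : closedFieldType) (I J : finType) (c : I -> J).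
Variables (X : vec K I -> Prop) (HX : zclosed c X) (d : J -> int).
Implicit Types (f g h : vec K I -> K) (v u : vec K I).

Lemma msq_iff p f : X p -> in_max_ideal_sq c X d p f <->
  [/\ regular_at c X d p f, f p = 0 & forall u, tangent c X p u -> djet c X d p f u = 0].
Proof.
move=> Xp; split=> [|[rf f0 df]]; first exact: (max_ideal_sq_djet HX).
exact: (max_ideal_sq_of_djet HX Xp).
Qed.

Lemma near_eq_at p f f' : X p -> near_eq c X p f f' -> f p = f' p.
Proof. by move=> Xp [a [w [_ wp H]]]; exact: H. Qed.

Lemma msq_near p f f' : X p -> near_eq c X p f f' -> in_max_ideal_sq c X d p f ->
  in_max_ideal_sq c X d p f'.
Proof.
move=> Xp ff /(msq_iff _ Xp) [rf f0 df]; apply/(msq_iff _ Xp); split.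
- exact: (regular_near HX ff rf).
- by rewrite -(near_eq_at Xp ff).
by move=> u tu; rewrite -(djet_near HX ff rf tu) df.
Qed.

Lemma msqB p f f' : X p -> in_max_ideal_sq c X d p f -> in_max_ideal_sq c X d p f' ->
  in_max_ideal_sq c X d p (fun v => f v - f' v).
Proof.
move=> Xp /(msq_iff _ Xp) [rf f0 df] /(msq_iff _ Xp) [rf' f0' df']; apply/(msq_iff _ Xp); split.
- exact: regularB.
- by rewrite f0 f0' subrr.
by move=> u tu; rewrite djetB // df // df' // subrr.
Qed.

Lemma msqN p f : X p -> in_max_ideal_sq c X d p f -> in_max_ideal_sq c X d p (fun v => - f v).
Proof.
move=> Xp mf; have m0 : in_max_ideal_sq c X d p (fun v => f v - f v).
  exact: msqB.
apply: (msq_near Xp _ (msqB Xp m0 mf)).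
by apply: near_eq_ext => // v Xv; rewrite subrr sub0r.
Qed.

Lemma near_scale p l Q : (forall j, l j != 0) -> near_in c X p Q -> near_in c X (scale c l p) Q.
Proof.
move=> l0 /(near_inP HX) [Xp [a [w [fw wp H]]]]; apply/(near_inP HX).
split; first exact: zclosed_scale.
exists a, w; split=> //; rewrite fw.2 // mulf_neq0 //.
by apply/prodf_neq0 => j _; rewrite expf_neq0.
Qed.

Lemma regular_at_scale d' p l f : (forall j, l j != 0) -> regular_at c X d' p f ->
  regular_at c X d' (scale c l p) f.
Proof.
move=> l0 [a [b [g [h [hg hh ab H]]]]]; exists a, b, g, h; split=> //.
exact: near_scale.
Qed.

Lemma msq_scale p l f : (forall j, l j != 0) -> in_max_ideal_sq c X d p f ->
  in_max_ideal_sq c X d (scale c l p) f.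
Proof.
move=> l0 [n [a [b [s [H near]]]]]; exists n, a, b, s; split; last exact: near_scale.
have mx g : in_max_ideal c X p g -> in_max_ideal c X (scale c l p) g.
  case=> rg g0; split; first exact: regular_at_scale.
  by rewrite (regular_scale HX rg l0) g0 mulr0.
by move=> k; have [ha hb hs] := H k; split; [exact: mx | exact: mx | exact: regular_at_scale].
Qed.

Lemma scaleK l v : (forall j, l j != 0) -> scale c (fun j => (l j)^-1) (scale c l v) = v.
Proof. by move=> l0; apply/ffunP => i; rewrite !ffunE mulKf. Qed.

Variable z : nat.

(** Surjectivity of the map from global sections to the sum of the stalks modulo squares of maximal
    ideals; the next lemmas are the two halves of its exact sequence with the first cohomology. *)
Definition jets_onto (p : 'I_z -> vec K I) := forall t : 'I_z -> vec K I -> K,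
  (forall k, regular_at c X d (p k) (t k)) -> exists2 s, line_bundle c X d X s &
  forall k, in_max_ideal_sq c X d (p k) (fun v => s v - t k v).

Lemma onto_scale p (l : 'I_z -> J -> K) : (forall k j, l k j != 0) ->
  jets_onto (fun k => scale c (l k) (p k)) -> jets_onto p.
Proof.
move=> l0 H t rt; have [|s Hs Hm] := H t; first by move=> k; exact: regular_at_scale.
exists s => // k; rewrite -(scaleK (p k) (l0 k)); apply: msq_scale => // j.
by rewrite invr_eq0.
Qed.

(** A cocycle of the twist splits in O(d). The splittings on different members of the cover have the
    same jets at the points, and one global section with these jets corrects all of them. *)
Lemma h1_of_onto p : (forall k, X (p k)) -> h1_vanishes c X (line_bundle c X d) -> jets_onto p ->
  h1_vanishes c X (double_points_twist c X d p).
Proof.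
move=> Xp H1 onto A U g [oU cU] Hg cg.
have [B [V [tau [h [[oV cV] VU Hh hE]]]]] := H1 A U g (conj oU cU) (fun a b => (Hg a b).1) cg.
pose bk k := proj1_sig (constructive_indefinite_description _ (cV (p k) (Xp k))).
have bkP k : V (bk k) (p k) := proj2_sig (constructive_indefinite_description _ (cV (p k) (Xp k))).
have [|s Hs Hm] := onto (fun k => h (bk k)); first by move=> k; exact: Hh.
have VX b v : V b v -> X v by move=> Vb; exact: zopen_sub (oV b) Vb.
exists B, V, tau, (fun b v => h b v - s v); split=> //.
  move=> b; split=> [q Vq|k Vk].
    by apply: regularB => //; [exact: Hh | apply: Hs; exact: VX Vq].
  have Xk := Xp k; have Vbk := bkP k.
  have mg : in_max_ideal_sq c X d (p k) (g (tau (bk k)) (tau b)).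
    by apply: (Hg _ _).2; split; exact: VU.
  apply: (msq_near Xk _ (msqB Xk mg (Hm k))).
  apply: (@near_open _ _ _ _ _ HX (fun v => V (bk k) v /\ V b v)) => //; first exact: zopen_and.
  by move=> v [V1 V2]; rewrite (hE _ _ v V1 V2) opprB addrA subrK.
by move=> b b' v Vb Vb'; rewrite (hE b b') // opprB addrA subrK.
Qed.

Hypothesis separated : forall p v, X p -> X v -> same_point c p v \/
  exists a f, [/\ form c a f, f p = 0 & f v != 0].

(** The prescribed local sections near the points, and 0 on open sets avoiding the points, have
    differences in the twist; a splitting of this cocycle glues them to a global section. *)
Lemma onto_of_h1 p : (forall k, X (p k)) -> (forall k l, k != l -> ~ same_point c (p k) (p l)) ->
  h1_vanishes c X (double_points_twist c X d p) -> jets_onto p.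
Proof.
move=> Xp dist H1 t rt.
have ex1 k : exists h b, [/\ form c b h, h (p k) != 0 & forall v, X v -> h v != 0 -> regular_at c X d v (t k)].
  have /(regular_atP HX) [g [h [a [b [fg fh ab [_ hp] E]]]]] := rt k.
  exists h, b; split=> // v Xv hv; apply/(regular_atP HX); exists g, h, a, b; split=> //.
pose h k := proj1_sig (constructive_indefinite_description _ (ex1 k)).
have hP k := proj2_sig (constructive_indefinite_description _ (ex1 k)).
have ex2 (kl : 'I_z * 'I_z) : exists f b, form c b f /\ (kl.1 != kl.2 -> f (p kl.2) = 0 /\ f (p kl.1) != 0).
  case: eqVneq => [e|kl12]; first by exists (fun=> 0), (fun=> 0%N); split=> //; exact: form0.
  have [/dist|[a [f [ff f0 f1]]]] := separated (Xp kl.2) (Xp kl.1).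
    by rewrite eq_sym => /(_ kl12).
  by exists f, a.
pose phi kl := proj1_sig (constructive_indefinite_description _ (ex2 kl)).
have phiP kl := proj2_sig (constructive_indefinite_description _ (ex2 kl)).
pose ph kl := if kl.1 == kl.2 then (fun=> 1 : K) else phi kl.
have phF kl : exists b, form c b (ph kl).
  rewrite /ph; case: ifP => _; first by exists (fun=> 0%N); exact: form_cst.
  by have [b [fb _]] := phiP kl; exists b.
pose bp kl := proj1_sig (constructive_indefinite_description _ (phF kl)).
have bpP kl := proj2_sig (constructive_indefinite_description _ (phF kl)).
(* Nonzero at [p k] and zero at the other points. Each [p k] thus lies in only one member of the
   cover, where the differences are trivially in the twist. *)
pose W k v := h k v * \prod_l ph (k, l) v.
have fW k : exists b, form c b (W k).
  have [b [fb _ _]] := hP k; eexists; apply: formM; first exact: fb.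
  exact: (form_prod _ (fun l => bpP (k, l))).
have Wk k : W k (p k) != 0.
  have [b [_ hk _]] := hP k; rewrite mulf_neq0 //; apply/prodf_neq0 => l _.
  rewrite /ph /=; case: (eqVneq k l) => [_|kl] /=; first by rewrite oner_eq0.
  by have [b' [_ /(_ kl) []]] := phiP (k, l).
have Wl k l : k != l -> W k (p l) = 0.
  move=> kl; rewrite /W (bigD1 l) //= /ph /= (negbTE kl).
  have [b' [_ /(_ kl) [e _]]] := phiP (k, l); have {e} e : phi (k, l) (p l) = 0 by exact: e.
  by rewrite e mul0r mulr0.
pose A := ('I_z + {f | (exists a, form c a f) /\ forall k, f (p k) = 0})%type.
pose U (a : A) v := X v /\ match a with inl k => W k v != 0 | inr f => proj1_sig f v != 0 end.
pose T (a : A) v := match a with inl k => t k v | inr _ => 0 end.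
have oU a : zopen_in c X (U a).
  case: a => [k|[f [[a ff] f0]]]; last exact: (zopen_form HX ff).
  by have [b fb] := fW k; exact: (zopen_form HX fb).
have cU v : X v -> exists a, U a v.
  move=> Xv; have [[k [l l0 lE]]|N] := classic (exists k, same_point c (p k) v).
    exists (inl k); split=> //; have [b fb] := fW k.
    have -> : v = scale c l (p k) by apply/ffunP => i; rewrite lE ffunE.
    by rewrite fb.2 // mulf_neq0 // ; apply/prodf_neq0 => j _; rewrite expf_neq0.
  have ex3 k : exists f a, [/\ form c a f, f (p k) = 0 & f v != 0].
    have [sp|[a [f [ff f0 f1]]]] := separated (Xp k) Xv; last by exists f, a.
    by case: N; exists k.
  pose f k := proj1_sig (constructive_indefinite_description _ (ex3 k)).
  have fP k := proj2_sig (constructive_indefinite_description _ (ex3 k)).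
  pose fa k := proj1_sig (constructive_indefinite_description _ (fP k)).
  have faP k : [/\ form c (fa k) (f k), f k (p k) = 0 & f k v != 0] :=
    proj2_sig (constructive_indefinite_description _ (fP k)).
  have F1 : (exists a, form c a (fun v => \prod_k f k v)) /\ forall k, \prod_l f l (p k) = 0.
    split; first by eexists; apply: form_prod => k; have [fk _ _] := faP k; exact: fk.
    by move=> k; rewrite (bigD1 k) //=; have [_ -> _] := faP k; rewrite mul0r.
  exists (inr (exist _ (fun v => \prod_k f k v) F1)); split=> //=.
  by apply/prodf_neq0 => k _; have [] := faP k.
have rT a v : U a v -> regular_at c X d v (T a).
  case: a => [k|f] [Xv Wv]; last exact: regular0.
  have [b [_ _]] := hP k; apply=> //.
  by move: Wv; rewrite /= mulf_eq0 negb_or => /andP [].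
have Ua k a : U a (p k) -> a = inl k.
  case: a => [l|[f [ff f0]]] [_ /=]; last by rewrite f0 eqxx.
  by case: (eqVneq l k) => [->|lk] //; rewrite Wl ?eqxx.
have [||B [V [tau [e [[oV cV] VU He eE]]]]] := H1 A U (fun a b v => T b v - T a v) (conj oU cU).
- move=> a b; split=> [v [Uav Ubv]|k [Uak Ubk]]; first by apply: regularB => //; exact: rT.
  rewrite (Ua k a Uak) (Ua k b Ubk); apply/(msq_iff _ (Xp k)); split.
  + by apply: regularB => //; exact: rt.
  + by rewrite subrr.
  by move=> u tu; rewrite djetB ?subrr //; exact: rt.
- by move=> a b e v _ _ _; rewrite [RHS]addrC addrA subrK.
have sB v : X v -> {b | V b v} by move=> /cV; exact: constructive_indefinite_description.
pose s v := if excluded_middle_informative (X v) is left h then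
  T (tau (proj1_sig (sB v h))) v - e (proj1_sig (sB v h)) v else 0.
have sE b v : V b v -> s v = T (tau b) v - e b v.
  move=> Vb; rewrite /s; case: excluded_middle_informative => [Xv|[]]; last exact: zopen_sub (oV b) Vb.
  case: (sB v Xv) => b' Vb' /=; have := eE b b' v Vb Vb' => E.
  by rewrite -[T (tau b') v](subrK (T (tau b) v)) E; move: (T _ _) (e _ _) (e _ _) => x y w; ring.
have s_near b v : V b v -> near_eq c X v (fun v => T (tau b) v - e b v) s.
  move=> Vb; apply: (@near_open _ _ _ _ _ HX (V b)) => // u Vu.
  by rewrite (sE b).
exists s.
  move=> v Xv; have [b Vb] := cV v Xv; apply: (regular_near HX (s_near b v Vb)).
  by apply: regularB => //; [apply: rT; exact: VU | exact: (He b).1].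
move=> k; have [b Vb] := cV (p k) (Xp k).
have tb : tau b = inl k by apply: Ua; exact: VU.
apply: (msq_near (Xp k) _ (msqN (Xp k) ((He b).2 k Vb))).
apply: (@near_open _ _ _ _ _ HX (V b)) => // u Vu.
by rewrite (sE b) // tb /= addrAC subrr add0r.
Qed.
End Jets.

(** * Polynomial frames of tangent spaces *)

Lemma frank_surj (K : closedFieldType) (A B : finType) (F : A -> B -> K) : (#|A| <= frank F)%N ->
  forall phi : A -> K, exists x : B -> K, forall a, \sum_b F a b * x b = phi a.
Proof.
move=> le phi; set M := \matrix_(i < #|A|, j < #|B|) F (enum_val i) (enum_val j).
have full : row_full M^T.
  by rewrite /row_full mxrank_tr eqn_leq rank_leq_row.
pose f : 'rV[K]_#|A| := \row_i phi (enum_val i).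
have /submxP [y yE] : (f <= M^T)%MS by exact: submx_full.
exists (fun b => y 0 (enum_rank b)) => a.
have /rowP /(_ (enum_rank a)) := yE; rewrite !mxE enum_rankK => ->.
rewrite (reindex (@enum_val B predT)) /=; last by apply: onW_bij; exact: enum_val_bij.
by apply: eq_bigr => j _; rewrite !mxE enum_rankK enum_valK mulrC.
Qed.

Lemma frank_of_surj (K : closedFieldType) (A B : finType) (F : A -> B -> K) :
  (forall phi : A -> K, exists x : B -> K, forall a, \sum_b F a b * x b = phi a) -> (#|A| <= frank F)%N.
Proof.
move=> H; set M := \matrix_(i < #|A|, j < #|B|) F (enum_val i) (enum_val j).
suff : row_full M^T by rewrite /row_full mxrank_tr /frank => /eqP ->.
rewrite -sub1mx; apply/row_subP => i; have [x xE] := H (fun a => (a == enum_val i)%:R).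
apply/submxP; exists (\row_j x (enum_val j)); apply/rowP => l; rewrite !mxE.
have := xE (enum_val l); rewrite (inj_eq enum_val_inj) eq_sym => <-.
rewrite (reindex (@enum_val B predT)) /=; last by apply: onW_bij; exact: enum_val_bij.
by apply: eq_bigr => j _; rewrite !mxE mulrC.
Qed.

Lemma rank_castmx (K : fieldType) m n m' n' (e : (m = m') * (n = n')) (A : 'M[K]_(m, n)) :
  \rank (castmx e A) = \rank A.
Proof. by case: e => e1 e2; destruct e1, e2; rewrite castmx_id. Qed.

Lemma complement_ex (K : fieldType) k R (G : 'M[K]_(k, R + k)) : row_free G ->
  exists C : 'M[K]_(R, R + k), col_mx C G \in unitmx.
Proof.
move=> fG; have rk : \rank (G^C)%MS = R by rewrite mxrank_compl (eqP fG) addnK.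
exists (castmx (rk, erefl) (row_base (G^C)%MS)); rewrite -row_full_unit -sub1mx.
rewrite -addsmxE (adds_eqmx (eqmx_trans (eqmx_cast _ _) (eq_row_base _)) (eqmx_refl G)).
by rewrite addsmxC sub1mx addsmx_compl_full.
Qed.

Lemma proj_separated (K : closedFieldType) n (p v : vec K 'I_n.+1) :
  is_point (@proj_col n) p -> is_point (@proj_col n) v -> same_point (@proj_col n) p v \/
  exists a f, [/\ form (@proj_col n) a f, f p = 0 & f v != 0].
Proof.
move=> /(_ tt) [i _ pi] /(_ tt) [i' _ vi'].
have [E|N] := classic (forall j, v j * p i = v i * p j).
  have vi : v i != 0.
    by apply/eqP => vi; have := E i'; rewrite vi mul0r => /eqP; rewrite mulf_eq0 (negbTE pi) (negbTE vi').
  left; exists (fun=> v i / p i) => [_|j]; first by rewrite mulf_neq0 ?invr_eq0.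
  by apply: (mulIf pi); rewrite E mulrAC divfK.
have [j Ej] := not_all_ex_not _ _ N; right.
exists (fun=> 1%N), (fun w => p i * w j + - p j * w i); split.
- by apply: formD; apply: formZ; apply: form_deg (form_var K (@proj_col n) _) => -[].
- by rewrite mulNr mulrC subrr.
by apply/eqP => e; apply: Ej; apply/eqP; rewrite -subr_eq0 -[X in _ == X]e; apply/eqP; ring.
Qed.

Section OnY.
Variables (K : closedFieldType) (n r alpha : nat).
Hypothesis charK : [pchar K] =i pred0.
Let cY := @proj_col n.
Variables (Y : vec K 'I_n.+1 -> Prop) (HY : zclosed cY Y) (IY : zirreducible cY Y).
Hypothesis Ydim : has_dim cY Y r.
Implicit Types (y u : vec K 'I_n.+1).

Let HI : #|{: unit}| = 1%N. Proof. exact: card_unit. Qed.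

(* The tangent spaces near a regular point are spanned by vectors depending polynomially on the
   point: columns of the adjugate of the matrix formed by the gradients of local equations and by
   constant rows completing them. *)
Lemma tangent_frame y0 : regular_point cY Y y0 -> exists (Om : vec K 'I_n.+1 -> K)
    (tau : 'I_r.+1 -> vec K 'I_n.+1 -> vec K 'I_n.+1) (ell : 'I_r.+1 -> vec K 'I_n.+1 -> K)
    (det : vec K 'I_n.+1 -> K),
  [/\ polyf Om, exists2 y, Y y & Om y != 0,
      forall j i, polyf (fun y => tau j y i), (forall j, form cY (fun=> 1%N) (ell j) /\ forall y u, D (ell j) y u = ell j u) &
      forall y, Y y -> Om y != 0 ->
        [/\ det y != 0, forall j, tangent cY Y y (tau j y),
            forall u, tangent cY Y y u -> u = [ffun i => \sum_j (ell j u / det y) * tau j y i],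
            forall j j', ell j (tau j' y) = (j == j')%:R * det y &
            exists k (A : 'M[K]_(k, #|'I_n.+1|)), conormal cY Y y A /\ (k + r = n)%N]].
Proof.
move=> ry0; have Yy0 := ry0.1.
have [k [A HA]] := conormal_ex cY Y y0.
have kr : (k + r = n)%N.
  by have := regular_point_codim HY Yy0 HA Ydim ry0; rewrite card_ord HI; lia.
have [d [[h0 [ph0 [yh Yyh h0yh] Hd]] Hch]] := dimension charK HY IY.
have dr : (r.+1 <= d)%N by have := Hch r Ydim.1; rewrite HI addn1.
have [fA HA2 HA3] := HA.
have ex1 b : exists f, (exists a, form cY a f) /\ vanish Y f /\ row b A = grad f y0.
  by have [a [f [h1 h2 h3]]] := HA2 b; exists f; split; [exists a|].
pose f b := proj1_sig (constructive_indefinite_description _ (ex1 b)).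
have fP b : (exists a, form cY a (f b)) /\ vanish Y (f b) /\ row b A = grad (f b) y0 :=
  proj2_sig (constructive_indefinite_description _ (ex1 b)).
have pf b : polyf (f b) by have [[a [pf _]] _] := fP b.
have eN : (r.+1 + k)%N = #|'I_n.+1| by rewrite card_ord -kr; lia.
pose e (i : 'I_(r.+1 + k)) : 'I_n.+1 := enum_val (cast_ord eN i).
pose e' (i : 'I_n.+1) : 'I_(r.+1 + k) := cast_ord (esym eN) (enum_rank i).
have ee' i : e (e' i) = i by rewrite /e /e' cast_ordKV enum_rankK.
have e'e i : e' (e i) = i by rewrite /e /e' enum_valK cast_ordK.
have be : {on predT, bijective e} by apply: onW_bij; exists e'.
pose G y : 'M[K]_(k, r.+1 + k) := \matrix_(b, i) D (f b) y (basev K (e i)).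
have GA : G y0 = castmx (erefl, esym eN) A.
  apply/matrixP => b i; rewrite castmxE !mxE /= esymK cast_ord_id.
  by have [_ [_ /rowP /(_ (cast_ord eN i))]] := fP b; rewrite !mxE.
have fG : row_free (G y0).
  by rewrite /row_free GA rank_castmx.
have [C uC] := complement_ex fG.
pose S y := col_mx C (G y).
pose det y := \det (S y).
have pS i j : polyf (fun y => S y i j).
  rewrite /S; case: (splitP i) => b ib.
    have -> : i = lshift k b by apply: ord_inj.
    by apply: (polyf_ext (f := fun=> C b j)); [move=> y; rewrite col_mxEu | exact: polyf_cst].
  have -> : i = rshift r.+1 b by apply: ord_inj.
  apply: (polyf_ext (f := fun y => D (f b) y (basev K (e j)))); first by move=> y; rewrite col_mxEd mxE.
  exact: polyf_D.
have pdet : polyf det.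
  apply: (polyf_ext (f := fun y => \det (\matrix_(i, j) S y i j))); last exact: polyf_det.
  by move=> y; congr (\det _); apply/matrixP => i j; rewrite mxE.
have padj i j : polyf (fun y => (\adj (S y)) i j).
  apply: (polyf_ext (f := fun y => (-1) ^+ (j + i) *
    \det (\matrix_(a, b) S y (lift j a) (lift i b)))).
    by move=> y; rewrite mxE /cofactor; congr (_ * \det _); apply/matrixP => a b; rewrite !mxE.
  by apply: polyfM; [exact: polyf_cst | apply: polyf_det].
have det0 : det y0 != 0 by rewrite /det -unitfE -unitmxE.
have [v [Yv h0v dv]] := irr_dom HY IY ph0 pdet (ex_intro2 _ _ yh Yyh h0yh) (ex_intro2 _ _ y0 Yy0 det0).
pose tau (j : 'I_r.+1) y : vec K 'I_n.+1 := [ffun i => (\adj (S y)) (e' i) (lshift k j)].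
pose ell (j : 'I_r.+1) u := \sum_i C j (e' i) * u i.
exists (fun y => h0 y * det y), tau, ell, det; split.
- exact: polyfM.
- by exists v => //; rewrite mulf_neq0.
- by move=> j i; apply: (polyf_ext (f := fun y => (\adj (S y)) (e' i) (lshift k j))) => // y; rewrite ffunE.
- move=> j; split=> [|y u].
    apply: form_sum => i _; apply: formZ.
    by apply: form_deg (form_var K cY i) => -[].
  rewrite /ell D_sum => [|i]; last by apply: polyfM; [exact: polyf_cst | exact: polyf_var].
  by apply: eq_bigr => i _; rewrite DZ ?D_var //; exact: polyf_var.
move=> y Yy; rewrite mulf_eq0 negb_or => /andP [h0y dy].
have [k' [A' HA']] := conormal_ex cY Y y; have [fA' HA'2 HA'3] := HA'.
have uS : S y \in unitmx by rewrite unitmxE unitfE.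
(* [G y] is the lower block of an invertible matrix; the right half of an inverse is a right inverse
   of it. *)
have rG : \rank (G y) = k.
  have : row_free (S y) by rewrite row_free_unit.
  by move=> /row_freeP [B SB]; apply/eqP; apply/row_freeP; exists (rsubmx B);
    have := congr1 (@drsubmx K r.+1 k r.+1 k) SB;
    rewrite /S -[B in X in X -> _]hsubmxK mul_col_mx !mul_mx_row -[X in drsubmx X]/(block_mx _ _ _ _) block_mxKdr
     -[1%:M]submxK scalar_mx_block // ?block_mxKdr.
pose Gc := castmx (erefl k, eN) (G y).
have rowGc b : row b Gc = grad (f b) y.
  apply/rowP => i; rewrite !mxE castmxE !mxE /=; congr (D _ _ (basev K _)); first by rewrite cast_ord_id.
  by rewrite /e cast_ordKV.
have rGc : \rank Gc = k.
  by rewrite -[RHS]rG /Gc rank_castmx.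
have GA' : (Gc <= A')%MS.
  apply/row_subP => b; apply: HA'3; rewrite rowGc; have [[a fa] [va _]] := fP b.
  by exists a, (f b).
have kk' : (k <= k')%N by rewrite -rGc -(eqP fA'); exact: mxrankS.
(* From [d + k' <= n.+1], [r.+1 <= d] and [k + r = n] follows [k' <= k]: equations chosen at [y0]
   span the conormal space at [y] too. *)
have dk := Hd y k' A' Yy h0y HA'; rewrite card_ord in dk.
have k'k : k' = k by clear - dk kr dr kk'; lia.
have A'G : (A' <= Gc)%MS.
  by have [_ <-] := mxrank_leqif_sup GA'; rewrite rGc (eqP fA') k'k.
have tanP u : (forall b, D (f b) y u = 0) -> tangent cY Y y u.
  move=> H; apply/(conormal_tangent u HA'); have /submxP [B ->] := A'G.
  rewrite -mulmxA (_ : Gc *m _ = 0) ?mulmx0 //; apply/colP => b.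
  by have := gradE y u (pf b); rewrite H -rowGc -row_mul [in X in _ = X]mxE => <-; rewrite mxE.
have DG b u : D (f b) y u = \sum_i G y b i * u (e i).
  rewrite D_basev // (reindex e be) /=; apply: eq_bigr => i _.
  by rewrite mulrC mxE.
have SG b u : \sum_i S y (rshift r.+1 b) i * u (e i) = D (f b) y u.
  by rewrite DG; apply: eq_bigr => i _; rewrite col_mxEd.
have SC j u : \sum_i S y (lshift k j) i * u (e i) = ell j u.
  rewrite /ell [RHS](reindex e be) /=; apply: eq_bigr => i _.
  by rewrite col_mxEu e'e.
have Stau i j : \sum_l S y i l * tau j y (e l) = (i == lshift k j)%:R * det y.
  have /matrixP /(_ i (lshift k j)) := mul_mx_adj (S y); rewrite !mxE mulr_natl => <-.
  by apply: eq_bigr => l _; rewrite ffunE e'e.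
split=> //.
- move=> j; apply: tanP => b; rewrite -SG Stau.
  by rewrite eq_rlshift mul0r.
- move=> u tu; apply/ffunP => i; rewrite ffunE; apply: (mulfI dy); rewrite mulr_sumr.
  have /matrixP adjS := mul_adj_mx (S y).
  have Su b : \sum_i S y (rshift r.+1 b) i * u (e i) = 0.
    by rewrite SG; have [[a fa] [va _]] := fP b; exact: tu fa va.
  have -> : det y * u i = \sum_l (\adj (S y) *m S y) (e' i) l * u (e l).
    rewrite (bigD1 (e' i)) //= adjS mxE eqxx mulr1n ee' [X in _ + X]big1 ?addr0 // => l li.
    by rewrite adjS mxE eq_sym (negbTE li) mul0r.
  rewrite (eq_bigr (fun l => \sum_a \adj (S y) (e' i) a * (S y a l * u (e l)))); last first.
    by move=> l _; rewrite mxE mulr_suml; apply: eq_bigr => a _; rewrite mulrA.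
  rewrite exchange_big big_split_ord /= [X in _ + X]big1 ?addr0; last first.
    by move=> b _; rewrite -mulr_sumr Su mulr0.
  apply: eq_bigr => j _; rewrite -mulr_sumr SC ffunE; field; rewrite ?dy //.
- by move=> j j'; rewrite -SC Stau (inj_eq (@lshift_inj _ _)).
by exists k', A'; split=> //; rewrite k'k.
Qed.

(** Values and differentials of all sections are made polynomial by the square of the product of
    their denominators; the square is due to the quotient rule. *)
Lemma section_frame y0 (s : 'I_alpha -> vec K 'I_n.+1 -> K) : Y y0 ->
  (forall k, regular_at cY Y (fun=> 1) y0 (s k)) ->
  exists (HH : vec K 'I_n.+1 -> K) (Jf : 'I_alpha -> vec K 'I_n.+1 -> vec K 'I_n.+1 -> K)
    (vf : 'I_alpha -> vec K 'I_n.+1 -> K),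
  [/\ polyf HH, HH y0 != 0, forall k, polyf (vf k),
      forall k (tau : vec K 'I_n.+1 -> vec K 'I_n.+1), (forall i, polyf (fun y => tau y i)) ->
        polyf (fun y => Jf k y (tau y)) &
      forall y, Y y -> HH y != 0 -> (forall k, vf k y = HH y ^+ 2 * s k y) /\
        forall k u, tangent cY Y y u -> Jf k y u = HH y ^+ 2 * djet cY Y (fun=> 1) y (s k) u].
Proof.
move=> Yy0 rs.
have ex k := (regular_atP HY (fun=> 1) y0 (s k)).1 (rs k).
pose g k := proj1_sig (constructive_indefinite_description _ (ex k)).
have ex2 k := proj2_sig (constructive_indefinite_description _ (ex k)).
pose h k := proj1_sig (constructive_indefinite_description _ (ex2 k)).
have hP k : rep cY Y (fun=> 1) y0 (s k) (g k) (h k) := proj2_sig (constructive_indefinite_description _ (ex2 k)).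
have pg k : polyf (g k) by have [a [b [[pf _] _ _ _ _]]] := hP k.
have ph k : polyf (h k) by have [a [b [_ [pf _] _ _ _]]] := hP k.
have h0 k : h k y0 != 0 by have [a [b [_ _ _ [_ h0] _]]] := hP k.
pose cc k y := \prod_(l | l != k) h l y.
have pcc k : polyf (cc k) by apply: polyf_prod => l _.
exists (fun y => \prod_k h k y), (fun k y u => cc k y ^+ 2 * (D (g k) y u * h k y - g k y * D (h k) y u)),
  (fun k y => cc k y ^+ 2 * (g k y * h k y)); split.
- by apply: polyf_prod => k _.
- by apply/prodf_neq0 => k _.
- by move=> k; apply: polyfM; [exact: polyfX | exact: polyfM].
- move=> k tau pt; have pD f : polyf f -> polyf (fun y => D f y (tau y)).
    move=> pf; apply: (polyf_ext (f := fun y => \sum_i tau y i * D f y (basev K i))).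
      by move=> y; rewrite D_basev.
    by apply: polyf_sum => i _; apply: polyfM => //; exact: polyf_D.
  by apply: polyfM; [exact: polyfX | apply: polyfB; apply: polyfM => //; exact: pD].
move=> y Yy /prodf_neq0 hy; have hk k : h k y != 0 by exact: hy.
have HE k : \prod_l h l y = h k y * cc k y by rewrite (bigD1 k).
have sE k : s k y = g k y / h k y by have [a [b [_ _ _ _ E]]] := hP k; exact: E.
split=> [k|k u tu]; first by rewrite (HE k) sE; move: (cc k y) => x; field; rewrite ?hk.
have ry : rep cY Y (fun=> 1) y (s k) (g k) (h k).
  by have [a [b [fg fh ab _ E]]] := hP k; exists a, b; split.
rewrite (djetE (near_eq_refl cY Y y (s k)) ry tu) /qder (HE k).
by move: (cc k y) (D _ _ _) (D _ _ _) => x d1 d2; field; rewrite ?hk.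
Qed.
End OnY.

Lemma zopen_form_ex (K : closedFieldType) (I J : finType) (c : I -> J) (X W : vec K I -> Prop) w :
  (forall v, X v -> is_point c v) -> zopen_in c X W -> W w ->
  exists a F, [/\ form c a F, F w != 0 & forall v, X v -> F v != 0 -> W v].
Proof.
move=> pX [Z cZ WE] Ww; have [Xw NZ] := (WE w).1 Ww.
have [a [F [fF FZ Fw]]] : exists a F, [/\ form c a F, vanish Z F & F w != 0].
  apply: NNPP => N; apply: NZ; apply/(zclosedE cZ); split; first exact: pX.
  by move=> a F fF vF; apply/eqP/negPn/negP => Fw; apply: N; exists a, F.
exists a, F; split=> // v Xv Fv; apply/WE; split=> // Zv.
by move/eqP: Fv; apply; exact: FZ.
Qed.

Section SubClass.
Variables (K : closedFieldType) (I J : finType) (c : I -> J).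
Variables (Y : vec K I -> Prop) (HY : zclosed c Y) (IY : zirreducible c Y).
Variables (Om : vec K I -> K) (pOm : polyf Om).

(** The parameter space substituted for [T]: the points of [Y] at which the frame and the cleared
    denominators are available. *)
Definition pts := {y | Y y /\ Om y != 0}.
Definition subc (f : pts -> K) := exists2 F, polyf F & forall t, f t = F (proj1_sig t).

Lemma fclass_sub : fclass subc.
Proof.
split.
- by move=> f g fg [F pF FE]; exists F => // t; rewrite -fg.
- by move=> a; exists (fun=> a) => //; exact: polyf_cst.
- by move=> f g [F pF FE] [G pG GE]; exists (fun y => F y + G y) => [|t]; rewrite ?FE ?GE //; exact: polyfD.
- by move=> f g [F pF FE] [G pG GE]; exists (fun y => F y * G y) => [|t]; rewrite ?FE ?GE //; exact: polyfM.
move=> f g [F pF FE] [G pG GE] [[y [Yy Oy]]]; rewrite FE /= => Fy [[y' [Yy' Oy']]]; rewrite GE /= => Gy'.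
have [||v [Yv]] := irr_dom HY IY (polyfM pF pOm) (polyfM pG pOm).
- by exists y => //; rewrite mulf_neq0.
- by exists y' => //; rewrite mulf_neq0.
rewrite !mulf_eq0 !negb_or => /andP [Fv Ov] /andP [Gv _].
by exists (exist _ v (conj Yv Ov)); rewrite FE GE.
Qed.

Definition assemble z (p : 'I_z -> vec K I) : vec K (I * 'I_z)%type := [ffun ik => p ik.2 ik.1].

Lemma component_assemble z (p : 'I_z -> vec K I) k : component (assemble p) k = p k.
Proof. by apply/ffunP => i; rewrite !ffunE. Qed.

Lemma polyf_component z (k : 'I_z) f : polyf f -> polyf (fun w : vec K (I * 'I_z)%type => f (component w k)).
Proof. by move=> pf; apply: (polyf_comp pf) => i; exact: polyf_var. Qed.

Lemma powc_assemble z F : polyf F -> powc (I := 'I_z) subc (fun p => F (assemble (fun k => proj1_sig (p k)))).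
Proof.
move=> pF p k; exists (fun y => F [ffun ik : I * 'I_z => if ik.2 == k then y ik.1 else proj1_sig (p ik.2) ik.1]).
  by apply: polyf_comp => // -[i l] /=; case: (l == k); [exact: polyf_var | exact: polyf_cst].
move=> t; congr F; apply/ffunP => -[i l]; rewrite !ffunE /= /setf; by case: (l == k).
Qed.
End SubClass.

(** * From ranks to double points on the product *)

Lemma DX (K : closedFieldType) (I : finType) (f : vec K I -> K) k v u : polyf f ->
  D (fun v => f v ^+ k) v u = k%:R * f v ^+ k.-1 * D f v u.
Proof.
move=> pf; elim: k => [|k IH]; first by rewrite !mul0r; exact: D_cst.
rewrite (D_ext v u (fun w => exprS (f w) k)) DM //; last exact: polyfX.
rewrite IH /=; case: k {IH} => [|k] /=; first by rewrite ?expr0 ?mul0r ?mulr0 ?addr0 ?mulr1 ?mul1r.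
rewrite [f v ^+ k.+1]exprS -[k.+2%:R]natr1.
by move: (f v) (f v ^+ k) (D f v u) (k.+1%:R : K) => a b c d; rewrite (mulrC c) (mulrDl d) mul1r mulrDl addrC -!mulrA (mulrCA a).
Qed.

Lemma polyf_emon (K : closedFieldType) (I : finType) m t (mu : Mon m t) (g : nat -> vec K I -> K) :
  (forall i, polyf (g i)) -> polyf (fun v => emon mu (fun i => g i v)).
Proof.
elim: m t mu g => [|m IHm] t mu g pg; first exact: polyfX.
elim: t mu => [|t IHt] mu; first exact: polyf_cst.
case: mu => mu; first exact: (IHm t.+1 mu (fun i => g i.+1)).
exact: (polyfM (pg 0%N) (IHt mu)).
Qed.

Lemma sum_leibniz (R : comPzRingType) m (a e : R) (d b : 'I_m.+1 -> R) :
  b ord0 * e + a * (\sum_i d i * b i) = \sum_(i < m.+1) ((i == 0 :> nat)%:R * e + a * d i) * b i.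
Proof.
under [RHS]eq_bigr => i _ do rewrite mulrDl -!mulrA.
rewrite big_split -mulr_sumr /=; congr (_ + _).
by rewrite big_ord_recl /= mul1r big1 ?addr0 1?mulrC // => i _; rewrite mul0r.
Qed.

Lemma D_emon (K : closedFieldType) (I : finType) m t (mu : Mon m t) (g : nat -> vec K I -> K) v u :
  (forall i, polyf (g i)) -> D (fun v => emon mu (fun i => g i v)) v u =
  \sum_(i < m.+1) demon (m := m) (t := t) mu i (fun i => g i v) * D (g i) v u.
Proof.
move=> pg; elim: m t mu g pg => [|m IHm] t mu g pg; first by rewrite big_ord1; exact: DX.
elim: t mu => [|t IHt] mu.
  by rewrite big1 => [|i _]; [exact: D_cst | rewrite /= mul0r].
case: mu => mu.
  rewrite big_ord_recl mul0r add0r -[LHS]/(D (fun v => emon mu (fun i => g i.+1 v)) v u).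
  by rewrite (IHm t.+1 mu (fun i => g i.+1)).
rewrite (D_ext v u (fun w => emonr mu (fun i => g i w))) DM //; last first.
  apply: (polyf_emon (m := m.+1)) => //.
rewrite IHt; apply: etrans (sum_leibniz (g 0%N v) (emon (m := m.+1) (t := t) mu (fun i => g i v))
  (fun i => demon (m := m.+1) (t := t) mu i (fun i => g i v)) (fun i => D (g i) v u)) _.
by apply: eq_bigr => i _; rewrite demonr.
Qed.

(** * Non-defectivity as a statement on ranks, on Y and on the product *)

Section JRank.
Variables (K : closedFieldType) (n r alpha : nat).
Let cY := @proj_col n.
Variables (Y : vec K 'I_n.+1 -> Prop) (HY : zclosed cY Y) (IY : zirreducible cY Y).
Hypothesis Ydim : has_dim cY Y r.
Implicit Types (y u : vec K 'I_n.+1).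
Variable s : 'I_alpha -> vec K 'I_n.+1 -> K.
Hypothesis rs : forall k, line_bundle cY Y (fun=> 1) Y (s k).
Hypothesis s_span : forall f, line_bundle cY Y (fun=> 1) Y f ->
  exists! l : 'rV[K]_alpha, forall v, Y v -> f v = \sum_(k < alpha) l 0 k * s k v.
Variables (Om : vec K 'I_n.+1 -> K) (tau : 'I_r.+1 -> vec K 'I_n.+1 -> vec K 'I_n.+1)
  (ell : 'I_r.+1 -> vec K 'I_n.+1 -> K) (det HH : vec K 'I_n.+1 -> K)
  (Jf : 'I_alpha -> vec K 'I_n.+1 -> vec K 'I_n.+1 -> K) (vf : 'I_alpha -> vec K 'I_n.+1 -> K).
Hypotheses (pOm : polyf Om) (exOm : exists2 y, Y y & Om y != 0).
Hypothesis fell : forall j, form cY (fun=> 1%N) (ell j) /\ forall y u, D (ell j) y u = ell j u.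
Hypothesis frame : forall y, Y y -> Om y != 0 ->
  [/\ det y != 0, forall j, tangent cY Y y (tau j y),
      forall u, tangent cY Y y u -> u = [ffun i => \sum_j (ell j u / det y) * tau j y i],
      forall j j', ell j (tau j' y) = (j == j')%:R * det y &
      exists k (A : 'M[K]_(k, #|'I_n.+1|)), conormal cY Y y A /\ (k + r = n)%N].
Hypotheses (pv : forall k, polyf (vf k)) (pJ : forall k j, polyf (fun y => Jf k y (tau j y))).
Hypothesis HH0 : forall y, Om y != 0 -> HH y != 0.
Hypothesis vE : forall y k, Y y -> Om y != 0 -> vf k y = HH y ^+ 2 * s k y.
Hypothesis JE : forall y k u, Y y -> Om y != 0 -> tangent cY Y y u ->
  Jf k y u = HH y ^+ 2 * djet cY Y (fun=> 1) y (s k) u.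

Let T := pts Y Om.
Definition Jt (k : 'I_alpha) (j : 'I_r.+1) (t : T) := Jf k (proj1_sig t) (tau j (proj1_sig t)).
Definition vt (k : 'I_alpha) (t : T) := vf k (proj1_sig t).
Definition bt (j : 'I_r.+1) (t : T) := ell j (proj1_sig t) / det (proj1_sig t).

Lemma euler_proj y : euler cY tt y = y.
Proof. by apply/ffunP => i; rewrite ffunE. Qed.

Lemma tangent_self y : Y y -> tangent cY Y y y.
Proof. by move=> Yy; rewrite -{2}(euler_proj y); exact: tangent_euler. Qed.

Lemma djet_self y f : regular_at cY Y (fun=> 1) y f -> djet cY Y (fun=> 1) y f y = f y.
Proof. by move=> rf; have := djet_euler HY tt rf; rewrite euler_proj mul1r. Qed.

Lemma djet_frame y f u d : Y y -> Om y != 0 -> regular_at cY Y d y f -> tangent cY Y y u ->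
  djet cY Y d y f u = \sum_j (ell j u / det y) * djet cY Y d y f (tau j y).
Proof.
move=> Yy Oy rf tu; have [_ tt_ ue _ _] := frame Yy Oy.
by rewrite {1}(ue u tu) (djet_sum_dir HY _ _ rf tt_).1.
Qed.

Lemma vtJ k t : vt k t = \sum_j bt j t * Jt k j t.
Proof.
case: t => y [Yy Oy]; rewrite /vt /bt /Jt /= vE //.
have [_ tt_ _ _ _] := frame Yy Oy.
rewrite -(djet_self (rs k Yy)) (djet_frame Yy Oy (rs k Yy) (tangent_self Yy)) mulr_sumr.
by apply: eq_bigr => j _; rewrite JE // mulrCA.
Qed.

Lemma regJt k j : subc (Jt k j).
Proof. by exists (fun y => Jf k y (tau j y)). Qed.

Lemma regvt k : subc (vt k).
Proof. by exists (vf k). Qed.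

Lemma combo_regular (x : 'I_alpha -> K) : line_bundle cY Y (fun=> 1) Y (fun y => \sum_k x k * s k y).
Proof. by move=> y Yy; apply: regular_sum => // k; apply: regularZ => //; exact: rs. Qed.

Lemma s_free (x : 'I_alpha -> K) : (forall y, Y y -> \sum_k x k * s k y = 0) -> forall k, x k = 0.
Proof.
move=> H k; have [|l [_ lu]] := s_span (f := fun=> 0); first by move=> y Yy; exact: regular0.
have l0 : l = 0 by apply: lu => y Yy; rewrite big1 // => k' _; rewrite mxE mul0r.
have lx : l = \row_k x k.
  by apply: lu => y Yy; rewrite -[LHS](H y Yy); apply: eq_bigr => k' _; rewrite mxE.
by have /rowP /(_ k) := lx; rewrite l0 !mxE => <-.
Qed.

Lemma vt_free (x : 'I_alpha -> K) : (exists k, x k != 0) -> exists t, \sum_k x k * vt k t != 0.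
Proof.
move=> [k0 xk0]; have [y Yy sy] : exists2 y, Y y & \sum_k x k * s k y != 0.
  apply: NNPP => N; move/eqP: xk0; apply; apply: s_free => y Yy.
  by apply/eqP/negPn/negP => h; apply: N; exists y.
have [g [h [a [b [[pg _] [ph _] _ [_ hy] E]]]]] := (regular_atP HY _ _ _).1 (combo_regular x Yy).
have gy : g y != 0 by move: sy; rewrite E // mulf_eq0 negb_or => /andP [].
have [y1 Yy1 Oy1] := exOm.
have [||v [Yv]] := irr_dom HY IY (polyfM pg ph) pOm.
- by exists y => //; rewrite mulf_neq0.
- by exists y1.
rewrite mulf_eq0 negb_or => /andP [gv hv] Ov; exists (exist _ v (conj Yv Ov)).
rewrite (eq_bigr (fun k => HH v ^+ 2 * (x k * s k v))); last by move=> k _; rewrite /vt /= vE // mulrCA.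
rewrite -mulr_sumr mulf_neq0 ?expf_neq0 ?HH0 //.
by rewrite (E v Yv hv) mulf_neq0 ?invr_eq0.
Qed.

Lemma regular_pts y : Y y -> Om y != 0 -> regular_point cY Y y.
Proof.
move=> Yy Oy; have [_ _ _ _ [k [A [HA kr]]]] := frame Yy Oy.
apply: (regular_point_of_codim HY Yy HA Ydim).
by rewrite card_ord card_unit -kr; clear; lia.
Qed.

Lemma Jt_combo (x : 'I_alpha -> K) (t : T) j : \sum_k Jt k j t * x k =
  HH (proj1_sig t) ^+ 2 * djet cY Y (fun=> 1) (proj1_sig t) (fun y => \sum_k x k * s k y) (tau j (proj1_sig t)).
Proof.
case: t => y [Yy Oy]; rewrite /Jt /=; have [_ tt_ _ _ _] := frame Yy Oy.
rewrite djet_sum // => [|k]; last by apply: regularZ => //; exact: rs.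
rewrite mulr_sumr; apply: eq_bigr => k _; rewrite djetZ //; last exact: rs.
by rewrite JE // mulrC mulrCA.
Qed.

Lemma rank_of_h0 z (t : 'I_z -> T) :
  has_h0 Y (double_points_twist cY Y (fun=> 1) (fun k => proj1_sig (t k))) 0 ->
  (alpha <= frank (fun (a : 'I_z * 'I_r.+1) k => Jt k a.2 (t a.1)))%N.
Proof.
move=> [s0 _ Hs]; rewrite -{1}(card_ord alpha); apply: eq_leq; apply/esym.
apply: frank_inj => x kx; apply: s_free => y Yy.
have [|l [lE _]] := Hs (fun y => \sum_k x k * s k y); last by rewrite lE // big_ord0.
split=> [|k _]; first exact: combo_regular.
have [Yk Ok] := proj2_sig (t k); apply/(msq_iff HY _ _ Yk).
have rf := combo_regular x Yk.
have dju u : tangent cY Y (proj1_sig (t k)) u ->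
    djet cY Y (fun=> 1) (proj1_sig (t k)) (fun y => \sum_k x k * s k y) u = 0.
  move=> tu; rewrite (djet_frame Yk Ok rf tu) big1 // => j _.
  suff -> : djet cY Y (fun=> 1) (proj1_sig (t k)) (fun y => \sum_k x k * s k y) (tau j (proj1_sig (t k))) = 0.
    by rewrite mulr0.
  by apply: (mulfI (expf_neq0 2 (HH0 Ok))); rewrite mulr0 -Jt_combo (kx (k, j)).
by split=> //; rewrite -(djet_self rf); apply: dju; exact: tangent_self.
Qed.

(** The local sections to be attained are combinations of the linear forms [ell], whose derivatives
    along the frame form a diagonal matrix; every vector of derivatives is thus prescribed. *)
Lemma rank_of_onto z (t : 'I_z -> T) : jets_onto cY Y (fun=> 1) (fun k => proj1_sig (t k)) ->
  (z * r.+1 <= frank (fun (a : 'I_z * 'I_r.+1) k => Jt k a.2 (t a.1)))%N.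
Proof.
move=> onto; rewrite -{1}(card_ord z) -{1}(card_ord r.+1) -card_prod.
apply: frank_of_surj => phi.
pose cc k j := phi (k, j) / (HH (proj1_sig (t k)) ^+ 2 * det (proj1_sig (t k))).
pose lin k y := \sum_j cc k j * ell j y.
have flin k : form cY (fun=> 1%N) (lin k).
  by apply: form_sum => j _; apply: formZ; have [] := fell j.
have Yt k : Y (proj1_sig (t k)) := (proj2_sig (t k)).1.
have rlin k : regular_at cY Y (fun=> 1) (proj1_sig (t k)) (lin k).
  by apply: (regular_form HY (Yt k) (flin k)).
have [f Hf Hm] := onto lin rlin.
have [l [lE _]] := s_span Hf; exists (fun k => l 0 k) => -[k j] /=.
have Ok := (proj2_sig (t k)).2; have Yk := Yt k; have [d0 tt_ _ le _] := frame Yk Ok.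
have [_ _ /(_ _ (tt_ j))] := (msq_iff HY _ _ Yk).1 (Hm k).
rewrite djetB //; last exact: Hf.
rewrite (djet_form Yk (flin k)) // => /eqP; rewrite subr_eq0 => /eqP E.
have pell j' : polyf (ell j') by have [[]] := fell j'.
rewrite Jt_combo.
have -> : djet cY Y (fun=> 1) (proj1_sig (t k)) (fun y => \sum_k l 0 k * s k y) (tau j (proj1_sig (t k))) =
    djet cY Y (fun=> 1) (proj1_sig (t k)) f (tau j (proj1_sig (t k))).
  apply: (djet_near HY) => //; last exact: combo_regular.
  by apply: near_eq_ext => y Yy; rewrite lE.
rewrite E D_sum; last by move=> j'; apply: polyfM; [exact: polyf_cst | exact: pell].
rewrite (eq_bigr (fun j' => cc k j' * ((j' == j)%:R * det (proj1_sig (t k))))); last first.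
  by move=> j' _; rewrite DZ // (fell j').2 le.
rewrite (bigD1 j) //= eqxx mul1r big1 ?addr0; last first.
  by move=> j' /negbTE ->; rewrite mul0r mulr0.
by rewrite /cc; field; rewrite ?d0 ?HH0.
Qed.

(** The distinct regular points provided by [Ldef] need not lie where the frame is defined. They are
    moved inside the open set [W], distinctness being kept through nonzero minors of pairs of
    points. *)
Lemma Jt_rank : not_secant_defective cY Y (fun=> 1) -> forall z, exists t : 'I_z -> T,
  (minn (z * r.+1) alpha <= frank (fun (a : 'I_z * 'I_r.+1) k => Jt k a.2 (t a.1)))%N.
Proof.
move=> Ldef z; have [y1 Yy1 Oy1] := exOm; pose t1 : T := exist _ y1 (conj Yy1 Oy1).
have [->|z0] := posnP z; first by exists (fun=> t1); rewrite mul0n min0n.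
have [_ [W [oW [w Ww [rw dw]]] HW]] := Ldef z z0.
have ptY v : power_set Y v -> is_point (power_col cY (z := z)) v.
  move=> Yv [j k]; have [i ij vi] := zclosed_point HY (Yv k) j; exists (i, k); first by rewrite /power_col /= ij.
  by move: vi; rewrite ffunE.
have Yw k : Y (component w k) by have [] := rw k.
have [a [F [fF Fw FW]]] := zopen_form_ex ptY oW Ww.
have p1 : polyf (fun _ : vec K 'I_n.+1 => 1 : K) by exact: polyf_cst.
pose T0 := pts Y (fun=> 1).
pose tw k : T0 := exist _ (component w k) (conj (Yw k) (oner_neq0 K)).
have aw : assemble (fun k => proj1_sig (tw k)) = w by apply/ffunP => -[i k]; rewrite !ffunE.
pose cl := powc (I := 'I_z) (@subc K _ Y (fun=> 1)).
have clP : fclass cl := fclass_pow ('I_z : finType) (fclass_sub HY IY p1).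
pose wp (p : 'I_z -> T0) := assemble (fun k => proj1_sig (p k)).
have clw G : polyf G -> cl (fun p => G (wp p)) by move=> pG; exact: powc_assemble.
have gF : generic cl (fun p => W (wp p)).
  exists (fun p => F (wp p)); split; first exact: (clw _ fF.1).
    by exists tw; rewrite /wp aw.
  move=> p Fp; apply: FW => // k; rewrite component_assemble; by case: (p k) => y [].
have gO k : generic cl (fun p => Om (proj1_sig (p k)) != 0).
  exists (fun p => Om (proj1_sig (p k))); split=> //.
    apply: (fc_ext clP (f := fun p => Om (component (wp p) k))); last exact: (clw _ (polyf_component k pOm)).
    by move=> p; rewrite component_assemble.
  by exists (fun=> exist _ y1 (conj Yy1 (oner_neq0 K))).
have gd (kl : 'I_z * 'I_z) : generic cl (fun p => kl.1 != kl.2 ->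
    ~ same_point cY (proj1_sig (p kl.1)) (proj1_sig (p kl.2))).
  case: kl => k l /=; have [<-|kl] := eqVneq k l.
    exists (fun=> 1); split=> //; first exact: (fc_cst clP).
    by exists tw; exact: oner_neq0.
  have [i [j ij]] : exists i j, component w k i * component w l j - component w k j * component w l i != 0.
    apply: NNPP => N.
    have [i _ ki] := zclosed_point HY (Yw k) tt; have [j _ lj] := zclosed_point HY (Yw l) tt.
    have E i' j' : component w k i' * component w l j' = component w k j' * component w l i'.
      by apply/eqP; rewrite -subr_eq0; apply/negPn/negP => h; apply: N; exists i', j'.
    have li : component w l i != 0.
      by apply/eqP => li; have /eqP := E i j; rewrite li mulr0 mulf_eq0 (negbTE ki) (negbTE lj).
    apply: (dw k l kl); exists (fun=> component w l i / component w k i).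
      by move=> _; rewrite mulf_neq0 ?invr_eq0.
    by move=> j'; apply: (mulfI ki); rewrite E mulrA mulrCA mulfV // mulr1 mulrC.
  pose G (w : vec K ('I_n.+1 * 'I_z)%type) := component w k i * component w l j - component w k j * component w l i.
  have pG : polyf G by apply: polyfB; apply: polyfM; apply: (polyf_component _ (polyf_var K _)).
  exists (fun p => G (wp p)); split; first exact: clw.
    by exists tw; rewrite /wp aw.
  move=> p pn _ [x x0 xE]; move/eqP: pn; apply; rewrite /G !component_assemble !xE.
  rewrite -[x (cY i)]/(x tt) -[x (cY j)]/(x tt).
  by move: (x tt) (proj1_sig (p k) i) (proj1_sig (p k) j) => a1 b1 b2; ring.
have gall (A : finType) (Q : A -> ('I_z -> T0) -> Prop) : (forall x, generic cl (Q x)) ->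
    generic cl (fun p => forall x, Q x p).
  move=> HQ; have H (l : seq A) : generic cl (fun p => forall x, x \in l -> Q x p).
    elim: l => [|x l IH].
      exists (fun=> 1); split=> //; first exact: (fc_cst clP).
      by exists tw; exact: oner_neq0.
    apply: generic_imp (generic_and clP (HQ x) IH) => p [h1 h2] y.
    by rewrite inE => /orP [/eqP ->|/h2].
  by apply: generic_imp (H (enum A)) => p Hp x; apply: Hp; rewrite mem_enum.
have [p [Wp [Op dp]]] := generic_ex (generic_and clP gF (generic_and clP (gall _ _ gO) (gall _ _ gd))).
have Yp k : Y (proj1_sig (p k)) by case: (p k) => y [].
pose t k : T := exist _ (proj1_sig (p k)) (conj (Yp k) (Op k)).
exists t; have cE : component (wp p) = (fun k => proj1_sig (t k)).
  by apply: functional_extensionality => k; rewrite component_assemble.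
have := HW _ Wp; rewrite cE => H0; have {H0} [|H|H] := H0.
- by split=> [k|k l kl]; rewrite cE; [exact: (regular_pts (Yp k) (Op k)) | exact: (dp (k, l))].
- by rewrite geq_min; apply/orP; right; exact: rank_of_h0.
rewrite geq_min; apply/orP; left; apply: rank_of_onto; apply: (onto_of_h1 HY) H => //.
- by move=> p' v Yp' Yv; apply: proj_separated; exact: (zclosed_point HY).
by move=> k l kl; exact: (dp (k, l)).
Qed.

Hypothesis charK : [pchar K] =i pred0.
Variable t : nat.
Let IX := ('I_n.+1 + 'I_3)%type.
Let cX := @times_proj_col n 2.
Let X := times_proj (m := 2) Y.
Let HX : zclosed cX X := zclosedX 2 HY.
Let dX := bidegree 1 t.+2.
Implicit Types (v : vec K IX) (q : vec K 'I_3).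

Definition sec (b : 'I_alpha * Mon 2 t.+2) v := s b.1 (fstv v) * emon b.2 (nq (sndv v)).

(** Together these directions span the tangent space of the cone over the product at a point over
    [y], when the frame is defined there. *)
Definition dir y (a : 'I_r.+1 + 'I_3) : vec K IX :=
  match a with inl j => pairv (tau j y) [ffun=> 0] | inr i => pairv [ffun=> 0] (basev K i) end.

Lemma tangent0 y : tangent cY Y y [ffun=> 0].
Proof.
move=> a f [pf _] _; rewrite D_basev // big1 // => i _; by rewrite ffunE mul0r.
Qed.

Lemma djet_dir0 y f : regular_at cY Y (fun=> 1) y f -> djet cY Y (fun=> 1) y f [ffun=> 0] = 0.
Proof.
move=> rf; have Yy := regular_X HY rf.
have := djet_sum_dir HY ([::] : seq unit) (fun=> 0) rf (fun=> tangent_self Yy).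
rewrite big_nil => -[e _]; rewrite -[RHS]e; congr (djet _ _ _ _ _ _).
by apply/ffunP => i; rewrite !ffunE big_nil.
Qed.

Lemma dir_tangent v a : X v -> Om (fstv v) != 0 -> tangent cX X v (dir (fstv v) a).
Proof.
move=> Xv Ov; apply/(tangentX _ Xv); have [Yv _] := (times_projE Y v).1 Xv.
case: a => [j|i]; rewrite fst_pair; last exact: tangent0.
by have [_ tt_ _ _ _] := frame Yv Ov.
Qed.

Definition dcoef y (u : vec K IX) (a : 'I_r.+1 + 'I_3) : K :=
  match a with inl j => ell j (fstv u) / det y | inr i => sndv u i end.

Lemma djet_dirs v f (u : vec K IX) : X v -> Om (fstv v) != 0 -> regular_at cX X dX v f -> tangent cX X v u ->
  djet cX X dX v f u = \sum_a dcoef (fstv v) u a * djet cX X dX v f (dir (fstv v) a).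
Proof.
move=> Xv Ov rf tu; have [Yv _] := (times_projE Y v).1 Xv.
rewrite -(djet_sum_dir HX (index_enum _) (dcoef (fstv v) u) rf (fun a => dir_tangent a Xv Ov)).1.
congr (djet _ _ _ _ _ _); have [_ _ ue _ _] := frame Yv Ov.
have tu' : tangent cY Y (fstv v) (fstv u) by apply/(tangentX _ Xv).
apply/ffunP => l; rewrite ffunE big_sumType /=; case: l => [i|i].
  rewrite [X in _ = _ + X]big1 ?addr0; last by move=> i' _; rewrite !ffunE mulr0.
  have -> : u (inl i) = fstv u i by rewrite ffunE.
  by rewrite {1}(ue _ tu') ffunE; apply: eq_bigr => j _; rewrite [pairv _ _ _]ffunE.
rewrite [X in _ = X + _]big1 ?add0r; last by move=> j _; rewrite !ffunE mulr0.
rewrite (bigD1 i) //= !ffunE eqxx mulr1 big1 ?addr0 // => i' ii'.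
by rewrite !ffunE (negbTE ii') mulr0.
Qed.

Lemma ell0 j : ell j [ffun=> 0] = 0.
Proof. by have [[pl _] lin] := fell j; rewrite -(lin [ffun=> 0]) D_basev // big1 // => i _; rewrite ffunE mul0r. Qed.

Lemma djet_value v f : X v -> Om (fstv v) != 0 -> regular_at cX X dX v f ->
  f v = \sum_j (ell j (fstv v) / det (fstv v)) * djet cX X dX v f (dir (fstv v) (inl j)).
Proof.
move=> Xv Ov rf; have := djet_euler HX (inl tt) rf; rewrite mul1r => <-.
rewrite (djet_dirs Xv Ov rf (tangent_euler _ Xv)) big_sumType /= [X in _ + X]big1 ?addr0; last first.
  by move=> i _; rewrite !ffunE mul0r.
apply: eq_bigr => j _; congr (ell j _ / _ * _).
by apply/ffunP => i; rewrite !ffunE.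
Qed.

Lemma djet_euler_snd v f : X v -> Om (fstv v) != 0 -> regular_at cX X dX v f ->
  \sum_i sndv v i * djet cX X dX v f (dir (fstv v) (inr i)) = t.+2%:R * f v.
Proof.
move=> Xv Ov rf; have := djet_euler HX (inr tt) rf; rewrite /= => <-.
rewrite (djet_dirs Xv Ov rf (tangent_euler _ Xv)) big_sumType /= [X in _ = X + _]big1 ?add0r; last first.
  move=> j _; have -> : fstv (euler cX (inr tt) v) = [ffun=> 0] by apply/ffunP => i; rewrite !ffunE.
  by rewrite ell0 !mul0r.
by apply: eq_bigr => i _; rewrite !ffunE.
Qed.

Lemma msq_dirs v f : X v -> Om (fstv v) != 0 -> regular_at cX X dX v f ->
  (forall a, djet cX X dX v f (dir (fstv v) a) = 0) -> in_max_ideal_sq cX X dX v f.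
Proof.
move=> Xv Ov rf H; apply/(msq_iff HX _ _ Xv); split=> //.
  by rewrite (djet_value Xv Ov rf) big1 // => j _; rewrite H mulr0.
by move=> u tu; rewrite (djet_dirs Xv Ov rf tu) big1 // => a _; rewrite H mulr0.
Qed.

Lemma sec_regular b v : X v -> regular_at cX X dX v (sec b).
Proof.
move=> Xv; have [Yv _] := (times_projE Y v).1 Xv.
apply: regular_deg (regularM HX (regular_pull HY Xv (rs b.1 Yv)) (regular_emon HY b.2 Xv)).
by case=> [[]|[]].
Qed.

Lemma djet_sec b v (u : vec K IX) : X v -> tangent cX X v u -> djet cX X dX v (sec b) u =
  djet cY Y (fun=> 1) (fstv v) (s b.1) (fstv u) * emon b.2 (nq (sndv v)) +
  s b.1 (fstv v) * \sum_(i < 3) demon b.2 i (nq (sndv v)) * sndv u i.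
Proof.
move=> Xv tu; have [Yv _] := (times_projE Y v).1 Xv.
have dE : dX = (fun j => bidegree 1 0 j + bidegree 0 t.+2 j).
  by apply: functional_extensionality => -[[]|[]].
rewrite dE (djetM HX (regular_pull HY Xv (rs b.1 Yv)) (regular_emon HY b.2 Xv) tu); congr (_ * _ + _ * _).
  have [g [h R]] := (regular_atP HY _ _ _).1 (rs b.1 Yv).
  have tu' : tangent cY Y (fstv v) (fstv u) by apply/(tangentX _ Xv).
  rewrite (djetE (near_eq_refl cY Y _ _) R tu').
  have RX : rep cX X (bidegree 1 0) v (fun v => s b.1 (fstv v)) (fun v => g (fstv v)) (fun v => h (fstv v)).
    have [a [a' [fg fh aa [_ hp] E]]] := R; exists (bideg (a tt) 0), (bideg (a' tt) 0); split.
    - exact: form_fst.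
    - exact: form_fst.
    - by case=> [[]|[]] /=; [exact: aa | rewrite subrr].
    - by [].
    by move=> v' /times_projE [Yv' _] hv'; exact: E.
  rewrite (djetE (near_eq_refl cX X _ _) RX tu) /qder.
  by have [a [a' [[pg _] [ph _] _ _ _]]] := R; rewrite !D_fst.
rewrite (djet_form Xv (form_snd n (form_emonq K b.2))) //; last by case=> [[]|[]].
have E (w : vec K IX) i : nq (sndv w) i = w (inr (inord i)) by rewrite /nq ffunE.
have pE i : polyf (fun w : vec K IX => nq (sndv w) i).
  by apply: (polyf_ext (f := fun w => w (inr (inord i)))); [move=> w; rewrite E | exact: polyf_var].
rewrite (D_emon b.2 v u pE); apply: eq_bigr => i _; congr (_ * _).
rewrite (D_ext v u (fun w => E w i)) D_var inord_val ffunE //.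
Qed.

Lemma cond_sec (p : T) v (pE : proj1_sig p = fstv v) : X v -> forall a b,
  cond Jt vt (p, nq (sndv v)) a b = HH (fstv v) ^+ 2 * djet cX X dX v (sec b) (dir (fstv v) a).
Proof.
move=> Xv a b; have [Yv _] := (times_projE Y v).1 Xv.
have Ov : Om (fstv v) != 0 by rewrite -pE; have [] := proj2_sig p.
have [_ tt_ _ _ _] := frame Yv Ov.
rewrite djet_sec //; last exact: dir_tangent.
case: a => [j|i]; rewrite /cond /Jt /vt /= pE ?fst_pair ?snd_pair.
  rewrite JE // [X in _ + _ * X]big1 ?mulr0 ?addr0 ?mulrA // => i _; by rewrite ffunE mulr0.
rewrite vE // djet_dir0 ?mul0r ?add0r -?mulrA; last exact: rs.
rewrite (bigD1 i) //= [basev _ _ _]ffunE eqxx mulr1 big1 ?addr0 // => i' ii'.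
by rewrite [basev _ _ _]ffunE [i == _]eq_sym (negbTE ii') mulr0.
Qed.

Definition comb (x : 'I_alpha * Mon 2 t.+2 -> K) v := \sum_b x b * sec b v.

Lemma comb_regular x v : X v -> regular_at cX X dX v (comb x).
Proof. by move=> Xv; apply: regular_sum => // b; apply: regularZ => //; exact: sec_regular. Qed.

Lemma cond_comb (p : T) v (pE : proj1_sig p = fstv v) x a : X v ->
  \sum_b cond Jt vt (p, nq (sndv v)) a b * x b = HH (fstv v) ^+ 2 * djet cX X dX v (comb x) (dir (fstv v) a).
Proof.
move=> Xv; have Ov : Om (fstv v) != 0 by rewrite -pE; have [] := proj2_sig p.
have td := dir_tangent a Xv Ov.
rewrite djet_sum // => [|b]; last by apply: regularZ => //; exact: sec_regular.
rewrite mulr_sumr; apply: eq_bigr => b _; rewrite djetZ //; last exact: sec_regular.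
by rewrite (cond_sec pE Xv) mulrC mulrCA.
Qed.

Lemma global_comb f : line_bundle cX X dX X f -> exists x, forall v, X v -> f v = comb x v.
Proof.
move=> Hf; have [|x xE] := @product_global_sections K n Y HY t.+2 alpha s _ f Hf; last by exists x.
by move=> g /s_span [l [lE _]]; exists (fun k => l 0 k).
Qed.

Section Points.
Variables (z : nat) (pt : 'I_z -> vec K IX) (tp : 'I_z -> T).
Hypotheses (Xpt : forall k, X (pt k)) (tpE : forall k, proj1_sig (tp k) = fstv (pt k)).

Definition cmat (a : 'I_z * ('I_r.+1 + 'I_3)) (b : 'I_alpha * Mon 2 t.+2) : K :=
  cond Jt vt (tp a.1, nq (sndv (pt a.1))) a.2 b.

Let Opt k : Om (fstv (pt k)) != 0. Proof. by rewrite -tpE; have [] := proj2_sig (tp k). Qed.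

Lemma sections_vanish f : (alpha * #|Mon 2 t.+2| <= frank cmat)%N -> line_bundle cX X dX X f ->
  (forall k, in_max_ideal_sq cX X dX (pt k) f) -> forall v, X v -> f v = 0.
Proof.
move=> le Hf Hm; have [x xE] := global_comb Hf.
suff x0 : forall b, x b = 0 by move=> v Xv; rewrite xE // /comb big1 // => b _; rewrite x0 mul0r.
apply: (frank_full (F := cmat)); first by rewrite card_prod card_ord.
move=> [k a]; rewrite /cmat (cond_comb (tpE k)) //.
have [_ _ H] := (msq_iff HX _ _ (Xpt k)).1 (Hm k).
rewrite -(djet_near HX (f := f)) ?H ?mulr0 //; try exact: dir_tangent; last exact: Hf.
by apply: near_eq_ext => v Xv; exact: xE.
Qed.

Lemma sections_onto : (z * (r.+1 + 2) <= frank cmat)%N -> jets_onto cX X dX pt.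
Proof.
move=> le tau' rt.
have ex k : exists i, sndv (pt k) i != 0.
  by have [_ /(_ tt) [i _ qi]] := (times_projE Y _).1 (Xpt k); exists i.
pose i0 k := proj1_sig (constructive_indefinite_description _ (ex k)).
have qi0 k : sndv (pt k) (i0 k) != 0 := proj2_sig (constructive_indefinite_description _ (ex k)).
(* The derivative in a coordinate [i0] that is nonzero at the point follows from the others by
   Euler's relations. Without it the rows are [z * (r.+1 + 2)] in number and can be independent. *)
pose A' := ('I_z * ('I_r.+1 + 'I_2))%type.
pose e (a : A') : 'I_z * ('I_r.+1 + 'I_3) :=
  (a.1, match a.2 with inl j => inl j | inr l => inr (lift (i0 a.1) l) end).
have rel k f : regular_at cX X dX (pt k) f -> sndv (pt k) (i0 k) * djet cX X dX (pt k) f (dir (fstv (pt k)) (inr (i0 k))) =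
    t.+2%:R * (\sum_j (ell j (fstv (pt k)) / det (fstv (pt k))) * djet cX X dX (pt k) f (dir (fstv (pt k)) (inl j))) -
    \sum_(l < 2) sndv (pt k) (lift (i0 k) l) * djet cX X dX (pt k) f (dir (fstv (pt k)) (inr (lift (i0 k) l))).
  move=> rf; rewrite -(djet_value (Xpt k) (Opt k) rf) -(djet_euler_snd (Xpt k) (Opt k) rf).
  by rewrite (bigD1_ord (i0 k)) //= addrK.
have le' : (#|{: A'}| <= frank (fun a b => cmat (e a) b))%N.
  rewrite card_prod card_sum !card_ord; apply: leq_trans le _; apply: frank_rows => -[k [j|i]].
    exact: (span_row _ (k, inl j)).
  case: (unliftP (i0 k) i) => [l ->|->]; first exact: (span_row _ (k, inr l)).
  pose g1 b := \sum_j (ell j (fstv (pt k)) / det (fstv (pt k))) * cmat (e (k, inl j)) b.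
  pose g2 b := \sum_(l < 2) sndv (pt k) (lift (i0 k) l) * cmat (e (k, inr l)) b.
  apply: (@span_ext _ _ _ _ (fun b => (sndv (pt k) (i0 k))^-1 * (t.+2%:R * g1 b + -1 * g2 b))).
    move=> b; apply: (mulfI (qi0 k)); rewrite mulVKf // mulN1r /g1 /g2.
    rewrite (eq_bigr (fun j => HH (fstv (pt k)) ^+ 2 * (ell j (fstv (pt k)) / det (fstv (pt k)) *
      djet cX X dX (pt k) (sec b) (dir (fstv (pt k)) (inl j))))); last first.
      by move=> j _; rewrite /cmat (cond_sec (tpE k)) // mulrCA.
    rewrite (eq_bigr (fun l => HH (fstv (pt k)) ^+ 2 * (sndv (pt k) (lift (i0 k) l) *
      djet cX X dX (pt k) (sec b) (dir (fstv (pt k)) (inr (lift (i0 k) l)))))); last first.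
      by move=> l _; rewrite /cmat (cond_sec (tpE k)) // mulrCA.
    rewrite /cmat (cond_sec (tpE k)) // -!mulr_sumr [RHS]mulrCA (rel k _ (sec_regular b (Xpt k))).
    by rewrite mulrBr [t.+2%:R * _]mulrCA.
  by apply: spanZ; apply: spanD; apply: spanZ; apply: span_sum => l; exact: span_row.
have [x xE] := frank_surj le' (fun a => HH (fstv (pt a.1)) ^+ 2 *
  djet cX X dX (pt a.1) (tau' a.1) (dir (fstv (pt a.1)) (e a).2)).
exists (comb x); first by move=> v Xv; exact: comb_regular.
move=> k; have rc := comb_regular x (Xpt k); have rd := regularB HX rc (rt k).
have H2 : HH (fstv (pt k)) ^+ 2 != 0 by rewrite expf_neq0 // HH0.
have He a : djet cX X dX (pt k) (fun v => comb x v - tau' k v) (dir (fstv (pt k)) (e (k, a)).2) = 0.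
  rewrite djetB //; last exact: dir_tangent.
  apply: (mulfI H2); rewrite mulr0 mulrBr -(xE (k, a)) /cmat (cond_comb (tpE k)) // subrr //.
apply: msq_dirs => // -[j|i]; first exact: (He (inl j)).
case: (unliftP (i0 k) i) => [l ->|->]; first exact: (He (inr l)).
apply: (mulfI (qi0 k)); rewrite mulr0 (rel k _ rd) !big1 ?mulr0 ?subrr // => l _.
  by rewrite (He (inr l)) mulr0.
by rewrite (He (inl l)) mulr0.
Qed.
End Points.

(** The flag gives the lower bound. For the upper one, at a general point the conormal rank
    [k = n - r] of [Y] gives [d <= r + 4], while a chain of length [r + 3] would need
    [r + 5 <= d]. *)
Lemma has_dimX : has_dim cX X (r + 2).
Proof.
split; first exact: times_proj_chain Ydim.1.
move=> ch; have IXr := times_proj_irreducible 2 HY IY.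
have [d [[h [ph [v Xv hv] Hd]] Hch]] := dimension charK HX IXr.
have := Hch _ ch; rewrite card_sum !card_unit => dr.
have [y Yy Oy] := exOm.
have pq : is_point (@proj_col 2) ([ffun=> 1] : vec K 'I_3) by apply: (@point_coord K 2 ord0); rewrite ffunE oner_neq0.
have [||w [Xw hw Ow]] := irr_dom HX IXr ph (polyf_fst 2 pOm).
- by exists v.
- by exists (pairv y [ffun=> 1]); [exact: pairX | rewrite fst_pair].
have [Yw _] := (times_projE Y w).1 Xw; have [_ _ _ _ [k [A [HA kr]]]] := frame Yw Ow.
have [A' HA'] := conormalX Xw HA.
have := Hd w k A' Xw hw HA'; rewrite card_sum !card_ord -kr.
by move: dr; clear; lia.
Qed.

Lemma regular_ptsX v : X v -> Om (fstv v) != 0 -> regular_point cX X v.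
Proof.
move=> Xv Ov; have [Yv _] := (times_projE Y v).1 Xv; have [_ _ _ _ [k [A [HA kr]]]] := frame Yv Ov.
have [A' HA'] := conormalX Xv HA.
apply: (regular_point_of_codim HX Xv HA' has_dimX).
by rewrite !card_sum !card_unit !card_ord -kr; clear; lia.
Qed.

Lemma polyf_demon (mu : Mon 2 t.+2) (i : 'I_3) : polyf (fun q => demon mu i (nq q)).
Proof.
have pE j : polyf (fun q : vec K 'I_3 => nq q j) by exact: polyf_var.
apply: (polyf_ext (f := fun q => D (fun q => emon mu (nq q)) q (basev K i))); last first.
  by apply: polyf_D; exact: (form_emonq K mu).1.
move=> q; rewrite (D_emon mu q _ pE) (bigD1 i) //= D_var inord_val [basev _ _ _]ffunE eqxx mulr1 big1 ?addr0 // => j ji.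
by rewrite D_var inord_val [basev _ _ _]ffunE [i == _]eq_sym (negbTE ji) mulr0.
Qed.

Definition entry (a : 'I_r.+1 + 'I_3) (b : 'I_alpha * Mon 2 t.+2) v : K :=
  match a with
  | inl j => Jf b.1 (fstv v) (tau j (fstv v)) * emon b.2 (nq (sndv v))
  | inr i => vf b.1 (fstv v) * demon b.2 i (nq (sndv v))
  end.

Lemma polyf_entry a b : polyf (entry a b).
Proof.
case: a => [j|i]; apply: polyfM.
- exact: (polyf_fst 2 (pJ b.1 j)).
- exact: (polyf_snd n (form_emonq K b.2).1).
- exact: (polyf_fst 2 (pv b.1)).
exact: (polyf_snd n (polyf_demon b.2 i)).
Qed.

Hypotheses (r2 : (2 <= r)%N) (alpha60 : (60 <= alpha)%N) (alphaR : (3 * (r.+1 * r.+2) <= alpha)%N).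
Hypothesis Ldef : not_secant_defective cY Y (fun=> 1).
Hypothesis h1L : h1_vanishes cY Y (line_bundle cY Y (fun=> 1)).

Lemma product_not_defective : not_secant_defective cX X dX.
Proof.
move=> z z0; have H1X := acyc_h1 (product_acyc HY (t := t.+2) (h1_acyc HY h1L)).
split; first exact: H1X.
have [y1 Yy1 Oy1] := exOm; pose t1 : T := exist _ y1 (conj Yy1 Oy1).
have regP := fclass_sub HY IY pOm.
pose rho := minn (z * (r.+1 + 2)) (alpha * #|Mon 2 t.+2|).
have Hb : bigp Jt vt 2 t.+2 z 0 rho.
  apply: (bigp_sup t1 (leqnn z) (leq0n _)).
  exact: (expected2 charK regP t1 regJt regvt vtJ vt_free (Jt_rank Ldef) r2 alpha60 alphaR).
pose cl := powc (I := 'I_z) (prodc (@subc K _ Y Om) (@linec K)).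
have pcP := fclass_prod regP (fclass_line K).
have clP : fclass cl := fclass_pow ('I_z : finType) pcP.
have gR := bigp_generic regP regJt regvt Hb.
have clq k i : cl (fun p => (p k).2 i).
  apply: (@pow_coord _ _ _ regP z (fun p : T * (nat -> K) => p.2 i) k).
  by split=> x /=; [exact: (fc_cst regP) | exact: linec_coord].
(* Ensures that the [q] represent points and are pairwise different, so that the points of the
   product are distinct whatever their images in [Y]. *)
have g0 (kl : 'I_z * 'I_z) : generic cl (fun p => (p kl.1).2 0%N != 0 /\
    (kl.1 != kl.2 -> (p kl.1).2 0%N * (p kl.2).2 1%N - (p kl.1).2 1%N * (p kl.2).2 0%N != 0)).
  case: kl => k l /=; apply: (generic_and clP).
    by exists (fun p => (p k).2 0%N); split=> //; exists (fun=> (t1, fun=> 1)); exact: oner_neq0.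
  have [->|kl] := eqVneq k l.
    exists (fun=> 1); split=> //; first exact: (fc_cst clP).
    by exists (fun=> (t1, fun=> 1)); exact: oner_neq0.
  exists (fun p => (p k).2 0%N * (p l).2 1%N + -1 * ((p k).2 1%N * (p l).2 0%N)); split.
  - apply: (fcD clP); first exact: (fcM clP).
    by apply: (fcM clP); [exact: (fc_cst clP) | exact: (fcM clP)].
  - exists (fun i => (t1, if i == k then (fun j => (j == 0%N)%:R) else (fun j => (j == 1%N)%:R))).
    by rewrite /= eqxx [l == k]eq_sym (negbTE kl) /= !(mulr0, mulr1, addr0) oner_neq0.
  by move=> p; rewrite mulN1r.
have gall (s' : seq ('I_z * 'I_z)) : generic cl (fun p => forall kl, kl \in s' -> (p kl.1).2 0%N != 0 /\
    (kl.1 != kl.2 -> (p kl.1).2 0%N * (p kl.2).2 1%N - (p kl.1).2 1%N * (p kl.2).2 0%N != 0)).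
  elim: s' => [|kl s' IH].
    by exists (fun=> 1); split=> //; [exact: (fc_cst clP) | exists (fun=> (t1, fun=> 1)); exact: oner_neq0].
  apply: generic_imp (generic_and clP (g0 kl) IH) => p [h1 h2] kl'.
  by rewrite inE => /orP [/eqP ->|/h2].
have [p [Rp Gp]] := generic_ex (generic_and clP gR (gall (enum {: 'I_z * 'I_z}))).
have {}Gp kl := Gp kl (mem_enum _ kl).
have [f [g fg]] := (frank_minor _ _).1 Rp.
(* The maximal minor times the conditions for the frame; it is not multihomogeneous, so [comp_nz]
   replaces it by a component [P], which defines the open set. *)
pose Psi (w : vec K (IX * 'I_z)%type) := \det (\matrix_(i, j) entry (f i).2 (g j) (component w (f i).1)) *
  \prod_k Om (fstv (component w k)).
have pPsi : polyf Psi.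
  apply: polyfM; last by apply: polyf_prod => k _; exact: (polyf_component k (polyf_fst 2 pOm)).
  apply: (@polyf_det _ _ _ (fun i j w => entry (f i).2 (g j) (component w (f i).1))) => i j.
  exact: (polyf_component _ (polyf_entry _ _)).
pose q0 k : vec K 'I_3 := [ffun i : 'I_3 => (p k).2 i].
pose v0 k : vec K IX := pairv (proj1_sig (p k).1) (q0 k).
pose w0 := assemble v0.
have pq0 k : is_point (@proj_col 2) (q0 k).
  by apply: (@point_coord K 2 ord0); rewrite ffunE; have [] := Gp (k, k).
have Xv0 k : X (v0 k) by apply: pairX => //; have [] := proj2_sig (p k).1.
have Ov0 k : Om (fstv (v0 k)) != 0 by rewrite fst_pair; have [] := proj2_sig (p k).1.
have Psi0 : Psi w0 != 0.
  rewrite mulf_neq0 //; last by apply/prodf_neq0 => k _; rewrite component_assemble.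
  move: fg; congr (\det _ != 0); apply/matrixP => i j; rewrite !mxE component_assemble.
  have nqE i' : (i' <= 2)%N -> (p (f i).1).2 i' = nq (sndv (v0 (f i).1)) i'.
    by move=> i2; rewrite /nq snd_pair ffunE inordK.
  rewrite /hq /entry /cond; case: (f i).2 => a; rewrite fst_pair.
    by rewrite (emon_ext _ nqE).
  by rewrite (demon_ext _ _ nqE).
have [P [[aP hP] [P0 PP]]] := comp_nz (power_col cX (z := z)) pPsi Psi0.
have pX w : power_set X w -> is_point (power_col cX (z := z)) w.
  move=> Xw [j k]; have [i ij vi] := zclosed_point HX (Xw k) j; exists (i, k); first by rewrite /power_col /= ij.
  by move: vi; rewrite ffunE.
exists (fun w => power_set X w /\ peval P w != 0); first split.
- exists (fun w => is_point (power_col cX (z := z)) w /\ forall F, F = peval P -> F w = 0).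
    by apply: zclosed_forms => F ->; exists aP; exact: multihomog_form.
  move=> w; split=> [[Xw Pw]|[Xw N]]; split=> //; first by move=> [_ /(_ _ erefl)] /eqP; rewrite (negbTE Pw).
  by apply/eqP => Pw; apply: N; split=> [|F ->]; [exact: pX | ].
- exists w0; first by split=> // k; rewrite component_assemble.
  split=> [k|k l kl]; rewrite !component_assemble; first exact: regular_ptsX.
  move=> [x x0 xE]; have [_ /(_ kl)] := Gp (k, l); apply/negP; rewrite negbK.
  have qE (i : 'I_3) : (p l).2 i = x (inr tt) * (p k).2 i by have := xE (inr i); rewrite !ffunE.
  rewrite (qE (@Ordinal 3 0 isT)) (qE (@Ordinal 3 1 isT)) /=.
  by move: (x (inr tt)) ((p k).2 0%N) ((p k).2 1%N) => a b c'; apply/eqP; ring.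
(* Where [P] is nonzero only a rescaled tuple [w'] is known to have [Psi] nonzero. Double points do
   not depend on representatives, so the conclusion is carried back to [w]. *)
move=> w [Xw Pw] _; have [l l0 Psil] := PP w Pw.
set w' := scale _ l w in Psil.
pose pt k := component w' k.
have ptE k : pt k = scale cX (fun j => l (j, k)) (component w k).
  by apply/ffunP => i; rewrite !ffunE.
have lk0 k j : l (j, k) != 0 by exact: l0.
have Xpt k : X (pt k) by rewrite ptE; exact: zclosed_scale (Xw k).
move: Psil; rewrite mulf_eq0 negb_or => /andP [minor /prodf_neq0 Oms].
have Opt k : Om (fstv (pt k)) != 0 by exact: Oms.
have Ypt k : Y (fstv (pt k)) by have [] := (times_projE Y _).1 (Xpt k).
pose tp k : T := exist _ (fstv (pt k)) (conj (Ypt k) (Opt k)).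
have Hr : (rho <= frank (cmat pt tp))%N.
  apply/frank_minor; exists f, g; exact: minor.
have [le|lt] := leqP (z * (r.+1 + 2)) (alpha * #|Mon 2 t.+2|).
  right; apply: (h1_of_onto HX Xw H1X).
  apply: (onto_scale HX (l := fun k j => l (j, k))) => //.
  have -> : (fun k => scale cX (fun j => l (j, k)) (component w k)) = pt.
    by apply: functional_extensionality => k; rewrite ptE.
  by apply: (sections_onto Xpt (tp := tp)) => //; move: Hr; rewrite /rho (minn_idPl le).
left; exists (fun=> fun=> 0) => [[]//|F [HF Fm]].
have F0 v : X v -> F v = 0.
  apply: (sections_vanish Xpt (tp := tp)) => //; first by move: Hr; rewrite /rho (minn_idPr (ltnW lt)).
  by move=> k; rewrite ptE; apply: msq_scale => //; apply: Fm; exact: Xw.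
exists 0; split=> [v Xv|l' _]; first by rewrite big_ord0 F0.
by apply/rowP => -[].
Qed.
End JRank.

Lemma bound_nat r alpha :
  (27%:R * r%:R ^+ 3 + 144%:R * r%:R ^+ 2 + 210%:R * r%:R + 79%:R) / 81%:R <= alpha%:R :> rat ->
  (27 * r ^ 3 + 144 * r ^ 2 + 210 * r + 79 <= alpha * 81)%N.
Proof. by rewrite ler_pdivrMr ?ltr0n // -!natrX -!natrM -!natrD ler_nat. Qed.

Lemma bound_alpha60 r alpha : (8 <= r)%N ->
  (27 * r ^ 3 + 144 * r ^ 2 + 210 * r + 79 <= alpha * 81)%N -> (60 <= alpha)%N.
Proof. by move=> r8; have := leq_exp2r 8 r (isT : 0 < 2)%N; have := leq_exp2r 8 r (isT : 0 < 3)%N; rewrite r8; lia. Qed.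

Lemma bound_alphaR r alpha : (8 <= r)%N ->
  (27 * r ^ 3 + 144 * r ^ 2 + 210 * r + 79 <= alpha * 81)%N -> (3 * (r.+1 * r.+2) <= alpha)%N.
Proof. by move=> r8; have := leq_mul r8 (leqnn (r ^ 2)); have := leq_mul r8 (leqnn r); rewrite -expnS; lia. Qed.

(* A pair (Y, L) with L very ample is a closed subvariety Y of some P^n with
   L = O_Y(1). *)
Theorem theorem1 (K : closedFieldType) (charK : [pchar K] =i pred0)
  (n r alpha : nat) (Y : vec K 'I_n.+1 -> Prop)
  (Yvar : integral_variety (@proj_col n) Y)
  (Ydim : has_dim (@proj_col n) Y r)
  (h1L : h1_vanishes (@proj_col n) Y
           (line_bundle (@proj_col n) Y (fun=> 1)))
  (Ldef : not_secant_defective (@proj_col n) Y (fun=> 1))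
  (h0L : has_h0 Y (line_bundle (@proj_col n) Y (fun=> 1)) alpha)
  (bound :
     ((r = 2 \/ r = 3) /\ (60 <= alpha))%N \/
     (r = 4 /\ (98 <= alpha))%N \/
     (r = 5 /\ (133 <= alpha))%N \/
     (r = 6 /\ (176 <= alpha))%N \/
     (r = 7 /\ (231 <= alpha))%N \/
     ((8 <= r)%N /\
      (27%:R * r%:R ^+ 3 + 144%:R * r%:R ^+ 2 + 210%:R * r%:R + 79%:R)
        / 81%:R <= alpha%:R :> rat)) :
  forall t : int, 2 <= t ->
    not_secant_defective (@times_proj_col n 2) (times_proj (m := 2) Y)
      (bidegree 1 t).
Proof.
have [HY IY] := Yvar.
have [r2 alpha60 alphaR] : [/\ (2 <= r)%N, (60 <= alpha)%N & (3 * (r.+1 * r.+2) <= alpha)%N].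
  case: bound => [[r23 a]|[[r4 a]|[[r5 a]|[[r6 a]|[[r7 a]|[r8 /bound_nat a]]]]]].
  - by case: r23 => ->; split=> //; exact: leq_trans a.
  - by rewrite r4; split=> //; exact: leq_trans a.
  - by rewrite r5; split=> //; exact: leq_trans a.
  - by rewrite r6; split=> //; exact: leq_trans a.
  - by rewrite r7; split=> //; exact: leq_trans a.
  - by split; [exact: leq_trans r8 | exact: bound_alpha60 r8 a | exact: bound_alphaR r8 a].
case=> [t|//] t2; case: t t2 => [|[|t]] // _.
(* The case of one point supplies a regular point of [Y], at which the frame is constructed. *)
have [_ [W [oW [w Ww [rw _]]] _]] := Ldef 1%N isT.
have Yy0 := (rw ord0).1; set y0 := component w ord0 in Yy0.
have [Om0 [tau [ell [det [pOm0 exOm0 ptau fell frame]]]]] := tangent_frame charK HY IY Ydim (rw ord0).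
have [s rs s_span] := h0L.
have [HH [Jf [vf [pHH HHy0 pv pJ HJ]]]] := section_frame HY Yy0 (fun k => rs k _ Yy0).
(* The frame and the common denominator are each usable on an open set only; by irreducibility these
   meet, and their product serves as [Om]. *)
have [y [Yy Oy Hy]] := irr_dom HY IY pOm0 pHH exOm0 (ex_intro2 _ _ y0 Yy0 HHy0).
apply: (@product_not_defective K n r alpha Y HY IY Ydim s rs s_span (fun y => Om0 y * HH y) tau ell det HH Jf vf) => //.
- exact: polyfM.
- by exists y => //; rewrite mulf_neq0.
- by move=> v Yv; rewrite mulf_eq0 negb_or => /andP [Ov _]; exact: frame.
- by move=> k j; exact: pJ.
- by move=> v; rewrite mulf_eq0 negb_or => /andP [].
- by move=> v k Yv; rewrite mulf_eq0 negb_or => /andP [_ Hv]; have [] := HJ v Yv Hv.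
by move=> v k u Yv; rewrite mulf_eq0 negb_or => /andP [_ Hv]; have [_] := HJ v Yv Hv; apply.
Qed.
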